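(* Let $P\subset\mathbb C$ be a discrete subset, $\Sigma=\mathbb C\setminus P$, and let $F:\Sigma\to\mathbb R^n$ be a branched minimal immersion that is locally complete with finite total curvature around $P$. Then $F$ is stable if and only if $F$ is holomorphic up to a rigid motion. (No completeness or curvature assumption is made at the end corresponding to $\infty$.)
   Context: A branched minimal immersion of a Riemann surface into $\mathbb R^n$ is a nonconstant smooth map that is harmonic and conformal in local holomorphic coordinates. For a compact surface $\Omega$ with smooth boundary, $F$ is stable if $\frac{d^2}{dt^2}\big|_{t=0}A(F+tW)\geq 0$ for every smooth $W:\Omega\to\mathbb R^n$ vanishing on $\partial\Omega$, where $A$ is the area of the induced (possibly degenerate) metric; for an open surface, $F$ is stable if its restriction to every compact subsurface with smooth boundary is stable. $F$ is locally complete with finite total curvature around $P$ if each $p\in P$ has a punctured neighborhood $U$ such that every curve in $U$ tending to $p$ has infinite length in the induced metric $F^*\delta$ and $\int_U |K|\,dA<\infty$ ($K$ the Gaussian curvature of the induced metric). $F$ is holomorphic up to a rigid motion if its image lies in an even-dimensional affine subspace $b+W\subset\mathbb R^n$ and there is a linear $J:W\to W$ with $J^2=-I$ preserving the Euclidean inner product such that $dF\circ j=J\circ dF$, $j$ the complex structure of the source. *)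

(* Defs.v *)
(* C is identified with R * R (z = x + i y),
   R^n with row vectors 'rV[R]_n. *)
From HB Require Import structures.
From mathcomp Require Import all_boot all_order all_algebra.
From mathcomp Require Import all_classical all_reals all_analysis.
Set Implicit Arguments. Unset Strict Implicit. Unset Printing Implicit Defensive.
Import Order.TTheory GRing.Theory Num.Theory.
Import numFieldNormedType.Exports.
Local Open Scope classical_set_scope.
Local Open Scope ring_scope.

Section Partials.
Variables (R : realType) (V : normedModType R).

Definition pdx (f : R -> R -> V) : R -> R -> V :=
  fun x y => derive1 (fun t => f t y) x.
Definition pdy (f : R -> R -> V) : R -> R -> V :=
  fun x y => derive1 (fun t => f x t) y.

Fixpoint ipartial (f : R -> R -> V) (s : seq bool) : R -> R -> V :=
  match s with
  | [::] => f
  | b :: s' => (if b then pdx else pdy) (ipartial f s')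
  end.

Definition smooth_on (U : set (R * R)) (f : R -> R -> V) : Prop :=
  forall (s : seq bool) (p : R * R), U p ->
    {for p, continuous (fun q : R * R => ipartial f s q.1 q.2)} /\
    derivable (fun t => ipartial f s t p.2) p.1 1 /\
    derivable (fun t => ipartial f s p.1 t) p.2 1.
End Partials.

Section Defs.
Variables (R : realType) (n : nat).
Local Notation V := 'rV[R]_n.

Definition dot (u v : V) : R := \sum_(i < n) u 0 i * v 0 i.
Definition enorm (u : V) : R := Num.sqrt (dot u u).

(* branched minimal immersion of the plane domain S (global holomorphic
   coordinate z = x + i y): nonconstant, smooth, harmonic, conformal *)
Definition branched_minimal_immersion (S : set (R * R)) (F : R -> R -> V) : Prop :=
  (exists p q, S p /\ S q /\ F p.1 p.2 <> F q.1 q.2) /\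
  smooth_on S F /\
  (forall p, S p -> pdx (pdx F) p.1 p.2 + pdy (pdy F) p.1 p.2 = 0) /\
  (forall p, S p ->
     dot (pdx F p.1 p.2) (pdx F p.1 p.2) = dot (pdy F p.1 p.2) (pdy F p.1 p.2) /\
     dot (pdx F p.1 p.2) (pdy F p.1 p.2) = 0).

Definition leb2 := ((@lebesgue_measure R) \x (@lebesgue_measure R))%E.

Definition gram (G : R -> R -> V) (q : R * R) : R :=
  let a := pdx G q.1 q.2 in let b := pdy G q.1 q.2 in
  dot a a * dot b b - (dot a b) ^+ 2.
Definition area (Om : set (R * R)) (G : R -> R -> V) : R :=
  Rintegral leb2 Om (fun q => Num.sqrt (gram G q)).

(* Om is a compact subsurface of S with smooth boundary: it is cut out in S
   by a smooth defining function rho with nonvanishing gradient on {rho = 0};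
   its boundary is then {q in S | rho q = 0}. *)
Definition smooth_domain_in (S Om : set (R * R)) (rho : R -> R -> R) : Prop :=
  compact Om /\ Om `<=` S /\
  smooth_on S rho /\
  Om = [set q | S q /\ rho q.1 q.2 <= 0] /\
  (forall q, S q -> rho q.1 q.2 = 0 ->
     pdx rho q.1 q.2 <> 0 \/ pdy rho q.1 q.2 <> 0).

Definition second_deriv_nonneg (a : R -> R) : Prop :=
  (\forall t \near 0, derivable a t 1) /\ derivable (derive1 a) 0 1 /\
  0 <= derive1 (derive1 a) 0.

Definition stable (S : set (R * R)) (F : R -> R -> V) : Prop :=
  forall (Om : set (R * R)) (rho : R -> R -> R), smooth_domain_in S Om rho ->
  forall (W : R -> R -> V),
    (exists U, open U /\ Om `<=` U /\ smooth_on U W) ->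
    (forall q, Om q -> rho q.1 q.2 = 0 -> W q.1 q.2 = 0) ->
    second_deriv_nonneg (fun t => area Om (fun x y => F x y + t *: W x y)).

(* length of a curve gamma : [0,1) -> plane in the induced metric, i.e. the
   length of F o gamma in R^n; "infinite length": partition sums unbounded *)
Definition polygonal_length (F : R -> R -> V) (gamma : R -> R * R) (s : seq R) : R :=
  \sum_(i < (size s).-1)
     enorm (F (gamma (nth 0 s i.+1)).1 (gamma (nth 0 s i.+1)).2
            - F (gamma (nth 0 s i)).1 (gamma (nth 0 s i)).2).
Definition infinite_length (F : R -> R -> V) (gamma : R -> R * R) : Prop :=
  forall M : R, exists s : seq R,
    sorted <%R s /\ all (fun u => (0 <= u) && (u < 1)) s /\
    M < polygonal_length F gamma s.

Definition conf_factor (F : R -> R -> V) (x y : R) : R :=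
  dot (pdx F x y) (pdx F x y).
Definition gauss_curv (F : R -> R -> V) (x y : R) : R :=
  let ll := fun a b => ln (conf_factor F a b) in
  - (pdx (pdx ll) x y + pdy (pdy ll) x y) / (2 * conf_factor F x y).

Definition locally_complete_finite_total_curvature
    (S P : set (R * R)) (F : R -> R -> V) : Prop :=
  forall p, P p -> exists U : set (R * R),
    open U /\ U `<=` S /\ nbhs p (U `|` [set p]) /\
    (forall gamma : R -> R * R,
       {within `[0, 1[, continuous gamma} ->
       (forall u, 0 <= u < 1 -> U (gamma u)) ->
       gamma @ (1 : R)^'- --> p ->
       infinite_length F gamma) /\
    (\int[leb2]_(q in U `&` [set q | conf_factor F q.1 q.2 != 0%R])
        ((`|gauss_curv F q.1 q.2| * conf_factor F q.1 q.2)%R)%:E < +oo)%E.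

(* holomorphic up to a rigid motion: image in b + W (W the row space of the
   matrix Wm, of even dimension), J linear (v |-> v *m J) preserving W, with
   J^2 = -1 and orthogonal on W, and dF o j = J o dF, i.e. F_y = J F_x *)
Definition holomorphic_up_to_rigid_motion (S : set (R * R)) (F : R -> R -> V) : Prop :=
  exists (b : V) (Wm : 'M[R]_n) (J : 'M[R]_n),
    ~~ odd (\rank Wm) /\
    (forall q, S q -> (F q.1 q.2 - b <= Wm)%MS) /\
    (forall w : V, (w <= Wm)%MS ->
       (w *m J <= Wm)%MS /\ w *m J *m J = - w) /\
    (forall w w' : V, (w <= Wm)%MS -> (w' <= Wm)%MS ->
       dot (w *m J) (w' *m J) = dot w w') /\
    (forall q, S q -> pdy F q.1 q.2 = pdx F q.1 q.2 *m J).

End Defs.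

Definition discrete_in_plane (R : realType) (P : set (R * R)) : Prop :=
  forall z : R * R, \forall w \near z^', ~ P w.

(* Main.v *)
(** If [F] is holomorphic for the complex structure [J] on [W], the Kaehler form
    of [J], composed with the orthogonal projection to [W], calibrates [F]:
    its integral over the surface does not change under a variation (Stokes), it
    is at most the area element (Wirtinger), with equality for [F] itself.  So
    the area is minimal at [t = 0]; it is twice differentiable there by dominated
    convergence, since the zeros of the area element at small [t] form a null set
    (the conformal factor has finite order at every point).

    Conversely let [F] be stable and [phi = F_x - i F_y], which is holomorphic.
    For all real [k], [l] the area element is at most
    [e (1 + (k^2 + l^2) / 2) - k al - l be], where [e], [al], [be] are half the
    sum and half the difference of the squared norms of the partial derivatives,
    and their inner product.  So stability gives, for every field
    [sigma = W1 + i W2] vanishing on the boundary and all bounded measurable [h],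
    [k], [l], an inequality whose terms free of [k], [l] measure how far the d-bar
    derivative of [sigma] is from [h] times the conjugate of [phi].  Take [sigma]
    to be a smoothing of the pole [phi(a) / (z - a)], cut off logarithmically at
    the points of [P] and near infinity: these terms tend to [0], whereas the
    terms in [k], [l], supported near [b], can be made negative in the limit
    unless the bilinear product [phi(a) . phi(b)] vanishes.  Hence it vanishes
    for all [a], [b], the values of [phi] span an isotropic subspace, and
    [F_x |-> F_y] extends to [J]. *)

Require Import Defs.
From HB Require Import structures.
From mathcomp Require Import all_boot all_order all_algebra.
From mathcomp Require Import all_classical all_reals all_analysis.
From mathcomp Require Import measurable_realfun ring lra.
Set Implicit Arguments. Unset Strict Implicit. Unset Printing Implicit Defensive.
Import Order.TTheory GRing.Theory Num.Theory.
Import numFieldNormedType.Exports.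
Local Open Scope classical_set_scope.
Local Open Scope ring_scope.

(** * Smooth functions of two real variables *)

(** The zeros of the conformal factor shape the argument: the classical second variation formula
    divides by the area element. The energy bound replaces it because it holds for every conformal
    structure; with parameters [t k], [t l] it is of second order in [t] without any division, and
    [h], [k], [l] may jump. For a pair of fields and [k = l = 0] the resulting form is |2 dbar sigma
    - h phi|^2 with [h] real. A pole of [sigma] at [a] with residue phi(a) is the right test field
    because the d-bar derivative of its smoothing is concentrated at [a], where it is a real
    multiple of phi(a) and can be absorbed by [h]. The terms linear in [k + i l] pair it with phi .
    (2 d sigma), and d sigma is close to - phi(a) / (z - a)^2: hence the product phi(a) . phi(b).
    The two cutoffs differ. Near [P] the field is bounded, so a cutoff of small energy suffices, and
    a logarithmic one has it; near infinity the field decays like 1 / |z|, so the quadratic cutoff 1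
    - |z - a|^2 / r^2 is enough. *)

Section Smoothness.
Variable R : realType.

Lemma near_hslice (U : set (R * R)) (p : R * R) :
  open U -> U p -> \forall t \near p.1, U (t, p.2).
Proof.
move=> oU Up.
have h : (fun t : R => (t, p.2)) @ p.1 --> p.
  by rewrite [X in _ --> X]surjective_pairing; exact: (cvg_pair cvg_id (cvg_cst _)).
by apply: h; exact: open_nbhs_nbhs.
Qed.

Lemma near_vslice (U : set (R * R)) (p : R * R) :
  open U -> U p -> \forall t \near p.2, U (p.1, t).
Proof.
move=> oU Up.
have h : (fun t : R => (p.1, t)) @ p.2 --> p.
  by rewrite [X in _ --> X]surjective_pairing; exact: (cvg_pair (cvg_cst _) cvg_id).
by apply: h; exact: open_nbhs_nbhs.
Qed.

Section NormedCodomain.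
Variable V : normedModType R.
Implicit Types f g : R -> R -> V.

Definition regular_at f (p : R * R) : Prop :=
  {for p, continuous (fun q : R * R => f q.1 q.2)} /\
  derivable (fun t => f t p.2) p.1 1 /\ derivable (fun t => f p.1 t) p.2 1.

Lemma smooth_on_regular (U : set (R * R)) f p :
  smooth_on U f -> U p -> regular_at f p.
Proof. by move=> /(_ [::]); apply. Qed.

(** The head of the list is the derivative taken last; splitting off the one taken first lets
    smoothness pass to [pdx f] and [pdy f]. *)
Lemma ipartial_rcons f s b :
  ipartial f (rcons s b) = ipartial ((if b then @pdx R V else @pdy R V) f) s.
Proof. by elim: s => //= a s ->. Qed.

Lemma smooth_on_pdx (U : set (R * R)) f : smooth_on U f -> smooth_on U (pdx f).
Proof. by move=> sf s; have := sf (rcons s true); rewrite ipartial_rcons. Qed.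

Lemma smooth_on_pdy (U : set (R * R)) f : smooth_on U f -> smooth_on U (pdy f).
Proof. by move=> sf s; have := sf (rcons s false); rewrite ipartial_rcons. Qed.

Lemma ipartial_cat f s s' : ipartial (ipartial f s) s' = ipartial f (s' ++ s).
Proof. by elim: s' => //= b s' ->. Qed.

Lemma smooth_ipartial (U : set (R * R)) f s : smooth_on U f -> smooth_on U (ipartial f s).
Proof. by move=> sf s'; rewrite ipartial_cat; exact: sf. Qed.

Lemma smooth_onS (U U' : set (R * R)) f : U' `<=` U -> smooth_on U f -> smooth_on U' f.
Proof. by move=> UU' sf s p /UU'; exact: sf. Qed.

Lemma pdx_cst (c : V) x y : pdx (fun _ _ => c) x y = 0.
Proof. by rewrite /pdx derive1_cst. Qed.

Lemma eq_on_pdx (U : set (R * R)) f g : open U ->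
  (forall p, U p -> f p.1 p.2 = g p.1 p.2) ->
  forall p, U p -> pdx f p.1 p.2 = pdx g p.1 p.2.
Proof.
move=> oU fg p Up; rewrite /pdx !derive1E; apply: near_eq_derive.
by apply: filterS (near_hslice oU Up) => t /fg.
Qed.

Lemma eq_on_pdy (U : set (R * R)) f g : open U ->
  (forall p, U p -> f p.1 p.2 = g p.1 p.2) ->
  forall p, U p -> pdy f p.1 p.2 = pdy g p.1 p.2.
Proof.
move=> oU fg p Up; rewrite /pdy !derive1E; apply: near_eq_derive.
by apply: filterS (near_vslice oU Up) => t /fg.
Qed.

Lemma eq_on_regular (U : set (R * R)) f g p : open U ->
  (forall p, U p -> f p.1 p.2 = g p.1 p.2) -> U p -> regular_at f p -> regular_at g p.
Proof.
move=> oU fg Up [cf [dx dy]]; split; [|split].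
- have Un : nbhs p U by exact: open_nbhs_nbhs.
  move: cf; rewrite /prop_for /continuous_at (fg _ Up) => cf; apply: cvg_trans cf; apply: near_eq_cvg.
  by apply: filterS Un => q /fg.
- by apply: near_eq_derivable dx; apply: filterS (near_hslice oU Up) => t /fg.
- by apply: near_eq_derivable dy; apply: filterS (near_vslice oU Up) => t /fg.
Qed.

(* Coinduction: a class of regular functions that contains, up to equality on
   [U], the partial derivatives of its members consists of smooth functions. *)
Lemma smooth_on_coind (U : set (R * R)) (C : (R -> R -> V) -> Prop) : open U ->
  (forall f, C f -> forall p, U p -> regular_at f p) ->
  (forall f, C f -> exists2 g, C g & forall p, U p -> pdx f p.1 p.2 = g p.1 p.2) ->
  (forall f, C f -> exists2 g, C g & forall p, U p -> pdy f p.1 p.2 = g p.1 p.2) ->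
  forall f, C f -> smooth_on U f.
Proof.
move=> oU Creg Cx Cy f Cf s.
have [g Cg fg] : exists2 g, C g & forall p, U p -> ipartial f s p.1 p.2 = g p.1 p.2.
  elim: s => [|b s [g Cg fg]]; first by exists f.
  case: b => /=.
    have [h Ch gh] := Cx _ Cg; exists h => // p Up.
    by rewrite -gh//; exact: eq_on_pdx Up.
  have [h Ch gh] := Cy _ Cg; exists h => // p Up.
  by rewrite -gh//; exact: eq_on_pdy Up.
by move=> p Up; apply: (@eq_on_regular _ _ _ _ oU _ Up (Creg _ Cg _ Up)) => q /fg.
Qed.

Lemma eq_on_smooth (U : set (R * R)) f g : open U ->
  (forall p, U p -> f p.1 p.2 = g p.1 p.2) -> smooth_on U f -> smooth_on U g.
Proof.
move=> oU fg sf; apply: (@smooth_on_coind U (fun h => exists2 k, smooth_on U k &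
  forall p, U p -> k p.1 p.2 = h p.1 p.2)) => //; last by exists f.
- by move=> h [k sk kh] p Up; apply: (@eq_on_regular _ _ _ _ oU kh Up); exact: smooth_on_regular Up.
- move=> h [k sk kh]; exists (pdx k); last by move=> p Up; apply/esym; exact: eq_on_pdx Up.
  by exists (pdx k) => //; exact: smooth_on_pdx.
- move=> h [k sk kh]; exists (pdy k); last by move=> p Up; apply/esym; exact: eq_on_pdy Up.
  by exists (pdy k) => //; exact: smooth_on_pdy.
Qed.

End NormedCodomain.

Implicit Types f g : R -> R -> R.

Lemma pdxE f (x y d : R) : is_derive x 1 (fun t => f t y) d -> pdx f x y = d.
Proof. by move=> h; rewrite /pdx derive1E derive_val. Qed.

Lemma pdyE f (x y d : R) : is_derive y 1 (fun t => f x t) d -> pdy f x y = d.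
Proof. by move=> h; rewrite /pdy derive1E derive_val. Qed.

Lemma derivable_dx f x y : derivable (fun t => f t y) x 1 ->
  is_derive x 1 (fun t => f t y) (pdx f x y).
Proof. by move=> h; rewrite /pdx derive1E; exact/derivableP. Qed.

Lemma derivable_dy f x y : derivable (fun t => f x t) y 1 ->
  is_derive y 1 (fun t => f x t) (pdy f x y).
Proof. by move=> h; rewrite /pdy derive1E; exact/derivableP. Qed.

Lemma pdx_swap f : pdx (fun x y => f y x) = fun x y => pdy f y x.
Proof. by []. Qed.

Lemma pdy_swap f : pdy (fun x y => f y x) = fun x y => pdx f y x.
Proof. by []. Qed.

Lemma regular_dx f p : regular_at f p ->
  is_derive p.1 1 (fun t => f t p.2) (pdx f p.1 p.2).
Proof. by case=> _ [h _]; exact: derivable_dx. Qed.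

Lemma regular_dy f p : regular_at f p ->
  is_derive p.2 1 (fun t => f p.1 t) (pdy f p.1 p.2).
Proof. by case=> _ [_ h]; exact: derivable_dy. Qed.

Lemma regularI f (p : R * R) (dx dy : R) : {for p, continuous (fun q : R * R => f q.1 q.2)} ->
  is_derive p.1 1 (fun t => f t p.2) dx -> is_derive p.2 1 (fun t => f p.1 t) dy ->
  regular_at f p.
Proof.
move=> cf hx hy; split; first exact: cf.
by split; [exact: (@ex_derive _ _ _ _ _ _ _ hx)|exact: (@ex_derive _ _ _ _ _ _ _ hy)].
Qed.

(** The coinduction needs a class containing the derivatives of its members. The derivative of a
    product is a sum of products and that of an inverse involves the inverse again, so all
    operations are closed up at once and proved smooth together. *)
Inductive smooth_closure (U : set (R * R)) : (R -> R -> R) -> Prop :=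
| SmoothBase f : smooth_on U f -> smooth_closure U f
| SmoothAdd f g : smooth_closure U f -> smooth_closure U g ->
    smooth_closure U (fun x y => f x y + g x y)
| SmoothMul f g : smooth_closure U f -> smooth_closure U g ->
    smooth_closure U (fun x y => f x y * g x y)
| SmoothInv f : smooth_closure U f -> (forall p, U p -> f p.1 p.2 != 0) ->
    smooth_closure U (fun x y => (f x y)^-1)
| SmoothLn f : smooth_closure U f -> (forall p, U p -> 0 < f p.1 p.2) ->
    smooth_closure U (fun x y => ln (f x y)).

Lemma cst_smooth (U : set (R * R)) (c : R) : open U -> smooth_on U (fun _ _ => c).
Proof.
move=> oU; apply: (@smooth_on_coind _ U (fun f => exists k : R, f = fun _ _ => k)) => //; last by exists c.
- move=> _ [k ->] p Up; apply: (@regularI _ _ 0 0); first exact: cst_continuous.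
    exact: is_derive_cst. exact: is_derive_cst.
- move=> _ [k ->]; exists (fun _ _ => 0); first by exists 0.
  by move=> p Up; exact: (pdxE (f := fun _ _ => k) (is_derive_cst k p.1 1)).
- move=> _ [k ->]; exists (fun _ _ => 0); first by exists 0.
  by move=> p Up; exact: (pdyE (f := fun _ _ => k) (is_derive_cst k p.2 1)).
Qed.

Lemma regular_add f g p : regular_at f p -> regular_at g p ->
  [/\ regular_at (fun x y => f x y + g x y) p,
   pdx (fun x y => f x y + g x y) p.1 p.2 = pdx f p.1 p.2 + pdx g p.1 p.2 &
   pdy (fun x y => f x y + g x y) p.1 p.2 = pdy f p.1 p.2 + pdy g p.1 p.2].
Proof.
move=> rf rg.
have hx := is_deriveD (regular_dx rf) (regular_dx rg).
have hy := is_deriveD (regular_dy rf) (regular_dy rg).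
split; [|exact: pdxE hx|exact: pdyE hy].
by apply: regularI hx hy; apply: continuousD; [case: rf|case: rg].
Qed.

Lemma regular_mul f g p : regular_at f p -> regular_at g p ->
  [/\ regular_at (fun x y => f x y * g x y) p,
   pdx (fun x y => f x y * g x y) p.1 p.2 =
     f p.1 p.2 * pdx g p.1 p.2 + g p.1 p.2 * pdx f p.1 p.2 &
   pdy (fun x y => f x y * g x y) p.1 p.2 =
     f p.1 p.2 * pdy g p.1 p.2 + g p.1 p.2 * pdy f p.1 p.2].
Proof.
move=> rf rg.
have hx := is_deriveM (regular_dx rf) (regular_dx rg).
have hy := is_deriveM (regular_dy rf) (regular_dy rg).
split; [|exact: pdxE hx|exact: pdyE hy].
by apply: regularI hx hy; apply: continuousM; [case: rf|case: rg].
Qed.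

Lemma regular_inv f p : regular_at f p -> f p.1 p.2 != 0 ->
  [/\ regular_at (fun x y => (f x y)^-1) p,
   pdx (fun x y => (f x y)^-1) p.1 p.2 = - f p.1 p.2 ^- 2 * pdx f p.1 p.2 &
   pdy (fun x y => (f x y)^-1) p.1 p.2 = - f p.1 p.2 ^- 2 * pdy f p.1 p.2].
Proof.
move=> rf f0.
have hx := is_deriveV (f := fun t => f t p.2) f0 (regular_dx rf).
have hy := is_deriveV (f := fun t => f p.1 t) f0 (regular_dy rf).
split; [|exact: pdxE hx|exact: pdyE hy].
by apply: regularI hx hy; apply: cvgV => //; case: rf.
Qed.

Lemma regular_ln f p : regular_at f p -> 0 < f p.1 p.2 ->
  [/\ regular_at (fun x y => ln (f x y)) p,
   pdx (fun x y => ln (f x y)) p.1 p.2 = (f p.1 p.2)^-1 * pdx f p.1 p.2 &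
   pdy (fun x y => ln (f x y)) p.1 p.2 = (f p.1 p.2)^-1 * pdy f p.1 p.2].
Proof.
move=> rf f0.
have hx := is_derive1_comp (is_derive1_ln f0) (regular_dx rf).
have hy := is_derive1_comp (is_derive1_ln f0) (regular_dy rf).
split; [|exact: pdxE hx|exact: pdyE hy].
apply: regularI hx hy; case: rf => + _.
by move/continuous_comp; apply; exact: continuous_ln.
Qed.

Lemma regular_smooth_closure (U : set (R * R)) f : smooth_closure U f ->
  forall p, U p -> regular_at f p.
Proof.
elim=> [{}f sf p Up|f1 g1 _ h1 _ h2 p Up|f1 g1 _ h1 _ h2 p Up|f1 _ h1 h p Up|f1 _ h1 h p Up].
- exact: smooth_on_regular Up.
- by have [] := regular_add (h1 _ Up) (h2 _ Up).
- by have [] := regular_mul (h1 _ Up) (h2 _ Up).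
- by have [] := regular_inv (h1 _ Up) (h _ Up).
- by have [] := regular_ln (h1 _ Up) (h _ Up).
Qed.

Lemma smooth_closureP (U : set (R * R)) f : open U -> smooth_closure U f -> smooth_on U f.
Proof.
move=> oU; apply: (@smooth_on_coind _ U (smooth_closure U)) => //.
- exact: regular_smooth_closure.
- move=> f0 cf; elim: cf => [f1 sf|f1 g1 c1 h1 c2 h2|f1 g1 c1 h1 c2 h2|f1 c1 h1 h|f1 c1 h1 h].
  + by exists (pdx f1) => //; apply: SmoothBase; exact: smooth_on_pdx.
  + have [f2 cf2 e1] := h1.
    have [g2 cg2 e2] := h2.
    exists (fun x y => f2 x y + g2 x y); first exact: SmoothAdd.
    move=> p Up; rewrite -e1// -e2//.
    by have [] := regular_add (regular_smooth_closure c1 Up) (regular_smooth_closure c2 Up).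
  + have [f2 cf2 e1] := h1.
    have [g2 cg2 e2] := h2.
    exists (fun x y => f1 x y * g2 x y + g1 x y * f2 x y).
      by apply: SmoothAdd; exact: SmoothMul.
    move=> p Up; rewrite -e1// -e2//.
    by have [] := regular_mul (regular_smooth_closure c1 Up) (regular_smooth_closure c2 Up).
  + have [f2 cf2 e1] := h1.
    exists (fun x y => (-1 * ((f1 x y)^-1 * (f1 x y)^-1)) * f2 x y).
      apply: SmoothMul => //; apply: SmoothMul; first by apply: SmoothBase; exact: cst_smooth.
      by apply: SmoothMul; exact: SmoothInv.
    move=> p Up; rewrite -e1//.
    have [_ -> _] := regular_inv (regular_smooth_closure c1 Up) (h _ Up).
    by rewrite expr2 invfM; ring.
  + have [f2 cf2 e1] := h1.
    exists (fun x y => (f1 x y)^-1 * f2 x y).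
      by apply: SmoothMul => //; apply: SmoothInv => // p Up; rewrite gt_eqF// h.
    move=> p Up; rewrite -e1//.
    by have [] := regular_ln (regular_smooth_closure c1 Up) (h _ Up).
- move=> f0 cf; elim: cf => [f1 sf|f1 g1 c1 h1 c2 h2|f1 g1 c1 h1 c2 h2|f1 c1 h1 h|f1 c1 h1 h].
  + by exists (pdy f1) => //; apply: SmoothBase; exact: smooth_on_pdy.
  + have [f2 cf2 e1] := h1.
    have [g2 cg2 e2] := h2.
    exists (fun x y => f2 x y + g2 x y); first exact: SmoothAdd.
    move=> p Up; rewrite -e1// -e2//.
    by have [] := regular_add (regular_smooth_closure c1 Up) (regular_smooth_closure c2 Up).
  + have [f2 cf2 e1] := h1.
    have [g2 cg2 e2] := h2.
    exists (fun x y => f1 x y * g2 x y + g1 x y * f2 x y).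
      by apply: SmoothAdd; exact: SmoothMul.
    move=> p Up; rewrite -e1// -e2//.
    by have [] := regular_mul (regular_smooth_closure c1 Up) (regular_smooth_closure c2 Up).
  + have [f2 cf2 e1] := h1.
    exists (fun x y => (-1 * ((f1 x y)^-1 * (f1 x y)^-1)) * f2 x y).
      apply: SmoothMul => //; apply: SmoothMul; first by apply: SmoothBase; exact: cst_smooth.
      by apply: SmoothMul; exact: SmoothInv.
    move=> p Up; rewrite -e1//.
    have [_ _ ->] := regular_inv (regular_smooth_closure c1 Up) (h _ Up).
    by rewrite expr2 invfM; ring.
  + have [f2 cf2 e1] := h1.
    exists (fun x y => (f1 x y)^-1 * f2 x y).
      by apply: SmoothMul => //; apply: SmoothInv => // p Up; rewrite gt_eqF// h.
    move=> p Up; rewrite -e1//.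
    by have [] := regular_ln (regular_smooth_closure c1 Up) (h _ Up).
Qed.

Lemma fst_smooth (U : set (R * R)) : open U -> smooth_on U (fun x _ => x : R).
Proof.
move=> oU; apply: (@smooth_on_coind _ U (fun f => f = (fun x _ => x) \/ exists k : R, f = fun _ _ => k)) => //; last by left.
- move=> _ [->|[k ->]] p Up; last exact: (smooth_on_regular (cst_smooth k oU) Up).
  apply: (regularI (f := fun x _ => x) _ (is_derive_id p.1 1) (is_derive_cst p.1 p.2 1)).
  exact: cvg_fst.
- move=> _ [->|[k ->]]; [exists (fun _ _ => 1); first by right; exists 1|exists (fun _ _ => 0); first by right; exists 0].
    by move=> p Up; exact: (pdxE (f := fun x _ => x) (is_derive_id p.1 1)).
  by move=> p Up; exact: (pdxE (f := fun _ _ => k) (is_derive_cst k p.1 1)).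
- move=> _ [->|[k ->]]; exists (fun _ _ => 0); try by right; exists 0.
    by move=> p Up; exact: (pdyE (f := fun x _ => x) (is_derive_cst p.1 p.2 1)).
  by move=> p Up; exact: (pdyE (f := fun _ _ => k) (is_derive_cst k p.2 1)).
Qed.

Lemma snd_smooth (U : set (R * R)) : open U -> smooth_on U (fun _ y => y : R).
Proof.
move=> oU; apply: (@smooth_on_coind _ U (fun f => f = (fun _ y => y) \/ exists k : R, f = fun _ _ => k)) => //; last by left.
- move=> _ [->|[k ->]] p Up; last exact: (smooth_on_regular (cst_smooth k oU) Up).
  apply: (regularI (f := fun _ y => y) _ (is_derive_cst p.2 p.1 1) (is_derive_id p.2 1)).
  exact: cvg_snd.
- move=> _ [->|[k ->]]; exists (fun _ _ => 0); try by right; exists 0.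
    by move=> p Up; exact: (pdxE (f := fun _ y => y) (is_derive_cst p.2 p.1 1)).
  by move=> p Up; exact: (pdxE (f := fun _ _ => k) (is_derive_cst k p.1 1)).
- move=> _ [->|[k ->]]; [exists (fun _ _ => 1); first by right; exists 1|exists (fun _ _ => 0); first by right; exists 0].
    by move=> p Up; exact: (pdyE (f := fun _ y => y) (is_derive_id p.2 1)).
  by move=> p Up; exact: (pdyE (f := fun _ _ => k) (is_derive_cst k p.2 1)).
Qed.

Lemma add_smooth (U : set (R * R)) f g : open U -> smooth_on U f -> smooth_on U g ->
  smooth_on U (fun x y => f x y + g x y).
Proof. by move=> oU sf sg; exact: (smooth_closureP oU (SmoothAdd (SmoothBase sf) (SmoothBase sg))). Qed.

Lemma mul_smooth (U : set (R * R)) f g : open U -> smooth_on U f -> smooth_on U g ->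
  smooth_on U (fun x y => f x y * g x y).
Proof. by move=> oU sf sg; exact: (smooth_closureP oU (SmoothMul (SmoothBase sf) (SmoothBase sg))). Qed.

Lemma opp_smooth (U : set (R * R)) f : open U -> smooth_on U f ->
  smooth_on U (fun x y => - f x y).
Proof.
move=> oU sf; have := mul_smooth oU (cst_smooth (-1) oU) sf.
by apply: eq_on_smooth => // p _; rewrite mulN1r.
Qed.

Lemma sub_smooth (U : set (R * R)) f g : open U -> smooth_on U f -> smooth_on U g ->
  smooth_on U (fun x y => f x y - g x y).
Proof. by move=> oU sf sg; exact: (add_smooth oU sf (opp_smooth oU sg)). Qed.

Lemma inv_smooth (U : set (R * R)) f : open U -> smooth_on U f ->
  (forall p, U p -> f p.1 p.2 != 0) -> smooth_on U (fun x y => (f x y)^-1).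
Proof. by move=> oU sf f0; exact: (smooth_closureP oU (SmoothInv (SmoothBase sf) f0)). Qed.

Lemma ln_smooth (U : set (R * R)) f : open U -> smooth_on U f ->
  (forall p, U p -> 0 < f p.1 p.2) -> smooth_on U (fun x y => ln (f x y)).
Proof. by move=> oU sf f0; exact: (smooth_closureP oU (SmoothLn (SmoothBase sf) f0)). Qed.

Lemma sum_smooth (U : set (R * R)) (I : Type) (r : seq I) (f : I -> R -> R -> R) :
  open U -> (forall i, smooth_on U (f i)) -> smooth_on U (fun x y => \sum_(i <- r) f i x y).
Proof.
move=> oU sf; elim: r => [|i r ih].
  by apply: eq_on_smooth (cst_smooth 0 oU) => // p _; rewrite big_nil.
by apply: eq_on_smooth (add_smooth oU (sf i) ih) => // p _; rewrite big_cons.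
Qed.

Lemma prod_smooth (U : set (R * R)) (I : Type) (r : seq I) (f : I -> R -> R -> R) :
  open U -> (forall i, smooth_on U (f i)) -> smooth_on U (fun x y => \prod_(i <- r) f i x y).
Proof.
move=> oU sf; elim: r => [|i r ih].
  by apply: eq_on_smooth (cst_smooth 1 oU) => // p _; rewrite big_nil.
by apply: eq_on_smooth (mul_smooth oU (sf i) ih) => // p _; rewrite big_cons.
Qed.

Section Coordinates.
Variable n : nat.
Implicit Types G : R -> R -> 'rV[R]_n.

Lemma regular_coord G p : regular_at G p ->
  forall i, [/\ regular_at (fun x y => G x y 0 i) p,
   pdx (fun x y => G x y 0 i) p.1 p.2 = pdx G p.1 p.2 0 i &
   pdy (fun x y => G x y 0 i) p.1 p.2 = pdy G p.1 p.2 0 i].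
Proof.
move=> [cG [dx dy]] i; split.
- split; last by split; [exact: (derivable_mxP _ _ _).1 dx 0 i|exact: (derivable_mxP _ _ _).1 dy 0 i].
  exact: (continuous_comp cG (@coord_continuous _ _ _ 0 i _)).
- by rewrite /pdx !derive1E (derive_mx dx) mxE.
- by rewrite /pdy !derive1E (derive_mx dy) mxE.
Qed.

Lemma regular_rowI G p : (forall i, regular_at (fun x y => G x y 0 i) p) -> regular_at G p.
Proof.
move=> h; split.
  apply/cvgrPdist_le => e e0; near=> q.
  rewrite [leLHS]/Num.Def.normr/= mx_normrE (bigmax_le _ (ltW e0))//= => -[i j] _.
  rewrite !mxE/= ord1; move: j; near: q; apply: filter_forall => j.
  by have [/cvgrPdist_le/(_ _ e0)] := h j.
split; [apply: (proj2 (derivable_mxP (fun t => G t p.2) p.1 1)) => i j|apply: (proj2 (derivable_mxP (fun t => G p.1 t) p.2 1)) => i j].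
  by rewrite ord1; have [_ [+ _]] := h j.
by rewrite ord1; have [_ [_ +]] := h j.
Unshelve. all: by end_near. Qed.

Lemma smooth_coord (U : set (R * R)) G : open U -> smooth_on U G ->
  forall i, smooth_on U (fun x y => G x y 0 i).
Proof.
move=> oU sG i.
pose C (f : R -> R -> R) := exists2 H : R -> R -> 'rV[R]_n, smooth_on U H & f = fun x y => H x y 0 i.
suff : forall f, C f -> smooth_on U f by apply; exists G.
apply: (smooth_on_coind oU).
- move=> _ [H sH ->] p Up; by have [] := regular_coord (smooth_on_regular sH Up) i.
- move=> _ [H sH ->]; exists (fun x y => pdx H x y 0 i).
    by exists (pdx H); first exact: smooth_on_pdx.
  by move=> p Up; have [] := regular_coord (smooth_on_regular sH Up) i.
- move=> _ [H sH ->]; exists (fun x y => pdy H x y 0 i).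
    by exists (pdy H); first exact: smooth_on_pdy.
  by move=> p Up; have [] := regular_coord (smooth_on_regular sH Up) i.
Qed.

Lemma smooth_rowI (U : set (R * R)) G : open U ->
  (forall i, smooth_on U (fun x y => G x y 0 i)) -> smooth_on U G.
Proof.
move=> oU; pose C (H : R -> R -> 'rV[R]_n) := forall i, smooth_on U (fun x y => H x y 0 i).
move: G; apply: (@smooth_on_coind _ U C oU).
- by move=> H sH p Up; apply: regular_rowI => i; exact: smooth_on_regular (sH i) Up.
- move=> H sH; exists (pdx H); last by move=> p Up; reflexivity.
  move=> i; apply: (eq_on_smooth oU _ (smooth_on_pdx (sH i))) => p Up.
  have rH : regular_at H p by apply: regular_rowI => j; exact: smooth_on_regular (sH j) Up.
  by have [] := regular_coord rH i.
- move=> H sH; exists (pdy H); last by move=> p Up; reflexivity.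
  move=> i; apply: (eq_on_smooth oU _ (smooth_on_pdy (sH i))) => p Up.
  have rH : regular_at H p by apply: regular_rowI => j; exact: smooth_on_regular (sH j) Up.
  by have [] := regular_coord rH i.
Qed.

End Coordinates.
End Smoothness.

(* Unfolding these makes failing unifications diverge. *)
Local Opaque smooth_on pdx pdy.

(** * Integration over compact plane sets *)

Section PlaneMeasure.
Variable R : realType.
Local Notation RR := (measurableTypeR R * measurableTypeR R)%type.
Local Notation leb := (@lebesgue_measure R).
Local Notation mu2 := (leb \x leb)%E.

Definition box (a b : R * R) : set (R * R) := `]a.1, b.1[ `*` `]a.2, b.2[.

Lemma nbhs_pairP (p : R * R) (A : set (R * R)) : nbhs p A ->
  exists2 e : R, 0 < e & forall q : R * R, `|q.1 - p.1| < e -> `|q.2 - p.2| < e -> A q.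
Proof.
move=> /nbhs_ballP[e /= e0 h]; exists e => // q q1 q2; apply: h.
by split; rewrite /ball/= distrC.
Qed.

Lemma nbhs_boxI (p : R * R) (A : set (R * R)) (e : R) : 0 < e ->
  (forall q : R * R, `|q.1 - p.1| < e -> `|q.2 - p.2| < e -> A q) -> nbhs p A.
Proof.
move=> e0 h; apply/nbhs_ballP; exists e => //= q [q1 q2].
by apply: h; rewrite distrC; [exact: q1|exact: q2].
Qed.

Lemma box_open (a b : R * R) : open (box a b).
Proof.
rewrite openE => p [p1 p2]; rewrite /interior.
exists ([set` `]a.1, b.1[], [set` `]a.2, b.2[]) => //=.
by split; apply: open_nbhs_nbhs; split=> //; exact: interval_open.
Qed.

Definition rbox (k : (rat * rat) * (rat * rat)) : set (R * R) :=
  box (ratr k.1.1, ratr k.1.2) (ratr k.2.1, ratr k.2.2).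

Lemma open_rbox (U : set (R * R)) p : open U -> U p ->
  exists k, rbox k p /\ rbox k `<=` U.
Proof.
move=> oU Up; have [e e0 h] := nbhs_pairP (open_nbhs_nbhs (conj oU Up)).
have [q1 /[!in_itv]/= /andP[a1 b1]] := @rat_in_itvoo R (p.1 - e) p.1 ltac:(lra).
have [q2 /[!in_itv]/= /andP[a2 b2]] := @rat_in_itvoo R p.1 (p.1 + e) ltac:(lra).
have [q3 /[!in_itv]/= /andP[a3 b3]] := @rat_in_itvoo R (p.2 - e) p.2 ltac:(lra).
have [q4 /[!in_itv]/= /andP[a4 b4]] := @rat_in_itvoo R p.2 (p.2 + e) ltac:(lra).
exists ((q1, q3), (q2, q4)); split.
  by split; rewrite /= in_itv/=; apply/andP.
move=> q []; rewrite /= !in_itv/= => /andP[? ?] /andP[? ?].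
by apply: h; rewrite ltr_norml; apply/andP; split; lra.
Qed.

Lemma box_measurable (a b : R * R) : measurable (box a b : set RR).
Proof. by apply: measurableX; exact: measurable_itv. Qed.

(* A second-countability argument: an open set is a union of rational boxes. *)
Lemma open_bigcup_rbox (U : set (R * R)) : open U ->
  U = \bigcup_(k in [set k | rbox k `<=` U]) rbox k.
Proof.
move=> oU; apply/seteqP; split=> [p Up|p [k /= kU kp]]; last exact: kU.
by have [k [kp kU]] := open_rbox oU Up; exists k.
Qed.

Lemma open_measurable2 (U : set (R * R)) : open U -> measurable (U : set RR).
Proof.
move=> oU; rewrite (open_bigcup_rbox oU) bigcup_mkcond.
apply: countable_bigcupT_measurable; first exact: countableP.
by move=> k; case: ifPn => // _; exact: box_measurable.
Qed.

Lemma closed_measurable2 (D : set (R * R)) : closed D -> measurable (D : set RR).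
Proof.
move=> cD; rewrite -(setCK D); apply: measurableC; apply: open_measurable2.
exact: closed_openC.
Qed.

Lemma compact_measurable2 (D : set (R * R)) : compact D -> measurable (D : set RR).
Proof. by move=> cD; apply: closed_measurable2; exact: compact_closed. Qed.

Lemma compact_sub_box (D : set (R * R)) : compact D ->
  exists2 M : R, 0 < M & D `<=` box (- M, - M) (M, M).
Proof.
move=> /compact_bounded[M [_ hM]]; exists (`|M| + 2); first by rewrite ltr_wpDl.
move=> p Dp; have /= := hM (`|M| + 1) ltac:(by rewrite (le_lt_trans (ler_norm _))// ltrDl) p Dp.
rewrite prod_normE/= ge_max => /andP[h1 h2].
by split; rewrite /= in_itv/= -ltr_norml; lra.
Qed.

Lemma mu2_box (a b : R * R) : a.1 <= b.1 -> a.2 <= b.2 ->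
  mu2 (box a b) = ((b.1 - a.1) * (b.2 - a.2))%:E.
Proof.
move=> h1 h2; rewrite product_measure1E//= !lebesgue_measure_itv/= !lte_fin EFinM.
congr (_ * _)%E; case: ltP => [h|h] /=.
- by rewrite EFinB.
- by congr EFin; lra.
- by rewrite EFinB.
- by congr EFin; lra.
Qed.

Lemma mu2_finite (D : set (R * R)) (a b : R * R) : measurable (D : set RR) ->
  D `<=` box a b -> (mu2 D < +oo)%E.
Proof.
move=> mD Dab.
have sub : D `<=` box (Num.min a.1 b.1, Num.min a.2 b.2) (Num.max a.1 b.1, Num.max a.2 b.2).
  move=> p /Dab[]; rewrite /= !in_itv/= => /andP[? ?] /andP[? ?].
  by split; rewrite /= in_itv/= lt_max gt_min; apply/andP; split; apply/orP; [left|right|left|right].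
set a' := (X in box X _) in sub; set b' := (X in box _ X) in sub.
have h1 : a'.1 <= b'.1 by rewrite /= ge_min le_max lexx.
have h2 : a'.2 <= b'.2 by rewrite /= ge_min le_max lexx.
have h : (mu2 D <= mu2 (box a' b'))%E.
  by apply: le_measure => //; rewrite inE; [exact: mD|exact: box_measurable].
by apply: (le_lt_trans h); rewrite (mu2_box h1 h2) ltry.
Qed.

Lemma compact_mu2_finite (D : set (R * R)) : compact D -> (mu2 D < +oo)%E.
Proof.
move=> cD; have [M _ DM] := compact_sub_box cD.
exact: mu2_finite (compact_measurable2 cD) DM.
Qed.

Lemma continuous_on_measurable (U D : set (R * R)) (f : R * R -> R) :
  open U -> D `<=` U -> measurable (D : set RR) ->
  (forall p, U p -> {for p, continuous f}) -> measurable_fun (D : set RR) f.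
Proof.
move=> oU DU mD cf; apply: (measurable_funS (E := U : set RR)) => //.
  exact: open_measurable2.
apply: (measurability _ (measurable_realfun.RGenOpens.measurableE R)).
move=> _ [_ [a [b ->] <-]]; apply: open_measurable2.
rewrite openE => p [Up fp]; rewrite /interior; apply: filterI.
  exact: open_nbhs_nbhs.
by apply: cf => //; apply: open_nbhs_nbhs; split => //; exact: interval_open.
Qed.

End PlaneMeasure.

Section PlaneIntegral.
Variable R : realType.
Local Notation RR := (measurableTypeR R * measurableTypeR R)%type.
Local Notation leb := (@lebesgue_measure R).
Local Notation mu2 := (leb \x leb)%E.

Lemma inv_measurable : measurable_fun setT (fun x : R => x^-1).
Proof.
rewrite -(setvU [set 0 : R]); apply/measurable_funU; [|exact: measurable_set1|split].
- by apply: measurableC; exact: measurable_set1.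
- apply: open_continuous_measurable_fun.
    by apply: closed_openC; apply: accessible_closed_set1; apply: hausdorff_accessible; exact: Rhausdorff.
  by move=> x; rewrite inE/= => /eqP x0; exact: inv_continuous.
- apply: (eq_measurable_fun (cst (0 : R))); last exact: measurable_cst.
  by move=> x; rewrite inE/= => ->; rewrite invr0.
Qed.

Section Domain.
Variable D : set (R * R).
Hypotheses (mD : measurable (D : set RR)) (fD : (mu2 D < +oo)%E).
Implicit Types f g : R * R -> R.

(** On a set of finite measure these functions form an algebra of integrable functions, so linearity
    and monotonicity of the integral apply without separate integrability arguments. *)
Definition bmf f := measurable_fun (D : set RR) f /\
  exists M : R, forall q, D q -> `|f q| <= M.

Lemma bmf_bound f : bmf f -> exists2 M : R, 0 < M & forall q, D q -> `|f q| <= M.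
Proof.
move=> [_ [M hM]]; exists (`|M| + 1); first by rewrite ltr_wpDl.
by move=> q /hM h; rewrite (le_trans h)// (le_trans (ler_norm _))// lerDl.
Qed.

Lemma bmf_cst (c : R) : bmf (fun _ => c).
Proof. by split; [exact: measurable_cst|exists `|c|]. Qed.

Lemma bmfD f g : bmf f -> bmf g -> bmf (fun q => f q + g q).
Proof.
move=> [mf [M hM]] [mg [N hN]]; split; first exact: measurable_funD.
by exists (M + N) => q Dq; rewrite (le_trans (ler_normD _ _))// lerD// ?hM ?hN.
Qed.

Lemma bmfM f g : bmf f -> bmf g -> bmf (fun q => f q * g q).
Proof.
move=> [mf [M hM]] [mg [N hN]]; split; first exact: measurable_funM.
by exists (M * N) => q Dq; rewrite normrM ler_pM// ?hM ?hN.
Qed.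

Lemma bmfN f : bmf f -> bmf (fun q => - f q).
Proof.
move=> /(bmfM (bmf_cst (-1))); rewrite (_ : (fun _ => _ * _) = (fun q => - f q))//.
by apply/funext => q; rewrite mulN1r.
Qed.

Lemma bmfB f g : bmf f -> bmf g -> bmf (fun q => f q - g q).
Proof. by move=> hf /bmfN; exact: bmfD. Qed.

Lemma bmf_sum (I : Type) (r : seq I) (f : I -> R * R -> R) :
  (forall i, bmf (f i)) -> bmf (fun q => \sum_(i <- r) f i q).
Proof.
move=> hf; elim: r => [|i r ih].
  by rewrite (_ : (fun _ => _) = (fun _ => 0)); [exact: bmf_cst|apply/funext=> q; rewrite big_nil].
rewrite (_ : (fun _ => _) = (fun q => f i q + \sum_(i <- r) f i q)); first exact: bmfD.
by apply/funext => q; rewrite big_cons.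
Qed.

Lemma bmf_indic (A : set (R * R)) : measurable (A : set RR) -> bmf (\1_A : R * R -> R).
Proof.
move=> mA; split; first exact: measurable_indic.
by exists 1 => q _; rewrite indicE; case: (q \in A); rewrite ?normr1// normr0.
Qed.

Lemma eq_bmf f g : (forall q, D q -> f q = g q) -> bmf f -> bmf g.
Proof.
move=> fg [mf [M hM]]; split.
  by apply: eq_measurable_fun mf => q /[!inE]; exact: fg.
by exists M => q Dq; rewrite -fg// hM.
Qed.

Lemma bmf_integrable f : bmf f -> mu2.-integrable D (EFin \o f).
Proof.
move=> [mf [M hM]]; apply: measurable_bounded_integrable => //.
by exists M; split; [exact: num_real|move=> x Mx q Dq /=; rewrite (le_trans (hM _ Dq))// ltW].
Qed.

Definition integ f : R := Rintegral (@leb2 R) D f.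

Lemma eq_integ f g : (forall q, D q -> f q = g q) -> integ f = integ g.
Proof. by move=> fg; apply: (@eq_Rintegral _ _ _ mu2) => q /[!inE]; exact: fg. Qed.

Lemma integD f g : bmf f -> bmf g -> integ (fun q => f q + g q) = integ f + integ g.
Proof. by move=> /bmf_integrable hf /bmf_integrable hg; exact: (@RintegralD _ _ _ mu2). Qed.

Lemma integZ (c : R) f : bmf f -> integ (fun q => c * f q) = c * integ f.
Proof. by move=> /bmf_integrable hf; exact: (@RintegralZl _ _ _ mu2). Qed.

Lemma integN f : bmf f -> integ (fun q => - f q) = - integ f.
Proof. by move=> hf; rewrite -mulN1r -integZ//; apply: eq_integ => q _; rewrite mulN1r. Qed.

Lemma integB f g : bmf f -> bmf g -> integ (fun q => f q - g q) = integ f - integ g.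
Proof. by move=> hf hg; rewrite integD// ?integN//; exact: bmfN. Qed.

Lemma integ_sum (I : Type) (r : seq I) (f : I -> R * R -> R) :
  (forall i, bmf (f i)) -> integ (fun q => \sum_(i <- r) f i q) = \sum_(i <- r) integ (f i).
Proof.
move=> hf; elim: r => [|i r ih].
  rewrite big_nil (@eq_integ _ (fun _ => 0)); last by move=> q _; rewrite big_nil.
  by rewrite /integ /leb2 Rintegral_cst// mul0r.
rewrite big_cons -ih -integD//; last exact: bmf_sum.
by apply: eq_integ => q _; rewrite big_cons.
Qed.

Lemma le_integ f g : bmf f -> bmf g -> (forall q, D q -> f q <= g q) -> integ f <= integ g.
Proof. by move=> /bmf_integrable hf /bmf_integrable hg; exact: (@le_Rintegral _ _ _ mu2). Qed.

Definition area_of : R := fine (mu2 D).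

Lemma integ_cst (c : R) : integ (fun _ => c) = c * area_of.
Proof. by rewrite /integ /leb2 Rintegral_cst. Qed.

Lemma integ_indic (A : set (R * R)) : measurable (A : set RR) -> (mu2 A < +oo)%E ->
  integ (\1_A) <= fine (mu2 A).
Proof.
move=> mA fA; rewrite /integ /leb2 /Rintegral integral_indic// fine_le//.
- by rewrite ge0_fin_numE// (le_lt_trans _ fA)// le_measure// inE//; exact: measurableI.
- by rewrite ge0_fin_numE.
- by rewrite le_measure// inE//; exact: measurableI.
Qed.

(** Dominated convergence along a real parameter reduces to sequences [u] tending to [t0]. The bound
    holds only for [t] within [r] of [t0], so the finitely many earlier terms are replaced by 0. *)
Lemma dominated_integ (g_ : R -> R * R -> R) (g : R * R -> R) (t0 r M : R) : 0 < r ->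
  (forall t, 0 < `|t - t0| < r -> measurable_fun (D : set RR) (g_ t)) ->
  measurable_fun (D : set RR) g ->
  (forall t q, 0 < `|t - t0| < r -> D q -> `|g_ t q| <= M) ->
  {ae mu2, forall q, D q -> g_ t q @[t --> t0^'] --> g q} ->
  integ (g_ t) @[t --> t0^'] --> integ g.
Proof.
move=> r0 mg_ mg gM gg; apply/cvgr_dnbhsP => u [ut0 ucvg].
pose h n q := if `|u n - t0| < r then g_ (u n) q else 0.
have ne n : 0 < `|u n - t0| by rewrite normr_gt0 subr_eq0.
have ev : \forall n \near \oo, `|u n - t0| < r.
  by move/cvgrPdist_lt : ucvg => /(_ r r0); apply: filterS => n; rewrite distrC.
have mh n : measurable_fun (D : set RR) (h n).
  rewrite /h; have [hn|_] := boolP (`|u n - t0| < r); last exact: measurable_cst.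
  by apply: mg_; apply/andP; split; [exact: ne|exact: hn].
have hM n q : D q -> `|h n q| <= `|M|.
  move=> Dq; rewrite /h; case: ifPn => [hn|_]; last by rewrite normr0.
  by rewrite (le_trans _ (ler_norm _))// gM//; apply/andP; split; [exact: ne|exact: hn].
have mono (P Q : RR -> Prop) : (forall q, P q -> Q q) -> {ae mu2, forall q, P q} -> {ae mu2, forall q, Q q}.
  by move=> PQ; apply: negligibleS => q /= nQ Pq; exact: nQ (PQ _ Pq).
have [ig _ cv] := @dominated_convergence _ RR R mu2 D mD (fun n q => (h n q)%:E)
  (EFin \o g) (fun _ => `|M|%:E)
  ltac:(by move=> n; apply/measurable_EFinP; exact: mh)
  ltac:(by apply/measurable_EFinP)
  ltac:(apply: mono gg => q gq Dq; apply: cvg_EFin; [by apply: nearW|]; apply: cvg_trans;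
    [|apply: (proj1 (cvgr_dnbhsP _ _ _) (gq Dq) u); split=> //];
    by apply: near_eq_cvg; apply: filterS ev => n hn; rewrite /h/= hn)
  ltac:(by apply: (bmf_integrable (bmf_cst `|M|)))
  ltac:(by apply: aeW => q n Dq; rewrite lee_fin hM).
rewrite (_ : integ g = fine (\int[mu2]_(x in D) (EFin \o g) x))//.
have fin : (\int[mu2]_(x in D) (EFin \o g) x)%E \is a fin_num by exact: integrable_fin_num.
have /fine_cvg : ([sequence \int[mu2]_(x in D) (h n x)%:E]_n @ \oo --> (fine (\int[mu2]_(x in D) (EFin \o g) x))%:E)%E.
  by rewrite fineK.
apply: cvg_trans; apply: near_eq_cvg; apply: filterS ev => n hn /=.
by rewrite /integ /leb2 /Rintegral; congr fine; apply: eq_integral => q _; rewrite /h hn.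
Qed.

End Domain.

Lemma compact_bmf (U D : set (R * R)) (f : R * R -> R) :
  compact D -> open U -> D `<=` U -> (forall p, U p -> {for p, continuous f}) -> bmf D f.
Proof.
move=> cD oU DU cf; split.
  exact: continuous_on_measurable (compact_measurable2 cD) cf.
have cfD : {within D, continuous f}.
  apply: continuous_in_subspaceT => p /[!inE] /DU; exact: cf.
have [M [_ hM]] := compact_bounded (continuous_compact cfD cD).
exists (`|M| + 1) => q Dq; apply: (hM (`|M| + 1)); last by exists q.
by rewrite (le_lt_trans (ler_norm _))// ltrDl.
Qed.

Lemma hslice_null (A : set (R * R)) : measurable (A : set RR) ->
  (forall y, leb [set x | A (x, y)] = 0%E) -> mu2 A = 0%E.
Proof.
move=> mA h; rewrite -(setIT A) -integral_indic// (fubini_tonelli2 (fun q : RR => (\1_A q)%:E)); first last.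
- by move=> q; rewrite lee_fin.
- by apply/measurable_EFinP; exact: measurable_indic.
apply: integral0_eq => y _; rewrite /fubini_G.
have e : (fun x => (\1_A (x, y))%:E) = (fun x => (\1_[set x | A (x, y)] x)%:E :> \bar R).
  by apply/funext => x; rewrite !indicE; congr (_%:R%:E); apply/idP/idP; rewrite !inE.
have es : [set x | A (x, y)] = ysection A y by apply/seteqP; split=> x /=; rewrite /ysection/= inE.
rewrite e integral_indic ?setIT; [exact: h|exact: measurableT|].
by rewrite es; exact: (measurable_ysection y mA).
Qed.

Lemma vslice_null (A : set (R * R)) : measurable (A : set RR) ->
  (forall x, leb [set y | A (x, y)] = 0%E) -> mu2 A = 0%E.
Proof.
move=> mA h; rewrite -(setIT A) -integral_indic// (fubini_tonelli1 (fun q : RR => (\1_A q)%:E)); first last.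
- by move=> q; rewrite lee_fin.
- by apply/measurable_EFinP; exact: measurable_indic.
apply: integral0_eq => x _; rewrite /fubini_F.
have e : (fun y => (\1_A (x, y))%:E) = (fun y => (\1_[set y | A (x, y)] y)%:E :> \bar R).
  by apply/funext => y; rewrite !indicE; congr (_%:R%:E); apply/idP/idP; rewrite !inE.
have es : [set y | A (x, y)] = xsection A x by apply/seteqP; split=> y /=; rewrite /xsection/= inE.
rewrite e integral_indic ?setIT; [exact: h|exact: measurableT|].
by rewrite es; exact: (measurable_xsection x mA).
Qed.

End PlaneIntegral.

(** * Mean value inequality and zero sets *)

Section PlaneCalculus.
Variable R : realType.
Implicit Types f g : R -> R -> R.

Lemma mvt_between (f df : R -> R) (a b : R) : a != b ->
  (forall x, Num.min a b <= x <= Num.max a b -> is_derive x 1 f (df x)) ->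
  exists2 c, Num.min a b < c < Num.max a b & f b - f a = df c * (b - a).
Proof.
wlog ab : a b / a < b.
  move=> h ne hd; move: (ne); rewrite neq_lt => /orP[ab|ba]; first exact: (h a b ab ne hd).
  have hd' x : Num.min b a <= x <= Num.max b a -> is_derive x 1 f (df x).
    by rewrite minC maxC; exact: hd.
  have [c hc e] := h b a ba ltac:(by rewrite eq_sym) hd'.
  exists c; first by rewrite minC maxC.
  by rewrite -[LHS]opprB e; ring.
move=> _; rewrite min_l ?max_r ?(ltW ab)// => hd.
have [||c] := @MVT R f df a b ab.
- by move=> x /[!in_itv]/= /andP[? ?]; apply: hd; apply/andP; split; exact: ltW.
- apply: derivable_within_continuous => x /[!in_itv]/= hx.
  by have [] := hd x hx.
by rewrite in_itv/= => hc e; exists c.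
Qed.

Lemma mvt_bound (f df : R -> R) (a b M : R) :
  (forall x, Num.min a b <= x <= Num.max a b -> is_derive x 1 f (df x)) ->
  (forall x, Num.min a b <= x <= Num.max a b -> `|df x| <= M) ->
  `|f b - f a| <= M * `|b - a|.
Proof.
move=> hd hM; have [<-|ab] := eqVneq a b; first by rewrite !subrr normr0 mulr0.
have [c /andP[c1 c2] ->] := mvt_between ab hd.
by rewrite normrM ler_wpM2r// hM// !ltW.
Qed.

Definition square (p : R * R) (r : R) : set (R * R) :=
  [set q | `|q.1 - p.1| < r /\ `|q.2 - p.2| < r].

Lemma open_square (U : set (R * R)) p : open U -> U p ->
  exists2 r, 0 < r & square p r `<=` U.
Proof.
move=> oU Up; have [e e0 h] := nbhs_pairP (open_nbhs_nbhs (conj oU Up)).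
by exists e => // q [q1 q2]; exact: h.
Qed.

Lemma square_nbhs (p : R * R) (r : R) : 0 < r -> nbhs p (square p r).
Proof. by move=> r0; apply: (nbhs_boxI r0). Qed.

Lemma square_center (p : R * R) (r : R) : 0 < r -> square p r p.
Proof. by move=> r0; split; rewrite subrr normr0. Qed.

Lemma squareE (p : R * R) (r : R) :
  square p r = box (p.1 - r, p.2 - r) (p.1 + r, p.2 + r).
Proof.
apply/seteqP; split=> q [] /=; rewrite ?in_itv/=.
  by rewrite !ltr_norml => /andP[? ?] /andP[? ?]; split; rewrite /= in_itv/=; apply/andP; split; lra.
by move=> /andP[? ?] /andP[? ?]; split; rewrite ltr_norml; apply/andP; split; lra.
Qed.

Lemma square_open (p : R * R) (r : R) : open (square p r).
Proof. by rewrite squareE; exact: box_open. Qed.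

Lemma rect_increment f (p q : R * R) (M : R) :
  (forall z, `|z.1 - p.1| <= `|q.1 - p.1| -> `|z.2 - p.2| <= `|q.2 - p.2| ->
    [/\ regular_at f z, `|pdx f z.1 z.2| <= M & `|pdy f z.1 z.2| <= M]) ->
  `|f q.1 q.2 - f p.1 p.2| <= M * (`|q.1 - p.1| + `|q.2 - p.2|).
Proof.
move=> h.
have bt (a b x : R) : Num.min a b <= x <= Num.max a b -> `|x - a| <= `|b - a|.
  rewrite ge_min le_max ler_norml.
  have := ler_norm (b - a); have := ler_norm (a - b); rewrite distrC => ? ?.
  have n0 := normr_ge0 (b - a).
  by move=> /andP[/orP[?|?] /orP[?|?]]; apply/andP; split; lra.
have -> : f q.1 q.2 - f p.1 p.2 = (f q.1 q.2 - f p.1 q.2) + (f p.1 q.2 - f p.1 p.2) by ring.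
rewrite mulrDr (le_trans (ler_normD _ _))// lerD//.
- apply: (@mvt_bound (fun t => f t q.2) (fun t => pdx f t q.2)) => x /bt hb.
    by apply: (@regular_dx _ f (x, q.2)); case: (h (x, q.2) hb (lexx _)).
  by case: (h (x, q.2) hb (lexx _)).
- have h0 : `|p.1 - p.1| <= `|q.1 - p.1| by rewrite subrr normr0.
  apply: (@mvt_bound (fun t => f p.1 t) (fun t => pdy f p.1 t)) => y /bt hb.
    by apply: (@regular_dy _ f (p.1, y)); case: (h (p.1, y) h0 hb).
  by case: (h (p.1, y) h0 hb).
Qed.

(** The mean value theorem is applied twice: in the first variable to the difference of [f] on two
    horizontal lines, then in the second variable to [pdx f]. *)
Lemma mixed_increment f (p : R * R) (r : R) : 0 < r ->
  (forall z, square p r z -> derivable (fun t => f t z.2) z.1 1) ->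
  (forall z, square p r z -> derivable (fun t => pdx f z.1 t) z.2 1) ->
  forall h, 0 < h < r -> exists2 z, square p h z &
    f (p.1 + h) (p.2 + h) - f (p.1 + h) p.2 - (f p.1 (p.2 + h) - f p.1 p.2) =
    pdy (pdx f) z.1 z.2 * h ^+ 2.
Proof.
move=> r0 dx dxy h /andP[h0 hr].
have mn (a : R) : Num.min a (a + h) = a by rewrite min_l// lerDl ltW.
have mx (a : R) : Num.max a (a + h) = a + h by rewrite max_r// lerDl ltW.
have inr (a x : R) : a <= x <= a + h -> `|x - a| < r.
  by move=> /andP[? ?]; rewrite ltr_norml; apply/andP; split; lra.
have inh (a x : R) : a < x < a + h -> `|x - a| < h.
  by move=> /andP[? ?]; rewrite ltr_norml; apply/andP; split; lra.
have nh (a : R) : a != a + h by rewrite lt_eqF// ltrDl.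
have c0 : `|p.2 - p.2| < r by rewrite subrr normr0.
have ch : `|p.2 + h - p.2| < r by apply: inr; rewrite lexx lerDl ltW.
have dX (x y : R) : `|x - p.1| < r -> `|y - p.2| < r -> is_derive x 1 (fun t => f t y) (pdx f x y).
  by move=> hx hy; apply: derivable_dx; exact: (dx (x, y)).
have [c] := @mvt_between (fun t => f t (p.2 + h) - f t p.2)
  (fun t => pdx f t (p.2 + h) - pdx f t p.2) p.1 (p.1 + h) (nh _)
  ltac:(by rewrite mn mx => x /inr hx; apply: is_deriveB; exact: dX).
rewrite mn mx => hc e1.
have [d] := @mvt_between (fun t => pdx f c t) (fun t => pdy (pdx f) c t) p.2 (p.2 + h) (nh _)
  ltac:(rewrite mn mx => y /inr hy; apply: derivable_dy; apply: (dxy (c, y));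
    split=> //; exact: lt_trans (inh _ _ hc) hr).
rewrite mn mx => hd e2.
exists (c, d); first by split; apply: inh.
rewrite /= expr2; move: e1 e2; rewrite ![_ + h - _]addrAC !subrr !add0r => e1 e2.
by rewrite mulrA -e2 -e1; ring.
Qed.

(** The second difference over a square is symmetric in the two variables. Applying
    [mixed_increment] to [f] and to [f] with its arguments exchanged shows that the two mixed
    partials take a common value at points arbitrarily close to [p]. *)
Lemma clairaut f (U : set (R * R)) p : open U -> smooth_on U f -> U p ->
  pdx (pdy f) p.1 p.2 = pdy (pdx f) p.1 p.2.
Proof.
move=> oU sf Up; have [r r0 rU] := open_square oU Up.
have cxy := (smooth_on_regular (smooth_on_pdy (smooth_on_pdx sf)) Up).1.
have cyx := (smooth_on_regular (smooth_on_pdx (smooth_on_pdy sf)) Up).1.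
apply/eqP; rewrite -subr_eq0 -normr_le0; apply/ler_addgt0Pl => e e0; rewrite addr0.
have /cvgrPdist_lt/(_ (e / 2) ltac:(by rewrite divr_gt0)) n1 := cxy.
have /cvgrPdist_lt/(_ (e / 2) ltac:(by rewrite divr_gt0)) n2 := cyx.
have [d d0 hd] := nbhs_pairP (filterI n1 n2).
pose h := Num.min r d / 2.
have m0 : 0 < Num.min r d by rewrite lt_min r0 d0.
have h0 : 0 < h by rewrite divr_gt0.
have hr : 0 < h < r by rewrite h0 /= /h ltr_pdivrMr// mulr_natr (@le_lt_trans _ _ r)// ?ge_min ?lexx// mulr2n ltrDl.
have hhd : h < d by rewrite /h ltr_pdivrMr// mulr_natr (@le_lt_trans _ _ d)// ?ge_min ?lexx ?orbT// mulr2n ltrDl.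
have [z1 z1h e1] := @mixed_increment f p r r0
  ltac:(by move=> z /rU Uz; exact: (smooth_on_regular sf Uz).2.1)
  ltac:(by move=> z /rU Uz; exact: (smooth_on_regular (smooth_on_pdx sf) Uz).2.2) h hr.
have swU (z : R * R) : square (p.2, p.1) r z -> U (z.2, z.1) by case=> h1 h2; apply: rU; split.
have dy' (z : R * R) : square (p.2, p.1) r z -> derivable (fun t => f z.2 t) z.1 1.
  by move=> /swU Uz; exact: (smooth_on_regular sf Uz).2.2.
have dyx (z : R * R) : square (p.2, p.1) r z -> derivable (fun t => pdx (fun x y => f y x) z.1 t) z.2 1.
  by move=> /swU Uz; rewrite pdx_swap; exact: (smooth_on_regular (smooth_on_pdy sf) Uz).2.1.
have [z2 z2h] := @mixed_increment (fun x y => f y x) (p.2, p.1) r r0 dy' dyx h hr.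
rewrite pdx_swap (pdy_swap (pdy f)) => e2.
have eq : pdy (pdx f) z1.1 z1.2 = pdx (pdy f) z2.2 z2.1.
  have hh : h ^+ 2 != 0 by rewrite expf_neq0// lt0r_neq0.
  move: e1 e2; move: (pdy (pdx f) z1.1 z1.2) (pdx (pdy f) z2.2 z2.1) => A B /= e1 e2.
  apply: (mulIf hh); rewrite -e1 -e2.
  by move: (f _ _) (f _ _) (f _ _) (f _ _) => A1 B1 C1 E1; ring.
have [a1 _] := hd z1 (lt_trans z1h.1 hhd) (lt_trans z1h.2 hhd).
have [_ a2] := hd (z2.2, z2.1) (lt_trans z2h.2 hhd) (lt_trans z2h.1 hhd).
move: a1 a2; rewrite /= -eq.
move: (pdy _ _ _) (pdx _ _ _) (pdy _ _ _) => A B C a1 a2.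
clear -a1 a2 e0.
rewrite (le_trans (ler_distD A _ _))// (splitr e) lerD// ltW//.
by rewrite distrC.
Qed.

End PlaneCalculus.

Section ZeroSets.
Variable R : realType.
Local Notation RR := (measurableTypeR R * measurableTypeR R)%type.
Local Notation leb := (@lebesgue_measure R).
Local Notation mu2 := (leb \x leb)%E.
Implicit Types f g : R -> R -> R.

Lemma subsingleton_null (A : set R) : (forall x y, A x -> A y -> x < y -> False) -> leb A = 0%E.
Proof.
move=> h; apply: countable_lebesgue_measure0; apply: finite_set_countable.
have [->|/set0P[x Ax]] := eqVneq A set0; first exact: finite_set0.
apply: (sub_finite_set _ (finite_set1 x)) => y Ay /=.
by have [xy|xy|//] := ltgtP y x; [case: (h _ _ Ay Ax xy)|case: (h _ _ Ax Ay xy)].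
Qed.

Lemma open_nonzero (U : set (R * R)) f : open U -> smooth_on U f ->
  open [set q | U q /\ f q.1 q.2 != 0].
Proof.
move=> oU sf; rewrite openE => p [Up fp]; rewrite /interior.
have n1 : nbhs p U by apply: open_nbhs_nbhs; split.
have n2 : nbhs p [set q | f q.1 q.2 != 0].
  have cf := (smooth_on_regular sf Up).1.
  exact: (cvgr_neq0 _ cf fp).
exact: filterI n1 n2.
Qed.

(** By the mean value theorem each horizontal line contains at most one zero in the box, and a set
    with null slices is null. *)
Lemma box_null_dx (a b : R * R) f : smooth_on (box a b) f ->
  (forall q, box a b q -> pdx f q.1 q.2 != 0) ->
  mu2.-negligible [set q | box a b q /\ f q.1 q.2 = 0].
Proof.
move=> sf f0.
have mA : measurable ([set q | box a b q /\ f q.1 q.2 = 0] : set RR).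
  have -> : [set q | box a b q /\ f q.1 q.2 = 0] =
    box a b `\` [set q | box a b q /\ f q.1 q.2 != 0].
    apply/seteqP; split=> q /=; first by move=> [Bq ->]; split=> // -[_]; rewrite eqxx.
    by move=> [Bq h]; split=> //; apply: contra_notP h => /eqP.
  apply: measurableD; first exact: box_measurable.
  by apply: open_measurable2; apply: open_nonzero => //; exact: box_open.
apply/negligibleP => //; apply: hslice_null => // y; apply: subsingleton_null => x1 x2.
move=> [[/= B1 B2] e1] [[/= B1' _] e2] x12.
have inb x : x1 <= x <= x2 -> box a b (x, y).
  move=> /andP[h1 h2]; split=> //=; move: B1 B1'; rewrite /= !in_itv/= => /andP[? ?] /andP[? ?].
  by apply/andP; split; lra.
have [|c] := @mvt_between R (fun t => f t y) (fun t => pdx f t y) x1 x2 ltac:(by rewrite lt_eqF).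
  rewrite min_l ?max_r ?(ltW x12)// => x /inb hx.
  by have := regular_dx (smooth_on_regular sf hx).
rewrite min_l ?max_r ?(ltW x12)// => /andP[c1 c2].
rewrite e1 e2 subrr => /esym/eqP; rewrite mulf_eq0 subr_eq0 (gt_eqF x12) orbF.
by apply/negP; apply: (f0 (c, y)); apply: inb; rewrite !ltW.
Qed.

Lemma box_null_dy (a b : R * R) f : smooth_on (box a b) f ->
  (forall q, box a b q -> pdy f q.1 q.2 != 0) ->
  mu2.-negligible [set q | box a b q /\ f q.1 q.2 = 0].
Proof.
move=> sf f0.
have mA : measurable ([set q | box a b q /\ f q.1 q.2 = 0] : set RR).
  have -> : [set q | box a b q /\ f q.1 q.2 = 0] =
    box a b `\` [set q | box a b q /\ f q.1 q.2 != 0].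
    apply/seteqP; split=> q /=; first by move=> [Bq ->]; split=> // -[_]; rewrite eqxx.
    by move=> [Bq h]; split=> //; apply: contra_notP h => /eqP.
  apply: measurableD; first exact: box_measurable.
  by apply: open_measurable2; apply: open_nonzero => //; exact: box_open.
apply/negligibleP => //; apply: vslice_null => // x; apply: subsingleton_null => y1 y2.
move=> [[/= B2 B1] e1] [[/= _ B1'] e2] y12.
have inb y : y1 <= y <= y2 -> box a b (x, y).
  move=> /andP[h1 h2]; split=> //=; move: B1 B1'; rewrite /= !in_itv/= => /andP[? ?] /andP[? ?].
  by apply/andP; split; lra.
have [|c] := @mvt_between R (fun t => f x t) (fun t => pdy f x t) y1 y2 ltac:(by rewrite lt_eqF).
  rewrite min_l ?max_r ?(ltW y12)// => y /inb hy.
  by have := regular_dy (smooth_on_regular sf hy).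
rewrite min_l ?max_r ?(ltW y12)// => /andP[c1 c2].
rewrite e1 e2 subrr => /esym/eqP; rewrite mulf_eq0 subr_eq0 (gt_eqF y12) orbF.
by apply/negP; apply: (f0 (x, c)); apply: inb; rewrite !ltW.
Qed.

Lemma rbox_negligible (V A : set (R * R)) : open V ->
  (forall k, @rbox R k `<=` V -> mu2.-negligible (@rbox R k `&` A)) ->
  mu2.-negligible (V `&` A).
Proof.
move=> oV h.
pose Fk (n : nat) : set RR := if @unpickle ((rat * rat) * (rat * rat))%type n is Some k
  then (if `[< @rbox R k `<=` V >] then @rbox R k `&` A else set0) else set0.
apply: (negligibleS _ (negligible_bigcup (F := Fk) _)).
- move=> p [Vp Ap]; have [k [kp kV]] := open_rbox oV Vp.
  exists (pickle k); first exact: I.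
  by rewrite /Fk pickleK (asboolT kV); split; [exact: kp|exact: Ap].
- move=> n; rewrite /Fk; case: (unpickle n) => [k|]; last exact: negligible_set0.
  by case: asboolP => [/h//|_]; exact: negligible_set0.
Qed.

(** Induction on the order of the derivative that does not vanish. Where the derivative of one order
    less vanishes, it does so with a nonzero first partial, on a null set; where it does not, an
    open set remains and the induction hypothesis applies on its rational boxes. *)
Lemma box_zero_set_negligible (s : seq bool) : forall (a b : R * R) f, smooth_on (box a b) f ->
  (forall q, box a b q -> ipartial f s q.1 q.2 != 0) ->
  mu2.-negligible [set q | box a b q /\ f q.1 q.2 = 0].
Proof.
elim: s => [|c s ih] a b f sf f0.
  rewrite (_ : [set q | _] = set0); first exact: negligible_set0.
  by apply/seteqP; split=> q //= [/f0 /[swap] /= ->]; rewrite eqxx.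
have sg := smooth_ipartial s sf.
have n1 : mu2.-negligible [set q | box a b q /\ ipartial f s q.1 q.2 = 0].
  by case: c f0 => f0; [exact: box_null_dx|exact: box_null_dy].
set V := [set q | box a b q /\ ipartial f s q.1 q.2 != 0].
have oV : open V by apply: open_nonzero => //; exact: box_open.
have n2 : mu2.-negligible (V `&` [set q | f q.1 q.2 = 0]).
  apply: rbox_negligible => // k kV; apply: ih; last by move=> q /kV[].
  by apply: smooth_onS sf => q /kV[].
apply: negligibleS (negligibleU n1 n2) => q [Bq fq] /=.
by have [e|ne] := eqVneq (ipartial f s q.1 q.2) 0; [left|right].
Qed.

End ZeroSets.

(** * Complements of closed discrete sets *)

Section DiscreteComplement.
Variable R : realType.
Implicit Types P : set (R * R).

Lemma open_setC_discrete P : discrete_in_plane P -> open (~` P).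
Proof.
move=> dP; rewrite openE => p nPp; rewrite /interior.
have := dP p; rewrite near_simpl/= => h.
have : \forall w \near p, w != p -> ~ P w by exact: h.
apply: filterS => w hw; have [->//|] := eqVneq w p; exact: hw.
Qed.

(** Every point of [P] is alone in some rational box, and a rational box isolates at most one
    point. *)
Lemma discrete_countable P : discrete_in_plane P -> countable P.
Proof.
move=> dP.
pose G k : set (R * R) := [set p | P p /\ forall q, @rbox R k q -> P q -> q = p] `&` @rbox R k.
have -> : P = \bigcup_(k in setT) G k.
  apply/seteqP; split=> [p Pp|p [k _ [[]]]]//.
  have h : \forall w \near p, w != p -> ~ P w by exact: (dP p).
  have [k [kp kV]] := @open_rbox R ([set w | w != p -> ~ P w]°) p (@open_interior _ _) h.
  exists k => //; split=> //; split=> // q /kV/interior_subset/= + Pq.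
  by have [//|ne] := eqVneq q p => /(_ isT).
apply: bigcup_countable; first exact: countableP.
move=> k _; apply: finite_set_countable.
have [->|/set0P[p Gp]] := eqVneq (G k) set0; first exact: finite_set0.
apply: (sub_finite_set _ (finite_set1 p)) => q [[Pq _] kq] /=.
by case: Gp => -[_ +] _; apply.
Qed.

Lemma countable_avoid (A : set R) (a b : R) : countable A -> a < b ->
  exists2 c, a < c < b & ~ A c.
Proof.
move=> cA ab; apply: contrapT => h.
have sub : `]a, b[ `<=` A.
  by move=> c /=; rewrite in_itv/= => hc; apply: contrapT => nA; apply: h; exists c.
have : (lebesgue_measure (`]a, b[%classic : set R) = 0)%E.
  apply: countable_lebesgue_measure0; exact: sub_countable (subset_card_le sub) cA.
rewrite lebesgue_measure_itv/= lte_fin ab -EFinB => -[]; lra.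
Qed.

Lemma locally_constant_line (g : R -> R) : (forall x, \forall t \near x, g t = g x) ->
  forall a b, g a = g b.
Proof.
move=> h a b; apply/eqP; rewrite eq_sym -subr_eq0 -normr_le0 -[leRHS](mul0r `|b - a|).
apply: (@mvt_bound R g (fun _ => 0)) => [x _|x _]; last by rewrite normr0.
apply: (@near_eq_is_derive R R R (cst (g x)) g x 1 0 _ (is_derive_cst (g x) x (1 : R))).
by apply: filterS (h x) => t ->.
Qed.

(** Connectedness through lines: [P] being countable, almost all horizontal and vertical lines avoid
    it. A short vertical move inside a neighborhood of local constancy reaches such a horizontal
    line, which leads to a fixed vertical line avoiding [P]. *)
Lemma locally_constant_compl P (g : R * R -> R) : discrete_in_plane P ->
  (forall z, ~ P z -> \forall w \near z, g w = g z) ->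
  forall z w, ~ P z -> ~ P w -> g z = g w.
Proof.
move=> dP lg z w Pz Pw; have cP := discrete_countable dP.
have cx : countable (fst @` P) by exact: sub_countable (card_image_le _ _) cP.
have cy : countable (snd @` P) by exact: sub_countable (card_image_le _ _) cP.
have [x0 _ hx0] := countable_avoid cx (ltr01 : (0 : R) < 1).
have toline (q : R * R) : ~ P q -> exists2 y, ~ (snd @` P) y & g q = g (q.1, y).
  move=> Pq; have [e e0 he] := nbhs_pairP (lg _ Pq).
  have [y hy1 hy] := countable_avoid cy (ltac:(lra) : q.2 - e < q.2 + e).
  exists y => //; apply/esym/(he (q.1, y)) => /=; first by rewrite subrr normr0.
  by rewrite ltr_norml; apply/andP; move: hy1 => /andP[? ?]; split; lra.
have hline y : ~ (snd @` P) y -> forall a b, g (a, y) = g (b, y).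
  move=> ny; apply: (locally_constant_line (g := fun t => g (t, y))) => x.
  have := @lg (x, y) ltac:(by move=> Pxy; apply: ny; exists (x, y)).
  move=> /nbhs_pairP[e e0 he]; near=> t; apply: (he (t, y)) => /=; last by rewrite subrr normr0.
  by rewrite distrC; near: t; apply: cvgr_dist_lt.
have vline : forall a b, g (x0, a) = g (x0, b).
  apply: (locally_constant_line (g := fun t => g (x0, t))) => y.
  have := @lg (x0, y) ltac:(by move=> Pxy; apply: hx0; exists (x0, y)).
  move=> /nbhs_pairP[e e0 he]; near=> t; apply: (he (x0, t)) => /=; first by rewrite subrr normr0.
  by rewrite distrC; near: t; apply: cvgr_dist_lt.
have [y ny ->] := toline z Pz; have [y' ny' ->] := toline w Pw.
by rewrite (hline y ny _ x0) (hline y' ny' _ x0).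
Unshelve. all: by end_near. Qed.

End DiscreteComplement.

(** * Jets and the identity theorem *)

Section SecondDerivative.
Variable R : realType.

Lemma is_derive_near_sign (f : R -> R) (a c : R) : is_derive a 1 f c -> c < 0 ->
  exists2 d, 0 < d & forall t, a < t < a + d -> f t < f a.
Proof.
move=> [df <-] c0.
have : h^-1 *: ((f \o shift a) (h *: 1) - f a) @[h --> 0^'] --> 'D_1 f a by exact: df.
move=> /cvgrPdist_lt/(_ (- 'D_1 f a) ltac:(by rewrite oppr_gt0)).
move=> [/= d d0 hd]; exists d => // t /andP[at_ td].
have := hd (t - a); rewrite /ball_/= sub0r normrN gtr0_norm ?subr_gt0// ltrBlDl.
move=> /(_ td); rewrite gt_eqF ?subr_gt0// => /(_ isT).
rewrite scaler1 /shift/= subrK => h.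
have {h} : (t - a)^-1 * (f t - f a) < 0.
  move: h; rewrite /GRing.scale/= ltr_norml opprK => /andP[+ _].
  by move: ('D_1 f a) (_ * _) => u v; lra.
by rewrite pmulr_rlt0 ?invr_gt0 ?subr_gt0// subr_lt0.
Qed.

(** The first derivative vanishes at [a]; were [c] negative, it would be negative just to the right
    of [a] and [f] would fall below [f a] there. *)
Lemma second_derivative_at_min (f f1 : R -> R) (a c : R) :
  (\forall t \near a, is_derive (t : R) (1 : R) f (f1 t)) -> is_derive a (1 : R) f1 c ->
  (\forall t \near a, f a <= f t) -> 0 <= c.
Proof.
move=> nf df1 mf; rewrite leNgt; apply/negP => c0.
have nfm : nbhs a [set t | is_derive (t : R) (1 : R) f (f1 t) /\ f a <= f t] by exact: filterI nf mf.
move: nfm => /nbhs_ballP[e /= e0 he].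
have ine (t : R) : t \in `]a - e, a + e[ -> is_derive t 1 f (f1 t) /\ f a <= f t.
  rewrite in_itv/= => /andP[? ?]; apply: he.
  by rewrite /ball/= ltr_norml; apply/andP; split; lra.
have f1a : f1 a = 0.
  have aI : a \in `]a - e, a + e[ by rewrite in_itv/=; apply/andP; split; lra.
  have h0 : is_derive a 1 f 0.
    apply: (@derive1_at_min R f (a - e) (a + e) a) => // [|t /ine[[]]//|t /ine[]//]; lra.
  have [ha _] := ine _ aI.
  have e1 := @derive_val _ _ _ _ _ _ _ ha; have e2 := @derive_val _ _ _ _ _ _ _ h0.
  by rewrite -e1 e2.
have [d d0 hd] := is_derive_near_sign df1 c0.
pose t := a + Num.min d e / 2.
have m0 : 0 < Num.min d e by rewrite lt_min d0 e0.
have at_ : a < t by rewrite /t ltrDl divr_gt0.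
have tm : t < a + Num.min d e by rewrite /t ltrD2l ltr_pdivrMr// ltr_pMr// ltr1n.
have td : t < a + d by apply: lt_le_trans tm _; rewrite lerD2l ge_min lexx.
have te : t < a + e by apply: lt_le_trans tm _; rewrite lerD2l ge_min lexx orbT.
have inI (x : R) : a <= x <= t -> x \in `]a - e, a + e[.
  by move=> /andP[? ?]; rewrite in_itv/=; apply/andP; split; lra.
have [|x /andP[x1 x2] ex] := @mvt_between R f f1 a t ltac:(by rewrite lt_eqF).
  by rewrite min_l ?max_r ?(ltW at_)// => x /inI/ine[].
move: x1 x2; rewrite min_l ?max_r ?(ltW at_)// => x1 x2.
have fx : f1 x < 0 by rewrite -f1a; apply: hd; rewrite x1 (lt_trans x2).
have [_] := ine t ltac:(by apply: inI; rewrite lexx (ltW at_)).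
by rewrite leNgt => /negP; apply; rewrite -subr_lt0 ex pmulr_llt0// subr_gt0.
Qed.

End SecondDerivative.

Section Jets.
Variable R : realType.
Implicit Types f g : R -> R -> R.

(** Regularity bundled with the values of the gradient: the rules below differentiate an explicit
    formula by following its syntax, and [jet_eq] then normalizes the result. *)
Definition jet f (p : R * R) (a b : R) :=
  [/\ regular_at f p, pdx f p.1 p.2 = a & pdy f p.1 p.2 = b].

Lemma jet_eq f p a b a' b' : jet f p a b -> a = a' -> b = b' -> jet f p a' b'.
Proof. by move=> h <- <-. Qed.

Lemma jet_smooth (U : set (R * R)) f p : smooth_on U f -> U p ->
  jet f p (pdx f p.1 p.2) (pdy f p.1 p.2).
Proof. by move=> sf Up; split; first exact: smooth_on_regular Up. Qed.

Lemma jet_cst (c : R) p : jet (fun _ _ => c) p 0 0.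
Proof.
split; first exact: (smooth_on_regular (cst_smooth c openT)).
  exact: (pdxE (f := fun _ _ => c) (is_derive_cst c p.1 1)).
exact: (pdyE (f := fun _ _ => c) (is_derive_cst c p.2 1)).
Qed.

Lemma jet_x p : jet (fun x _ => x) p 1 0.
Proof.
split; first exact: (smooth_on_regular (fst_smooth openT)).
  exact: (pdxE (f := fun x _ => x) (is_derive_id p.1 1)).
exact: (pdyE (f := fun x _ => x) (is_derive_cst p.1 p.2 1)).
Qed.

Lemma jet_y p : jet (fun _ y => y) p 0 1.
Proof.
split; first exact: (smooth_on_regular (snd_smooth openT)).
  exact: (pdxE (f := fun _ y => y) (is_derive_cst p.2 p.1 1)).
exact: (pdyE (f := fun _ y => y) (is_derive_id p.2 1)).
Qed.

Lemma jetD f g p a b c d : jet f p a b -> jet g p c d ->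
  jet (fun x y => f x y + g x y) p (a + c) (b + d).
Proof. by move=> [rf <- <-] [rg <- <-]; exact: regular_add. Qed.

Lemma jetM f g p a b c d : jet f p a b -> jet g p c d ->
  jet (fun x y => f x y * g x y) p (f p.1 p.2 * c + g p.1 p.2 * a) (f p.1 p.2 * d + g p.1 p.2 * b).
Proof. by move=> [rf <- <-] [rg <- <-]; exact: regular_mul. Qed.

Lemma jetN f p a b : jet f p a b -> jet (fun x y => - f x y) p (- a) (- b).
Proof.
move=> /(jetM (jet_cst (-1) p)) h.
have -> : (fun x y => - f x y) = (fun x y => -1 * f x y) by apply/funext => x; apply/funext => y; rewrite mulN1r.
by apply: jet_eq h _ _; ring.
Qed.

Lemma jetB f g p a b c d : jet f p a b -> jet g p c d ->
  jet (fun x y => f x y - g x y) p (a - c) (b - d).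
Proof. by move=> hf /jetN; exact: jetD. Qed.

Lemma jetV f p a b : jet f p a b -> f p.1 p.2 != 0 ->
  jet (fun x y => (f x y)^-1) p (- f p.1 p.2 ^- 2 * a) (- f p.1 p.2 ^- 2 * b).
Proof. by move=> [rf <- <-] f0; exact: regular_inv. Qed.

Lemma jet_ln f p a b : jet f p a b -> 0 < f p.1 p.2 ->
  jet (fun x y => ln (f x y)) p ((f p.1 p.2)^-1 * a) ((f p.1 p.2)^-1 * b).
Proof. by move=> [rf <- <-] f0; exact: regular_ln. Qed.

End Jets.

Section IdentityTheorem.
Variable R : realType.
Implicit Types (f g P Q : R -> R -> R) (p z : R * R).

Definition taxi (p z : R * R) : R := `|z.1 - p.1| + `|z.2 - p.2|.

Lemma taxi_ge0 p z : 0 <= taxi p z.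
Proof. by rewrite addr_ge0. Qed.

Definition flat_at f p := forall N : nat, exists C : R,
  \forall z \near p, `|f z.1 z.2| <= C * taxi p z ^+ N.

(** Induction on [N] for all [f] at once: the partial derivatives satisfy the same hypothesis, and
    the mean value inequality gains one order. *)
Lemma flat_of_partials (U : set (R * R)) f p : open U -> smooth_on U f -> U p ->
  (forall s, ipartial f s p.1 p.2 = 0) -> flat_at f p.
Proof.
move=> oU sf Up fs N; elim: N f sf fs => [|N ih] f sf fs.
  exists 1; have cf := (smooth_on_regular sf Up).1.
  have := fs [::]; rewrite /= => f0.
  have /cvgrPdist_le/(_ 1 ltr01) := cf; rewrite f0.
  by apply: filterS => z; rewrite sub0r normrN expr0 mulr1.
have [C1 h1] := ih _ (smooth_on_pdx sf) ltac:(by move=> s; rewrite -(ipartial_rcons f s true)).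
have [C2 h2] := ih _ (smooth_on_pdy sf) ltac:(by move=> s; rewrite -(ipartial_rcons f s false)).
have n3 : nbhs p U by apply: open_nbhs_nbhs; split.
have [e e0 he] := nbhs_pairP (filterI n3 (filterI h1 h2)).
exists (`|C1| + `|C2|); apply: (nbhs_boxI e0) => z z1 z2 /=.
have := @rect_increment R f p z ((`|C1| + `|C2|) * taxi p z ^+ N).
rewrite (fs [::] : f p.1 p.2 = 0) subr0 => h; rewrite exprSr mulrA; apply: h => w w1 w2.
have [Uw [g1 g2]] := he w (le_lt_trans w1 z1) (le_lt_trans w2 z2).
have mw : taxi p w ^+ N <= taxi p z ^+ N by rewrite lerXn2r ?nnegrE ?taxi_ge0// lerD.
have mw0 : 0 <= taxi p w ^+ N by rewrite exprn_ge0// taxi_ge0.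
split; first exact: smooth_on_regular Uw.
- rewrite (le_trans g1)// (@le_trans _ _ (`|C1| * taxi p w ^+ N))//.
    by rewrite ler_wpM2r// ler_norm.
  by rewrite ler_pM// lerDl.
- rewrite (le_trans g2)// (@le_trans _ _ (`|C2| * taxi p w ^+ N))//.
    by rewrite ler_wpM2r// ler_norm.
  by rewrite ler_pM// lerDr.
Qed.

(* Cauchy-Riemann: [P + i Q] is holomorphic on [V]. *)
Definition cr (V : set (R * R)) P Q := [/\ smooth_on V P, smooth_on V Q &
  forall z, V z -> pdx P z.1 z.2 = pdy Q z.1 z.2 /\ pdy P z.1 z.2 = - pdx Q z.1 z.2].

Lemma cr_mul (V : set (R * R)) P Q A B : open V -> cr V P Q -> cr V A B ->
  cr V (fun x y => P x y * A x y - Q x y * B x y) (fun x y => P x y * B x y + Q x y * A x y).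
Proof.
move=> oV [sP sQ PQ] [sA sB AB]; split.
- by apply: (sub_smooth oV); apply: (mul_smooth oV).
- by apply: (add_smooth oV); apply: (mul_smooth oV).
move=> z Vz; have [e1 e2] := PQ z Vz; have [e3 e4] := AB z Vz.
have [jP jQ] := (jet_smooth sP Vz, jet_smooth sQ Vz).
have [jA jB] := (jet_smooth sA Vz, jet_smooth sB Vz).
have [_ -> ->] := jetB (jetM jP jA) (jetM jQ jB).
have [_ -> ->] := jetD (jetM jP jB) (jetM jQ jA).
rewrite e1 e2 e3 e4; move: (pdy _ _ _) (pdx _ _ _) (pdy _ _ _) (pdx _ _ _) => a b c d.
by split; ring.
Qed.

Lemma cr_laplacian (V : set (R * R)) P Q z : open V -> cr V P Q -> V z ->
  pdx (pdx P) z.1 z.2 + pdy (pdy P) z.1 z.2 = 0 /\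
  pdx (pdx Q) z.1 z.2 + pdy (pdy Q) z.1 z.2 = 0.
Proof.
move=> oV [sP sQ PQ] Vz.
have e1 := eq_on_pdx oV (fun z Vz => (PQ z Vz).1) Vz.
have e2 := eq_on_pdy oV (fun z Vz => (PQ z Vz).1) Vz.
have e3 : pdx (pdy P) z.1 z.2 = - pdx (pdx Q) z.1 z.2.
  rewrite (eq_on_pdx oV (g := fun x y => - pdx Q x y) (fun z Vz => (PQ z Vz).2) Vz).
  by have [_ e _] := jetN (jet_smooth (smooth_on_pdx sQ) Vz); exact: e.
have e4 : pdy (pdy P) z.1 z.2 = - pdy (pdx Q) z.1 z.2.
  rewrite (eq_on_pdy oV (g := fun x y => - pdx Q x y) (fun z Vz => (PQ z Vz).2) Vz).
  by have [_ _ e] := jetN (jet_smooth (smooth_on_pdx sQ) Vz); exact: e.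
split; first exact: (etrans (congr2 +%R (etrans e1 (clairaut oV sQ Vz)) e4) (subrr _)).
have h := etrans (esym e2) (etrans (esym (clairaut oV sP Vz)) e3).
exact: (etrans (congr1 (+%R _) h) (subrr _)).
Qed.

Definition sqdist p (x y : R) : R := (x - p.1) * (x - p.1) + (y - p.2) * (y - p.2).

Lemma sqdist_ge0 p x y : 0 <= sqdist p x y.
Proof. by rewrite addr_ge0// -expr2 sqr_ge0. Qed.

Lemma sqdist_gt0 p z : z != p -> 0 < sqdist p z.1 z.2.
Proof.
move=> zp; rewrite lt_neqAle sqdist_ge0 andbT eq_sym /sqdist -!expr2 paddr_eq0 ?sqr_ge0//.
rewrite !sqrf_eq0 !subr_eq0; apply: contra zp => /andP[/eqP e1 /eqP e2].
by apply/eqP; rewrite [z]surjective_pairing [p]surjective_pairing e1 e2.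
Qed.

Lemma jet_dx p z : jet (fun x _ => x - p.1) z 1 0.
Proof. by apply: jet_eq (jetB (jet_x z) (jet_cst p.1 z)) _ _; rewrite subr0. Qed.

Lemma jet_dy p z : jet (fun _ y => y - p.2) z 0 1.
Proof. by apply: jet_eq (jetB (jet_y z) (jet_cst p.2 z)) _ _; rewrite subr0. Qed.

Lemma jet_sqdist p z : jet (sqdist p) z (2 * (z.1 - p.1)) (2 * (z.2 - p.2)).
Proof.
apply: jet_eq (jetD (jetM (jet_dx p z) (jet_dx p z)) (jetM (jet_dy p z) (jet_dy p z))) _ _; ring.
Qed.

Lemma dx_smooth (U : set (R * R)) p : open U -> smooth_on U (fun x _ => x - p.1).
Proof. by move=> oU; exact: (sub_smooth oU (fst_smooth oU) (cst_smooth p.1 oU)). Qed.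

Lemma dy_smooth (U : set (R * R)) p : open U -> smooth_on U (fun _ y => y - p.2).
Proof. by move=> oU; exact: (sub_smooth oU (snd_smooth oU) (cst_smooth p.2 oU)). Qed.

Lemma sqdist_smooth (U : set (R * R)) p : open U -> smooth_on U (sqdist p).
Proof.
move=> oU; have sx := dx_smooth p oU; have sy := dy_smooth p oU.
exact: (add_smooth oU (mul_smooth oU sx sx) (mul_smooth oU sy sy)).
Qed.

(** The two functions are the real and imaginary parts of [1 / (z - p)]. *)
Lemma cr_inv (V : set (R * R)) p : open V -> (forall z, V z -> z != p) -> cr V
  (fun x y => (x - p.1) * (sqdist p x y)^-1) (fun x y => - (y - p.2) * (sqdist p x y)^-1).
Proof.
move=> oV Vp; have si : smooth_on V (fun x y => (sqdist p x y)^-1).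
  by apply: inv_smooth => // [|z /Vp/sqdist_gt0/lt0r_neq0//]; exact: sqdist_smooth.
split.
- exact: (mul_smooth oV (dx_smooth p oV) si).
- exact: (mul_smooth oV (opp_smooth oV (dy_smooth p oV)) si).
move=> z /Vp/sqdist_gt0/lt0r_neq0 z0.
have ji := jetV (jet_sqdist p z) z0.
have [_ -> ->] := jetM (jet_dx p z) ji.
have [_ -> ->] := jetM (jetN (jet_dy p z)) ji.
rewrite /sqdist in z0 *; move: z0; move: (z.1 - p.1) (z.2 - p.2) => X Y z0.
by split; field.
Qed.

(** The Laplacian of [P^2 + Q^2] is twice the sum of the squared partials of [P] and [Q], as both
    are harmonic. The term in [e] adds [4 e]: strict positivity is what excludes an interior maximum
    by the second derivative test. *)
Lemma cr_square_laplacian (V : set (R * R)) P Q p (e : R) z : open V -> cr V P Q -> 0 < e -> V z ->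
  let w x y := P x y * P x y + Q x y * Q x y + e * sqdist p x y in
  smooth_on V w /\ 0 < pdx (pdx w) z.1 z.2 + pdy (pdy w) z.1 z.2.
Proof.
move=> oV crPQ e0 Vz w; have [sP sQ _] := crPQ.
have sw : smooth_on V w.
  apply: (add_smooth oV).
    exact: (add_smooth oV (mul_smooth oV sP sP) (mul_smooth oV sQ sQ)).
  exact: (mul_smooth oV (cst_smooth e oV) (sqdist_smooth p oV)).
split=> //.
have jw q : V q -> jet w q (2 * (P q.1 q.2 * pdx P q.1 q.2 + Q q.1 q.2 * pdx Q q.1 q.2 + e * (q.1 - p.1)))
    (2 * (P q.1 q.2 * pdy P q.1 q.2 + Q q.1 q.2 * pdy Q q.1 q.2 + e * (q.2 - p.2))).
  move=> Vq; have [jP jQ] := (jet_smooth sP Vq, jet_smooth sQ Vq).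
  move: (pdx P _ _) (pdy P _ _) (pdx Q _ _) (pdy Q _ _) jP jQ => a b c d jP jQ.
  apply: jet_eq (jetD (jetD (jetM jP jP) (jetM jQ jQ)) (jetM (jet_cst e q) (jet_sqdist p q))) _ _; ring.
have [l1 l2] := cr_laplacian oV crPQ Vz.
have exx : pdx (pdx w) z.1 z.2 = 2 * (pdx P z.1 z.2 ^+ 2 + P z.1 z.2 * pdx (pdx P) z.1 z.2 +
    pdx Q z.1 z.2 ^+ 2 + Q z.1 z.2 * pdx (pdx Q) z.1 z.2 + e).
  pose wx x y := 2 * (P x y * pdx P x y + Q x y * pdx Q x y + e * (x - p.1)).
  rewrite (eq_on_pdx oV (g := wx) (fun q Vq => let: And3 _ h _ := jw q Vq in h) Vz).
  have [jP jQ] := (jet_smooth sP Vz, jet_smooth sQ Vz).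
  have [jPx jQx] := (jet_smooth (smooth_on_pdx sP) Vz, jet_smooth (smooth_on_pdx sQ) Vz).
  have [_ h _] := jetM (jet_cst 2 z) (jetD (jetD (jetM jP jPx) (jetM jQ jQx)) (jetM (jet_cst e z) (jet_dx p z))).
  apply: (etrans h).
  move: (pdx (pdx P) _ _) (pdx (pdx Q) _ _) (pdx P _ _) (pdx Q _ _) => a b c d; ring.
have eyy : pdy (pdy w) z.1 z.2 = 2 * (pdy P z.1 z.2 ^+ 2 + P z.1 z.2 * pdy (pdy P) z.1 z.2 +
    pdy Q z.1 z.2 ^+ 2 + Q z.1 z.2 * pdy (pdy Q) z.1 z.2 + e).
  pose wy x y := 2 * (P x y * pdy P x y + Q x y * pdy Q x y + e * (y - p.2)).
  rewrite (eq_on_pdy oV (g := wy) (fun q Vq => let: And3 _ _ h := jw q Vq in h) Vz).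
  have [jP jQ] := (jet_smooth sP Vz, jet_smooth sQ Vz).
  have [jPy jQy] := (jet_smooth (smooth_on_pdy sP) Vz, jet_smooth (smooth_on_pdy sQ) Vz).
  have [_ _ h] := jetM (jet_cst 2 z) (jetD (jetD (jetM jP jPy) (jetM jQ jQy)) (jetM (jet_cst e z) (jet_dy p z))).
  apply: (etrans h).
  move: (pdy (pdy P) _ _) (pdy (pdy Q) _ _) (pdy P _ _) (pdy Q _ _) => a b c d; ring.
rewrite exx eyy.
have pos (A B a b c d a' b' c' d' : R) : a + a' = 0 -> b + b' = 0 ->
    0 < 2 * (c ^+ 2 + A * a + d ^+ 2 + B * b + e) + 2 * (c' ^+ 2 + A * a' + d' ^+ 2 + B * b' + e).
  clear -e0; move=> h1 h2.
  have [-> ->] : a' = - a /\ b' = - b by split; lra.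
  have := sqr_ge0 c; have := sqr_ge0 d; have := sqr_ge0 c'; have := sqr_ge0 d' => ? ? ? ?.
  rewrite (_ : _ + _ = 2 * (c ^+ 2 + d ^+ 2 + c' ^+ 2 + d' ^+ 2 + e + e)); last ring.
  lra.
exact: pos l1 l2.
Qed.

Lemma local_max_laplacian (V : set (R * R)) (w : R -> R -> R) z : open V -> smooth_on V w -> V z ->
  (\forall q \near z, w q.1 q.2 <= w z.1 z.2) ->
  pdx (pdx w) z.1 z.2 + pdy (pdy w) z.1 z.2 <= 0.
Proof.
move=> oV sw Vz mx; have [e e0 he] := nbhs_pairP mx.
have h1 : 0 <= - pdx (pdx w) z.1 z.2.
  apply: (@second_derivative_at_min _ (fun t => - w t z.2) (fun t => - pdx w t z.2) z.1).
  - apply: filterS (near_hslice oV Vz) => t Vt.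
    exact: (is_deriveN (regular_dx (smooth_on_regular sw Vt))).
  - exact: (is_deriveN (regular_dx (smooth_on_regular (smooth_on_pdx sw) Vz))).
  - near=> t; rewrite lerN2; apply: (he (t, z.2)) => /=; last by rewrite subrr normr0.
    by rewrite distrC; near: t; exact: cvgr_dist_lt.
have h2 : 0 <= - pdy (pdy w) z.1 z.2.
  apply: (@second_derivative_at_min _ (fun t => - w z.1 t) (fun t => - pdy w z.1 t) z.2).
  - apply: filterS (near_vslice oV Vz) => t Vt.
    exact: (is_deriveN (regular_dy (smooth_on_regular sw Vt))).
  - exact: (is_deriveN (regular_dy (smooth_on_regular (smooth_on_pdy sw) Vz))).
  - near=> t; rewrite lerN2; apply: (he (z.1, t)) => /=; first by rewrite subrr normr0.
    by rewrite distrC; near: t; exact: cvgr_dist_lt.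
by move: h1 h2; move: (pdx _ _ _) (pdy _ _ _) => a b; clear => ? ?; lra.
Unshelve. all: by end_near. Qed.

(* Near [p] the quotient [h / (z - p)^k] of the flat holomorphic function
   [h = P + i Q] tends to [0], so by the maximum principle it is bounded by its
   values at distance [r]; let [k] tend to infinity. *)
Lemma cr_flat_zero (U : set (R * R)) P Q p : open U -> U p -> cr U P Q ->
  flat_at P p -> flat_at Q p -> \forall z \near p, P z.1 z.2 = 0 /\ Q z.1 z.2 = 0.
Proof.
move=> oU Up crPQ fP fQ; have [sP sQ _] := crPQ.
have flat0 f : flat_at f p -> f p.1 p.2 = 0.
  move=> /(_ 1)[C /nbhs_singleton]; rewrite /taxi !subrr normr0 addr0 expr1 mulr0.
  by rewrite normr_le0 => /eqP.
have [P0 Q0] := (flat0 _ fP, flat0 _ fQ).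
have [r0 r00 r0U] := open_square oU Up.
pose r := r0 / 2; have r1 : 0 < r by rewrite divr_gt0.
pose K := [set z : R * R | `|z.1 - p.1| <= r /\ `|z.2 - p.2| <= r].
have KU : K `<=` U.
  move=> z [z1 z2]; apply: r0U; split; [apply: le_lt_trans z1 _|apply: le_lt_trans z2 _];
  by rewrite /r ltr_pdivrMr// ltr_pMr// ltr1n.
have KE : K = `[p.1 - r, p.1 + r] `*` `[p.2 - r, p.2 + r].
  apply/seteqP; split=> z [].
    rewrite !ler_norml => /andP[? ?] /andP[? ?].
    by split; rewrite /= in_itv/=; apply/andP; split; lra.
  rewrite /= !in_itv/= => /andP[? ?] /andP[? ?].
  by split; rewrite ler_norml; apply/andP; split; lra.
have cK : compact K by rewrite KE; apply: compact_setX; exact: segment_compact.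
have Kp : K p by rewrite /K/= !subrr normr0 (ltW r1).
pose h x y := P x y * P x y + Q x y * Q x y.
have sh : smooth_on U h by exact: (add_smooth oU (mul_smooth oU sP sP) (mul_smooth oU sQ sQ)).
have h0 x y : 0 <= h x y by rewrite addr_ge0// -expr2 sqr_ge0.
have hp : h p.1 p.2 = 0 by rewrite /h P0 Q0 !mul0r addr0.
have [_ [M0 hM0]] := @compact_bmf R U K (fun q => h q.1 q.2) cK oU KU
  (fun q Uq => (smooth_on_regular sh Uq).1).
have M00 : 0 <= M0 by apply: le_trans (hM0 p Kp).
pose V := U `&` [set z | z != p].
have oV : open V.
  apply: openI => //; rewrite (_ : [set z | z != p] = ~` [set p]); last first.
    by apply/seteqP; split=> z /= /eqP.
  by apply: closed_openC; apply: accessible_closed_set1; apply: hausdorff_accessible.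
have crV : cr V P Q.
  have VU : V `<=` U by move=> z [].
  split; [exact: smooth_onS sP|exact: smooth_onS sQ|].
  by move=> z [Uz _]; case: crPQ => _ _; apply.
have key k z : K z -> z != p -> h z.1 z.2 / sqdist p z.1 z.2 ^+ k <= M0 / (r ^+ 2) ^+ k.
  move=> Kz zp.
  (* [A + i B] is [(P + i Q) / (z - p)^k], and its squared modulus is the quotient to be bounded. *)
  have [A [B [crAB eAB]]] : exists A B, cr V A B /\ forall q, V q ->
      A q.1 q.2 * A q.1 q.2 + B q.1 q.2 * B q.1 q.2 = h q.1 q.2 / sqdist p q.1 q.2 ^+ k.
    elim: k => [|k [A [B [crAB eAB]]]].
      by exists P, Q; split=> // q _; rewrite expr0 divr1.
    have ci : cr V (fun x y => (x - p.1) * (sqdist p x y)^-1) (fun x y => - (y - p.2) * (sqdist p x y)^-1).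
      by apply: cr_inv => // q [].
    have cm := cr_mul oV crAB ci.
    eexists; eexists; split; first exact: cm.
    move=> q Vq; rewrite [RHS](_ : _ = h q.1 q.2 / sqdist p q.1 q.2 ^+ k / sqdist p q.1 q.2); last first.
      by rewrite exprSr invfM mulrA.
    rewrite -(eAB q Vq).
    have q0 : sqdist p q.1 q.2 != 0 by case: Vq => _ /sqdist_gt0/lt0r_neq0.
    clear -q0; rewrite /sqdist in q0 *; move: (A _ _) (B _ _) => a b.
    by move: (q.1 - p.1) (q.2 - p.2) q0 => X Y q0; field.
  (* The perturbation by [e] makes the Laplacian strictly positive off [p], so a maximum over [K]
     lies at [p] or on the boundary. At [p] the value is 0 since [h p = 0], whatever the inverse of
     the vanishing denominator is. *)
  pose v (e : R) (q : R * R) := h q.1 q.2 / sqdist p q.1 q.2 ^+ k + e * sqdist p q.1 q.2.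
  have vp e : v e p = 0 by rewrite /v hp mul0r /sqdist !subrr !mulr0 addr0 mulr0 addr0.
  have vM (e : R) : 0 < e -> v e z <= M0 / (r ^+ 2) ^+ k + e * (2 * r ^+ 2).
    move=> e0.
    have cv : {within K, continuous (v e)}.
      apply: continuous_in_subspaceT => q /[!inE] Kq.
      have [->|qp] := eqVneq q p; last first.
        have Vq : V q by split=> //; exact: KU.
        have [sw _] := cr_square_laplacian p oV crAB e0 Vq.
        have eqv z' : V z' -> A z'.1 z'.2 * A z'.1 z'.2 + B z'.1 z'.2 * B z'.1 z'.2 +
            e * sqdist p z'.1 z'.2 = v e (z'.1, z'.2) by move=> Vz'; rewrite eAB.
        have [cve _] := @eq_on_regular _ _ V _ (fun x y => v e (x, y)) q oV eqv Vq (smooth_on_regular sw Vq).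
        have -> : v e = fun q : R * R => v e (q.1, q.2) by apply/funext => -[].
        exact: cve.
      (* Continuity at [p]: flatness of order [k + 1] leaves a factor [taxi^2] after the division by
         [sqdist^k], which is comparable to [taxi^(2 k)]. *)
      have [C1 n1] := fP k.+1; have [C2 n2] := fQ k.+1.
      pose C := (C1 ^+ 2 + C2 ^+ 2) * 2 ^+ k + e.
      have C0 : 0 < C by rewrite ltr_wpDl// mulr_ge0 ?exprn_ge0// addr_ge0 ?sqr_ge0.
      apply/cvgrPdist_le => d d0; rewrite vp.
      pose m := Num.min 1 (d / C) / 2.
      have m0 : 0 < m by rewrite divr_gt0// lt_min ltr01 divr_gt0.
      apply: filterS (filterI (filterI n1 n2) (square_nbhs p m0)) => {q Kq} q [[g1 g2] [q1 q2]].
      rewrite sub0r normrN.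
      have mq : taxi p q <= Num.min 1 (d / C) by rewrite (splitr (Num.min _ _)) lerD// ltW.
      have mq1 : taxi p q <= 1 by apply: le_trans mq _; rewrite ge_min lexx.
      have mqd : taxi p q <= d / C by apply: le_trans mq _; rewrite ge_min lexx orbT.
      have mq0 := taxi_ge0 p q.
      suff vC : `|v e q| <= C * taxi p q ^+ 2.
        apply: (le_trans vC); rewrite mulrC -ler_pdivlMr//; apply: le_trans mqd.
        by rewrite expr2 ler_piMl.
      have [->|qp] := eqVneq q p; first by rewrite vp normr0 mulr_ge0 ?sqr_ge0// ltW.
      have rho0 := sqdist_gt0 qp.
      have rm : sqdist p q.1 q.2 <= taxi p q ^+ 2.
        rewrite /sqdist /taxi -!expr2 -(real_normK (num_real (q.1 - p.1))) -(real_normK (num_real (q.2 - p.2))).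
        by rewrite sqrrD lerD2r lerDl mulrn_wge0// mulr_ge0.
      have mr : taxi p q ^+ 2 <= 2 * sqdist p q.1 q.2.
        rewrite /sqdist /taxi -!expr2 -(real_normK (num_real (q.1 - p.1))) -(real_normK (num_real (q.2 - p.2))).
        rewrite -subr_ge0 (_ : _ - _ = (`|q.1 - p.1| - `|q.2 - p.2|) ^+ 2) ?sqr_ge0//.
        by clear; move: (`|_|) (`|_|) => s t; ring.
      rewrite ger0_norm; last first.
        apply: addr_ge0; first exact: (divr_ge0 (h0 _ _) (exprn_ge0 k (sqdist_ge0 _ _ _))).
        exact: (mulr_ge0 (ltW e0) (sqdist_ge0 _ _ _)).
      rewrite /v /C [leRHS]mulrDl lerD//; last by rewrite ler_wpM2l// ltW.
      have sq (f : R) (c : R) : `|f| <= c * taxi p q ^+ k.+1 -> f * f <= c ^+ 2 * (taxi p q ^+ 2 * (taxi p q ^+ 2) ^+ k).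
        move=> hf; rewrite -expr2 -(real_normK (num_real f)) -exprS -exprM mulnC exprM -exprMn.
        by rewrite lerXn2r// nnegrE// (le_trans _ hf).
      rewrite ler_pdivrMr ?exprn_gt0//.
      apply: (@le_trans _ _ ((C1 ^+ 2 + C2 ^+ 2) * (taxi p q ^+ 2 * (taxi p q ^+ 2) ^+ k))).
        by rewrite mulrDl lerD//; exact: sq.
      have alg (c m2 r2 : R) : 0 <= c -> 0 <= m2 -> 0 <= r2 -> m2 <= 2 * r2 ->
          c * (m2 * m2 ^+ k) <= c * 2 ^+ k * m2 * r2 ^+ k.
        move=> c0 m20 r20 mr2; rewrite -!mulrA ler_wpM2l// [leRHS]mulrCA ler_wpM2l// -exprMn.
        by rewrite lerXn2r// nnegrE// mulr_ge0.
      by apply: alg => //; rewrite ?addr_ge0 ?sqr_ge0// ltW.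
    have [z1 /[!inE] Kz1 mz1] := compact_EVT_max (ex_intro _ p Kp) cK cv.
    apply: (le_trans (mz1 z _)); first by rewrite inE.
    have pos : 0 <= M0 / (r ^+ 2) ^+ k + e * (2 * r ^+ 2).
      apply: addr_ge0; first exact: (divr_ge0 M00 (exprn_ge0 k (exprn_ge0 2 (ltW r1)))).
      exact: (mulr_ge0 (ltW e0) (mulr_ge0 (ler0n _ 2) (exprn_ge0 2 (ltW r1)))).
    have [->|z1p] := eqVneq z1 p; first by rewrite vp.
    have Vz1 : V z1 by split=> //; exact: KU.
    have [Kz11 Kz12] := Kz1.
    have [inn|bnd] := boolP ((`|z1.1 - p.1| < r) && (`|z1.2 - p.2| < r)).
      exfalso.
      have [sw lw] := cr_square_laplacian p oV crAB e0 Vz1.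
      suff : pdx (pdx (fun x y => A x y * A x y + B x y * B x y + e * sqdist p x y)) z1.1 z1.2 +
             pdy (pdy (fun x y => A x y * A x y + B x y * B x y + e * sqdist p x y)) z1.1 z1.2 <= 0.
        by move=> le0; have := lt_le_trans lw le0; rewrite ltxx.
      apply: (local_max_laplacian oV sw Vz1).
      have n1 : nbhs z1 (square p r) by apply: open_nbhs_nbhs; split; [exact: square_open|move/andP: inn].
      have n2 : nbhs z1 V by apply: open_nbhs_nbhs; split.
      apply: filterS (filterI n1 n2) => q [[q1 q2] Vq]; rewrite !eAB//.
      by apply: mz1; rewrite inE; split; exact: ltW.
    have rho1 : r ^+ 2 <= sqdist p z1.1 z1.2.
      rewrite /sqdist -!expr2 -(real_normK (num_real (z1.1 - p.1))) -(real_normK (num_real (z1.2 - p.2))).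
      move: bnd; rewrite negb_and -!leNgt => /orP[b|b].
        by rewrite (@le_trans _ _ (`|z1.1 - p.1| ^+ 2))// ?lerDl ?sqr_ge0// lerXn2r// ?nnegrE// ltW.
      by rewrite (@le_trans _ _ (`|z1.2 - p.2| ^+ 2))// ?lerDr ?sqr_ge0// lerXn2r// ?nnegrE// ltW.
    have rho2 : sqdist p z1.1 z1.2 <= 2 * r ^+ 2.
      rewrite /sqdist -!expr2 -(real_normK (num_real (z1.1 - p.1))) -(real_normK (num_real (z1.2 - p.2))).
      by rewrite mulr_natl mulr2n lerD// lerXn2r// ?nnegrE// ltW.
    have rk : 0 < (r ^+ 2) ^+ k by rewrite !exprn_gt0.
    rewrite /v lerD//; last by rewrite ler_pM2l.
    rewrite ler_pM// ?invr_ge0 ?exprn_ge0 ?sqdist_ge0//.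
      by have := hM0 z1 Kz1; rewrite ger0_norm.
    rewrite lef_pV2 ?posrE ?exprn_gt0 ?sqdist_gt0//.
    by rewrite lerXn2r ?nnegrE ?sqdist_ge0// ltW// exprn_gt0.
  apply/ler_addgt0Pr => e e0.
  have r20 : 0 < 2 * r ^+ 2 by rewrite mulr_gt0// exprn_gt0.
  have := vM (e / (2 * r ^+ 2)) ltac:(by rewrite divr_gt0).
  rewrite divfK ?gt_eqF//; apply: le_trans; rewrite /v lerDl.
  by rewrite mulr_ge0 ?sqdist_ge0// divr_ge0// ltW.
(* On this smaller disc the bound [key] gives [h <= M0 / 2^k] for every [k]. *)
have hz z : K z -> sqdist p z.1 z.2 <= r ^+ 2 / 2 -> h z.1 z.2 = 0.
  move=> Kz rz; apply/eqP; rewrite eq_le h0 andbT leNgt; apply/negP => hz0.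
  have zp : z != p by apply: contraTneq hz0 => ->; rewrite hp ltxx.
  have rho0 := sqdist_gt0 zp.
  have ub k : h z.1 z.2 * k%:R <= M0.
    have := key k z Kz zp; rewrite ler_pdivrMr ?exprn_gt0// => hk.
    have h2 : h z.1 z.2 <= M0 / 2 ^+ k.
      apply: (le_trans hk); rewrite -mulrA ler_wpM2l//.
      have -> : (2 ^+ k)^-1 = ((r ^+ 2) ^+ k)^-1 * (r ^+ 2 / 2) ^+ k.
        rewrite -!exprVn -exprMn; congr (_ ^+ k).
        by clear -r1; field; rewrite gt_eqF.
      rewrite ler_wpM2l ?invr_ge0 ?exprn_ge0 ?(ltW r1)//.
      by rewrite lerXn2r ?nnegrE ?sqdist_ge0// divr_ge0// exprn_ge0// ltW.
    rewrite -[leRHS](@divfK _ (2 ^+ k)) ?expf_neq0// ler_pM//.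
    by rewrite -natrX ler_nat ltnW// ltn_expl.
  have [k hk] : exists k : nat, M0 / h z.1 z.2 < k%:R.
    by exists (Num.bound (M0 / h z.1 z.2)); apply: archi_boundP; rewrite divr_ge0.
  by have := ub k; rewrite leNgt -ltr_pdivrMl// mulrC hk.
have rr : 0 < r / 2 by rewrite divr_gt0.
apply: (nbhs_boxI rr) => z z1 z2.
have r2r : r / 2 <= r by rewrite ler_pdivrMr// ler_pMr// ler1n.
have : h z.1 z.2 = 0.
  apply: hz; first by split; [exact: le_trans (ltW z1) _|exact: le_trans (ltW z2) _].
  rewrite /sqdist -!expr2 -(real_normK (num_real (z.1 - p.1))) -(real_normK (num_real (z.2 - p.2))).
  have -> : r ^+ 2 / 2 = (r / 2) ^+ 2 + (r / 2) ^+ 2 by field.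
  by rewrite lerD// lerXn2r ?nnegrE// ltW.
move/eqP; rewrite /h -!expr2 paddr_eq0 ?sqr_ge0// !sqrf_eq0 => /andP[/eqP ? /eqP ?].
by split.
Qed.

End IdentityTheorem.

(** * Finite order of the conformal factor *)

Section MinimalImmersion.
Variables (R : realType) (n : nat) (P : set (R * R)) (F : R -> R -> 'rV[R]_n).
Local Notation RR := (measurableTypeR R * measurableTypeR R)%type.
Local Notation mu2 := ((@lebesgue_measure R) \x (@lebesgue_measure R))%E.
Hypothesis dP : discrete_in_plane P.

Let S := ~` P.
Let oS : open S := open_setC_discrete dP.

Lemma zero_gradient_constant (g : R -> R -> R) : smooth_on S g ->
  (forall z, S z -> pdx g z.1 z.2 = 0 /\ pdy g z.1 z.2 = 0) ->
  forall z w, S z -> S w -> g z.1 z.2 = g w.1 w.2.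
Proof.
move=> sg g0 z w Sz Sw.
apply: (@locally_constant_compl R P (fun q => g q.1 q.2) dP _ z w Sz Sw) => p Sp.
have [r r0 rS] := open_square oS Sp.
apply: filterS (square_nbhs p r0) => q [q1 q2].
apply/eqP; rewrite -subr_eq0 -normr_le0.
rewrite -[leRHS](mul0r (`|q.1 - p.1| + `|q.2 - p.2|)); apply: rect_increment => v v1 v2.
have Sv : S v by apply: rS; split; [exact: le_lt_trans v1 q1|exact: le_lt_trans v2 q2].
have [e1 e2] := g0 v Sv.
by split; [exact: (smooth_on_regular sg Sv)|rewrite e1 normr0|rewrite e2 normr0].
Qed.

Hypothesis bF : branched_minimal_immersion S F.

Definition comp (i : 'I_n) : R -> R -> R := fun x y => F x y 0 i.

Lemma comp_smooth i : smooth_on S (comp i).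
Proof. by case: bF => _ [sF _]; exact: smooth_coord oS sF i. Qed.

Lemma comp_partials z : S z -> forall i, pdx F z.1 z.2 0 i = pdx (comp i) z.1 z.2 /\
  pdy F z.1 z.2 0 i = pdy (comp i) z.1 z.2.
Proof.
move=> Sz i; case: bF => _ [sF _].
have [_ h1 h2] := regular_coord (smooth_on_regular sF Sz) i.
by split; [exact: esym h1|exact: esym h2].
Qed.

Lemma comp_harmonic z i : S z -> pdx (pdx (comp i)) z.1 z.2 + pdy (pdy (comp i)) z.1 z.2 = 0.
Proof.
move=> Sz; case: bF => _ [sF [hF _]].
have e1 : pdx (pdx (comp i)) z.1 z.2 = pdx (pdx F) z.1 z.2 0 i.
  have [_ h _] := regular_coord (smooth_on_regular (smooth_on_pdx sF) Sz) i.
  apply: etrans h.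
  exact: (eq_on_pdx (g := fun x y => pdx F x y 0 i) oS (fun q Sq => esym (comp_partials Sq i).1) Sz).
have e2 : pdy (pdy (comp i)) z.1 z.2 = pdy (pdy F) z.1 z.2 0 i.
  have [_ _ h] := regular_coord (smooth_on_regular (smooth_on_pdy sF) Sz) i.
  apply: etrans h.
  exact: (eq_on_pdy (g := fun x y => pdy F x y 0 i) oS (fun q Sq => esym (comp_partials Sq i).2) Sz).
have h := congr1 (fun v : 'rV[R]_n => v 0 i) (hF z Sz).
have h' : pdx (pdx F) z.1 z.2 0 i + pdy (pdy F) z.1 z.2 0 i = 0 by move: h; rewrite /= !mxE.
exact: (etrans (congr2 +%R e1 e2) h').
Qed.

Lemma comp_conformal z : S z ->
  \sum_i pdx (comp i) z.1 z.2 * pdx (comp i) z.1 z.2 =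
  \sum_i pdy (comp i) z.1 z.2 * pdy (comp i) z.1 z.2 /\
  \sum_i pdx (comp i) z.1 z.2 * pdy (comp i) z.1 z.2 = 0.
Proof.
move=> Sz; case: bF => _ [sF [_ cF]]; have := cF z Sz; rewrite /dot.
have ex : forall i, pdx F z.1 z.2 0 i = pdx (comp i) z.1 z.2 by move=> i; case: (comp_partials Sz i).
have ey : forall i, pdy F z.1 z.2 0 i = pdy (comp i) z.1 z.2 by move=> i; case: (comp_partials Sz i).
have exx : \sum_i pdx F z.1 z.2 0 i * pdx F z.1 z.2 0 i =
    \sum_i pdx (comp i) z.1 z.2 * pdx (comp i) z.1 z.2.
  by apply: eq_bigr => i _; exact: (congr2 *%R (ex i) (ex i)).
have eyy : \sum_i pdy F z.1 z.2 0 i * pdy F z.1 z.2 0 i =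
    \sum_i pdy (comp i) z.1 z.2 * pdy (comp i) z.1 z.2.
  by apply: eq_bigr => i _; exact: (congr2 *%R (ey i) (ey i)).
have exy : \sum_i pdx F z.1 z.2 0 i * pdy F z.1 z.2 0 i =
    \sum_i pdx (comp i) z.1 z.2 * pdy (comp i) z.1 z.2.
  by apply: eq_bigr => i _; exact: (congr2 *%R (ex i) (ey i)).
move=> [h1 h2]; split; [exact: (etrans (esym exx) (etrans h1 eyy))|exact: (etrans (esym exy) h2)].
Qed.

Lemma comp_cr i : cr S (pdx (comp i)) (fun x y => - pdy (comp i) x y).
Proof.
have sc := comp_smooth i; have sx := smooth_on_pdx sc; have sy := smooth_on_pdy sc.
split; [exact: sx|exact: (opp_smooth oS sy)|] => z Sz.
have [_ -> ->] := jetN (jet_smooth sy Sz).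
have h := comp_harmonic i Sz; have c := clairaut oS sc Sz.
split; last exact: (etrans (esym c) (esym (opprK _))).
have opp (a b : R) : a + b = 0 -> a = - b by move/eqP; rewrite addr_eq0 => /eqP.
exact: opp h.
Qed.

Definition lam (x y : R) : R := \sum_i pdx (comp i) x y * pdx (comp i) x y.

Lemma lam_smooth : smooth_on S lam.
Proof.
apply: (sum_smooth _ oS) => i.
exact: (mul_smooth oS (smooth_on_pdx (comp_smooth i)) (smooth_on_pdx (comp_smooth i))).
Qed.

Lemma sq_le_lam z i : S z -> pdx (comp i) z.1 z.2 * pdx (comp i) z.1 z.2 <= lam z.1 z.2 /\
  pdy (comp i) z.1 z.2 * pdy (comp i) z.1 z.2 <= lam z.1 z.2.
Proof.
move=> Sz; split; last rewrite /lam (comp_conformal Sz).1.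
  by rewrite /lam (bigD1 i)//= lerDl sumr_ge0// => j _; rewrite -expr2 sqr_ge0.
by rewrite (bigD1 i)//= lerDl sumr_ge0// => j _; rewrite -expr2 sqr_ge0.
Qed.

Lemma lam_ge0 x y : 0 <= lam x y.
Proof. by apply: sumr_ge0 => i _; rewrite -expr2 sqr_ge0. Qed.

(** The Gram determinant of [F]: it is the squared area element and will be the constant term of the
    polynomial in [t] describing a variation. *)
Definition lam2 (x y : R) : R := lam x y * lam x y.

Lemma lam2_smooth : smooth_on S lam2.
Proof. exact: (mul_smooth oS lam_smooth lam_smooth). Qed.

Definition stationary_near (z : R * R) := \forall w \near z, forall i,
  pdx (comp i) w.1 w.2 = 0 /\ pdy (comp i) w.1 w.2 = 0.

Lemma ipartial_zero (f : R -> R -> R) (z : R * R) :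
  (\forall w \near z, f w.1 w.2 = 0) -> forall s, ipartial f s z.1 z.2 = 0.
Proof.
move=> fz s; have oI := @open_interior _ [set w : R * R | f w.1 w.2 = 0].
suff h : forall w, [set w : R * R | f w.1 w.2 = 0]° w -> ipartial f s w.1 w.2 = 0 by exact: h fz.
elim: s => [w /interior_subset//|b s ih w Iw].
case: b => /=.
  rewrite (eq_on_pdx (g := fun _ _ => 0) oI ih Iw).
  by have [_ -> _] := jet_cst (0 : R) w.
rewrite (eq_on_pdy (g := fun _ _ => 0) oI ih Iw).
by have [_ _ ->] := jet_cst (0 : R) w.
Qed.

(** Every first partial [f] of a component satisfies [f^4 <= lam2], so flatness of [lam2] to order
    [4 N] gives flatness of [f] to order [N]; the identity theorem then applies to each
    component. *)
Lemma flat_lam2_stationary z : S z -> (forall s, ipartial lam2 s z.1 z.2 = 0) -> stationary_near z.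
Proof.
move=> Sz h0; have fl := flat_of_partials oS lam2_smooth Sz h0.
have nS : \forall w \near z, S w by apply: open_nbhs_nbhs; split.
have root4 (f : R -> R -> R) : (forall w, S w -> f w.1 w.2 * f w.1 w.2 <= lam w.1 w.2) -> flat_at f z.
  move=> hf N; have [C hC] := fl (4 * N)%N.
  exists (`|C| + 1); apply: filterS (filterI nS hC) => w [Sw].
  have l0 := lam_ge0 w.1 w.2.
  rewrite /lam2 ger0_norm ?mulr_ge0// mulnC exprM => hw.
  have m0 : 0 <= taxi z w ^+ N by rewrite exprn_ge0// taxi_ge0.
  rewrite -(@ler_pXn2r _ 4)// ?nnegrE ?mulr_ge0 ?addr_ge0// exprMn.
  apply: (@le_trans _ _ (C * (taxi z w ^+ N) ^+ 4)).
    apply: le_trans hw; rewrite (_ : 4 = 2 * 2)%N// exprM real_normK ?num_real// !expr2.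
    by apply: ler_pM; rewrite -?expr2 ?sqr_ge0// expr2 hf.
  rewrite ler_wpM2r ?exprn_ge0 ?taxi_ge0//.
  have c1 : 1 <= `|C| + 1 by rewrite lerDr.
  apply: (@le_trans _ _ (`|C| + 1)); first by apply: (le_trans (ler_norm C)); rewrite lerDl.
  by rewrite ler_eXnr.
have nz i : \forall w \near z, pdx (comp i) w.1 w.2 = 0 /\ - pdy (comp i) w.1 w.2 = 0.
  apply: (cr_flat_zero oS Sz (comp_cr i)).
    by apply: root4 => w Sw; have [] := sq_le_lam i Sw.
  by apply: root4 => w Sw; rewrite mulrNN; have [] := sq_le_lam i Sw.
have nzi i : \forall w \near z, pdx (comp i) w.1 w.2 = 0 /\ pdy (comp i) w.1 w.2 = 0.
  by apply: filterS (nz i) => w [e1 /eqP]; rewrite oppr_eq0 => /eqP e2.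
exact: filter_forall nzi.
Qed.

Lemma stationary_lam2 z : S z -> stationary_near z -> forall s, ipartial lam2 s z.1 z.2 = 0.
Proof.
move=> Sz h; apply: ipartial_zero; apply: filterS h => w hw.
by rewrite /lam2 /lam big1 ?mul0r// => i _; have [-> _] := hw i; rewrite mul0r.
Qed.

(* Otherwise [F_x - i F_y] would vanish to infinite order at [z], hence
   identically near [z], and [F] would be constant. *)
Lemma lam2_finite_order z : S z -> exists s, ipartial lam2 s z.1 z.2 != 0.
Proof.
move=> Sz; apply: contrapT => hs.
have h0 s : ipartial lam2 s z.1 z.2 = 0.
  by apply/eqP; apply: contrapT => hne; apply: hs; exists s; apply/negP.
have stz := flat_lam2_stationary Sz h0.
(* Stationarity near a point is an open condition. Its failure is open too, since then some partial
   derivative of [lam2] is nonzero at the point and hence nearby; so [chi] is locally constant. *)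
pose chi (w : R * R) : R := if `[< stationary_near w >] then 1 else 0.
have lchi w : ~ P w -> \forall v \near w, chi v = chi w.
  move=> Sw; rewrite /chi; case: asboolP => [st|nst].
    apply: (filterS _ (nbhs_interior st)) => v hv.
    by rewrite asboolT.
  have [s sne] : exists s, ipartial lam2 s w.1 w.2 != 0.
    apply: contrapT => hs'; apply: nst; apply: flat_lam2_stationary => // s.
    by apply/eqP; apply: contrapT => hne; apply: hs'; exists s; apply/negP.
  have nS : \forall v \near w, S v by apply: open_nbhs_nbhs; split.
  have cs := (smooth_on_regular (smooth_ipartial s lam2_smooth) Sw).1.
  have nn : \forall v \near w, ipartial lam2 s v.1 v.2 != 0 by exact: (cvgr_neq0 _ cs sne).
  apply: filterS (filterI nS nn) => v [Sv vn]; rewrite asboolF// => /(stationary_lam2 Sv)/(_ s) e.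
  by move: vn; rewrite e eqxx.
have [[p [q [Sp [Sq ne]]]] _] := bF.
have all0 w : S w -> forall i, pdx (comp i) w.1 w.2 = 0 /\ pdy (comp i) w.1 w.2 = 0.
  move=> Sw; have := locally_constant_compl dP lchi Sz Sw.
  rewrite /chi asboolT//; case: asboolP => [st _|_ /eqP]; last by rewrite oner_eq0.
  exact: nbhs_singleton st.
apply: ne; apply/rowP => i.
exact: (zero_gradient_constant (comp_smooth i) (fun w Sw => all0 w Sw i) Sp Sq).
Qed.

End MinimalImmersion.

(** * Stokes formulas on compact domains *)

Section TruncatedSlices.
Variable R : realType.
Local Notation leb := (@lebesgue_measure R).

(* A smooth substitute for the identity that vanishes to third order at [0], so
   that [trunc t \o u], extended by [0] across a boundary where [u = 0], is
   still continuously differentiable; its derivative tends to [1] as [t -> 0]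
   wherever [u != 0]. *)
Definition trunc (t s : R) : R := s * (s * s) * (s * s + t * t)^-1.
Definition dtrunc (t s : R) : R :=
  (s * s * (s * s) + 3 * (s * s) * (t * t)) * ((s * s + t * t)^-1 * (s * s + t * t)^-1).

Lemma trunc_den (t s : R) : t != 0 -> 0 < s * s + t * t.
Proof. by move=> t0; rewrite -!expr2 ltr_wpDl ?sqr_ge0// lt_neqAle eq_sym sqrf_eq0 t0 sqr_ge0. Qed.

Lemma is_derive_trunc (t s : R) : t != 0 -> is_derive s 1 (trunc t) (dtrunc t s).
Proof.
move=> t0; have d0 := lt0r_neq0 (trunc_den s t0).
have di := is_derive_id s (1 : R).
have d2 := is_deriveM di di.
have d3 := is_deriveM di d2.
have dd := is_deriveD d2 (is_derive_cst (t * t) s 1).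
have dv := is_deriveV (f := fun s => s * s + t * t) d0 dd.
have h := is_deriveM d3 dv.
apply: (is_derive_eq h).
transitivity (s * (s * s) * (- (s * s + t * t) ^- 2 * (s * 1 + s * 1 + 0)) +
  (s * s + t * t)^-1 * (s * (s * 1 + s * 1) + s * s * 1)); first by [].
by rewrite /dtrunc; clear -d0; field.
Qed.

Lemma trunc_bound (t s : R) : t != 0 -> `|trunc t s| <= `|s| * `|s| / `|t|.
Proof.
move=> t0; have d0 := trunc_den s t0.
have n0 : 0 < `|t| by rewrite normr_gt0.
rewrite /trunc normrM normfV (gtr0_norm d0) !normrM ler_pdivrMr//.
have -> : s * s + t * t = `|s| * `|s| + `|t| * `|t| by rewrite -!normrM !ger0_norm// -expr2 sqr_ge0.
rewrite [leRHS]mulrAC ler_pdivlMr//.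
have := mulr_ge0 (sqr_ge0 `|s|) (addr_ge0 (sqr_ge0 (`|s| - `|t|)) (mulr_ge0 (normr_ge0 s) (normr_ge0 t))).
move: (`|s|) (`|t|) => a b; clear => h; lra.
Qed.

Lemma dtrunc_bound (t s : R) : t != 0 -> `|dtrunc t s| <= 2.
Proof.
move=> t0; have d0 := trunc_den s t0.
have s0 : 0 <= s * s by rewrite -expr2 sqr_ge0.
have t00 : 0 <= t * t by rewrite -expr2 sqr_ge0.
rewrite ger0_norm /dtrunc; last first.
  apply: mulr_ge0; last by rewrite mulr_ge0// invr_ge0 ltW.
  by apply: addr_ge0; apply: mulr_ge0 => //; exact: mulr_ge0.
rewrite -invfM ler_pdivrMr ?mulr_gt0//.
move: (s * s) (t * t) s0 t00 => a b; clear => ha hb; nra.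
Qed.

Lemma dtrunc0 (t : R) : dtrunc t 0 = 0.
Proof. by rewrite /dtrunc !(mul0r, mulr0) addr0 mul0r. Qed.

Lemma dtrunc_continuous (t s : R) : t != 0 -> {for s, continuous (dtrunc t)}.
Proof.
move=> t0.
have c2 : {for s, continuous (fun s : R => s * s)} by apply: continuousM; exact: cvg_id.
have cd : {for s, continuous (fun s : R => s * s + t * t)} by apply: continuousD => //; exact: cvg_cst.
have ci : {for s, continuous (fun s : R => (s * s + t * t)^-1)}.
  by apply: cvgV => //; rewrite lt0r_neq0// trunc_den.
apply: continuousM; last exact: continuousM.
apply: continuousD; first exact: continuousM.
apply: continuousM; last exact: cvg_cst.
by apply: continuousM => //; exact: cvg_cst.
Qed.

Section Slice.
Variables (K : set R) (f f1 : R -> R) (M t : R).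
Hypotheses (t0 : t != 0) (M0 : 0 < M) (cK : closed K) (KM : forall x, K x -> - M < x < M).
Hypothesis fK : forall x, K x ->
  [/\ is_derive x 1 f (f1 x), {for x, continuous f1} & K° x \/ f x = 0].

Let v x := if `[< K x >] then trunc t (f x) else 0.
Let v1 x := if `[< K x >] then dtrunc t (f x) * f1 x else 0.

Let near_out (x : R) : ~ K x -> \forall y \near x, ~ K y.
Proof. by move=> nK; apply: open_nbhs_nbhs; split => //; exact: closed_openC. Qed.

Let fc (x : R) : K x -> {for x, continuous f}.
Proof.
by move=> /fK[[df _] _ _]; apply: differentiable_continuous; exact/derivable1_diffP.
Qed.

Let v_derive (x : R) : is_derive x 1 v (v1 x).
Proof.
rewrite /v1; case: asboolP => [Kx|nK]; last first.
  apply: (@near_eq_is_derive R R R (cst 0) v x 1 0 _ (is_derive_cst (0 : R) x (1 : R))).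
  by apply: filterS (near_out nK) => y nKy; rewrite /v asboolF.
have [df _ [iK|fx0]] := fK Kx.
  have h := is_derive1_comp (is_derive_trunc (f x) t0) df.
  apply: (@near_eq_is_derive R R R _ v x 1 _ _ h).
  by apply: filterS iK => y Ky; rewrite /v asboolT.
rewrite fx0 dtrunc0 mul0r.
suff h : h^-1 *: ((v \o shift x) (h *: 1) - v x) @[h --> 0^'] --> (0 : R).
  by apply: DeriveDef; [apply/cvg_ex; exists 0|apply/cvg_lim].
have vx : v x = 0 by rewrite /v asboolT// fx0 /trunc !mul0r.
have [df' _] := df.
have q1 : h^-1 *: ((f \o shift x) (h *: 1) - f x) @[h --> 0^'] --> 'D_1 f x by exact: df'.
have sh : (shift x (h *: (1 : R)) : R) @[h --> (0 : R)^'] --> x.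
  rewrite -[X in _ --> X]add0r; apply: cvgD; last exact: cvg_cst.
  apply: cvg_trans (cvg_app _ (@nbhs_dnbhs _ 0)) _.
  by rewrite -[X in _ --> X](scale0r (1 : R)); apply: cvgZl; exact: cvg_id.
have q2 : (f \o shift x) (h *: 1) @[h --> 0^'] --> f x by apply: cvg_comp sh _; exact: fc.
apply/norm_cvg0P.
(* By [trunc_bound] the difference quotient of [v] is at most that of [f] times [|f| / |t|], and [f]
   tends to 0 at this point. *)
have up : `|h^-1 *: ((f \o shift x) (h *: 1) - f x)| * `|(f \o shift x) (h *: 1)| / `|t| @[h --> 0^']
    --> `|'D_1 f x| * `|f x| / `|t|.
  by apply: cvgM; [apply: cvgM; exact: cvg_norm|exact: cvg_cst].
rewrite fx0 normr0 mulr0 mul0r in up.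
apply: (squeeze_cvgr _ (cvg_cst 0) up).
apply: nearW => h; rewrite normr_ge0/= vx !subr0 /v /=.
case: asboolP => [Kh|_]; last by rewrite scaler0 normr0 !mulr_ge0.
rewrite normrZ [X in _ <= X * _ / _]normrZ -[leRHS]mulrA -[leRHS]mulrA ler_wpM2l//.
by rewrite mulrA; exact: trunc_bound.
Qed.

Let v1_continuous : continuous v1.
Proof.
move=> x; have [Kx|nK] := pselect (K x); last first.
  rewrite /continuous_at {2}/v1 asboolF//.
  have e : \forall y \near x, (cst 0 : R -> R) y = v1 y.
    by apply: filterS (near_out nK) => y nKy; rewrite /v1 asboolF.
  exact: cvg_trans (near_eq_cvg e) (cvg_cst _).
have [_ cf1 alt] := fK Kx.
have cg : {for x, continuous (fun y => dtrunc t (f y) * f1 y)}.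
  apply: continuousM => //; apply: continuous_comp; first exact: fc.
  exact: dtrunc_continuous.
case: alt => [iK|fx0].
  rewrite /continuous_at {2}/v1 asboolT//.
  have e : \forall y \near x, dtrunc t (f y) * f1 y = v1 y.
    by apply: filterS iK => y Ky; rewrite /v1 asboolT.
  exact: cvg_trans (near_eq_cvg e) cg.
rewrite /continuous_at {2}/v1 asboolT// fx0 dtrunc0 mul0r.
apply/norm_cvg0P.
have up : `|dtrunc t (f y) * f1 y| @[y --> x] --> `|dtrunc t (f x) * f1 x|.
  by apply: cvg_norm; exact: cg.
rewrite fx0 dtrunc0 mul0r normr0 in up.
have lo : (cst 0 : R -> R) y @[y --> x] --> (0 : R) by exact: cvg_cst.
apply: (squeeze_cvgr _ lo up).
apply: nearW => y; rewrite normr_ge0/= /v1; case: asboolP => // _.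
by rewrite normr0.
Qed.

(** The truncated function, extended by 0 outside [K], is continuously differentiable on the whole
    line and vanishes at both ends of [[-M, M]]; the fundamental theorem of calculus gives the
    integral of its derivative. *)
Lemma truncated_slice_integral :
  (\int[leb]_x (if `[< K x >] then dtrunc t (f x) * f1 x else 0)%:E = 0)%E.
Proof.
have MM : - M < M by rewrite gtrN.
have vc x : {for x, continuous v}.
  by apply: differentiable_continuous; apply/derivable1_diffP; have [] := v_derive x.
have := @continuous_FTC2 R v1 v (- M) M MM.
have nM : ~ K M by move=> /KM; rewrite ltxx andbF.
have nMM : ~ K (- M) by move=> /KM; rewrite ltxx.
have -> : v M = 0 by rewrite /v asboolF.
have -> : v (- M) = 0 by rewrite /v asboolF.
rewrite subee// => h.
transitivity (integral leb `[- M, M] (fun x => (v1 x)%:E)); last first.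
  apply: h.
  - by apply: continuous_subspaceT; exact: v1_continuous.
  - split; first by move=> x _; have [] := v_derive x.
      by apply: cvg_at_right_filter; exact: vc.
    by apply: cvg_at_left_filter; exact: vc.
  - by move=> x _; rewrite derive1E; have [_] := v_derive x.
rewrite [RHS]integral_mkcond; apply: eq_integral => x _.
rewrite patchE -/(v1 x); have [//|xM] := boolP (x \in `[- M, M]%classic).
rewrite /v1 asboolF// => /KM/andP[h1 h2].
by move: xM; rewrite notin_setE/= in_itv/=; apply; rewrite !ltW.
Qed.

End Slice.
End TruncatedSlices.

Lemma dtrunc_cvg1 (R : realType) (s : R) : s != 0 -> dtrunc t s @[t --> 0^'] --> (1 : R).
Proof.
move=> s0; have d0 : s * s + 0 * 0 != 0 by rewrite mul0r addr0 mulf_neq0.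
have ct : {for (0 : R), continuous (fun t : R => t * t)} by apply: continuousM; exact: cvg_id.
have cs (c : R) : {for (0 : R), continuous (fun _ : R => c)} by exact: cvg_cst.
have ci : {for (0 : R), continuous (fun t : R => (s * s + t * t)^-1)}.
  exact: (cvgV d0 (continuousD (cs (s * s)) ct)).
have c : {for (0 : R), continuous (fun t : R => dtrunc t s)}.
  apply: continuousM; last exact: (continuousM ci ci).
  exact: (continuousD (cs (s * s * (s * s))) (continuousM (cs (3 * (s * s))) ct)).
have e : dtrunc 0 s = 1 by rewrite /dtrunc; clear -s0; field.
have h : dtrunc t s @[t --> (0 : R)] --> dtrunc 0 s by exact: c.
rewrite e in h; exact: cvg_trans (cvg_app _ (@nbhs_dnbhs _ 0)) h.
Qed.

Section Stokes.
Variable R : realType.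
Local Notation RR := (measurableTypeR R * measurableTypeR R)%type.
Local Notation leb := (@lebesgue_measure R).
Local Notation mu2 := (leb \x leb)%E.
Variables (U D : set (R * R)).
Hypotheses (oU : open U) (cD : compact D) (DU : D `<=` U).

Let mD : measurable (D : set RR) := compact_measurable2 cD.
Let fD : (mu2 D < +oo)%E := compact_mu2_finite cD.

Lemma smooth_bmf (f : R -> R -> R) : smooth_on U f -> bmf D (fun q => f q.1 q.2).
Proof. by move=> sf; apply: (compact_bmf cD oU DU) => p Up; exact: (smooth_on_regular sf Up).1. Qed.

Variable u : R -> R -> R.
Hypotheses (su : smooth_on U u) (u0 : forall q, D q -> ~ D° q -> u q.1 q.2 = 0).

Let dtrunc_u_bmf (t : R) (g : R -> R -> R) : t != 0 -> smooth_on U g ->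
  bmf D (fun q => dtrunc t (u q.1 q.2) * g q.1 q.2).
Proof.
move=> t0 sg; apply: bmfM; last exact: smooth_bmf.
apply: (compact_bmf cD oU DU) => p Up.
have c1 := (smooth_on_regular su Up).1.
have c2 : {for u p.1 p.2, continuous (dtrunc t)} by exact: dtrunc_continuous.
exact: (continuous_comp c1 c2).
Qed.

Let trunc_slicex (t y : R) : t != 0 ->
  (\int[leb]_x (((fun q : RR => (dtrunc t (u q.1 q.2) * pdx u q.1 q.2)%:E) \_ D) (x, y)) = 0)%E.
Proof.
move=> t0; have [M M0 DM] := compact_sub_box cD.
pose K := [set x : R | D (x, y)].
have cK : closed K.
  apply: (closed_comp (f := fun x : R => (x, y))).
    by move=> x' _; exact: (cvg_pair cvg_id (cvg_cst _)).
  exact: compact_closed.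
have KM x : K x -> - M < x < M by move=> /DM[]; rewrite /= !in_itv/=.
have h := @truncated_slice_integral R K (fun x => u x y) (fun x => pdx u x y) M t t0 M0 cK KM.
rewrite -[RHS]h.
  apply: eq_integral => x' _; rewrite patchE.
  have [Dx|nDx] := pselect (D (x', y)).
    by rewrite asboolT// mem_set.
  by rewrite asboolF// memNset.
move=> x' Kx; have Ux : U (x', y) by exact: DU.
split.
- exact: (regular_dx (smooth_on_regular su Ux)).
- have c := (smooth_on_regular (smooth_on_pdx su) Ux).1.
  have cp : {for x', continuous (fun x : R => (x, y))} by exact: (cvg_pair cvg_id (cvg_cst _)).
  exact: (continuous_comp cp c).
- have [iD|nD] := pselect (D° (x', y)); last by right; exact: (u0 Kx nD).
  left; have := @near_hslice R D° (x', y) (@open_interior _ _) iD.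
  by apply: filterS => z /interior_subset.
Qed.

Let integ_trunc_x (t : R) : t != 0 -> integ D (fun q => dtrunc t (u q.1 q.2) * pdx u q.1 q.2) = 0.
Proof.
move=> t0; rewrite /integ /leb2 /Rintegral integral_mkcond.
have ig := bmf_integrable mD fD (dtrunc_u_bmf t0 (smooth_on_pdx su)).
rewrite -integral21_prod_meas1; last by apply/(integrable_mkcond _ mD); exact: ig.
by rewrite integral0_eq// => y _; exact: trunc_slicex.
Qed.

(** On each horizontal slice the truncated integrals vanish. As [t] tends to 0 the integrand tends
    to [pdx u] wherever [u] is nonzero, and also where [pdx u = 0]; the remaining points are zeros
    of [u] with nonzero derivative and form a null set. *)
Lemma integ_pdx_zero : integ D (fun q => pdx u q.1 q.2) = 0.
Proof.
have [M M0 hM] := bmf_bound (smooth_bmf (smooth_on_pdx su)).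
have cv := @dominated_integ R D mD fD (fun t q => dtrunc t (u q.1 q.2) * pdx u q.1 q.2)
  (fun q => pdx u q.1 q.2) 0 1 (2 * M) ltr01.
have lim : integ D (fun q => dtrunc t (u q.1 q.2) * pdx u q.1 q.2) @[t --> 0^'] -->
    integ D (fun q => pdx u q.1 q.2).
  apply: cv.
  - move=> t; rewrite subr0 normr_gt0 => /andP[t0 _].
    by have [] := dtrunc_u_bmf t0 (smooth_on_pdx su).
  - by have [] := smooth_bmf (smooth_on_pdx su).
  - move=> t q; rewrite subr0 normr_gt0 => /andP[t0 _] Dq.
    by rewrite normrM ler_pM// ?dtrunc_bound// hM.
  pose V := [set q : R * R | U q /\ pdx u q.1 q.2 != 0].
  have oV : open V by apply: (open_nonzero oU); exact: smooth_on_pdx.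
  have nV : mu2.-negligible (V `&` [set q | u q.1 q.2 = 0]).
    apply: (rbox_negligible oV) => k kV; apply: box_null_dx; last by move=> q /kV[].
    by apply: smooth_onS su => q /kV[].
  apply: negligibleS nV => q /= nq.
  have Dq : D q by apply: contrapT => nD; apply: nq.
  have [uq|uq] := eqVneq (u q.1 q.2) 0; last first.
    exfalso; apply: nq => _; rewrite -[X in _ --> X]mul1r.
    by apply: cvgM; [exact: dtrunc_cvg1|exact: cvg_cst].
  split=> //; split; first exact: DU.
  apply/eqP => du; apply: nq => _; rewrite du.
  under eq_fun do rewrite mulr0; exact: cvg_cst.
have lim0 : integ D (fun q => dtrunc t (u q.1 q.2) * pdx u q.1 q.2) @[t --> 0^'] --> (0 : R).
  have e : \forall t \near (0 : R)^', (cst 0 : R -> R) t =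
      integ D (fun q => dtrunc t (u q.1 q.2) * pdx u q.1 q.2).
    by near=> t; rewrite integ_trunc_x//; near: t; exact: nbhs_dnbhs_neq.
  exact: cvg_trans (near_eq_cvg e) (cvg_cst _).
exact: (cvg_unique _ lim lim0).
Unshelve. all: by end_near. Qed.

Let trunc_slicey (t x : R) : t != 0 ->
  (\int[leb]_y (((fun q : RR => (dtrunc t (u q.1 q.2) * pdy u q.1 q.2)%:E) \_ D) (x, y)) = 0)%E.
Proof.
move=> t0; have [M M0 DM] := compact_sub_box cD.
pose K := [set y : R | D (x, y)].
have cK : closed K.
  apply: (closed_comp (f := fun y : R => (x, y))).
    by move=> y' _; exact: (cvg_pair (cvg_cst _) cvg_id).
  exact: compact_closed.
have KM y : K y -> - M < y < M by move=> /DM[]; rewrite /= !in_itv/=.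
have h := @truncated_slice_integral R K (fun y => u x y) (fun y => pdy u x y) M t t0 M0 cK KM.
rewrite -[RHS]h.
  apply: eq_integral => y' _; rewrite patchE.
  have [Dx|nDx] := pselect (D (x, y')).
    by rewrite asboolT// mem_set.
  by rewrite asboolF// memNset.
move=> y' Kx; have Ux : U (x, y') by exact: DU.
split.
- exact: (regular_dy (smooth_on_regular su Ux)).
- have c := (smooth_on_regular (smooth_on_pdy su) Ux).1.
  have cp : {for y', continuous (fun y : R => (x, y))} by exact: (cvg_pair (cvg_cst _) cvg_id).
  exact: (continuous_comp cp c).
- have [iD|nD] := pselect (D° (x, y')); last by right; exact: (u0 Kx nD).
  left; have := @near_vslice R D° (x, y') (@open_interior _ _) iD.
  by apply: filterS => z /interior_subset.
Qed.

Let integ_trunc_y (t : R) : t != 0 -> integ D (fun q => dtrunc t (u q.1 q.2) * pdy u q.1 q.2) = 0.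
Proof.
move=> t0; rewrite /integ /leb2 /Rintegral integral_mkcond.
have ig := bmf_integrable mD fD (dtrunc_u_bmf t0 (smooth_on_pdy su)).
rewrite -integral12_prod_meas1; last by apply/(integrable_mkcond _ mD); exact: ig.
by rewrite integral0_eq// => x _; exact: trunc_slicey.
Qed.

Lemma integ_pdy_zero : integ D (fun q => pdy u q.1 q.2) = 0.
Proof.
have [M M0 hM] := bmf_bound (smooth_bmf (smooth_on_pdy su)).
have cv := @dominated_integ R D mD fD (fun t q => dtrunc t (u q.1 q.2) * pdy u q.1 q.2)
  (fun q => pdy u q.1 q.2) 0 1 (2 * M) ltr01.
have lim : integ D (fun q => dtrunc t (u q.1 q.2) * pdy u q.1 q.2) @[t --> 0^'] -->
    integ D (fun q => pdy u q.1 q.2).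
  apply: cv.
  - move=> t; rewrite subr0 normr_gt0 => /andP[t0 _].
    by have [] := dtrunc_u_bmf t0 (smooth_on_pdy su).
  - by have [] := smooth_bmf (smooth_on_pdy su).
  - move=> t q; rewrite subr0 normr_gt0 => /andP[t0 _] Dq.
    by rewrite normrM ler_pM// ?dtrunc_bound// hM.
  pose V := [set q : R * R | U q /\ pdy u q.1 q.2 != 0].
  have oV : open V by apply: (open_nonzero oU); exact: smooth_on_pdy.
  have nV : mu2.-negligible (V `&` [set q | u q.1 q.2 = 0]).
    apply: (rbox_negligible oV) => k kV; apply: box_null_dy; last by move=> q /kV[].
    by apply: smooth_onS su => q /kV[].
  apply: negligibleS nV => q /= nq.
  have Dq : D q by apply: contrapT => nD; apply: nq.
  have [uq|uq] := eqVneq (u q.1 q.2) 0; last first.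
    exfalso; apply: nq => _; rewrite -[X in _ --> X]mul1r.
    by apply: cvgM; [exact: dtrunc_cvg1|exact: cvg_cst].
  split=> //; split; first exact: DU.
  apply/eqP => du; apply: nq => _; rewrite du.
  under eq_fun do rewrite mulr0; exact: cvg_cst.
have lim0 : integ D (fun q => dtrunc t (u q.1 q.2) * pdy u q.1 q.2) @[t --> 0^'] --> (0 : R).
  have e : \forall t \near (0 : R)^', (cst 0 : R -> R) t =
      integ D (fun q => dtrunc t (u q.1 q.2) * pdy u q.1 q.2).
    by near=> t; rewrite integ_trunc_y//; near: t; exact: nbhs_dnbhs_neq.
  exact: cvg_trans (near_eq_cvg e) (cvg_cst _).
exact: (cvg_unique _ lim lim0).
Unshelve. all: by end_near. Qed.

End Stokes.

(** * Euclidean products and the energy bound for the area element *)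

Section DotProduct.
Variables (R : realType) (n : nat).
Implicit Types u v w : 'rV[R]_n.

Lemma dotC u v : dot u v = dot v u.
Proof. by apply: eq_bigr => i _; rewrite mulrC. Qed.

Lemma dotDl u v w : dot (u + v) w = dot u w + dot v w.
Proof. by rewrite -big_split; apply: eq_bigr => i _; rewrite mxE mulrDl. Qed.

Lemma dotZl (c : R) u v : dot (c *: u) v = c * dot u v.
Proof. by rewrite mulr_sumr; apply: eq_bigr => i _; rewrite mxE mulrA. Qed.

Lemma dotDr u v w : dot u (v + w) = dot u v + dot u w.
Proof. by rewrite dotC dotDl !(dotC u). Qed.

Lemma dotZr (c : R) u v : dot u (c *: v) = c * dot u v.
Proof. by rewrite dotC dotZl (dotC u). Qed.

Lemma dotNl u v : dot (- u) v = - dot u v.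
Proof. by rewrite -scaleN1r dotZl mulN1r. Qed.

Lemma dotNr u v : dot u (- v) = - dot u v.
Proof. by rewrite dotC dotNl dotC. Qed.

Lemma dotBl u v w : dot (u - v) w = dot u w - dot v w.
Proof. by rewrite dotDl dotNl. Qed.

Lemma dotBr u v w : dot u (v - w) = dot u v - dot u w.
Proof. by rewrite dotDr dotNr. Qed.

Lemma dot0l u : dot 0 u = 0.
Proof. by rewrite -(scale0r (0 : 'rV[R]_n)) dotZl mul0r. Qed.

Lemma dot_ge0 u : 0 <= dot u u.
Proof. by apply: sumr_ge0 => i _; rewrite -expr2 sqr_ge0. Qed.

Lemma dot_eq0 u : (dot u u == 0) = (u == 0).
Proof.
apply/idP/eqP => [|->]; last by rewrite dot0l.
rewrite psumr_eq0 => [/allP h|i _]; last by rewrite -expr2 sqr_ge0.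
apply/rowP => i; rewrite mxE; have := h i (mem_index_enum i).
by rewrite mulf_eq0 orbb => /eqP.
Qed.

Lemma dot_cauchy u v : dot u v ^+ 2 <= dot u u * dot v v.
Proof.
have [->|u0] := eqVneq u 0; first by rewrite !dot0l expr0n mul0r.
have u1 : 0 < dot u u by rewrite lt_neqAle eq_sym dot_eq0 u0 dot_ge0.
have := dot_ge0 (dot u u *: v - dot u v *: u).
rewrite !(dotBl, dotBr, dotZl, dotZr) (dotC v u).
move: (dot u u) (dot u v) (dot v v) u1 => a b c a0 h.
rewrite -subr_ge0 -(pmulr_rge0 _ a0).
by move: h; congr (_ <= _); ring.
Qed.

Lemma dotE u v : dot u v = (u *m v^T) 0 0.
Proof. by rewrite mxE; apply: eq_bigr => i _; rewrite mxE. Qed.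

(* The area element of [p, q] is at most half their energy in any constant
   conformal structure; [k] and [l] parametrize the structure. *)
Lemma area_element_le_energy u v (k l : R) :
  Num.sqrt (dot u u * dot v v - dot u v ^+ 2) <=
  (dot u u + dot v v) / 2 * (1 + (k ^+ 2 + l ^+ 2) / 2) - k * ((dot u u - dot v v) / 2) - l * dot u v.
Proof.
(* Twice the right-hand side is the trace of the Gram matrix against the positive matrix with
   diagonal [p], [q] and off-diagonal entry [r], of determinant [d = 1 + c^2 >= 1]. The claim is the
   inequality of arithmetic and geometric means for the eigenvalues, proved by completing
   squares. *)
pose c := (k ^+ 2 + l ^+ 2) / 2.
pose p := 1 + c - k; pose q := 1 + c + k; pose r := - l.
have := dot_cauchy u v; have := dot_ge0 (q *: v + r *: u); have := dot_ge0 u.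
rewrite !(dotDl, dotDr, dotZl, dotZr) (dotC v u) -/c.
move: (dot u u) (dot u v) (dot v v) => e h g e0 X0 cs.
have q0 : 0 < q.
  have -> : q = (1 + ((k + 1) ^+ 2 + l ^+ 2)) / 2 by rewrite /q /c; clear; field.
  by rewrite divr_gt0// ltr_wpDr// addr_ge0// sqr_ge0.
set X := (X in 0 <= X) in X0.
pose d := 1 + c ^+ 2.
have d1 : 1 <= d by rewrite lerDl sqr_ge0.
have dE : d = p * q - r ^+ 2 by rewrite /d /p /q /r /c; clear; field.
set T := (X in _ <= X).
have TE : 2 * T = p * e + q * g + 2 * r * h by rewrite /T /p /q /r /c; clear; field.
have qT : q * (2 * T) = X + d * e by rewrite TE /X dE; clear; ring.
have EX : e * X = q ^+ 2 * (e * g - h ^+ 2) + (q * h + r * e) ^+ 2 by rewrite /X; clear; ring.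
have T0 : 0 <= T.
  have : 0 <= q * (2 * T) by rewrite qT addr_ge0// mulr_ge0// (le_trans ler01).
  by rewrite pmulr_rge0// pmulr_rge0.
have gr0 : 0 <= e * g - h ^+ 2 by rewrite subr_ge0.
rewrite -(@ler_pXn2r _ 2)// ?nnegrE ?sqrtr_ge0// sqr_sqrtr//.
rewrite -(@ler_pM2l _ (q ^+ 2 * 4)) ?mulr_gt0 ?exprn_gt0//.
have -> : q ^+ 2 * 4 * T ^+ 2 = (X + d * e) ^+ 2 by rewrite -qT; clear; ring.
apply: (@le_trans _ _ (4 * (e * X))).
  rewrite EX -subr_ge0.
  have -> : 4 * (q ^+ 2 * (e * g - h ^+ 2) + (q * h + r * e) ^+ 2) - q ^+ 2 * 4 * (e * g - h ^+ 2) =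
    4 * (q * h + r * e) ^+ 2 by clear; ring.
  by rewrite mulr_ge0// sqr_ge0.
have eX : 0 <= e * X by exact: mulr_ge0.
apply: (@le_trans _ _ (4 * d * (e * X))); first by rewrite ler_wpM2r// ler_peMr.
rewrite -subr_ge0; have -> : (X + d * e) ^+ 2 - 4 * d * (e * X) = (X - d * e) ^+ 2 by ring.
exact: sqr_ge0.
Qed.

End DotProduct.

Lemma jet_sum (R : realType) (I : Type) (r : seq I) (f : I -> R -> R -> R) p (a b : I -> R) :
  (forall i, jet (f i) p (a i) (b i)) ->
  jet (fun x y => \sum_(i <- r) f i x y) p (\sum_(i <- r) a i) (\sum_(i <- r) b i).
Proof.
move=> h; elim: r => [|i r ih].
  have -> : (fun x y => \sum_(i <- [::]) f i x y) = (fun _ _ => 0).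
    by apply/funext => x; apply/funext => y; rewrite big_nil.
  by rewrite !big_nil; exact: jet_cst.
have -> : (fun x y => \sum_(j <- i :: r) f j x y) = (fun x y => f i x y + \sum_(j <- r) f j x y).
  by apply/funext => x; apply/funext => y; rewrite big_cons.
by rewrite !big_cons; exact: jetD.
Qed.

Section VectorFields.
Variables (R : realType) (n : nat).
Implicit Types G W : R -> R -> 'rV[R]_n.

Lemma regular_lin G W (t : R) (p : R * R) : regular_at G p -> regular_at W p ->
  pdx (fun x y => G x y + t *: W x y) p.1 p.2 = pdx G p.1 p.2 + t *: pdx W p.1 p.2 /\
  pdy (fun x y => G x y + t *: W x y) p.1 p.2 = pdy G p.1 p.2 + t *: pdy W p.1 p.2.
Proof.
move=> rG rW.
have jG i := regular_coord rG i; have jW i := regular_coord rW i.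
have jet_i i : jet (fun x y => (G x y + t *: W x y) 0 i) p
    (pdx G p.1 p.2 0 i + t * pdx W p.1 p.2 0 i) (pdy G p.1 p.2 0 i + t * pdy W p.1 p.2 0 i).
  have h := jetD (jG i) (jetM (jet_cst t p) (jW i)).
  have -> : (fun x y => (G x y + t *: W x y) 0 i) = (fun x y => G x y 0 i + t * W x y 0 i).
    by apply/funext => x; apply/funext => y; rewrite !mxE.
  by apply: (jet_eq h); rewrite mulr0 addr0.
have rL : regular_at (fun x y => G x y + t *: W x y) p.
  by apply: regular_rowI => i; have [] := jet_i i.
split; apply/rowP => i; have [_ ex ey] := regular_coord rL i; have [_ ex' ey'] := jet_i i.
- by rewrite !mxE; exact: (etrans (esym ex) ex').
- by rewrite !mxE; exact: (etrans (esym ey) ey').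
Qed.

Lemma lin_smooth (U : set (R * R)) G W (t : R) : open U -> smooth_on U G -> smooth_on U W ->
  smooth_on U (fun x y => G x y + t *: W x y).
Proof.
move=> oU sG sW; apply: (smooth_rowI oU) => i.
have h := add_smooth oU (smooth_coord oU sG i) (mul_smooth oU (cst_smooth t oU) (smooth_coord oU sW i)).
by apply: (eq_on_smooth oU _ h) => p _; rewrite !mxE.
Qed.

Lemma dot_smooth (U : set (R * R)) G W : open U -> smooth_on U G -> smooth_on U W ->
  smooth_on U (fun x y => dot (G x y) (W x y)).
Proof.
move=> oU sG sW; apply: (sum_smooth _ oU) => i.
exact: (mul_smooth oU (smooth_coord oU sG i) (smooth_coord oU sW i)).
Qed.

Lemma mulmx_smooth (U : set (R * R)) G (K : 'M[R]_n) : open U -> smooth_on U G ->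
  smooth_on U (fun x y => G x y *m K) /\
  forall p, U p -> pdx (fun x y => G x y *m K) p.1 p.2 = pdx G p.1 p.2 *m K /\
                   pdy (fun x y => G x y *m K) p.1 p.2 = pdy G p.1 p.2 *m K.
Proof.
move=> oU sG.
have cE x y i : (G x y *m K) 0 i = \sum_j G x y 0 j * K j i by rewrite mxE.
have jsum i p : U p -> jet (fun x y => (G x y *m K) 0 i) p
   ((pdx G p.1 p.2 *m K) 0 i) ((pdy G p.1 p.2 *m K) 0 i).
  move=> Up; have rG := smooth_on_regular sG Up.
  have -> : (fun x y => (G x y *m K) 0 i) = (fun x y => \sum_j G x y 0 j * K j i).
    by apply/funext => x; apply/funext => y.
  have h j := jetM (regular_coord rG j) (jet_cst (K j i) p).
  by apply: (jet_eq (jet_sum _ h)); rewrite mxE; apply: eq_bigr => j _; rewrite mulr0 add0r mulrC.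
have sc : smooth_on U (fun x y => G x y *m K).
  apply: (smooth_rowI oU) => i.
  have h j := mul_smooth oU (smooth_coord oU sG j) (cst_smooth (K j i) oU).
  by apply: (eq_on_smooth oU _ (sum_smooth (index_enum 'I_n) oU h)) => p _; rewrite cE.
split=> // p Up; have rL := smooth_on_regular sc Up.
split; apply/rowP => i; have [_ ex ey] := regular_coord rL i; have [_ ex' ey'] := jsum i p Up.
- exact: (etrans (esym ex) ex').
- exact: (etrans (esym ey) ey').
Qed.

Lemma scale_smooth (U : set (R * R)) (f : R -> R -> R) G : open U -> smooth_on U f -> smooth_on U G ->
  smooth_on U (fun x y => f x y *: G x y) /\
  forall p, U p ->
    pdx (fun x y => f x y *: G x y) p.1 p.2 = pdx f p.1 p.2 *: G p.1 p.2 + f p.1 p.2 *: pdx G p.1 p.2 /\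
    pdy (fun x y => f x y *: G x y) p.1 p.2 = pdy f p.1 p.2 *: G p.1 p.2 + f p.1 p.2 *: pdy G p.1 p.2.
Proof.
move=> oU sf sG.
have e i : (fun x y => (f x y *: G x y) 0 i) = (fun x y => f x y * G x y 0 i).
  by apply/funext => x; apply/funext => y; rewrite mxE.
have sc : smooth_on U (fun x y => f x y *: G x y).
  by apply: (smooth_rowI oU) => i; rewrite e; exact: (mul_smooth oU sf (smooth_coord oU sG i)).
split=> // p Up; have rL := smooth_on_regular sc Up.
have alg (a b c d : R) : a * b + c * d = d * c + a * b by ring.
have h i := jetM (jet_smooth sf Up) (regular_coord (smooth_on_regular sG Up) i).
split; apply/rowP => i; have [_ ex ey] := regular_coord rL i; have [_ ex' ey'] := h i.
- rewrite e in ex; rewrite !mxE; apply: (etrans (etrans (esym ex) ex')).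
  exact: alg.
- rewrite e in ey; rewrite !mxE; apply: (etrans (etrans (esym ey) ey')).
  exact: alg.
Qed.

End VectorFields.

Section Bracket.
Variables (R : realType) (n : nat) (U D : set (R * R)).
Hypotheses (oU : open U) (cD : compact D) (DU : D `<=` U).

Lemma bracket_smooth (u v : R -> R -> R) : smooth_on U u -> smooth_on U v ->
  smooth_on U (fun x y => pdx u x y * pdy v x y - pdy u x y * pdx v x y).
Proof.
move=> su sv; apply: (sub_smooth oU).
  exact: (mul_smooth oU (smooth_on_pdx su) (smooth_on_pdy sv)).
exact: (mul_smooth oU (smooth_on_pdy su) (smooth_on_pdx sv)).
Qed.

(* [u_x v_y - u_y v_x = (u v_y)_x - (u v_x)_y]. *)
Lemma integ_bracket (u v : R -> R -> R) : smooth_on U u -> smooth_on U v ->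
  (forall q, D q -> ~ D° q -> u q.1 q.2 = 0) ->
  integ D (fun q => pdx u q.1 q.2 * pdy v q.1 q.2 - pdy u q.1 q.2 * pdx v q.1 q.2) = 0.
Proof.
move=> su sv u0.
have s1 := mul_smooth oU su (smooth_on_pdy sv); have s2 := mul_smooth oU su (smooth_on_pdx sv).
have b1 q : D q -> ~ D° q -> u q.1 q.2 * pdy v q.1 q.2 = 0 by move=> h1 h2; rewrite u0// mul0r.
have b2 q : D q -> ~ D° q -> u q.1 q.2 * pdx v q.1 q.2 = 0 by move=> h1 h2; rewrite u0// mul0r.
have z1 := integ_pdx_zero oU cD DU s1 b1; have z2 := integ_pdy_zero oU cD DU s2 b2.
have mD := compact_measurable2 cD; have fD := compact_mu2_finite cD.
have h1 := smooth_bmf oU cD DU (smooth_on_pdx s1).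
have h2 := smooth_bmf oU cD DU (smooth_on_pdy s2).
have zz := integB mD fD h1 h2.
apply: etrans (etrans zz (etrans (congr2 (fun a b => a - b) z1 z2) (subrr 0))).
apply: eq_integ => q Dq; have Uq := DU Dq.
have [_ e1 _] := jetM (jet_smooth su Uq) (jet_smooth (smooth_on_pdy sv) Uq).
have [_ _ e2] := jetM (jet_smooth su Uq) (jet_smooth (smooth_on_pdx sv) Uq).
have alg (a b c d e f g : R) : f = g -> b * c - d * e = a * f + c * b - (a * g + e * d).
  by move=> ->; ring.
exact: (etrans (alg _ _ _ _ _ _ _ (clairaut oU sv Uq)) (esym (congr2 (fun a b => a - b) e1 e2))).
Qed.

Lemma integ_vector_bracket (V W : R -> R -> 'rV[R]_n) : smooth_on U V -> smooth_on U W ->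
  (forall q, D q -> ~ D° q -> V q.1 q.2 = 0) ->
  integ D (fun q => dot (pdx V q.1 q.2) (pdy W q.1 q.2) - dot (pdy V q.1 q.2) (pdx W q.1 q.2)) = 0.
Proof.
move=> sV sW V0.
have mD := compact_measurable2 cD; have fD := compact_mu2_finite cD.
have sVi := smooth_coord oU sV; have sWi := smooth_coord oU sW.
have b i := smooth_bmf oU cD DU (bracket_smooth (sVi i) (sWi i)).
have s := integ_sum mD fD (index_enum 'I_n) b.
rewrite [RHS](_ : 0 = \sum_(i <- index_enum 'I_n) integ D (fun q =>
    pdx (fun x y => V x y 0 i) q.1 q.2 * pdy (fun x y => W x y 0 i) q.1 q.2 -
    pdy (fun x y => V x y 0 i) q.1 q.2 * pdx (fun x y => W x y 0 i) q.1 q.2)); last first.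
  rewrite big1// => i _; apply: integ_bracket => [||q Dq nq]; [exact: sVi|exact: sWi|].
  by rewrite V0// mxE.
rewrite -s; apply: eq_integ => q Dq; rewrite /dot -sumrB; apply: eq_bigr => i _.
have [_ e1 e2] := regular_coord (smooth_on_regular sV (DU Dq)) i.
have [_ e3 e4] := regular_coord (smooth_on_regular sW (DU Dq)) i.
exact: (congr2 (fun a b => a - b) (congr2 *%R (esym e1) (esym e4)) (congr2 *%R (esym e2) (esym e3))).
Qed.

End Bracket.

(** * The stability inequality *)

(** Otherwise [A t + A (- t) + c t^2] would have a local maximum at 0, while its second derivative
    there is [2 A''(0) + 2 c > 0]. *)
Lemma second_difference_not_neg (R : realType) (A : R -> R) (c : R) : 0 < c ->
  second_deriv_nonneg A -> ~ \forall t \near (0 : R), A t + A (- t) - 2 * A 0 <= - (c * t ^+ 2).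
Proof.
move=> c0 [nA [dA1 A2]] diff.
pose g t := - (A t + A (- t) + c * (t * t)).
pose g1 t := - (derive1 A t - derive1 A (- t) + c * (2 * t)).
have nA' : \forall t \near (0 : R), derivable A (- t) 1.
  have /nbhs_ballP[e e0 he] : nbhs (0 : R) [set t | derivable A t 1] := nA.
  apply/nbhs_ballP; exists e; first exact: e0.
  move=> t ht; have bt : ball (0 : R) e (- t).
    by move: ht; rewrite /ball/= !sub0r !normrN.
  exact: (he _ bt).
have dN (f : R -> R) (x d : R) : is_derive (- x) (1 : R) f d -> is_derive x (1 : R) (fun t => f (- t)) (- d).
  move=> hf; have dopp : is_derive x (1 : R) (fun t : R => - t) (- 1).
    by apply: is_deriveN; exact: is_derive_id.
  by apply: (is_derive_eq (is_derive1_comp hf dopp)); rewrite mulrN1.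
have dsq (x : R) : is_derive x (1 : R) (fun t : R => c * (t * t)) (c * (2 * x)).
  have h := is_deriveM (is_derive_cst c x (1 : R)) (is_deriveM (is_derive_id x (1 : R)) (is_derive_id x (1 : R))).
  by apply: (is_derive_eq h); rewrite /GRing.scale/= mulr0 addr0; clear; ring.
have dA (t : R) : derivable A t 1 -> is_derive t (1 : R) A (derive1 A t).
  by move=> h; rewrite derive1E; exact/derivableP.
have gd : \forall t \near (0 : R), is_derive t (1 : R) g (g1 t).
  apply: filterS (filterI nA nA') => t [h1 h2].
  exact: (is_deriveN (is_deriveD (is_deriveD (dA _ h1) (dN _ _ _ (dA _ h2))) (dsq t))).
pose a2 := derive1 (derive1 A) 0.
have g1d : is_derive (0 : R) (1 : R) g1 (- (a2 + a2 + c * 2)).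
  have i1 : is_derive (0 : R) (1 : R) (derive1 A) a2.
    by rewrite /a2 derive1E; exact/derivableP.
  have i2 : is_derive (0 : R) (1 : R) (fun t => derive1 A (- t)) (- a2).
    by apply: dN; rewrite oppr0.
  have i3 : is_derive (0 : R) (1 : R) (fun t : R => c * (2 * t)) (c * 2).
    have h := is_deriveM (is_derive_cst c (0 : R) (1 : R)) (is_deriveM (is_derive_cst (2 : R) (0 : R) (1 : R)) (is_derive_id (0 : R) (1 : R))).
    by apply: (is_derive_eq h); rewrite /GRing.scale/= !mulr0 !addr0 mulr1.
  apply: (is_derive_eq (is_deriveN (is_deriveD (is_deriveB i1 i2) i3))).
  by rewrite opprK.
have gmin : \forall t \near (0 : R), g 0 <= g t.
  apply: filterS diff => t; rewrite /g oppr0 mulr0 mulr0 addr0 lerN2 expr2.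
  by move: (A t) (A (- t)) (A 0) => x y z; clear; lra.
have := second_derivative_at_min gd g1d gmin.
rewrite oppr_ge0 leNgt => /negP; apply.
by rewrite ltr_wpDl ?mulr_gt0// addr_ge0.
Qed.

Section StabilityInequality.
Variables (R : realType) (n : nat) (S : set (R * R)) (F : R -> R -> 'rV[R]_n).
Hypotheses (oS : open S) (bF : branched_minimal_immersion S F).

(** Points of [Om] with [rho < 0] are interior; a condition on the zero set of [rho] thus gives the
    boundary condition of the Stokes formulas. *)
Lemma domain_boundary (Om : set (R * R)) (rho : R -> R -> R) q :
  smooth_domain_in S Om rho -> Om q -> ~ Om° q -> rho q.1 q.2 = 0.
Proof.
move=> [_ [OmS [srho [OmE _]]]] Oq nI; have Sq := OmS q Oq.
have le0 : rho q.1 q.2 <= 0 by move: Oq; rewrite OmE => -[].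
apply/eqP; rewrite eq_le le0 leNgt; apply/negP => lt0; apply: nI.
have nS : nbhs q S by apply: open_nbhs_nbhs; split.
have c := (smooth_on_regular srho Sq).1.
have nr : \forall p \near q, rho p.1 p.2 < 0 by exact: (cvgr_lt _ c _ lt0).
have sub : S `&` [set p | rho p.1 p.2 < 0] `<=` Om.
  by move=> p [Sp rp]; rewrite OmE; split=> //=; exact: ltW.
by apply: (filterS sub); exact: filterI nS nr.
Qed.

Lemma gram_smooth (U : set (R * R)) (G : R -> R -> 'rV[R]_n) : open U -> smooth_on U G ->
  smooth_on U (fun x y => gram G (x, y)).
Proof.
move=> oU sG; have sx := smooth_on_pdx sG; have sy := smooth_on_pdy sG.
have h := sub_smooth oU (mul_smooth oU (dot_smooth oU sx sx) (dot_smooth oU sy sy))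
  (mul_smooth oU (dot_smooth oU sx sy) (dot_smooth oU sx sy)).
by apply: (eq_on_smooth oU _ h) => p _; rewrite /gram /= expr2.
Qed.

Lemma gram_bmf (U Om : set (R * R)) (G : R -> R -> 'rV[R]_n) : open U -> compact Om -> Om `<=` U ->
  smooth_on U G -> bmf Om (fun q => Num.sqrt (gram G q)).
Proof.
move=> oU cO OU sG; apply: (compact_bmf cO oU OU) => p Up.
have h := (smooth_on_regular (gram_smooth oU sG) Up).1.
have e : (fun q : R * R => gram G (q.1, q.2)) = gram G by apply/funext => -[].
rewrite e in h; apply: (continuous_comp h); exact: sqrt_continuous.
Qed.

Variables (Om : set (R * R)) (rho : R -> R -> R).
Hypothesis dom : smooth_domain_in S Om rho.
Variables (U : set (R * R)) (W : R -> R -> 'rV[R]_n).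
Hypotheses (oU : open U) (OmU : Om `<=` U) (sW : smooth_on U W).

Let cOm : compact Om. Proof. by case: dom. Qed.
Let OmS : Om `<=` S. Proof. by case: dom => _ []. Qed.
Let oSU : open (S `&` U). Proof. exact: openI. Qed.
Let OmSU : Om `<=` S `&` U. Proof. by move=> q Oq; split; [exact: OmS|exact: OmU]. Qed.
Let sF : smooth_on (S `&` U) F.
Proof. by case: bF => _ [h _]; apply: smooth_onS h => q []. Qed.
Let sW' : smooth_on (S `&` U) W.
Proof. by apply: smooth_onS sW => q []. Qed.
Let mOm := compact_measurable2 cOm.
Let fOm := compact_mu2_finite cOm.

Definition vary (t : R) : R -> R -> 'rV[R]_n := fun x y => F x y + t *: W x y.

Lemma vary_gram (t : R) q : Om q ->
  gram (vary t) q =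
  let a := pdx F q.1 q.2 + t *: pdx W q.1 q.2 in
  let b := pdy F q.1 q.2 + t *: pdy W q.1 q.2 in
  dot a a * dot b b - dot a b ^+ 2.
Proof.
move=> Oq; have SUq := OmSU Oq.
have [e1 e2] := regular_lin t (smooth_on_regular sF SUq) (smooth_on_regular sW' SUq).
rewrite /gram /vary; cbv zeta.
have gg (a b a' b' : 'rV[R]_n) : a = a' -> b = b' ->
  dot a a * dot b b - dot a b ^+ 2 = dot a' a' * dot b' b' - dot a' b' ^+ 2 by move=> -> ->.
exact: gg e1 e2.
Qed.

Lemma vary_bmf (t : R) : bmf Om (fun q => Num.sqrt (gram (vary t) q)).
Proof. by apply: (gram_bmf oSU cOm OmSU); exact: lin_smooth. Qed.

Let conf q : Om q -> dot (pdy F q.1 q.2) (pdy F q.1 q.2) = dot (pdx F q.1 q.2) (pdx F q.1 q.2) /\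
  dot (pdx F q.1 q.2) (pdy F q.1 q.2) = 0.
Proof. by move=> /OmS Sq; have [e1 e2] := bF.2.2.2 q Sq; split; [exact: esym e1|exact: e2]. Qed.

(* The second variation of the area element is at most [index_form k l], for
   all [k] and [l]; this avoids dividing by the area element at branch points. *)
Definition index_form (k l : R * R -> R) (q : R * R) : R :=
  let a := pdx F q.1 q.2 in let b := pdy F q.1 q.2 in
  let u := pdx W q.1 q.2 in let v := pdy W q.1 q.2 in
  dot u u + dot v v + (k q ^+ 2 + l q ^+ 2) * dot a a -
  2 * (k q * (dot a u - dot b v) + l q * (dot a v + dot b u)).

(** The energy bound is used with [(t k, t l)] for [t] and with the opposite parameters for [- t],
    so that the terms of odd order in [t] cancel; at [t = 0] the area element equals the energy
    because [F] is conformal. *)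
Lemma second_difference_le (k l : R * R -> R) (t : R) q : Om q ->
  Num.sqrt (gram (vary t) q) + Num.sqrt (gram (vary (- t)) q) - 2 * Num.sqrt (gram (vary 0) q) <=
  t ^+ 2 * index_form k l q +
  t ^+ 2 * t ^+ 2 * ((k q ^+ 2 + l q ^+ 2) *
    ((dot (pdx W q.1 q.2) (pdx W q.1 q.2) + dot (pdy W q.1 q.2) (pdy W q.1 q.2)) / 2)).
Proof.
move=> Oq; have [cf1 cf2] := conf Oq.
rewrite (vary_gram t Oq) (vary_gram (- t) Oq) (vary_gram 0 Oq); cbv zeta; rewrite /index_form; cbv zeta.
move: (pdx F q.1 q.2) (pdy F q.1 q.2) (pdx W q.1 q.2) (pdy W q.1 q.2) cf1 cf2 => a b u v cf1 cf2.
have h1 := area_element_le_energy (a + t *: u) (b + t *: v) (t * k q) (t * l q).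
have h2 := area_element_le_energy (a + - t *: u) (b + - t *: v) (- t * k q) (- t * l q).
have -> : Num.sqrt (dot (a + 0 *: u) (a + 0 *: u) * dot (b + 0 *: v) (b + 0 *: v) -
   dot (a + 0 *: u) (b + 0 *: v) ^+ 2) = dot a a.
  by rewrite !scale0r !addr0 cf1 cf2 expr0n subr0 -expr2 sqrtr_sqr ger0_norm// dot_ge0.
move: h1 h2; set s1 := Num.sqrt _; set s2 := Num.sqrt _.
rewrite !(dotDl, dotDr, dotZl, dotZr) (dotC u a) (dotC v b) (dotC u b) cf1 cf2.
move: (dot a a) (dot a u) (dot a v) (dot b u) (dot b v) (dot u u) (dot u v) (dot v v) (k q) (l q).
move=> A au av bu bv uu uv vv K L h1 h2.
apply: (le_trans (lerD (lerD h1 h2) (lexx _))); rewrite -subr_ge0.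
set D := (X in 0 <= X); have -> : D = 0; last by [].
by rewrite /D; field.
Qed.

Hypothesis stF : stable S F.
Hypothesis W0 : forall q, Om q -> rho q.1 q.2 = 0 -> W q.1 q.2 = 0.

Lemma stability_inequality (k l : R * R -> R) : bmf Om k -> bmf Om l ->
  0 <= integ Om (index_form k l).
Proof.
move=> bk bl.
have sFx := smooth_on_pdx sF; have sFy := smooth_on_pdy sF.
have sWx := smooth_on_pdx sW'; have sWy := smooth_on_pdy sW'.
have bd (G H : R -> R -> 'rV[R]_n) : smooth_on (S `&` U) G -> smooth_on (S `&` U) H ->
  bmf Om (fun q => dot (G q.1 q.2) (H q.1 q.2)).
  by move=> sG sH; exact: (smooth_bmf oSU cOm OmSU (dot_smooth oSU sG sH)).
have bk2 : bmf Om (fun q => k q ^+ 2 + l q ^+ 2) by apply: bmfD; exact: bmfM.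
have bI : bmf Om (index_form k l).
  apply: bmfB.
    apply: bmfD; first by apply: bmfD; exact: bd.
    by apply: bmfM => //; exact: bd.
  apply: (bmfM (bmf_cst _ 2)); apply: bmfD; apply: bmfM => //.
    by apply: bmfB; exact: bd.
  by apply: bmfD; exact: bd.
pose J q := (k q ^+ 2 + l q ^+ 2) *
    ((dot (pdx W q.1 q.2) (pdx W q.1 q.2) + dot (pdy W q.1 q.2) (pdy W q.1 q.2)) / 2).
have bJ : bmf Om J.
  apply: bmfM => //; apply: bmfM; last exact: bmf_cst.
  by apply: bmfD; exact: bd.
pose A t := area Om (vary t).
have AE t : A t = integ Om (fun q => Num.sqrt (gram (vary t) q)) by [].
have diff t : A t + A (- t) - 2 * A 0 <= t ^+ 2 * integ Om (index_form k l) + t ^+ 2 * t ^+ 2 * integ Om J.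
  rewrite !AE -(integZ mOm fOm 2 (vary_bmf 0)) -(integD mOm fOm (vary_bmf t) (vary_bmf (- t))).
  rewrite -(integB mOm fOm (bmfD (vary_bmf t) (vary_bmf (- t))) (bmfM (bmf_cst _ 2) (vary_bmf 0))).
  rewrite -(integZ mOm fOm _ bI) -(integZ mOm fOm _ bJ).
  rewrite -(integD mOm fOm (bmfM (bmf_cst _ (t ^+ 2)) bI) (bmfM (bmf_cst _ (t ^+ 2 * t ^+ 2)) bJ)).
  apply: (le_integ mOm fOm).
  - apply: bmfB; first exact: bmfD (vary_bmf t) (vary_bmf (- t)).
    exact: bmfM (bmf_cst _ 2) (vary_bmf 0).
  - by apply: bmfD; apply: bmfM => //; exact: bmf_cst.
  - by move=> q Oq; exact: second_difference_le.
rewrite leNgt; apply/negP => neg.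
have stA : second_deriv_nonneg A.
  apply: (stF dom); last exact: W0.
  by exists U.
move: (integ Om (index_form k l)) (integ Om J) neg diff => I0 J0 neg diff.
(* Half of the negative second-order coefficient is kept; the other half dominates the term of order
   four once [|t| <= c / (|J0| + 1)]. *)
pose c := - I0 / 2; have c0 : 0 < c by rewrite divr_gt0// oppr_gt0.
apply: (second_difference_not_neg c0 stA).
have e0 : 0 < c / (`|J0| + 1) by rewrite divr_gt0// ltr_wpDl.
near=> t.
have t1 : `|t| <= 1 by rewrite -(subr0 t) distrC; near: t; apply: cvgr_dist_le.
have t2 : `|t| <= c / (`|J0| + 1) by rewrite -(subr0 t) distrC; near: t; apply: cvgr_dist_le.
apply: (le_trans (diff t)).
have tt : t ^+ 2 * J0 <= c.
  apply: (le_trans (ler_norm _)); rewrite normrM.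
  apply: (@le_trans _ _ (`|t| * (`|J0| + 1))).
    by rewrite normrX expr2 ler_pM// ?mulr_ge0// ?lerDl// ler_piMl.
  by rewrite -ler_pdivlMr// ltr_wpDl.
have I0E : I0 = - (2 * c) by rewrite /c; field.
rewrite -[t ^+ 2 * t ^+ 2 * J0]mulrA I0E.
have := ler_wpM2l (sqr_ge0 t) tt.
move: (t ^+ 2 * (t ^+ 2 * J0)) (t ^+ 2) (c) => w s d hd; lra.
Unshelve. all: by end_near. Qed.

End StabilityInequality.

Section PairInequality.
Variables (R : realType) (n : nat) (S : set (R * R)) (F : R -> R -> 'rV[R]_n).
Hypotheses (oS : open S) (bF : branched_minimal_immersion S F) (stF : stable S F).
Variables (Om : set (R * R)) (rho : R -> R -> R).
Hypothesis dom : smooth_domain_in S Om rho.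
Variables (W1 W2 : R -> R -> 'rV[R]_n).
Hypotheses (sW1 : smooth_on S W1) (sW2 : smooth_on S W2).
Hypothesis W10 : forall q, Om q -> rho q.1 q.2 = 0 -> W1 q.1 q.2 = 0.
Hypothesis W20 : forall q, Om q -> rho q.1 q.2 = 0 -> W2 q.1 q.2 = 0.

Let cOm : compact Om. Proof. by case: dom. Qed.
Let OmS : Om `<=` S. Proof. by case: dom => _ []. Qed.
Let mOm := compact_measurable2 cOm.
Let fOm := compact_mu2_finite cOm.

(* Completing squares in [W1] with parameters [(h + k, l)] and in [W2] with
   parameters [(- l, k - h)]: the cross terms form a null Lagrangian, and where
   [k = l = 0] only the d-bar derivative of [W1 + i W2] is left. *)
Definition pair_form (h k l : R * R -> R) (q : R * R) : R :=
  let a := pdx F q.1 q.2 in let b := pdy F q.1 q.2 in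
  let P := pdx W1 q.1 q.2 - pdy W2 q.1 q.2 in
  let Q := pdy W1 q.1 q.2 + pdx W2 q.1 q.2 in
  let M := pdx W1 q.1 q.2 + pdy W2 q.1 q.2 in
  let N := pdx W2 q.1 q.2 - pdy W1 q.1 q.2 in
  dot (P - h q *: a) (P - h q *: a) + dot (Q + h q *: b) (Q + h q *: b) +
  2 * (k q ^+ 2 + l q ^+ 2) * dot a a -
  2 * (k q * (dot a M + dot b N) + l q * (dot b M - dot a N)).

Lemma pair_formE (h k l : R * R -> R) q : Om q ->
  pair_form h k l q =
  index_form F W1 (fun q => h q + k q) l q + index_form F W2 (fun q => - l q) (fun q => k q - h q) q -
  2 * (dot (pdx W1 q.1 q.2) (pdy W2 q.1 q.2) - dot (pdy W1 q.1 q.2) (pdx W2 q.1 q.2)).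
Proof.
move=> /OmS Sq; have [e1 e2] := bF.2.2.2 q Sq.
rewrite /pair_form /index_form; cbv zeta.
move: (pdx F q.1 q.2) (pdy F q.1 q.2) (pdx W1 q.1 q.2) (pdy W1 q.1 q.2) (pdx W2 q.1 q.2)
  (pdy W2 q.1 q.2) e1 e2 (h q) (k q) (l q) => a b u1 v1 u2 v2 e1 e2 H K L.
rewrite !(dotDl, dotDr, dotZl, dotZr, dotBl, dotBr, dotNl, dotNr) -e1.
rewrite (dotC u1 a) (dotC v2 a) (dotC v1 b) (dotC u2 b) (dotC v2 u1) (dotC u2 v1).
move: (dot a a) (dot a u1) (dot a v1) (dot a u2) (dot a v2) (dot b u1) (dot b v1) (dot b u2) (dot b v2).
move=> aa au1 av1 au2 av2 bu1 bv1 bu2 bv2.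
move: (dot u1 u1) (dot u1 v2) (dot v2 v2) (dot v1 v1) (dot v1 u2) (dot u2 u2) => x1 x2 x3 x4 x5 x6.
ring.
Qed.

Lemma pair_inequality (h k l : R * R -> R) : bmf Om h -> bmf Om k -> bmf Om l ->
  bmf Om (pair_form h k l) /\ 0 <= integ Om (pair_form h k l).
Proof.
move=> bh bk bl.
have bd (G H : R -> R -> 'rV[R]_n) : smooth_on S G -> smooth_on S H ->
  bmf Om (fun q => dot (G q.1 q.2) (H q.1 q.2)).
  by move=> sG sH; exact: (smooth_bmf oS cOm OmS (dot_smooth oS sG sH)).
have sF : smooth_on S F by case: bF => _ [].
have [sFx sFy] := (smooth_on_pdx sF, smooth_on_pdy sF).
have bI W (k' l' : R * R -> R) : smooth_on S W -> bmf Om k' -> bmf Om l' -> bmf Om (index_form F W k' l').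
  move=> sW bk' bl'; have [sWx sWy] := (smooth_on_pdx sW, smooth_on_pdy sW).
  apply: bmfB.
    apply: bmfD; first by apply: bmfD; exact: bd.
    by apply: bmfM; [apply: bmfD; exact: bmfM|exact: bd].
  apply: (bmfM (bmf_cst _ 2)); apply: bmfD; apply: bmfM => //.
    by apply: bmfB; exact: bd.
  by apply: bmfD; exact: bd.
have b1 := bI W1 _ _ sW1 (bmfD bh bk) bl.
have b2 := bI W2 _ _ sW2 (bmfN bl) (bmfB bk bh).
have W10' q : Om q -> ~ Om° q -> W1 q.1 q.2 = 0.
  by move=> Oq nO; apply: W10 => //; exact: domain_boundary dom Oq nO.
have br := integ_vector_bracket oS cOm OmS sW1 sW2 W10'.
have bb : bmf Om (fun q => dot (pdx W1 q.1 q.2) (pdy W2 q.1 q.2) - dot (pdy W1 q.1 q.2) (pdx W2 q.1 q.2)).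
  exact: (bmfB (bd _ _ (smooth_on_pdx sW1) (smooth_on_pdy sW2)) (bd _ _ (smooth_on_pdy sW1) (smooth_on_pdx sW2))).
have e : integ Om (pair_form h k l) = integ Om (fun q =>
   index_form F W1 (fun q => h q + k q) l q + index_form F W2 (fun q => - l q) (fun q => k q - h q) q -
   2 * (dot (pdx W1 q.1 q.2) (pdy W2 q.1 q.2) - dot (pdy W1 q.1 q.2) (pdx W2 q.1 q.2))).
  by apply: eq_integ => q Oq; exact: pair_formE.
split.
  apply: (eq_bmf _ (bmfB (bmfD b1 b2) (bmfM (bmf_cst Om 2) bb))) => q Oq.
  exact/esym/pair_formE.
have zz := integB mOm fOm (bmfD b1 b2) (bmfM (bmf_cst Om 2) bb).
have z2 := integZ mOm fOm 2 bb; have zd := integD mOm fOm b1 b2.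
have i1 := stability_inequality oS bF dom oS OmS sW1 stF W10 (bmfD bh bk) bl.
have i2 := stability_inequality oS bF dom oS OmS sW2 stF W20 (bmfN bl) (bmfB bk bh).
have fin (x y z w i j c : R) : x = y -> y = z - w -> w = 2 * c -> c = 0 -> z = i + j -> 0 <= i -> 0 <= j -> 0 <= x.
  by move=> -> -> -> -> -> hi hj; rewrite mulr0 subr0 addr_ge0.
apply: (fin _ _ _ _ _ _ _ e); [exact: zz|exact: z2|exact: br|exact: zd|exact: i1|exact: i2].
Qed.

End PairInequality.

(** * The test field *)

Section Taylor.
Variable R : realType.

(** The mean value inequality is applied to the Taylor remainder, whose gradient it has already
    shown to be of first order. Halving the square makes it compact, hence the second derivatives
    bounded. *)
Lemma taylor2 (S : set (R * R)) (f : R -> R -> R) (a : R * R) (r0 : R) : smooth_on S f ->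
  open S -> 0 < r0 -> square a r0 `<=` S ->
  exists2 C : R, 0 <= C & forall z, square a (r0 / 2) z ->
    `|f z.1 z.2 - f a.1 a.2 - (z.1 - a.1) * pdx f a.1 a.2 - (z.2 - a.2) * pdy f a.1 a.2|
      <= C * sqdist a z.1 z.2.
Proof.
move=> sf oS r00 r0S; have [sx sy] := (smooth_on_pdx sf, smooth_on_pdy sf).
have Sa : S a by apply: r0S; exact: square_center.
pose r := r0 / 2; have r1 : 0 < r by rewrite divr_gt0.
pose K := `[a.1 - r, a.1 + r] `*` `[a.2 - r, a.2 + r].
have cK : compact K by apply: compact_setX; exact: segment_compact.
have rr0 : r < r0 by rewrite /r ltr_pdivrMr// ltr_pMr// ltr1n.
have inK z : `|z.1 - a.1| <= r -> `|z.2 - a.2| <= r -> K z.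
  rewrite !ler_norml => /andP[? ?] /andP[? ?].
  by split; rewrite /= in_itv/=; apply/andP; split; lra.
have KS : K `<=` S.
  move=> z []; rewrite /= !in_itv/= => /andP[? ?] /andP[? ?].
  by apply: r0S; split; rewrite ltr_norml; apply/andP; split; lra.
have bd (g : R -> R -> R) : smooth_on S g -> exists2 M : R, 0 < M & forall z, K z -> `|g z.1 z.2| <= M.
  by move=> sg; exact: bmf_bound (smooth_bmf oS cK KS sg).
have [M1 M10 h1] := bd _ (smooth_on_pdx sx); have [M2 M20 h2] := bd _ (smooth_on_pdy sx).
have [M3 M30 h3] := bd _ (smooth_on_pdx sy); have [M4 M40 h4] := bd _ (smooth_on_pdy sy).
pose M := M1 + M2 + M3 + M4.
have lip (g : R -> R -> R) (N1 N2 : R) : smooth_on S g -> N1 <= M -> N2 <= M ->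
    (forall z, K z -> `|pdx g z.1 z.2| <= N1) -> (forall z, K z -> `|pdy g z.1 z.2| <= N2) ->
    forall w, `|w.1 - a.1| <= r -> `|w.2 - a.2| <= r ->
    `|g w.1 w.2 - g a.1 a.2| <= M * taxi a w.
  move=> sg N1M N2M g1 g2 w w1 w2; apply: rect_increment => z z1 z2.
  have Kz := inK z (le_trans z1 w1) (le_trans z2 w2).
  by split; [exact: smooth_on_regular sg (KS _ Kz)|exact: le_trans (g1 _ Kz) N1M|exact: le_trans (g2 _ Kz) N2M].
have lx := lip _ M1 M2 sx ltac:(rewrite /M; lra) ltac:(rewrite /M; lra) h1 h2.
have ly := lip _ M3 M4 sy ltac:(rewrite /M; lra) ltac:(rewrite /M; lra) h3 h4.
have M0 : 0 <= M by rewrite /M; lra.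
exists (2 * M); first by rewrite mulr_ge0.
move=> z [z1 z2].
pose g x y := f x y - (x - a.1) * pdx f a.1 a.2 - (y - a.2) * pdy f a.1 a.2.
have -> : f z.1 z.2 - f a.1 a.2 - (z.1 - a.1) * pdx f a.1 a.2 - (z.2 - a.2) * pdy f a.1 a.2 =
    g z.1 z.2 - g a.1 a.2.
  by rewrite /g; move: (pdx _ _ _) (pdy _ _ _) => u v; clear; ring.
have t0 := taxi_ge0 a z.
have lin (u v v' X Y : R) : (u - (X * 0 + v * 1) - (Y * 0 + v' * 0) = u - v) *
    (u - (X * 0 + v * 0) - (Y * 0 + v' * 1) = u - v') by split; ring.
have : `|g z.1 z.2 - g a.1 a.2| <= (M * taxi a z) * taxi a z.
  apply: rect_increment => w w1 w2.
  have w1r := le_trans w1 (ltW z1); have w2r := le_trans w2 (ltW z2).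
  have Sw := KS _ (inK w w1r w2r).
  have jg := jetB (jetB (jet_smooth sf Sw) (jetM (jet_dx a w) (jet_cst (pdx f a.1 a.2) w)))
    (jetM (jet_dy a w) (jet_cst (pdy f a.1 a.2) w)).
  have [rg ex ey] := jg.
  have tw : taxi a w <= taxi a z by rewrite lerD.
  split; first exact: rg.
  - have -> : pdx g w.1 w.2 = pdx f w.1 w.2 - pdx f a.1 a.2.
      exact: etrans ex (lin _ _ _ _ _).1.
    by apply: (le_trans (lx w w1r w2r)); rewrite ler_wpM2l.
  - have -> : pdy g w.1 w.2 = pdy f w.1 w.2 - pdy f a.1 a.2.
      exact: etrans ey (lin _ _ _ _ _).2.
    by apply: (le_trans (ly w w1r w2r)); rewrite ler_wpM2l.
move/le_trans; apply; rewrite -mulrA -[2 * M]mulrC -mulrA ler_wpM2l// /taxi /sqdist -!expr2.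
rewrite -[(z.1 - _) ^+ 2]real_normK ?num_real// -[(z.2 - _) ^+ 2]real_normK ?num_real//.
by have := sqr_ge0 (`|z.1 - a.1| - `|z.2 - a.2|); move: (`|_|) (`|_|) => u v; clear; nra.
Qed.

End Taylor.

Section TestField.
Variables (R : realType) (n : nat).
Variables (a : R * R) (s : R) (A B C D : 'rV[R]_n).
Hypothesis s0 : 0 < s.

(* [sfield1 + i sfield2] is
   [(conj(w) (A - i B) - s (C - i D)) / (|w|^2 + s)], [w = z - a]: a smoothing of
   the pole [(A - i B) / w] whose d-bar derivative
   [s (A - i B + w (C - i D)) / (|w|^2 + s)^2] agrees to second order at [a]
   with a multiple of [F_x - i F_y] when [A, B, C, D] are the values of
   [F_x, F_y, F_xx, F_xy] at [a]. *)
Definition den (x y : R) : R := sqdist a x y + s.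
Definition sfield1 (x y : R) : 'rV[R]_n :=
  (den x y)^-1 *: ((x - a.1) *: A - (y - a.2) *: B - s *: C).
Definition sfield2 (x y : R) : 'rV[R]_n :=
  (den x y)^-1 *: (s *: D - (x - a.1) *: B - (y - a.2) *: A).

Lemma den_gt0 x y : 0 < den x y.
Proof. by rewrite ltr_wpDl// sqdist_ge0. Qed.

Let den_neq0 x y : den x y != 0. Proof. exact/lt0r_neq0/den_gt0. Qed.

Let jet_den (p : R * R) : jet den p (2 * (p.1 - a.1)) (2 * (p.2 - a.2)).
Proof. by apply: (jet_eq (jetD (jet_sqdist a p) (jet_cst s p))); rewrite addr0. Qed.

Let jet_lin (p : R * R) (u v w : R) :
  jet (fun x y => (x - a.1) * u + (y - a.2) * v + w) p u v.
Proof.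
apply: (jet_eq (jetD (jetD (jetM (jet_dx a p) (jet_cst u p)) (jetM (jet_dy a p) (jet_cst v p))) (jet_cst w p)));
ring.
Qed.

Let jet_frac (p : R * R) (u v w : R) :
  jet (fun x y => (den x y)^-1 * ((x - a.1) * u + (y - a.2) * v + w)) p
   ((den p.1 p.2)^-1 * u - 2 * (p.1 - a.1) * (den p.1 p.2) ^- 2 * ((p.1 - a.1) * u + (p.2 - a.2) * v + w))
   ((den p.1 p.2)^-1 * v - 2 * (p.2 - a.2) * (den p.1 p.2) ^- 2 * ((p.1 - a.1) * u + (p.2 - a.2) * v + w)).
Proof.
apply: (jet_eq (jetM (jetV (jet_den p) (den_neq0 _ _)) (jet_lin p u v w)));
move: (den_neq0 p.1 p.2); move: (den _ _) => d d0; field; exact: d0.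
Qed.

Let jet1 (p : R * R) i : jet (fun x y => sfield1 x y 0 i) p
   ((den p.1 p.2)^-1 * A 0 i - 2 * (p.1 - a.1) * (den p.1 p.2) ^- 2 *
     ((p.1 - a.1) * A 0 i + (p.2 - a.2) * (- B 0 i) + (- (s * C 0 i))))
   ((den p.1 p.2)^-1 * (- B 0 i) - 2 * (p.2 - a.2) * (den p.1 p.2) ^- 2 *
     ((p.1 - a.1) * A 0 i + (p.2 - a.2) * (- B 0 i) + (- (s * C 0 i)))).
Proof.
have -> : (fun x y => sfield1 x y 0 i) =
    (fun x y => (den x y)^-1 * ((x - a.1) * A 0 i + (y - a.2) * (- B 0 i) + (- (s * C 0 i)))).
  by apply/funext => x; apply/funext => y; rewrite !mxE mulrN.
exact: jet_frac.
Qed.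

Let jet2 (p : R * R) i : jet (fun x y => sfield2 x y 0 i) p
   ((den p.1 p.2)^-1 * (- B 0 i) - 2 * (p.1 - a.1) * (den p.1 p.2) ^- 2 *
     ((p.1 - a.1) * (- B 0 i) + (p.2 - a.2) * (- A 0 i) + s * D 0 i))
   ((den p.1 p.2)^-1 * (- A 0 i) - 2 * (p.2 - a.2) * (den p.1 p.2) ^- 2 *
     ((p.1 - a.1) * (- B 0 i) + (p.2 - a.2) * (- A 0 i) + s * D 0 i)).
Proof.
have -> : (fun x y => sfield2 x y 0 i) =
    (fun x y => (den x y)^-1 * ((x - a.1) * (- B 0 i) + (y - a.2) * (- A 0 i) + s * D 0 i)).
  apply/funext => x; apply/funext => y; rewrite !mxE; congr (_ * _).
  by rewrite addrC !mulrN; ring.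
exact: jet_frac.
Qed.

Lemma sfield_smooth : smooth_on setT sfield1 /\ smooth_on setT sfield2.
Proof.
have oT : open (setT : set (R * R)) by exact: openT.
have si : smooth_on setT (fun x y => (den x y)^-1).
  apply: (inv_smooth oT); last by move=> p _; exact: den_neq0.
  exact: (add_smooth oT (sqdist_smooth a oT) (cst_smooth s oT)).
have sl (u v w : R) : smooth_on setT (fun x y => (x - a.1) * u + (y - a.2) * v + w).
  apply: (add_smooth oT); last exact: cst_smooth.
  apply: (add_smooth oT); apply: (mul_smooth oT); (try exact: (cst_smooth _ oT)).
    exact: dx_smooth.
  exact: dy_smooth.
split; apply: (smooth_rowI oT) => i.
  apply: (eq_on_smooth oT _ (mul_smooth oT si (sl (A 0 i) (- B 0 i) (- (s * C 0 i))))) => p _.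
  by rewrite !mxE mulrN.
apply: (eq_on_smooth oT _ (mul_smooth oT si (sl (- B 0 i) (- A 0 i) (s * D 0 i)))) => p _.
by rewrite !mxE; congr (_ * _); rewrite !mulrN; ring.
Qed.

(** The first two combinations are the real and imaginary parts of twice the d-bar derivative of
    [sfield1 + i sfield2], the last two those of twice its holomorphic derivative: exactly the
    vectors [P], [Q], [M], [N] of [pair_form]. *)
Lemma sfield_dbar (p : R * R) :
  let X := p.1 - a.1 in let Y := p.2 - a.2 in let d := den p.1 p.2 in
  [/\ pdx sfield1 p.1 p.2 - pdy sfield2 p.1 p.2 = (2 * s * d ^- 2) *: (A + X *: C + Y *: D),
   pdy sfield1 p.1 p.2 + pdx sfield2 p.1 p.2 = (2 * s * d ^- 2) *: (Y *: C - X *: D - B),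
   pdx sfield1 p.1 p.2 + pdy sfield2 p.1 p.2 =
     d ^- 2 *: ((2 * (Y * Y - X * X)) *: A + (4 * (X * Y)) *: B + (2 * s * X) *: C - (2 * s * Y) *: D) &
   pdx sfield2 p.1 p.2 - pdy sfield1 p.1 p.2 =
     d ^- 2 *: ((4 * (X * Y)) *: A - (2 * (Y * Y - X * X)) *: B - (2 * s * X) *: D - (2 * s * Y) *: C)].
Proof.
move=> X Y d.
have [sf1 sf2] := sfield_smooth.
have r1 : regular_at sfield1 p by exact: (smooth_on_regular sf1 I).
have r2 : regular_at sfield2 p by exact: (smooth_on_regular sf2 I).
have e1 i : pdx sfield1 p.1 p.2 0 i = d^-1 * A 0 i - 2 * X * d ^- 2 * (X * A 0 i + Y * (- B 0 i) + (- (s * C 0 i))) /\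
    pdy sfield1 p.1 p.2 0 i = d^-1 * (- B 0 i) - 2 * Y * d ^- 2 * (X * A 0 i + Y * (- B 0 i) + (- (s * C 0 i))).
  have [_ h1 h2] := regular_coord r1 i; have [_ h1' h2'] := jet1 p i.
  by split; [exact: etrans (esym h1) h1'|exact: etrans (esym h2) h2'].
have e2 i : pdx sfield2 p.1 p.2 0 i = d^-1 * (- B 0 i) - 2 * X * d ^- 2 * (X * (- B 0 i) + Y * (- A 0 i) + s * D 0 i) /\
    pdy sfield2 p.1 p.2 0 i = d^-1 * (- A 0 i) - 2 * Y * d ^- 2 * (X * (- B 0 i) + Y * (- A 0 i) + s * D 0 i).
  have [_ h1 h2] := regular_coord r2 i; have [_ h1' h2'] := jet2 p i.
  by split; [exact: etrans (esym h1) h1'|exact: etrans (esym h2) h2'].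
have dE : d = X * X + Y * Y + s by [].
have d0 : d != 0 by exact: den_neq0.
move: (pdx sfield1 _ _) (pdy sfield1 _ _) (pdx sfield2 _ _) (pdy sfield2 _ _) e1 e2.
move=> u1 v1 u2 v2 e1 e2; move: X Y d dE d0 e1 e2 => X Y d dE d0 e1 e2.
split; apply/rowP => i; have [h1 h2] := e1 i; have [h3 h4] := e2 i.
- rewrite !mxE h1 h4; move: (A 0 i) (B 0 i) (C 0 i) (D 0 i) => A' B' C' D'.
  have -> : s = d - X * X - Y * Y by rewrite dE; ring.
  by field.
- rewrite !mxE h2 h3; move: (A 0 i) (B 0 i) (C 0 i) (D 0 i) => A' B' C' D'.
  have -> : s = d - X * X - Y * Y by rewrite dE; ring.
  by field.
- rewrite !mxE h1 h4; move: (A 0 i) (B 0 i) (C 0 i) (D 0 i) => A' B' C' D'.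
  have -> : s = d - X * X - Y * Y by rewrite dE; ring.
  by field.
- rewrite !mxE h2 h3; move: (A 0 i) (B 0 i) (C 0 i) (D 0 i) => A' B' C' D'.
  have -> : s = d - X * X - Y * Y by rewrite dE; ring.
  by field.
Qed.

End TestField.

Section PointwiseBounds.
Variables (R : realType) (n : nat).
Implicit Types (A B C D U V : 'rV[R]_n).

Lemma dot_le2 (I : 'I_n -> R) U V : (forall i, U 0 i ^+ 2 + V 0 i ^+ 2 <= I i) ->
  dot U U + dot V V <= \sum_i I i.
Proof.
by move=> h; rewrite /dot -big_split; apply: ler_sum => i _ /=; rewrite -!expr2.
Qed.

(** The parameter carries the factor [e] of the cutoff as well, so the error is [e] times the uncut
    one plus the gradient of the cutoff times the field. The two sides differ by the complementary
    squares of the parallelogram law. *)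
Lemma cutoff_energy U1 U2 u1 v1 u2 v2 fx fy P Q (e ex ey c : R) :
  P = (ex *: U1 + e *: u1) - (ey *: U2 + e *: v2) ->
  Q = (ey *: U1 + e *: v1) + (ex *: U2 + e *: u2) ->
  dot (P - (e * c) *: fx) (P - (e * c) *: fx) + dot (Q + (e * c) *: fy) (Q + (e * c) *: fy) <=
  2 * e ^+ 2 * (dot (u1 - v2 - c *: fx) (u1 - v2 - c *: fx) + dot (v1 + u2 + c *: fy) (v1 + u2 + c *: fy)) +
  2 * (ex ^+ 2 + ey ^+ 2) * (dot U1 U1 + dot U2 U2).
Proof.
move=> PE QE.
have h : dot (P - (e * c) *: fx) (P - (e * c) *: fx) + dot (Q + (e * c) *: fy) (Q + (e * c) *: fy) <=
  \sum_i (2 * e ^+ 2 * ((u1 - v2 - c *: fx) 0 i ^+ 2 + (v1 + u2 + c *: fy) 0 i ^+ 2) +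
  2 * (ex ^+ 2 + ey ^+ 2) * (U1 0 i ^+ 2 + U2 0 i ^+ 2)).
  apply: dot_le2 => i; rewrite PE QE !mxE -subr_ge0.
  move: (U1 0 i) (U2 0 i) (u1 0 i) (u2 0 i) (v1 0 i) (v2 0 i) (fx 0 i) (fy 0 i) => a b a1 b1 a2 b2 f g.
  rewrite (_ : _ - _ = (e * (a1 - b2 - c * f) - (ex * a - ey * b)) ^+ 2 +
     (e * (a2 + b1 + c * g) - (ey * a + ex * b)) ^+ 2); last by ring.
  by rewrite addr_ge0 ?sqr_ge0.
apply: (le_trans h); rewrite big_split/= -!mulr_sumr !big_split/= /dot.
by rewrite lerD// ler_wpM2l ?mulr_ge0 ?addr_ge0 ?sqr_ge0// lerD//; apply: ler_sum => i _; rewrite expr2.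
Qed.

Let sq3 (x y z : R) : (x + y + z) ^+ 2 <= 3 * (x ^+ 2 + y ^+ 2 + z ^+ 2).
Proof.
rewrite -subr_ge0 (_ : _ - _ = (x - y) ^+ 2 + (x - z) ^+ 2 + (y - z) ^+ 2); last by ring.
by rewrite !addr_ge0 ?sqr_ge0.
Qed.

Definition mass A B C D := dot A A + dot B B + dot C C + dot D D.

Lemma mass_ge0 A B C D : 0 <= mass A B C D.
Proof. by rewrite /mass !addr_ge0 ?dot_ge0. Qed.

Let massE A B C D (c : R) :
  \sum_i c * (A 0 i ^+ 2 + B 0 i ^+ 2 + C 0 i ^+ 2 + D 0 i ^+ 2) = c * mass A B C D.
Proof.
rewrite -mulr_sumr !big_split /mass /dot; congr (c * _).
Qed.

(** The squared field is O(1 / d): bounded away from the pole, which the logarithmic cutoffs need,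
    and decaying at infinity, which the quadratic one needs. *)
Lemma field_bound A B C D (X Y s d : R) : d = X * X + Y * Y + s -> 0 < s <= 1 ->
  dot (d^-1 *: (X *: A - Y *: B - s *: C)) (d^-1 *: (X *: A - Y *: B - s *: C)) +
  dot (d^-1 *: (s *: D - X *: B - Y *: A)) (d^-1 *: (s *: D - X *: B - Y *: A)) <=
  3 / d * mass A B C D.
Proof.
move=> dE /andP[s0 s1].
have s1' : 0 <= 1 - s by rewrite subr_ge0.
have X2 : 0 <= X * X by rewrite -expr2 sqr_ge0.
have Y2 : 0 <= Y * Y by rewrite -expr2 sqr_ge0.
have d0 : 0 < d by rewrite dE; lra.
rewrite -massE; apply: dot_le2 => i; rewrite !mxE.
move: (A 0 i) (B 0 i) (C 0 i) (D 0 i) => a b c e.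
rewrite !exprMn -mulrDr.
have -> : 3 / d * (a ^+ 2 + b ^+ 2 + c ^+ 2 + e ^+ 2) = d^-1 ^+ 2 * (3 * ((a ^+ 2 + b ^+ 2 + c ^+ 2 + e ^+ 2) * d)).
  by field; exact: lt0r_neq0.
rewrite ler_wpM2l ?sqr_ge0//.
have h1 := sq3 (X * a) (- (Y * b)) (- (s * c)).
have h2 := sq3 (s * e) (- (X * b)) (- (Y * a)).
apply: (le_trans (lerD h1 h2)); rewrite -mulrDr ler_pM2l// -subr_ge0.
have -> : (a ^+ 2 + b ^+ 2 + c ^+ 2 + e ^+ 2) * d -
  ((X * a) ^+ 2 + (- (Y * b)) ^+ 2 + (- (s * c)) ^+ 2 + ((s * e) ^+ 2 + (- (X * b)) ^+ 2 + (- (Y * a)) ^+ 2)) =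
  s * (a ^+ 2 + b ^+ 2) + (X * X + Y * Y) * (c ^+ 2 + e ^+ 2) + s * (1 - s) * (c ^+ 2 + e ^+ 2).
  by rewrite dE; ring.
have [a2 [b2 [c2 e2]]] : 0 <= a ^+ 2 /\ 0 <= b ^+ 2 /\ 0 <= c ^+ 2 /\ 0 <= e ^+ 2 by rewrite !sqr_ge0.
have := mulr_ge0 (ltW s0) (addr_ge0 a2 b2); have := mulr_ge0 (addr_ge0 X2 Y2) (addr_ge0 c2 e2).
by have := mulr_ge0 (mulr_ge0 (ltW s0) s1') (addr_ge0 c2 e2); lra.
Qed.

(** For use away from the pole, where [h] is 0 and the d-bar derivative is small by itself. *)
Lemma dbar_bound A B C D (X Y c0 : R) :
  dot (c0 *: (A + X *: C + Y *: D)) (c0 *: (A + X *: C + Y *: D)) +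
  dot (c0 *: (Y *: C - X *: D - B)) (c0 *: (Y *: C - X *: D - B)) <=
  3 * c0 ^+ 2 * (1 + (X * X + Y * Y)) * mass A B C D.
Proof.
rewrite -massE; apply: dot_le2 => i; rewrite !mxE.
move: (A 0 i) (B 0 i) (C 0 i) (D 0 i) => a b c e.
have h1 := sq3 a (X * c) (Y * e); have h2 := sq3 (Y * c) (- (X * e)) (- b).
rewrite !exprMn -mulrDr.
have -> : 3 * c0 ^+ 2 * (1 + (X * X + Y * Y)) * (a ^+ 2 + b ^+ 2 + c ^+ 2 + e ^+ 2) =
  c0 ^+ 2 * (3 * ((1 + (X * X + Y * Y)) * (a ^+ 2 + b ^+ 2 + c ^+ 2 + e ^+ 2))) by ring.
rewrite ler_wpM2l ?sqr_ge0//.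
apply: (le_trans (lerD h1 h2)); rewrite -mulrDr ler_pM2l// -subr_ge0.
rewrite (_ : _ - _ = (X * X + Y * Y) * (a ^+ 2 + b ^+ 2) + (c ^+ 2 + e ^+ 2)); last by ring.
have X2 : 0 <= X * X by rewrite -expr2 sqr_ge0.
have Y2 : 0 <= Y * Y by rewrite -expr2 sqr_ge0.
by have := mulr_ge0 (addr_ge0 X2 Y2) (addr_ge0 (sqr_ge0 a) (sqr_ge0 b)); have := addr_ge0 (sqr_ge0 c) (sqr_ge0 e); lra.
Qed.

End PointwiseBounds.

(** * Cutoffs and domains *)

Section LogCutoff.
Variable R : realType.
Local Notation mu2 := ((@lebesgue_measure R) \x (@lebesgue_measure R))%E.
Local Notation RR := (measurableTypeR R * measurableTypeR R)%type.
Implicit Types (p z : R * R) (L : R).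

(** The unsimplified left-hand side is what the jet rules produce for [logcut]. The squared gradient
    of [ln (1 + 1 / q)] is [4 / (q (q + 1)^2)]. *)
Lemma log_gradient (L l q X Y : R) : 0 < q -> q = X ^+ 2 + Y ^+ 2 ->
  (0 - (L^-1 * ((1 + q^-1)^-1 * (0 + - q ^- 2 * (2 * X))) + l * 0)) ^+ 2 +
  (0 - (L^-1 * ((1 + q^-1)^-1 * (0 + - q ^- 2 * (2 * Y))) + l * 0)) ^+ 2 <= 4 * L ^- 2 / q.
Proof.
move=> q0 qE.
rewrite [X in _ <= X](_ : _ = L ^- 2 * (4 / q)); last by rewrite mulrA (mulrC 4).
have -> : (0 - (L^-1 * ((1 + q^-1)^-1 * (0 + - q ^- 2 * (2 * X))) + l * 0)) ^+ 2 +
  (0 - (L^-1 * ((1 + q^-1)^-1 * (0 + - q ^- 2 * (2 * Y))) + l * 0)) ^+ 2 =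
  L ^- 2 * ((1 + q^-1) ^- 2 * (4 * q ^- 4) * (X ^+ 2 + Y ^+ 2)).
  by rewrite -!exprVn; ring.
rewrite -qE ler_wpM2l//; first by rewrite -exprVn sqr_ge0.
have -> : (1 + q^-1) ^- 2 * (4 * q ^- 4) * q = (4 / q) * ((q + 1) ^- 2).
  by field; rewrite !lt0r_neq0// addr_gt0.
rewrite ler_piMr//; first by rewrite divr_ge0// ltW.
by rewrite invf_le1 ?exprn_gt0 ?addr_gt0// exprn_ege1// lerDr ltW.
Qed.

(* The logarithmic cutoff of a point: with [L = ln (1 + 4 ^+ N)] it vanishes on
   the circle of radius [2 ^- N] and has energy [O(1 / N)] outside of it. *)
Definition logcut L p (x y : R) : R := 1 - L^-1 * ln (1 + (sqdist p x y)^-1).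

Lemma logcut_jet L p z : z != p -> exists u v,
  jet (logcut L p) z u v /\ u ^+ 2 + v ^+ 2 <= 4 * L ^- 2 / sqdist p z.1 z.2.
Proof.
move=> zp; have q0 := sqdist_gt0 zp.
have jq := jet_sqdist p z.
have jl := jet_ln (jetD (jet_cst 1 z) (jetV jq (lt0r_neq0 q0)))
  (addr_gt0 ltr01 (eq_ind_r is_true q0 (invr_gt0 _))).
have j := jetB (jet_cst 1 z) (jetM (jet_cst L^-1 z) jl).
eexists; eexists; split; first exact: j.
have qE : sqdist p z.1 z.2 = (z.1 - p.1) ^+ 2 + (z.2 - p.2) ^+ 2 by rewrite /sqdist -!expr2.
exact: log_gradient q0 qE.
Qed.

Lemma logcut_smooth (U : set (R * R)) L p : open U -> (forall z, U z -> z != p) -> smooth_on U (logcut L p).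
Proof.
move=> oU Up.
have q0 z : U z -> 0 < sqdist p z.1 z.2 by move=> /Up; exact: sqdist_gt0.
have sv := inv_smooth oU (sqdist_smooth p oU) (fun z Uz => lt0r_neq0 (q0 z Uz)).
apply: (sub_smooth oU (cst_smooth 1 oU)); apply: (mul_smooth oU (cst_smooth _ oU)).
apply: (ln_smooth oU (add_smooth oU (cst_smooth 1 oU) sv)) => z Uz.
by rewrite addr_gt0// invr_gt0; exact: q0.
Qed.

(** [d] is the squared radius of the circle on which the cutoff vanishes. The second bound is
    [ln (1 + x) <= x]: away from [p] the cutoff differs from 1 by O(1 / L). *)
Lemma logcut_range (d : R) p z : 0 < d -> d <= sqdist p z.1 z.2 ->
  0 <= logcut (ln (1 + d^-1)) p z.1 z.2 <= 1 /\
  1 - logcut (ln (1 + d^-1)) p z.1 z.2 <= (ln (1 + d^-1))^-1 / sqdist p z.1 z.2.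
Proof.
move=> d0 dq; have q0 := lt_le_trans d0 dq.
have L0 : 0 < ln (1 + d^-1) by rewrite ln_gt0// ltrDl invr_gt0.
have l0 : 0 <= ln (1 + (sqdist p z.1 z.2)^-1) by rewrite ln_ge0// lerDl invr_ge0 ltW.
have lL : ln (1 + (sqdist p z.1 z.2)^-1) <= ln (1 + d^-1).
  by rewrite ler_ln ?posrE ?addr_gt0 ?invr_gt0// lerD2l lef_pV2.
split; last first.
  rewrite /logcut opprB addrC subrK ler_pM2l ?invr_gt0//.
  by apply: le_ln1Dx; rewrite (lt_trans (ltrN10 R))// invr_gt0.
rewrite /logcut; apply/andP; split.
  by rewrite subr_ge0 mulrC ler_pdivrMr// mul1r.
by rewrite gerBl mulr_ge0// invr_ge0 ltW.
Qed.

Lemma logcut0 (d : R) p z : 0 < d -> sqdist p z.1 z.2 = d -> logcut (ln (1 + d^-1)) p z.1 z.2 = 0.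
Proof.
move=> d0 dE; rewrite /logcut dE mulVf ?subrr//; apply: lt0r_neq0.
by rewrite ln_gt0// ltrDl invr_gt0.
Qed.

Lemma mul_cutoff (f g u v u' v' : R) : 0 <= f <= 1 -> 0 <= g <= 1 ->
  (f * u' + g * u) ^+ 2 + (f * v' + g * v) ^+ 2 <= 2 * (u' ^+ 2 + v' ^+ 2) + 2 * (u ^+ 2 + v ^+ 2).
Proof.
move=> /andP[f0 f1] /andP[g0 g1].
have h (x y : R) : (f * x + g * y) ^+ 2 <= 2 * x ^+ 2 + 2 * y ^+ 2.
  have k (e t : R) : 0 <= e -> e <= 1 -> (e * t) ^+ 2 <= t ^+ 2.
    by move=> e0 e1; rewrite exprMn ler_piMl ?sqr_ge0// exprn_ile1.
  apply: (@le_trans _ _ (2 * (f * x) ^+ 2 + 2 * (g * y) ^+ 2)).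
    by rewrite -subr_ge0 (_ : _ - _ = (f * x - g * y) ^+ 2) ?sqr_ge0//; ring.
  by rewrite lerD// ler_wpM2l// k.
by have := h u' u; have := h v' v; lra.
Qed.

(** Each factor doubles the bound on the squared gradient. The resulting power of 2 is harmless,
    since the number of punctures is fixed before the inner radius is chosen. *)
Lemma prod_cutoff (I : eqType) (r : seq I) (f : I -> R -> R -> R) z (g : I -> R) :
  (forall i, i \in r -> exists u v, jet (f i) z u v /\ u ^+ 2 + v ^+ 2 <= g i) ->
  (forall i, i \in r -> 0 <= f i z.1 z.2 <= 1) ->
  [/\ 0 <= \prod_(i <- r) f i z.1 z.2 <= 1,
   1 - \prod_(i <- r) f i z.1 z.2 <= \sum_(i <- r) (1 - f i z.1 z.2) &
   exists u v, jet (fun x y => \prod_(i <- r) f i x y) z u v /\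
     u ^+ 2 + v ^+ 2 <= 2 ^+ size r * \sum_(i <- r) g i].
Proof.
elim: r => [|i r ih] hj h01.
  rewrite !big_nil mulr0 subrr ler01 lexx; split=> //.
  exists 0, 0; split; last by rewrite expr0n addr0.
  rewrite (_ : (fun _ _ => _) = (fun _ _ => 1)); first exact: jet_cst.
  by apply/funext => x; apply/funext => y; rewrite big_nil.
have [] := ih (fun j jr => hj j (mem_behead (s := i :: r) jr)) (fun j jr => h01 j (mem_behead (s := i :: r) jr)).
move=> p01 pb [u [v [j uv]]].
have [u' [v' [j' uv']]] := hj i (mem_head _ _); have f01 := h01 i (mem_head _ _).
have [/andP[p0 p1] /andP[f0 f1]] := (p01, f01).
split.
- by rewrite !big_cons mulr_ge0// mulr_ile1.
- rewrite !big_cons.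
  apply: (@le_trans _ _ ((1 - f i z.1 z.2) + (1 - \prod_(i <- r) f i z.1 z.2))); last by rewrite lerD2l.
  rewrite -subr_ge0 (_ : _ - _ = (1 - f i z.1 z.2) * (1 - \prod_(i <- r) f i z.1 z.2)); last by ring.
  by rewrite mulr_ge0// subr_ge0.
- eexists; eexists; split.
    rewrite (_ : (fun _ _ => _) = (fun x y => f i x y * \prod_(i <- r) f i x y)); first exact: jetM j' j.
    by apply/funext => x; apply/funext => y; rewrite big_cons.
  apply: (le_trans (mul_cutoff _ _ _ _ f01 p01)).
  rewrite /= big_cons addrC [X in _ <= X]mulrDr (exprS 2 (size r)); apply: lerD; last by rewrite -mulrA ler_pM2l.
  have g0 : 0 <= g i by rewrite (le_trans _ uv')// addr_ge0 ?sqr_ge0.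
  rewrite -mulrA ler_pM2l// (le_trans uv')// ler_peMl// exprn_ege1//.
  by rewrite ler1n.
Qed.

Let sc (i : nat) : R := (2 ^+ i)^-1.

(** In the annulus between the scales [2^-(i+1)] and [2^-i] the inverse square is at most [4^(i+1)],
    and the annulus lies in the square of half-side [2^-i]. *)
Lemma dyadic_bound (p z : R * R) N : (4 ^+ N)^-1 <= sqdist p z.1 z.2 ->
  (sqdist p z.1 z.2)^-1 <= 1 + \sum_(i < N) 4 ^+ i.+1 * \1_(square p (sc i)) z.
Proof.
elim: N => [|N ih].
  by rewrite expr0 invr1 big_ord0 addr0 => h; rewrite invf_le1// (lt_le_trans _ h).
rewrite big_ord_recr/= addrA => h; have q0 : 0 < sqdist p z.1 z.2 by rewrite (lt_le_trans _ h)// invr_gt0 exprn_gt0.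
have [h'|h'] := leP (4 ^+ N)^-1 (sqdist p z.1 z.2).
  by rewrite (le_trans (ih h'))// lerDl mulr_ge0// exprn_ge0.
have zs : square p (sc N) z.
  have e : (4 ^+ N)^-1 = sc N ^+ 2 :> R.
    by rewrite /sc exprVn -exprM mulnC exprM; congr ((_ ^+ _)^-1); ring.
  have sc0 : 0 < sc N by rewrite invr_gt0 exprn_gt0.
  move: h'; rewrite e /sqdist -!expr2 => h'; split; rewrite -(ltr_pXn2r (n := 2))// ?nnegrE ?ltW// real_normK ?num_real//;
    by apply: le_lt_trans h'; rewrite ?lerDl ?lerDr sqr_ge0.
rewrite indicE mem_set// mulr1 ler_wpDl//; last by rewrite -[X in _ <= X]invrK lef_pV2// posrE invr_gt0 exprn_gt0.
by rewrite addr_ge0// sumr_ge0// => i _; rewrite mulr_ge0// exprn_ge0.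
Qed.

Lemma mu2_square (p : R * R) (r : R) : 0 < r -> mu2 (square p r : set RR) = (4 * r ^+ 2)%:E.
Proof.
move=> r0; rewrite squareE mu2_box/=; [|lra|lra].
by congr (_%:E); ring.
Qed.

Lemma square_measurable (p : R * R) (r : R) : measurable (square p r : set RR).
Proof. by rewrite squareE; exact: box_measurable. Qed.

Lemma inv_sqdist_bmf (D : set (R * R)) p : compact D -> ~ D p -> bmf D (fun z => (sqdist p z.1 z.2)^-1).
Proof.
move=> cD Dp; have oU : open (~` [set p]) by apply: closed_openC; apply: compact_closed => //; exact: compact_set1.
have DU : D `<=` ~` [set p] by move=> z Dz zp; apply: Dp; rewrite -zp.
have h := inv_smooth oU (sqdist_smooth p oU) (fun z Uz => lt0r_neq0 (sqdist_gt0 (introN eqP Uz))).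
exact: (smooth_bmf oU cD DU h).
Qed.

(** Every dyadic scale contributes [4^(i+1) * 4 * 4^-i = 16], so the integral grows linearly in [N].
    The factor [L^-2] of the squared gradient is O(N^-2), whence an energy of O(1 / N). *)
Lemma inv_sqdist_integ (D : set (R * R)) p N : compact D ->
  (forall z, D z -> (4 ^+ N)^-1 <= sqdist p z.1 z.2) ->
  integ D (fun z => (sqdist p z.1 z.2)^-1) <= area_of D + 16 * N%:R.
Proof.
move=> cD hD; have [mD fD] := (compact_measurable2 cD, compact_mu2_finite cD).
have Dp : ~ D p.
  by move=> /hD; rewrite /sqdist !subrr mulr0 addr0 leNgt invr_gt0 exprn_gt0.
have bi i : bmf D (fun z => 4 ^+ i.+1 * \1_(square p (sc i)) z).
  exact: (bmfM (bmf_cst _ _) (bmf_indic _ (square_measurable _ _))).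
have bs := bmf_sum (index_enum 'I_N) (fun i => bi i).
apply: (@le_trans _ _ (integ D (fun z => 1 + \sum_(i < N) 4 ^+ i.+1 * \1_(square p (sc i)) z))).
  apply: (le_integ mD fD (inv_sqdist_bmf cD Dp) (bmfD (bmf_cst D 1) bs)) => z Dz.
  by apply: dyadic_bound; exact: hD.
rewrite (integD mD fD (bmf_cst D 1) bs) (integ_cst mD) mul1r lerD2l.
rewrite (integ_sum mD fD) => [|i]; last exact: bi.
have -> : 16 * N%:R = \sum_(i < N) (16 : R) by rewrite sumr_const card_ord mulr_natr.
apply: ler_sum => i _; rewrite (integZ mD fD); last exact: bmf_indic (square_measurable _ _).
have s0 : 0 < sc i by rewrite invr_gt0 exprn_gt0.
have sm := square_measurable p (sc i).
have fs : (mu2 (square p (sc i) : set RR) < +oo)%E by rewrite mu2_square// ltry.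
have h := integ_indic mD sm fs.
apply: (le_trans (ler_wpM2l (exprn_ge0 i.+1 (ler0n R 4)) h)).
rewrite mu2_square//= /sc exprVn -exprM mulnC exprM.
have -> : 2 ^+ 2 = 4 :> R by ring.
by rewrite exprS mulrACA mulfV ?expf_neq0// mulr1 -natrM.
Qed.

End LogCutoff.

Section Domain.
Variable R : realType.
Local Notation mu2 := ((@lebesgue_measure R) \x (@lebesgue_measure R))%E.
Local Notation RR := (measurableTypeR R * measurableTypeR R)%type.
Implicit Types (p z : R * R).

Lemma discrete_compact_finite (P D : set (R * R)) : discrete_in_plane P -> compact D ->
  exists2 ps : seq (R * R), uniq ps & forall z, z \in ps <-> P z /\ D z.
Proof.
move=> dP /compact_near_coveringP cD.
(* Finite lists directed by inclusion: a property holds near [G] if it holds for all lists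
   containing some given one. Compactness in its near-covering form then provides one list for the
   whole of [D]. *)
pose G : set_system (seq (R * R)) := 
  [set A | exists s : seq (R * R), forall t : seq (R * R), {subset s <= t} -> A t].
have fG : Filter G.
  split; first by exists [::].
  - move=> A B [s As] [t Bt]; exists (s ++ t) => u stu.
    by split; [apply: As|apply: Bt] => x xs; apply: stu; rewrite mem_cat xs ?orbT.
  - by move=> A B AB [s As]; exists s => t /As/AB.
have [s hs] : \forall s \near G, D `<=` [set z | P z -> z \in s].
  apply: cD => z Dz.
  exists ([set w | w != z -> ~ P w], [set s : seq (R * R) | (z : R * R) \in s]).
    split; first exact: (dP z).
    by exists [:: z] => t; apply; exact: mem_head.
  move=> [w s] /= [wz zs] Pw; have [->//|/wz] := eqVneq w z; by move/(_ Pw).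
exists (undup [seq z <- s | `[< P z /\ D z >]]); first exact: undup_uniq.
move=> z; rewrite mem_undup mem_filter; split=> [/andP[/asboolP]//|h].
by apply/andP; split; [exact/asboolP|exact: hs h.2 h.1].
Qed.

Lemma finite_threshold (I : eqType) (r : seq I) (Q : I -> R -> Prop) :
  (forall i, i \in r -> exists2 d, 0 < d & forall e, 0 < e <= d -> Q i e) ->
  exists2 d, 0 < d & forall e, 0 < e <= d -> forall i, i \in r -> Q i e.
Proof.
elim: r => [|i r ih] h; first by exists 1.
have [d d0 hd] := ih (fun j jr => h j (mem_behead (s := i :: r) jr)).
have [d' d'0 hd'] := h i (mem_head _ _).
exists (Num.min d d'); first by rewrite lt_min d0.
move=> e /andP[e0]; rewrite le_min => /andP[ed ed'] j; rewrite inE => /predU1P[->|jr].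
  by apply: hd'; rewrite e0.
by apply: hd => //; rewrite e0.
Qed.

Lemma separated_discs (p p' : R * R) : p != p' ->
  exists2 d, 0 < d & forall e, 0 < e <= d -> forall z, sqdist p z.1 z.2 <= e -> e < sqdist p' z.1 z.2.
Proof.
(* A common point would give a squared distance of at most [2 e + 2 e], against [e] being at most an
   eighth of it. *)
move=> pp; have q0 := sqdist_gt0 pp; exists (sqdist p' p.1 p.2 / 8); first by rewrite divr_gt0.
move=> e /andP[e0 ed] z ze; rewrite ltNge; apply/negP => z'e.
move: ze z'e ed q0; rewrite /sqdist.
move: p.1 p.2 p'.1 p'.2 z.1 z.2 => a b c d x y.
have := sqr_ge0 (x - a + (x - c)); have := sqr_ge0 (y - b + (y - d)); nra.
Qed.

Lemma inner_disc (a p : R * R) (c : R) : sqdist a p.1 p.2 < c ->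
  exists2 d, 0 < d & forall e, 0 < e <= d -> forall z, c <= sqdist a z.1 z.2 -> e < sqdist p z.1 z.2.
Proof.
move=> pc; have sq := smooth_on_regular (sqdist_smooth a openT) (I : setT p).
have : \forall z \near p, sqdist a z.1 z.2 < c by exact: (cvgr_lt _ sq.1 _ pc).
move=> /nbhs_pairP[e e0 he]; exists (e ^+ 2 / 2); first by rewrite divr_gt0 ?exprn_gt0.
move=> d /andP[d0 de] z cz; rewrite ltNge; apply/negP => zd.
have de2 : d < e ^+ 2 by rewrite (le_lt_trans de)// ltr_pdivrMr// ltr_pMr ?exprn_gt0// ltr1n.
suff : sqdist a z.1 z.2 < c by rewrite ltNge cz.
apply: he; rewrite -(ltr_pXn2r (n := 2))// ?nnegrE ?ltW// real_normK ?num_real//;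
  apply: le_lt_trans de2; apply: le_trans zd; by rewrite /sqdist -!expr2 ?lerDl ?lerDr sqr_ge0.
Qed.

Definition circ (c : (R * R) * R) (x y : R) : R := sqdist c.1 x y - c.2.

Lemma circ_smooth (U : set (R * R)) c : open U -> smooth_on U (circ c).
Proof. by move=> oU; exact: (sub_smooth oU (sqdist_smooth c.1 oU) (cst_smooth c.2 oU)). Qed.

Lemma circ_jet c z : jet (circ c) z (2 * (z.1 - c.1.1)) (2 * (z.2 - c.1.2)).
Proof. by apply: (jet_eq (jetB (jet_sqdist c.1 z) (jet_cst c.2 z))); rewrite subr0. Qed.

(** At a zero only one circle function vanishes, so the gradient of the product is that of this
    circle times a nonzero number; the gradient of a circle function vanishes only at the center. *)
Lemma prod_circ_regular (cs : seq ((R * R) * R)) z : uniq cs ->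
  (forall c, c \in cs -> 0 < c.2) ->
  (forall c c', c \in cs -> c' \in cs -> c' != c -> circ c z.1 z.2 = 0 -> circ c' z.1 z.2 != 0) ->
  \prod_(c <- cs) circ c z.1 z.2 = 0 ->
  pdx (fun x y => \prod_(c <- cs) circ c x y) z.1 z.2 <> 0 \/
  pdy (fun x y => \prod_(c <- cs) circ c x y) z.1 z.2 <> 0.
Proof.
move=> ucs c0 sep /eqP; rewrite prodf_seq_eq0 => /hasP[c ccs /eqP/= cz].
pose rest x y := \prod_(d <- cs | d != c) circ d x y.
have restE x y : rest x y = \prod_(d <- [seq d <- cs | d != c]) circ d x y by rewrite big_filter.
have sr : smooth_on setT rest.
  have -> : rest = (fun x y => \prod_(d <- [seq d <- cs | d != c]) circ d x y).
    by apply/funext => x; apply/funext => y.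
  by apply: (prod_smooth _ openT) => d; exact: circ_smooth openT.
have -> : (fun x y => \prod_(c <- cs) circ c x y) = (fun x y => circ c x y * rest x y).
  by apply/funext => x; apply/funext => y; rewrite (bigD1_seq c).
have r0 : rest z.1 z.2 != 0.
  rewrite /rest prodf_seq_neq0; apply/allP => d dcs; apply/implyP => dc; exact: sep cz.
have [_ -> ->] := jetM (circ_jet c z) (jet_smooth sr (I : setT z)).
rewrite cz; have alg (u v : R) : 0 * u + rest z.1 z.2 * (2 * v) = 0 -> v = 0.
  rewrite mul0r add0r => /eqP; rewrite !mulf_eq0 (negPf r0)/= pnatr_eq0/=.
  by move=> /eqP.
have [X0|X0] := eqVneq (z.1 - c.1.1) 0; last by left => /alg; exact/eqP.
right => /alg Y0; move: cz (c0 c ccs); rewrite /circ /sqdist X0 Y0 mulr0 addr0 sub0r.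
by move=> /eqP; rewrite oppr_eq0 => /eqP ->; rewrite ltxx.
Qed.

Lemma sqdist_closed (a : R * R) (c : R) :
  closed [set z | sqdist a z.1 z.2 <= c] /\ closed [set z | c <= sqdist a z.1 z.2].
Proof.
have cont : continuous (fun z : R * R => sqdist a z.1 z.2).
  by move=> z; exact: (smooth_on_regular (sqdist_smooth a openT) (I : setT z)).1.
by split; [exact: (preimage_closed (fun z _ => cont z) (@closed_le R c))|
  exact: (preimage_closed (fun z _ => cont z) (@closed_ge R c))].
Qed.

Lemma sqdist_lt_square (a z : R * R) (r : R) : 0 < r -> sqdist a z.1 z.2 < r ^+ 2 -> square a r z.
Proof.
move=> r0 h; split; rewrite -(ltr_pXn2r (n := 2))// ?nnegrE ?ltW// real_normK ?num_real//;
  apply: le_lt_trans h; by rewrite /sqdist -!expr2 ?lerDl ?lerDr sqr_ge0.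
Qed.

Lemma disc_compact (a : R * R) (r : R) : 0 < r -> compact [set z | sqdist a z.1 z.2 <= r ^+ 2].
Proof.
move=> r0; pose s := r * 2.
have cK : compact (`[a.1 - s, a.1 + s] `*` `[a.2 - s, a.2 + s]).
  by apply: compact_setX; exact: segment_compact.
apply: (subclosed_compact (sqdist_closed a _).1 cK) => z /= h.
have : square a s z.
  apply: sqdist_lt_square; first by rewrite mulr_gt0.
  by rewrite (le_lt_trans h)// /s exprMn ltr_pMr ?exprn_gt0// exprn_egt1// ltr1n.
move=> []; rewrite !ltr_norml => /andP[? ?] /andP[? ?].
by split; rewrite /= in_itv/=; apply/andP; split; lra.
Qed.

Variables (P : set (R * R)) (a : R * R) (r : R) (ps : seq (R * R)) (d : R).
Hypotheses (dP : discrete_in_plane P) (r0 : 0 < r) (d0 : 0 < d) (dr : d < r ^+ 2) (ups : uniq ps).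
Hypothesis psP : forall z, P z -> sqdist a z.1 z.2 <= r ^+ 2 -> z \in ps.
Hypothesis ps_in : forall p, p \in ps -> forall z, r ^+ 2 <= sqdist a z.1 z.2 -> d < sqdist p z.1 z.2.
Hypothesis ps_sep : forall p p', p \in ps -> p' \in ps -> p != p' ->
  forall z, sqdist p z.1 z.2 <= d -> d < sqdist p' z.1 z.2.

Let cs := (a, r ^+ 2) :: [seq (p, d) | p <- ps].
Let rho x y := \prod_(c <- cs) circ c x y.
Let Om := [set z | (~` P) z /\ rho z.1 z.2 <= 0].

Let rhoE x y : rho x y = (sqdist a x y - r ^+ 2) * \prod_(p <- ps) (sqdist p x y - d).
Proof. by rewrite /rho /cs big_cons big_map. Qed.

(** The circles are disjoint and the small ones lie inside the large one. Outside the large disc all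
    factors are positive, and inside a small one exactly two are negative, so [rho <= 0] describes
    the disc with the small open discs removed. *)
Lemma punctured_disc_domain :
  smooth_domain_in (~` P) Om rho /\
  (forall z, Om z <-> sqdist a z.1 z.2 <= r ^+ 2 /\ forall p, p \in ps -> d <= sqdist p z.1 z.2) /\
  (forall z, Om z -> rho z.1 z.2 = 0 -> sqdist a z.1 z.2 = r ^+ 2 \/ exists2 p, p \in ps & sqdist p z.1 z.2 = d).
Proof.
have oS := open_setC_discrete dP.
have prod_gt z : (forall p, p \in ps -> d < sqdist p z.1 z.2) -> 0 < \prod_(p <- ps) (sqdist p z.1 z.2 - d).
  by move=> h; rewrite big_seq_cond prodr_gt0// => p /andP[pps _]; rewrite subr_gt0 h.
have OmE z : Om z <-> sqdist a z.1 z.2 <= r ^+ 2 /\ forall p, p \in ps -> d <= sqdist p z.1 z.2.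
  split=> [[Sz] |[za zp]].
    rewrite /= rhoE => le0.
    have za : sqdist a z.1 z.2 <= r ^+ 2.
      rewrite leNgt; apply/negP => gt0; move: le0; rewrite leNgt => /negP; apply.
      by rewrite mulr_gt0 ?subr_gt0// prod_gt// => p pps; apply: ps_in => //; exact: ltW.
    split=> // p pps; rewrite leNgt; apply/negP => pd; move: le0; rewrite leNgt => /negP; apply.
    have za' : sqdist a z.1 z.2 < r ^+ 2.
      by rewrite ltNge; apply/negP => /(ps_in pps); rewrite ltNge ltW.
    rewrite nmulr_rgt0 ?subr_lt0// (bigD1_seq p)//= nmulr_rlt0 ?subr_lt0//.
    rewrite big_seq_cond prodr_gt0// => p' /andP[pps' pp]; rewrite subr_gt0.
    by apply: (ps_sep pps pps') (ltW pd); rewrite eq_sym.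
  split; first by move=> Pz; have := zp z (psP Pz za); rewrite /sqdist !subrr mulr0 addr0 leNgt d0.
  rewrite /= rhoE mulr_le0_ge0 ?subr_le0// big_seq_cond prodr_ge0// => p /andP[pps _]; rewrite subr_ge0; exact: zp.
split; last split=> //.
  split; first last.
    split; first by move=> z [].
    split; first by apply: (prod_smooth _ oS) => c; exact: circ_smooth oS.
    split=> // z Sz; apply: prod_circ_regular.
    - rewrite /cs/= map_inj_uniq ?ups ?andbT; last by move=> p p' [].
      by apply/negP => /mapP[p _ [_ e]]; move: dr; rewrite e ltxx.
    - by move=> c; rewrite inE => /predU1P[->/=|/mapP[p _ ->]]//; rewrite exprn_gt0.
    - move=> c c'; rewrite !inE => /predU1P[->/=|/mapP[p pps ->]] /predU1P[->/=|/mapP[p' pps' ->]].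
      + by rewrite eqxx.
      + by move=> _; rewrite /circ/= => /eqP; rewrite subr_eq0 => /eqP e; rewrite subr_eq0 gt_eqF// ps_in// e.
      + move=> _; rewrite /circ/= => /eqP; rewrite subr_eq0 => /eqP e; rewrite subr_eq0 lt_eqF//.
        by rewrite ltNge; apply/negP => /(ps_in pps); rewrite e ltxx.
      + move=> pp; rewrite /circ/= => /eqP; rewrite subr_eq0 => /eqP e; rewrite subr_eq0 gt_eqF//.
        apply: (ps_sep pps pps'); last by rewrite e.
        by apply: contra_neq pp => ->.
  have -> : Om = [set z | sqdist a z.1 z.2 <= r ^+ 2] `&`
      \bigcap_(p in [set` ps]) [set z | d <= sqdist p z.1 z.2].
    by apply/seteqP; split=> z /OmE.
  apply: (subclosed_compact _ (disc_compact (a := a) r0)); last by move=> z [].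
  apply: closedI; first exact: (sqdist_closed a _).1.
  by apply: closed_bigI => p _; exact: (sqdist_closed p d).2.
move=> z Oz; rewrite rhoE => /eqP; rewrite mulf_eq0 => /orP[|].
  by rewrite subr_eq0 => /eqP; left.
rewrite prodf_seq_eq0 => /hasP[p pps]; rewrite /= subr_eq0 => /eqP; right; by exists p.
Qed.

End Domain.

(** * The cutoff function of a punctured disc *)

Section DiscCutoff.
Variable R : realType.
Local Notation mu2 := ((@lebesgue_measure R) \x (@lebesgue_measure R))%E.
Local Notation RR := (measurableTypeR R * measurableTypeR R)%type.

Lemma area_of_disc (D : set (R * R)) (a : R * R) (r : R) : 0 < r -> measurable (D : set RR) ->
  (forall z, D z -> sqdist a z.1 z.2 <= r ^+ 2) -> area_of D <= 16 * r ^+ 2.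
Proof.
move=> r0 mD hD; have r2 : 0 < r * 2 by rewrite mulr_gt0.
have DK : D `<=` square a (r * 2).
  move=> z /hD h; apply: sqdist_lt_square => //.
  by rewrite (le_lt_trans h)// exprMn ltr_pMr ?exprn_gt0// exprn_egt1// ltr1n.
have mK := square_measurable a (r * 2).
have e := mu2_square a r2.
have le : (mu2 D <= mu2 (square a (r * 2) : set RR))%E by apply: le_measure => //; rewrite inE.
have -> : 16 * r ^+ 2 = fine (mu2 (square a (r * 2) : set RR)) by rewrite e/=; ring.
rewrite /area_of fine_le//; last by rewrite e.
by rewrite ge0_fin_numE// (le_lt_trans le)// e ltry.
Qed.

Lemma separation_threshold (ps : seq (R * R)) : exists2 d : R, 0 < d & forall e, 0 < e <= d ->
  forall p, p \in ps -> forall p', p' \in ps -> p != p' ->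
  forall z, sqdist p z.1 z.2 <= e -> e < sqdist p' z.1 z.2.
Proof.
apply: (@finite_threshold _ _ ps (fun p e => forall p', p' \in ps -> p != p' ->
  forall z, sqdist p z.1 z.2 <= e -> e < sqdist p' z.1 z.2)) => p _.
apply: (@finite_threshold _ _ ps (fun p' e => p != p' ->
  forall z, sqdist p z.1 z.2 <= e -> e < sqdist p' z.1 z.2)) => p' _.
have [->|pp] := eqVneq p p'; first by exists 1.
by have [d d0 hd] := separated_discs pp; exists d => // e he _; exact: hd.
Qed.

Variables (P : set (R * R)) (a : R * R) (r : R).
Hypotheses (dP : discrete_in_plane P) (r0 : 0 < r).
Hypothesis circle_avoids : forall z, P z -> sqdist a z.1 z.2 != r ^+ 2.

(** [eta] is the product of [1 - |z - a|^2 / r^2], vanishing on the outer circle, and one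
    logarithmic cutoff for each puncture in the disc. In its squared gradient [8 sqdist / r^4] is
    twice the share of the first factor, and [g], of small integral, bounds the rest. The last
    clause says that away from [P] the punctures are hardly felt. *)
Lemma punctured_disc_cutoff (r1 eps : R) : 0 < r1 -> 0 < eps ->
  exists (Om : set (R * R)) (rho eta : R -> R -> R) (g : R * R -> R),
  [/\ smooth_domain_in (~` P) Om rho,
   smooth_on (~` P) eta /\ (forall z, Om z -> rho z.1 z.2 = 0 -> eta z.1 z.2 = 0),
   (forall z, Om z -> [/\ sqdist a z.1 z.2 <= r ^+ 2, 0 <= eta z.1 z.2 <= 1, 0 <= g z &
     pdx eta z.1 z.2 ^+ 2 + pdy eta z.1 z.2 ^+ 2 <= 8 * sqdist a z.1 z.2 / r ^+ 4 + g z]),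
   bmf Om g /\ integ Om g <= eps &
   (forall z, sqdist a z.1 z.2 <= r ^+ 2 -> (forall p, P p -> r1 <= sqdist p z.1 z.2) ->
     [/\ Om z, 1 - eta z.1 z.2 <= sqdist a z.1 z.2 / r ^+ 2 + eps & g z <= eps])].
Proof.
move=> r10 eps0; have oS := open_setC_discrete dP.
have [ps ups psE] := discrete_compact_finite dP (disc_compact (a := a) r0).
have [d1 d10 hd1] := separation_threshold ps.
have [d2 d20 hd2] : exists2 d : R, 0 < d & forall e, 0 < e <= d -> forall p, p \in ps ->
    forall z, r ^+ 2 <= sqdist a z.1 z.2 -> e < sqdist p z.1 z.2.
  apply: (@finite_threshold _ _ ps (fun p e => forall z, r ^+ 2 <= sqdist a z.1 z.2 -> e < sqdist p z.1 z.2)) => p.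
  move=> /psE[Pp /= hp]; apply: inner_disc; rewrite lt_neqAle hp andbT; exact: circle_avoids.
pose n := size ps; pose c : R := ln 4.
have c0 : 0 < c by rewrite ln_gt0// ltr1n.
have n0 : 0 <= n%:R :> R by rewrite ler0n.
have t0 : 0 < 2 ^+ n :> R by rewrite exprn_gt0.
(* Divided by [N], these constants bound the integral of [g], the values of [g] away from [P], and
   the deviation of the logarithmic factor from 1 away from [P]. *)
pose C1 := 8 * 2 ^+ n * n%:R * (16 * r ^+ 2 + 16) / c ^+ 2.
pose C2 := 8 * 2 ^+ n * n%:R / r1 / c ^+ 2.
pose C3 := n%:R / r1 / c.
have r20 : 0 < r ^+ 2 by rewrite exprn_gt0.
have n8 : 0 <= 8 * 2 ^+ n * n%:R :> R by apply: mulr_ge0 => //; apply: mulr_ge0 => //; exact: ltW.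
have C10 : 0 <= C1.
  by apply: divr_ge0 (sqr_ge0 _); apply: mulr_ge0 n8 _; rewrite addr_ge0// mulr_ge0// ltW.
have C20 : 0 <= C2 by apply: divr_ge0 (sqr_ge0 _); apply: divr_ge0 n8 _; exact: ltW.
have C30 : 0 <= C3 by apply: divr_ge0 (ltW c0); apply: divr_ge0 n0 _; exact: ltW.
have [CS1 [CS2 CS3]] : C1 <= C1 + C2 + C3 /\ C2 <= C1 + C2 + C3 /\ C3 <= C1 + C2 + C3 by lra.
(* One lower bound for [N]: the inverses put [d <= 1 / N] below every geometric threshold, and the
   quotient by [eps] puts each [C / N] below [eps]. *)
pose B := d1^-1 + d2^-1 + 2 / r ^+ 2 + r1^-1 + (C1 + C2 + C3) / eps + 1.
have [N hN] : exists N : nat, B < N%:R.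
  by exists (Num.bound `|B|); rewrite (le_lt_trans (ler_norm _))// archi_boundP.
have [q1 [q2 [q3 [q4 q5]]]] : 0 < d1^-1 /\ 0 < d2^-1 /\ 0 < 2 / r ^+ 2 /\ 0 < r1^-1 /\ 0 <= (C1 + C2 + C3) / eps.
  by rewrite !invr_gt0 !divr_gt0// divr_ge0 ?(ltW eps0)// !addr_ge0.
have N0 : 0 < N%:R :> R by rewrite (le_lt_trans _ hN)// /B; lra.
have Nn : (0 < N)%N by rewrite -(ltr0n R).
have small C : 0 <= C -> C <= C1 + C2 + C3 -> C / N%:R <= eps.
  move=> C0 hC; rewrite ler_pdivrMr// mulrC -ler_pdivrMr//.
  have : C / eps <= (C1 + C2 + C3) / eps by rewrite ler_pM2r// invr_gt0.
  by move: hN; rewrite /B; lra.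
pose d : R := (4 ^+ N)^-1.
have d0 : 0 < d by rewrite invr_gt0 exprn_gt0.
have dN : d <= N%:R^-1.
  rewrite lef_pV2 ?posrE ?exprn_gt0//.
  by rewrite -natrX ler_nat ltnW// ltn_expl.
have dlt x : 0 < x -> x^-1 < N%:R -> d < x.
  by move=> x0 xN; rewrite (le_lt_trans dN)// -[ltRHS]invrK ltf_pV2// posrE invr_gt0.
have dd1 : d < d1 by apply: dlt => //; move: hN; rewrite /B; lra.
have dd2 : d < d2 by apply: dlt => //; move: hN; rewrite /B; lra.
have dr1 : d < r1 by apply: dlt => //; move: hN; rewrite /B; lra.
have dr2 : d < r ^+ 2.
  apply: dlt => //; move: hN q3; rewrite /B; move: (r ^+ 2)^-1 => t; lra.
have h1 p p' : p \in ps -> p' \in ps -> p != p' -> forall z, sqdist p z.1 z.2 <= d -> d < sqdist p' z.1 z.2.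
  by move=> pps pps' pp; apply: (hd1 d _ p pps p' pps' pp); rewrite d0 ltW.
have h2 p : p \in ps -> forall z, r ^+ 2 <= sqdist a z.1 z.2 -> d < sqdist p z.1 z.2.
  by move=> pps; apply: (hd2 d _ p pps); rewrite d0 ltW.
have psP z : P z -> sqdist a z.1 z.2 <= r ^+ 2 -> z \in ps by move=> Pz hz; apply/psE.
have [dom [OmE bdry]] := punctured_disc_domain dP r0 d0 dr2 ups psP h2 h1.
move: dom OmE bdry; set rho := (fun x y : R => _); set Om := [set z | _] => dom OmE bdry.
have [cOm [OmS _]] := dom; have [mOm fOm] := (compact_measurable2 cOm, compact_mu2_finite cOm).
pose L := ln (1 + d^-1).
pose f x y := 1 - (r ^+ 2)^-1 * sqdist a x y.
pose Pi x y := \prod_(p <- ps) logcut L p x y.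
pose g z := 2 * (2 ^+ n * \sum_(p <- ps) 4 * L ^- 2 / sqdist p z.1 z.2).
have LN : N%:R * c <= L.
  rewrite mulrC mulr_natr /c -lnXn// /L ler_ln ?posrE ?exprn_gt0//; last by rewrite addr_gt0// invr_gt0.
  by rewrite /d invrK lerDr.
have NC : 0 < N%:R * c by rewrite mulr_gt0.
have L0 : 0 < L := lt_le_trans NC LN.
have LV : L^-1 <= c^-1 / N%:R by rewrite -invfM mulrC lef_pV2.
have LV2 : L ^- 2 <= (c ^+ 2)^-1 / N%:R / N%:R.
  rewrite -exprVn; apply: (@le_trans _ _ ((c^-1 / N%:R) ^+ 2)).
    by rewrite ler_pXn2r ?nnegrE ?divr_ge0 ?invr_ge0// ltW.
  by rewrite le_eqVlt; apply/orP; left; apply/eqP; field; rewrite !lt0r_neq0.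
have PiE z : Om z -> [/\ 0 <= Pi z.1 z.2 <= 1,
   1 - Pi z.1 z.2 <= \sum_(p <- ps) (1 - logcut L p z.1 z.2) &
   exists u v, jet Pi z u v /\ u ^+ 2 + v ^+ 2 <= 2 ^+ n * \sum_(p <- ps) 4 * L ^- 2 / sqdist p z.1 z.2].
  move=> Oz; have [za zp] := (OmE z).1 Oz; apply: prod_cutoff => p pps.
    apply: logcut_jet; apply/eqP => zE; have := OmS z Oz; apply; rewrite zE; exact: ((psE p).1 pps).1.
  exact: (logcut_range d0 (zp p pps)).1.
have jf z : jet f z (- (2 * (z.1 - a.1) / r ^+ 2)) (- (2 * (z.2 - a.2) / r ^+ 2)).
  by apply: (jet_eq (jetB (jet_cst 1 z) (jetM (jet_cst (r ^+ 2)^-1 z) (jet_sqdist a z)))); ring.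
have f01 z : sqdist a z.1 z.2 <= r ^+ 2 -> 0 <= f z.1 z.2 <= 1.
  move=> za; rewrite /f subr_ge0 gerBl mulr_ge0 ?invr_ge0 ?sqdist_ge0 ?(ltW r20)// andbT.
  by rewrite mulrC ler_pdivrMr// mul1r.
have bi p : p \in ps -> bmf Om (fun z => (sqdist p z.1 z.2)^-1).
  by move=> pps; apply: inv_sqdist_bmf => // /OmS; apply; exact: ((psE p).1 pps).1.
have g0 z : 0 <= g z.
  rewrite !mulr_ge0 ?(ltW t0)//; apply: sumr_ge0 => p _.
  by rewrite divr_ge0 ?sqdist_ge0// mulr_ge0// -exprVn sqr_ge0.
pose K := 8 * 2 ^+ n * L ^- 2.
have K0 : 0 <= K by rewrite mulr_ge0 ?mulr_ge0 ?(ltW t0)// -exprVn sqr_ge0.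
have gE z : g z = K * \sum_(i < n) (sqdist (nth a ps i) z.1 z.2)^-1.
  by rewrite /g (big_nth a) big_mkord /K !mulr_sumr; apply: eq_bigr => i _; ring.
have bI (i : 'I_n) : bmf Om (fun z => (sqdist (nth a ps i) z.1 z.2)^-1) by exact: bi (mem_nth _ (ltn_ord i)).
have bS := bmf_sum (index_enum 'I_n) bI.
have bg : bmf Om g by apply: (eq_bmf _ (bmfM (bmf_cst Om K) bS)) => z _; rewrite gE.
exists Om, rho, (fun x y => f x y * Pi x y), g; split.
- exact: dom.
- split.
    apply: (mul_smooth oS).
      exact: (sub_smooth oS (cst_smooth 1 oS) (mul_smooth oS (cst_smooth _ oS) (sqdist_smooth a oS))).
    have : forall q : seq (R * R), {subset q <= ps} -> smooth_on (~` P) (fun x y => \prod_(p <- q) logcut L p x y).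
      elim=> [|p q ih] qps.
        by apply: (eq_on_smooth oS _ (cst_smooth 1 oS)) => z _; rewrite big_nil.
      have sq := ih (fun x xq => qps x (mem_behead (s := p :: q) xq)).
      have sp : smooth_on (~` P) (logcut L p).
        apply: (logcut_smooth _ oS) => z Sz; apply/eqP => zp; apply: Sz; rewrite zp.
        exact: ((psE p).1 (qps p (mem_head _ _))).1.
      by apply: (eq_on_smooth oS _ (mul_smooth oS sp sq)) => z _; rewrite big_cons.
    by apply.
  move=> z Oz /(bdry z Oz) [zr|[p pps zd]].
    by rewrite /f zr mulVf ?subrr ?mul0r// lt0r_neq0.
  by rewrite /Pi (big_rem p)//= logcut0// mul0r mulr0.
- move=> z Oz; have [za zp] := (OmE z).1 Oz.
  have [/andP[P0 P1] PS [u [v [jP uv]]]] := PiE z Oz; have /andP[f0 f1] := f01 z za.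
  have [_ -> ->] := jetM (jf z) jP.
  split=> //; first by rewrite mulr_ge0// mulr_ile1.
  apply: (le_trans (mul_cutoff _ _ _ _ (f01 z za) (introT andP (conj P0 P1)))).
  rewrite addrC; apply: lerD; last by rewrite /g ler_pM2l.
  rewrite le_eqVlt; apply/orP; left; apply/eqP; rewrite /sqdist; field; exact: lt0r_neq0.
- split; first exact: bg.
  rewrite (eq_integ (g := fun z => K * \sum_(i < n) (sqdist (nth a ps i) z.1 z.2)^-1)); last by move=> z _; exact: gE.
  rewrite (integZ mOm fOm _ bS) (integ_sum mOm fOm _ bI).
  have step : \sum_(i < n) integ Om (fun z => (sqdist (nth a ps i) z.1 z.2)^-1) <= n%:R * ((16 * r ^+ 2 + 16) * N%:R).
    have -> : n%:R * ((16 * r ^+ 2 + 16) * N%:R) = \sum_(i < n) ((16 * r ^+ 2 + 16) * N%:R).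
      by rewrite sumr_const card_ord mulr_natl.
    apply: ler_sum => i _; apply: le_trans (inv_sqdist_integ cOm _) _.
      by move=> z /OmE[_ h]; apply: h; exact: mem_nth.
    have := area_of_disc r0 mOm (fun z Oz => ((OmE z).1 Oz).1).
    have N1 : 1 <= N%:R :> R by rewrite ler1n.
    have : 0 <= r ^+ 2 * (N%:R - 1) by rewrite mulr_ge0 ?subr_ge0// ltW.
    rewrite mulrBr mulr1 subr_ge0 => h3 h4; rewrite (mulrDl (16 * _)).
    by apply: lerD => //; apply: (le_trans h4); rewrite -mulrA ler_pM2l.
  apply: (le_trans (ler_wpM2l K0 step)); apply: le_trans (small C1 C10 CS1).
  have -> : C1 / N%:R = 8 * 2 ^+ n * ((c ^+ 2)^-1 / N%:R / N%:R) * (n%:R * ((16 * r ^+ 2 + 16) * N%:R)).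
    by rewrite /C1; field; rewrite !lt0r_neq0.
  rewrite ler_wpM2r//.
    by rewrite !mulr_ge0// ?(ltW N0)// addr_ge0// mulr_ge0// ltW.
  by rewrite ler_wpM2l// mulr_ge0// ltW.
- move=> z za zP.
  have zp p : p \in ps -> r1 <= sqdist p z.1 z.2 by move=> /psE[/zP].
  have Oz : Om z.
    by apply/OmE; split=> // p /zp; apply: le_trans; exact: ltW.
  have inv1 (i : 'I_n) : (sqdist (nth a ps i) z.1 z.2)^-1 <= r1^-1.
    have h := zp _ (mem_nth a (ltn_ord i)).
    by rewrite lef_pV2// posrE (lt_le_trans r10 h).
  have sum1 : \sum_(i < n) (sqdist (nth a ps i) z.1 z.2)^-1 <= n%:R / r1.
    have -> : n%:R / r1 = \sum_(i < n) r1^-1 by rewrite sumr_const card_ord mulr_natl.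
    by apply: ler_sum => i _.
  split; [exact: Oz| |]; last first.
    rewrite gE; apply: (le_trans (ler_wpM2l K0 sum1)); apply: le_trans (small C2 C20 CS2).
    have N1 : N%:R^-1 <= 1 :> R by rewrite invf_le1// ler1n.
    have -> : C2 / N%:R = 8 * 2 ^+ n * ((c ^+ 2)^-1 / N%:R) * (n%:R / r1).
      by rewrite /C2; field; rewrite !lt0r_neq0.
    rewrite ler_wpM2r ?divr_ge0 ?(ltW r10)// ler_wpM2l// ?mulr_ge0 ?(ltW t0)//.
    by apply: (le_trans LV2); rewrite ler_piMr// divr_ge0 ?(ltW N0)// invr_ge0 sqr_ge0.
  have [/andP[P0 P1] PS _] := PiE z Oz; have /andP[f0 f1] := f01 z za.
  have le1 : 1 - f z.1 z.2 * Pi z.1 z.2 <= (1 - f z.1 z.2) + (1 - Pi z.1 z.2).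
    rewrite -subr_ge0 (_ : _ - _ = (1 - f z.1 z.2) * (1 - Pi z.1 z.2)); last by ring.
    by rewrite mulr_ge0// subr_ge0.
  cbv beta; apply: (le_trans le1); apply: lerD; first by rewrite /f opprB addrC subrK mulrC.
  apply: (le_trans PS); apply: le_trans (small C3 C30 CS3).
  rewrite (big_nth a) big_mkord.
  apply: (@le_trans _ _ (L^-1 * \sum_(i < n) (sqdist (nth a ps i) z.1 z.2)^-1)).
    rewrite mulr_sumr; apply: ler_sum => i _.
    exact: (logcut_range d0 (le_trans (ltW dr1) (zp _ (mem_nth a (ltn_ord i))))).2.
  apply: (le_trans (ler_wpM2l _ sum1)); first by rewrite invr_ge0 ltW.
  have -> : C3 / N%:R = (c^-1 / N%:R) * (n%:R / r1) by rewrite /C3; field; rewrite !lt0r_neq0.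
  by rewrite ler_wpM2r// divr_ge0// ltW.
Qed.

End DiscCutoff.

(** * Isotropy of the gradient *)

Section ContinuityAt.
Variables (R : realType) (n : nat) (T : topologicalType) (w0 : T).
Implicit Types (f g : T -> R) (u v : T -> 'rV[R]_n).

Definition cont_at (V : normedModType R) (f : T -> V) := {for w0, continuous f}.

Lemma cont_cst (V : normedModType R) (c : V) : cont_at (fun _ => c).
Proof. exact: cvg_cst. Qed.

Lemma cont_add (V : normedModType R) (f g : T -> V) : cont_at f -> cont_at g -> cont_at (fun w => f w + g w).
Proof. by move=> hf hg; apply: cvgD. Qed.

Lemma cont_opp (V : normedModType R) (f : T -> V) : cont_at f -> cont_at (fun w => - f w).
Proof. by move=> hf; apply: cvgN. Qed.

Lemma cont_mul f g : cont_at (V := R^o) f -> cont_at (V := R^o) g -> cont_at (V := R^o) (fun w => f w * g w).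
Proof. by move=> hf hg; apply: cvgM. Qed.

Lemma cont_inv f : f w0 != 0 -> cont_at (V := R^o) f -> cont_at (V := R^o) (fun w => (f w)^-1).
Proof. by move=> f0 hf; apply: cvgV. Qed.

Lemma cont_scale f u : cont_at (V := R^o) f -> cont_at u -> cont_at (fun w => f w *: u w).
Proof. by move=> hf hu; apply: cvgZ. Qed.

Lemma cont_coord u i : cont_at u -> cont_at (V := R^o) (fun w => u w 0 i).
Proof. by move=> hu; exact: (continuous_comp hu (@coord_continuous _ _ _ 0 i _)). Qed.

Lemma cont_sum (I : Type) (r : seq I) (h : I -> T -> R) : (forall i, cont_at (V := R^o) (h i)) ->
  cont_at (V := R^o) (fun w => \sum_(i <- r) h i w).
Proof.
move=> hh; elim: r => [|i r ih].
  by rewrite (_ : (fun _ => _) = (fun _ => 0)); [exact: cont_cst|apply/funext => w; rewrite big_nil].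
rewrite (_ : (fun _ => _) = (fun w => h i w + \sum_(j <- r) h j w)); first exact: cont_add (hh i) ih.
by apply/funext => w; rewrite big_cons.
Qed.

Lemma cont_dot u v : cont_at u -> cont_at v -> cont_at (V := R^o) (fun w => dot (u w) (v w)).
Proof. by move=> hu hv; apply: cont_sum => i; apply: cont_mul; exact: cont_coord. Qed.

End ContinuityAt.

Section Region.
Variables (R : realType) (n : nat) (S : set (R * R)) (F : R -> R -> 'rV[R]_n) (a b : R * R).
Hypotheses (sF : smooth_on S F) (Sb : S b) (ab : b != a).
Variables A B C D : 'rV[R]_n.

(** With [fieldN], twice the holomorphic derivative of the test field as in [sfield_dbar], here with
    [s] as a variable and meaningful at [s = 0], where the field is the pole itself. *)
Definition fieldM (x y s : R) : 'rV[R]_n :=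
  let X := x - a.1 in let Y := y - a.2 in
  (den a s x y) ^- 2 *: ((2 * (Y * Y - X * X)) *: A + (4 * (X * Y)) *: B + (2 * s * X) *: C - (2 * s * Y) *: D).
Definition fieldN (x y s : R) : 'rV[R]_n :=
  let X := x - a.1 in let Y := y - a.2 in
  (den a s x y) ^- 2 *: ((4 * (X * Y)) *: A - (2 * (Y * Y - X * X)) *: B - (2 * s * X) *: D - (2 * s * Y) *: C).

(* The part of [pair_form] depending on [k] and [l], for the test pair
   [eta *: sfield1], [eta *: sfield2]; [e], [ex], [ey] are the values of [eta]
   and of its partial derivatives. *)
Definition coupling (k l x y s e ex ey : R) : R :=
  let M := e *: fieldM x y s + (ex *: sfield1 a s A B C x y + ey *: sfield2 a s A B D x y) in
  let N := e *: fieldN x y s + (ex *: sfield2 a s A B D x y - ey *: sfield1 a s A B C x y) in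
  let f := pdx F x y in let g := pdy F x y in
  2 * (k ^+ 2 + l ^+ 2) * dot f f - 2 * (k * (dot f M + dot g N) + l * (dot g M - dot f N)).

(** [0 1 0 0] is the limit of the parameters: no smoothing, no cutoff. Since [b] differs from [a],
    the denominator is nonzero at [b] for [s = 0], so the coupling is jointly continuous there and a
    strict inequality persists. *)
Lemma coupling_near (k l : R) (c : R) : coupling k l b.1 b.2 0 1 0 0 < c ->
  exists2 r : R, 0 < r & forall z s e ex ey, square b r z -> `|s| < r -> `|e - 1| < r -> `|ex| < r -> `|ey| < r ->
    coupling k l z.1 z.2 s e ex ey < c.
Proof.
move=> hc.
pose Phi (w : (R * R) * R * (R * (R * R))) : R := coupling k l w.1.1.1 w.1.1.2 w.1.2 w.2.1 w.2.2.1 w.2.2.2.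
pose w0 : (R * R) * R * (R * (R * R)) := (b, 0, (1, (0, 0))).
have fst_c (T1 T2 T3 : topologicalType) (u0 : T1) (h : T1 -> T2 * T3) : {for u0, continuous h} ->
    {for u0, continuous (fun u => (h u).1)}.
  by move=> hh; apply: (cvg_comp _ _ hh); exact: cvg_fst.
have snd_c (T1 T2 T3 : topologicalType) (u0 : T1) (h : T1 -> T2 * T3) : {for u0, continuous h} ->
    {for u0, continuous (fun u => (h u).2)}.
  by move=> hh; apply: (cvg_comp _ _ hh); exact: cvg_snd.
have cid : {for w0, continuous (fun w : (R * R) * R * (R * (R * R)) => w)} by exact: cvg_id.
have c1 := fst_c _ _ _ _ _ cid; have c2 := snd_c _ _ _ _ _ cid.
have cz := fst_c _ _ _ _ _ c1.
have cx : cont_at (V := R^o) w0 (fun w => w.1.1.1) := fst_c _ _ _ _ _ cz.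
have cy : cont_at (V := R^o) w0 (fun w => w.1.1.2) := snd_c _ _ _ _ _ cz.
have cs : cont_at (V := R^o) w0 (fun w => w.1.2) := snd_c _ _ _ _ _ c1.
have ce : cont_at (V := R^o) w0 (fun w => w.2.1) := fst_c _ _ _ _ _ c2.
have c22 := snd_c _ _ _ _ _ c2.
have cex : cont_at (V := R^o) w0 (fun w => w.2.2.1) := fst_c _ _ _ _ _ c22.
have cey : cont_at (V := R^o) w0 (fun w => w.2.2.2) := snd_c _ _ _ _ _ c22.
have cfx : cont_at w0 (fun w => pdx F w.1.1.1 w.1.1.2).
  exact: (cvg_comp _ _ cz (smooth_on_regular (smooth_on_pdx sF) Sb).1).
have cfy : cont_at w0 (fun w => pdy F w.1.1.1 w.1.1.2).
  exact: (cvg_comp _ _ cz (smooth_on_regular (smooth_on_pdy sF) Sb).1).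
have d0 : den a 0 b.1 b.2 != 0 by rewrite /den addr0 lt0r_neq0// sqdist_gt0.
have cc (c' : R) : cont_at (V := R^o) w0 (fun _ => c') by exact: cont_cst.
have cv (c' : 'rV[R]_n) : cont_at w0 (fun _ => c') by exact: cont_cst.
have cX := cont_add cx (cont_opp (cc a.1)); have cY := cont_add cy (cont_opp (cc a.2)).
have cden : cont_at (V := R^o) w0 (fun w => den a w.1.2 w.1.1.1 w.1.1.2).
  by apply: cont_add cs; apply: cont_add; exact: cont_mul.
have cd1 : cont_at (V := R^o) w0 (fun w => (den a w.1.2 w.1.1.1 w.1.1.2)^-1).
  by apply: cont_inv cden; exact: d0.
have cd2 : cont_at (V := R^o) w0 (fun w => den a w.1.2 w.1.1.1 w.1.1.2 ^- 2).
  by apply: cont_inv (cont_mul cden cden); exact: mulf_neq0.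
have cXX := cont_mul cX cX; have cYY := cont_mul cY cY; have cXY := cont_mul cX cY.
have cq := cont_mul (cc 2) (cont_add cYY (cont_opp cXX)).
have cXY4 := cont_mul (cc 4) cXY.
have csX := cont_mul (cont_mul (cc 2) cs) cX; have csY := cont_mul (cont_mul (cc 2) cs) cY.
have cM : cont_at w0 (fun w => fieldM w.1.1.1 w.1.1.2 w.1.2).
  exact: (cont_scale cd2 (cont_add (cont_add (cont_add (cont_scale cq (cv A)) (cont_scale cXY4 (cv B)))
    (cont_scale csX (cv C))) (cont_opp (cont_scale csY (cv D))))).
have cN : cont_at w0 (fun w => fieldN w.1.1.1 w.1.1.2 w.1.2).
  exact: (cont_scale cd2 (cont_add (cont_add (cont_add (cont_scale cXY4 (cv A)) (cont_opp (cont_scale cq (cv B))))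
    (cont_opp (cont_scale csX (cv D)))) (cont_opp (cont_scale csY (cv C))))).
have cU1 : cont_at w0 (fun w => sfield1 a w.1.2 A B C w.1.1.1 w.1.1.2).
  exact: (cont_scale cd1 (cont_add (cont_add (cont_scale cX (cv A)) (cont_opp (cont_scale cY (cv B))))
    (cont_opp (cont_scale cs (cv C))))).
have cU2 : cont_at w0 (fun w => sfield2 a w.1.2 A B D w.1.1.1 w.1.1.2).
  exact: (cont_scale cd1 (cont_add (cont_add (cont_scale cs (cv D)) (cont_opp (cont_scale cX (cv B))))
    (cont_opp (cont_scale cY (cv A))))).
have cMM := cont_add (cont_scale ce cM) (cont_add (cont_scale cex cU1) (cont_scale cey cU2)).
have cNN := cont_add (cont_scale ce cN) (cont_add (cont_scale cex cU2) (cont_opp (cont_scale cey cU1))).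
have cPhi : cont_at (V := R^o) w0 Phi.
  apply: (cont_add (cont_mul (cc (2 * (k ^+ 2 + l ^+ 2))) (cont_dot cfx cfx)) (cont_opp (cont_mul (cc 2) (cont_add
    (cont_mul (cc k) (cont_add (cont_dot cfx cMM) (cont_dot cfy cNN)))
    (cont_mul (cc l) (cont_add (cont_dot cfy cMM) (cont_opp (cont_dot cfx cNN)))))))).
have : \forall w \near w0, Phi w < c by exact: (cvgr_lt _ cPhi _ hc).
move=> /nbhs_ballP[r r0 hr]; exists r; first exact: r0.
move=> z s e ex ey [z1 z2] hs he hex hey.
apply: (hr (z, s, (e, (ex, ey)))).
by split; split; [split|..|split]; rewrite /ball/= ?sub0r ?normrN// distrC.
Qed.

End Region.

Section CouplingSign.
Variables (R : realType) (n : nat) (F : R -> R -> 'rV[R]_n) (a b : R * R) (A B C D : 'rV[R]_n).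
Hypothesis ab : b != a.

(** At [s = 0] the linear coefficients [c1], [c2] are, up to sign, the real and imaginary parts of
    [2 phi(a) . phi(b) / (b - a)^2], of squared modulus [4 q^-2] times that of the product. The
    hypothesis says that this product is nonzero. *)
Lemma coupling_negative :
  (dot A (pdx F b.1 b.2) != dot B (pdy F b.1 b.2)) || (dot A (pdy F b.1 b.2) + dot B (pdx F b.1 b.2) != 0) ->
  exists k l, coupling F a A B C D k l b.1 b.2 0 1 0 0 < 0.
Proof.
move=> hne; have q0 := sqdist_gt0 ab.
rewrite /coupling /fieldM /fieldN /den addr0; cbv zeta.
set X := b.1 - a.1; set Y := b.2 - a.2; set q := sqdist _ _ _ in q0 *.
have qE : q = X * X + Y * Y by [].
move: (pdx F _ _) (pdy F _ _) hne => f g hne.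
pose g1 := dot A f - dot B g; pose g2 := dot A g + dot B f.
pose al := 2 * (Y * Y - X * X); pose be := 4 * (X * Y).
pose c1 := q ^- 2 * (al * g1 + be * g2); pose c2 := q ^- 2 * (al * g2 - be * g1).
have cc : 0 < c1 ^+ 2 + c2 ^+ 2.
  have -> : c1 ^+ 2 + c2 ^+ 2 = 4 * q ^- 2 * (g1 ^+ 2 + g2 ^+ 2).
    have -> : c1 ^+ 2 + c2 ^+ 2 = q ^- 4 * (al ^+ 2 + be ^+ 2) * (g1 ^+ 2 + g2 ^+ 2).
      by rewrite /c1 /c2 -!exprVn; ring.
    have -> : al ^+ 2 + be ^+ 2 = 4 * q ^+ 2 by rewrite /al /be qE; ring.
    by field; exact: lt0r_neq0.
  rewrite !mulr_gt0 ?invr_gt0 ?exprn_gt0// lt_neqAle eq_sym addr_ge0 ?sqr_ge0// andbT.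
  rewrite paddr_eq0 ?sqr_ge0// !sqrf_eq0 negb_and /g1 subr_eq0; exact: hne.
(* Along [(t c1, t c2)] the linear part is [- 2 t (c1^2 + c2^2)]; this [t] makes [t |F_x|^2 < 1], so
   the quadratic part is smaller. *)
have l0 := dot_ge0 f; pose t := (2 * (dot f f + 1))^-1.
have t0 : 0 < t by rewrite invr_gt0 mulr_gt0// ltr_wpDl.
exists (t * c1), (t * c2).
rewrite !scale1r !scale0r !(addr0, subr0).
rewrite !mulr0 !mul0r !scale0r !(addr0, subr0) !dotZr !dotDr !dotNr !dotZr.
rewrite (dotC f A) (dotC f B) (dotC g A) (dotC g B).
have e1 : q ^- 2 * (al * dot A f + be * dot B f) + q ^- 2 * (be * dot A g - al * dot B g) = c1.
  by rewrite /c1 /g1 /g2; ring.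
have e2 : q ^- 2 * (al * dot A g + be * dot B g) - q ^- 2 * (be * dot A f - al * dot B f) = c2.
  by rewrite /c2 /g1 /g2; ring.
rewrite -/al -/be e1 e2.
have tl : t * dot f f < 1.
  by rewrite /t mulrC ltr_pdivrMr ?mul1r ?mulr_gt0 ?ltr_wpDl//; lra.
rewrite (_ : _ - _ = 2 * t * (c1 ^+ 2 + c2 ^+ 2) * (t * dot f f - 1)); last by ring.
by rewrite nmulr_llt0 ?subr_lt0// !mulr_gt0.
Qed.

End CouplingSign.

Section TestEnergy.
Variables (R : realType) (n : nat) (S : set (R * R)) (F : R -> R -> 'rV[R]_n) (a : R * R) (s : R).
Variables (A B C D : 'rV[R]_n) (eta : R -> R -> R).
Hypotheses (oS : open S) (s0 : 0 < s) (s1 : s <= 1) (seta : smooth_on S eta).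

Let U1 := sfield1 a s A B C.
Let U2 := sfield2 a s A B D.

Definition test1 x y := eta x y *: sfield1 a s A B C x y.
Definition test2 x y := eta x y *: sfield2 a s A B D x y.

Let sU : smooth_on S U1 /\ smooth_on S U2.
Proof.
have [h1 h2] := sfield_smooth a A B C D s0.
by split; [exact: (smooth_onS _ h1)|exact: (smooth_onS _ h2)].
Qed.

Lemma test_smooth : smooth_on S test1 /\ smooth_on S test2.
Proof. by have [h1 h2] := sU; split; [exact: (scale_smooth oS seta h1).1|exact: (scale_smooth oS seta h2).1]. Qed.

(** [x] stands for the value of an indicator, hence [x * x = x]: [k] and [l] are constants on a
    region. The three summands on the right are the d-bar error, the price of the cutoff and the
    gain from [k] and [l]. *)
Lemma test_pair_form z (h k l : R * R -> R) (c x k0 l0 : R) : S z ->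
  h z = eta z.1 z.2 * c -> k z = k0 * x -> l z = l0 * x -> x * x = x ->
  0 <= eta z.1 z.2 <= 1 ->
  pair_form F test1 test2 h k l z <=
    2 * (dot (pdx U1 z.1 z.2 - pdy U2 z.1 z.2 - c *: pdx F z.1 z.2) (pdx U1 z.1 z.2 - pdy U2 z.1 z.2 - c *: pdx F z.1 z.2) +
         dot (pdy U1 z.1 z.2 + pdx U2 z.1 z.2 + c *: pdy F z.1 z.2) (pdy U1 z.1 z.2 + pdx U2 z.1 z.2 + c *: pdy F z.1 z.2)) +
    6 * mass A B C D * (pdx eta z.1 z.2 ^+ 2 + pdy eta z.1 z.2 ^+ 2) / den a s z.1 z.2 +
    x * coupling F a A B C D k0 l0 z.1 z.2 s (eta z.1 z.2) (pdx eta z.1 z.2) (pdy eta z.1 z.2).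
Proof.
move=> Sz hE kE lE xx e01; have [h1 h2] := sU.
have [x1 y1] := (scale_smooth oS seta h1).2 z Sz; have [x2 y2] := (scale_smooth oS seta h2).2 z Sz.
have [_ _ dM dN] := sfield_dbar a A B C D s0 z.
rewrite /pair_form hE kE lE; cbv zeta.
have -> : pdx test1 z.1 z.2 = pdx eta z.1 z.2 *: U1 z.1 z.2 + eta z.1 z.2 *: pdx U1 z.1 z.2 by exact: x1.
have -> : pdy test1 z.1 z.2 = pdy eta z.1 z.2 *: U1 z.1 z.2 + eta z.1 z.2 *: pdy U1 z.1 z.2 by exact: y1.
have -> : pdx test2 z.1 z.2 = pdx eta z.1 z.2 *: U2 z.1 z.2 + eta z.1 z.2 *: pdx U2 z.1 z.2 by exact: x2.
have -> : pdy test2 z.1 z.2 = pdy eta z.1 z.2 *: U2 z.1 z.2 + eta z.1 z.2 *: pdy U2 z.1 z.2 by exact: y2.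
rewrite /coupling; cbv zeta.
have -> : fieldM a A B C D z.1 z.2 s = pdx U1 z.1 z.2 + pdy U2 z.1 z.2 by rewrite dM.
have -> : fieldN a A B C D z.1 z.2 s = pdx U2 z.1 z.2 - pdy U1 z.1 z.2 by rewrite dN.
have fb : dot (U1 z.1 z.2) (U1 z.1 z.2) + dot (U2 z.1 z.2) (U2 z.1 z.2) <= 3 / den a s z.1 z.2 * mass A B C D.
  by apply: field_bound => //; rewrite s0.
have d0 : 0 < den a s z.1 z.2 by exact: den_gt0.
rewrite -/U1 -/U2.
move: (U1 z.1 z.2) (U2 z.1 z.2) (pdx U1 z.1 z.2) (pdy U1 z.1 z.2) (pdx U2 z.1 z.2) (pdy U2 z.1 z.2)
  (pdx F z.1 z.2) (pdy F z.1 z.2) fb => V1 V2 u1 v1 u2 v2 fx fy fb.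
move: (eta z.1 z.2) (pdx eta z.1 z.2) (pdy eta z.1 z.2) (den _ _ _ _) (mass _ _ _ _) (mass_ge0 A B C D) e01 fb d0
  => e ex ey d m m0 /andP[e0 e1] fb d0.
have ce := @cutoff_energy _ _ V1 V2 u1 v1 u2 v2 fx fy _ _ e ex ey c erefl erefl.
have e21 : e ^+ 2 <= 1 by rewrite exprn_ile1.
have bound : 2 * e ^+ 2 * (dot (u1 - v2 - c *: fx) (u1 - v2 - c *: fx) + dot (v1 + u2 + c *: fy) (v1 + u2 + c *: fy)) +
  2 * (ex ^+ 2 + ey ^+ 2) * (dot V1 V1 + dot V2 V2) <=
  2 * (dot (u1 - v2 - c *: fx) (u1 - v2 - c *: fx) + dot (v1 + u2 + c *: fy) (v1 + u2 + c *: fy)) +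
  6 * m * (ex ^+ 2 + ey ^+ 2) / d.
  apply: lerD.
    rewrite -mulrA ler_pM2l// ler_piMl// addr_ge0 ?dot_ge0//.
  apply: (@le_trans _ _ (2 * (ex ^+ 2 + ey ^+ 2) * (3 / d * m))).
    by rewrite ler_wpM2l// mulr_ge0// addr_ge0 ?sqr_ge0.
  by rewrite le_eqVlt; apply/orP; left; apply/eqP; field; exact: lt0r_neq0.
have := le_trans ce bound.
move: (dot (_ - _ - (e * c) *: fx) _) (dot (_ + _ + (e * c) *: fy) _).
move=> E1 E2 hE'.
rewrite (_ : ex *: V1 + e *: u1 + (ey *: V2 + e *: v2) = e *: (u1 + v2) + (ex *: V1 + ey *: V2)); last first.
  by rewrite scalerDr addrACA addrC.
rewrite (_ : ex *: V2 + e *: u2 - (ey *: V1 + e *: v1) = e *: (u2 - v1) + (ex *: V2 - ey *: V1)); last first.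
  by rewrite scalerBr opprD addrACA addrC.
move: (dot fx (_ + _)) (dot fy (_ + _)) (dot fy (_ + _)) (dot fx (_ + _)) hE' => p1 p2 p3 p4 hE'.
rewrite (_ : 2 * ((k0 * x) ^+ 2 + (l0 * x) ^+ 2) = x * (2 * (k0 ^+ 2 + l0 ^+ 2))); last first.
  by rewrite !exprMn (expr2 x) xx; ring.
rewrite (_ : _ - _ = E1 + E2 + x * (2 * (k0 ^+ 2 + l0 ^+ 2) * dot fx fx - 2 * (k0 * (p4 + p3) + l0 * (p2 - p1)))); last by ring.
by rewrite lerD2r.
Qed.

End TestEnergy.

Lemma clairaut_row (R : realType) (n : nat) (S : set (R * R)) (G : R -> R -> 'rV[R]_n) p :
  open S -> smooth_on S G -> S p -> pdx (pdy G) p.1 p.2 = pdy (pdx G) p.1 p.2.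
Proof.
move=> oS sG Sp; apply/rowP => i.
have [_ e1 _] := regular_coord (smooth_on_regular (smooth_on_pdy sG) Sp) i.
have [_ _ e2] := regular_coord (smooth_on_regular (smooth_on_pdx sG) Sp) i.
have e3 : forall z, S z -> pdy (fun x y => G x y 0 i) z.1 z.2 = pdy G z.1 z.2 0 i.
  by move=> z Sz; have [_ _ h] := regular_coord (smooth_on_regular sG Sz) i.
have e4 : forall z, S z -> pdx (fun x y => G x y 0 i) z.1 z.2 = pdx G z.1 z.2 0 i.
  by move=> z Sz; have [_ h _] := regular_coord (smooth_on_regular sG Sz) i.
apply: (etrans (esym e1)); apply: etrans (esym (eq_on_pdx oS e3 Sp)) _.
apply: etrans (clairaut oS (smooth_coord oS sG i) Sp) _.
exact: etrans (eq_on_pdy oS e4 Sp) e2.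
Qed.

Section Isotropy.
Variables (R : realType) (n : nat) (P : set (R * R)) (F : R -> R -> 'rV[R]_n).
Hypotheses (dP : discrete_in_plane P) (bF : branched_minimal_immersion (~` P) F).
Let S := ~` P.
Let oS : open S := open_setC_discrete dP.
Let sF : smooth_on S F. Proof. by case: bF => _ []. Qed.

(** This is the Taylor formula for [phi] with complex derivative [C - i D]: harmonicity and equality
    of the mixed partials express the second derivatives of [F] through [C] and [D] alone. *)
Lemma taylor_gradient (a : R * R) (r0 : R) : 0 < r0 -> square a r0 `<=` S ->
  let A := pdx F a.1 a.2 in let B := pdy F a.1 a.2 in
  let C := pdx (pdx F) a.1 a.2 in let D := pdy (pdx F) a.1 a.2 in
  exists2 c : R, 0 <= c & forall z, square a (r0 / 2) z ->
    dot (pdx F z.1 z.2 - (A + (z.1 - a.1) *: C + (z.2 - a.2) *: D)) (pdx F z.1 z.2 - (A + (z.1 - a.1) *: C + (z.2 - a.2) *: D)) +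
    dot (pdy F z.1 z.2 - (B + (z.1 - a.1) *: D - (z.2 - a.2) *: C)) (pdy F z.1 z.2 - (B + (z.1 - a.1) *: D - (z.2 - a.2) *: C))
    <= c * sqdist a z.1 z.2 ^+ 2.
Proof.
move=> r00 r0S A B C D; have Sa : S a by apply: r0S; exact: square_center.
have [sx sy] := (smooth_on_pdx sF, smooth_on_pdy sF).
have coords (G : R -> R -> 'rV[R]_n) i : smooth_on S G ->
    exists2 c : R, 0 <= c & forall z, square a (r0 / 2) z ->
    `|G z.1 z.2 0 i - G a.1 a.2 0 i - (z.1 - a.1) * pdx G a.1 a.2 0 i - (z.2 - a.2) * pdy G a.1 a.2 0 i|
      <= c * sqdist a z.1 z.2.
  move=> sG; have [_ e1 e2] := regular_coord (smooth_on_regular sG Sa) i.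
  have [c c0 hc] := taylor2 (smooth_coord oS sG i) oS r00 r0S.
  exists c; first exact: c0.
  move=> z hz; move: (hc z hz); set u := pdx _ _ _; set v := pdy _ _ _.
  have -> : u = pdx G a.1 a.2 0 i by exact: e1.
  by have -> : v = pdy G a.1 a.2 0 i by exact: e2.
have [c1 hc1] := choice (fun i => let: ex_intro2 c p q := coords _ i sx in ex_intro _ c (conj p q)).
have [c2 hc2] := choice (fun i => let: ex_intro2 c p q := coords _ i sy in ex_intro _ c (conj p q)).
exists (\sum_i (c1 i ^+ 2 + c2 i ^+ 2)); first by apply: sumr_ge0 => i _; rewrite addr_ge0 ?sqr_ge0.
move=> z hz.
have hyx : pdx (pdy F) a.1 a.2 = D by exact: clairaut_row oS sF Sa.
have hyy : pdy (pdy F) a.1 a.2 = - C.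
  by apply/eqP; rewrite -addr_eq0 addrC; apply/eqP; exact: bF.2.2.1 a Sa.
have h1 i := (hc1 i).2 z hz; have h2 i := (hc2 i).2 z hz.
have {}h2 i : `|pdy F z.1 z.2 0 i - B 0 i - (z.1 - a.1) * D 0 i - (z.2 - a.2) * (- C) 0 i| <= c2 i * sqdist a z.1 z.2.
  by rewrite -hyx -hyy; exact: h2.
have {}h1 i : `|pdx F z.1 z.2 0 i - A 0 i - (z.1 - a.1) * C 0 i - (z.2 - a.2) * D 0 i| <= c1 i * sqdist a z.1 z.2.
  exact: h1.
move: (pdx F z.1 z.2) (pdy F z.1 z.2) A B C D {hyx hyy} h1 h2 => f g A B C D h1 h2.
have sq (x y : R) : `|x| <= y -> x ^+ 2 <= y ^+ 2.
  by move=> xy; rewrite -(real_normK (num_real x)) ler_pXn2r// nnegrE (le_trans _ xy).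
rewrite mulr_suml; apply: (@dot_le2 _ _ (fun i => (c1 i ^+ 2 + c2 i ^+ 2) * sqdist a z.1 z.2 ^+ 2)) => i.
have {}h1 := h1 i; have {}h2 := h2 i; rewrite mxE in h2; rewrite !mxE.
rewrite [X in _ <= X]mulrDl -!exprMn; apply: lerD; apply: sq.
  apply: le_trans h1; rewrite le_eqVlt; apply/orP; left; apply/eqP; congr `|_|; ring.
apply: le_trans h2; rewrite le_eqVlt; apply/orP; left; apply/eqP; congr `|_|; ring.
Qed.

End Isotropy.

(** * Error terms and the choice of scales *)

Section ScalarBounds.
Variable R : realType.
Implicit Types q s d c t r k : R.

(** The left-hand side is [8 c (s / d)^2 (q / d)^2] with both ratios at most 1. This gives O(1) in
    the core, [x = 1]; off the core [s / d <= s / t^2]. *)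
Lemma near_pole_bound q s d c t (x : R) : 0 <= q -> 0 < s -> d = q + s -> 0 <= c -> 0 < t ->
  x = 1 \/ (x = 0 /\ t ^+ 2 <= q) ->
  2 * ((2 * s * d ^- 2) ^+ 2 * (c * q ^+ 2)) <= 8 * c * x + 8 * c * (s / t ^+ 2) ^+ 2.
Proof.
move=> q0 s0 dE c0 t0 hx; have d0 : 0 < d by rewrite dE ltr_wpDl.
have t20 : 0 < t ^+ 2 by rewrite exprn_gt0.
have sd : 0 <= s / d by rewrite divr_ge0 ?ltW.
have qd : (q / d) ^+ 2 <= 1.
  rewrite exprn_ile1// ?divr_ge0 ?(ltW d0)// ler_pdivrMr// mul1r dE lerDl; exact: ltW.
have -> : 2 * ((2 * s * d ^- 2) ^+ 2 * (c * q ^+ 2)) = 8 * c * ((s / d) ^+ 2 * (q / d) ^+ 2).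
  by field; exact: lt0r_neq0.
rewrite -mulrDr ler_wpM2l ?mulr_ge0//.
apply: (@le_trans _ _ ((s / d) ^+ 2)); first by rewrite ler_piMr// sqr_ge0.
have [->|[-> tq]] := hx.
  by rewrite ler_wpDr ?sqr_ge0// exprn_ile1// ler_pdivrMr// mul1r dE lerDr.
rewrite add0r ler_pXn2r ?nnegrE//; first last.
  by rewrite divr_ge0// ltW.
rewrite ler_pM2l// lef_pV2// dE (le_trans tq)// lerDl; exact: ltW.
Qed.

(** Here [d >= q >= r], which leaves [s^2] as the small factor; [r] is a bound for the squared
    distance. *)
Lemma far_pole_bound q s d k r : 0 < r -> r <= q -> 0 < s -> d = q + s -> 0 <= k ->
  2 * (3 * (2 * s * d ^- 2) ^+ 2 * (1 + q) * k) <= 24 * k * s ^+ 2 * (r ^- 4 + r ^- 3).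
Proof.
move=> r0 rq s0 dE k0; have q0 := lt_le_trans r0 rq.
have d0 : 0 < d by rewrite dE addr_gt0.
have -> : 2 * (3 * (2 * s * d ^- 2) ^+ 2 * (1 + q) * k) = 24 * k * s ^+ 2 * (d ^- 4 * (1 + q)).
  by field; exact: lt0r_neq0.
have k24 : 0 <= 24 * k * s ^+ 2 by rewrite mulr_ge0 ?sqr_ge0// mulr_ge0.
rewrite ler_wpM2l//; apply: (@le_trans _ _ (q ^- 4 * (1 + q))).
  rewrite ler_wpM2r ?addr_ge0 ?(ltW q0)// lef_pV2 ?posrE ?exprn_gt0// ler_pXn2r ?nnegrE ?(ltW q0) ?(ltW d0)//.
  by rewrite dE lerDl ltW.
have -> : q ^- 4 * (1 + q) = q ^- 4 + q ^- 3 by field; exact: lt0r_neq0.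
by rewrite lerD// lef_pV2 ?posrE ?exprn_gt0// ler_pXn2r ?nnegrE ?(ltW q0) ?(ltW r0).
Qed.

(** The quadratic cutoff contributes a factor [q], absorbed by the decay [1 / d] of the squared
    field. For the logarithmic part [1 / d <= 1 / s] is used, to be paid for by the small integral
    of [g]. *)
Lemma gradient_term_bound q s d k w (g e : R) : 0 <= q -> 0 < s -> d = q + s -> 0 <= k -> 0 <= g -> 0 < w ->
  e <= 8 * q / w + g -> 6 * k * e / d <= 48 * k / w + 6 * k / s * g.
Proof.
move=> q0 s0 dE k0 g0 w0 he; have d0 : 0 < d by rewrite dE ltr_wpDl.
apply: (@le_trans _ _ (6 * k * (8 * q / w + g) / d)).
  by rewrite ler_pM2r ?invr_gt0// ler_wpM2l// mulr_ge0.
rewrite mulrDr mulrDl; apply: lerD.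
  have -> : 6 * k * (8 * q / w) / d = 48 * k / w * (q / d) by field; rewrite !lt0r_neq0.
  rewrite ler_piMr ?divr_ge0 ?mulr_ge0 ?(ltW w0)// ler_pdivrMr// mul1r dE lerDl; exact: ltW.
rewrite -[X in _ <= X]mulrA [s^-1 * g]mulrC mulrA ler_wpM2l ?mulr_ge0//.
by rewrite lef_pV2// dE lerDr.
Qed.

End ScalarBounds.

Lemma integ_indic_sub (R : realType) (D A : set (R * R)) :
  measurable (D : set (measurableTypeR R * measurableTypeR R)) ->
  measurable (A : set (measurableTypeR R * measurableTypeR R)) -> A `<=` D ->
  integ D (\1_A) = fine (@leb2 R A).
Proof. by move=> mD mA AD; rewrite /integ /leb2 /Rintegral integral_indic// setIidl. Qed.

(** The conditions serve in turn to place [s = x^6] below [rk], the square about [b] inside the disc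
    of radius [x^-2], the cutoff near 1 and its gradient near 0 on that square, and the total error
    below the gain; the last one keeps [P] off the outer circle. *)
Lemma small_scale (R : realType) (P : set (R * R)) (a : R * R) (rk gam Q c : R) :
  discrete_in_plane P -> 0 < rk -> 0 < gam -> 0 <= Q -> 0 <= c ->
  exists x : R, [/\ 0 < x < 1, x < rk, x * (Q + 1) < 1, x * (Q + 1) < rk &
  [/\ x * (8 * Q + 1) < rk ^+ 2, x * c < 4 * gam * rk ^+ 2 &
   forall p, P p -> sqdist a p.1 p.2 != ((x ^+ 2)^-1) ^+ 2]].
Proof.
move=> dP rk0 gam0 Q0 c0.
have rk20 : 0 < rk ^+ 2 by rewrite exprn_gt0.
pose t1 := rk^-1; pose t2 := (Q + 1) / rk; pose t3 := (8 * Q + 1) / rk ^+ 2; pose t4 := c / (4 * gam * rk ^+ 2).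
have t10 : 0 < t1 by rewrite invr_gt0.
have t20 : 0 <= t2 by apply: divr_ge0; [rewrite addr_ge0|exact: ltW].
have t30 : 0 <= t3 by apply: divr_ge0; [rewrite addr_ge0// mulr_ge0|exact: ltW].
have g0 : 0 < 4 * gam * rk ^+ 2 by apply: mulr_gt0 => //; exact: mulr_gt0.
have t40 : 0 <= t4 by apply: divr_ge0 => //; exact: ltW.
(* All inequalities have the form [x t < 1], so it suffices to take [x] below the inverse of the
   sum. *)
pose B0 := 1 + t1 + (Q + 1) + t2 + t3 + t4.
have B00 : 0 < B0 by rewrite /B0; lra.
(* The values of [x] for which the circle of radius [x^-2] about [a] meets [P] are the inverse
   fourth roots of the squared distances to points of [P]. *)
have cP : countable ((fun p : R * R => (Num.sqrt (Num.sqrt (sqdist a p.1 p.2)))^-1) @` P).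
  exact: sub_countable (card_image_le _ _) (discrete_countable dP).
have iB : 0 < B0^-1 by rewrite invr_gt0.
have [x /andP[x0 xB] xP] := countable_avoid cP iB.
have xB1 : x * B0 < 1 by rewrite -ltr_pdivlMr// mul1r.
have p t : 0 <= t -> 0 <= x * t by move=> ?; rewrite mulr_ge0// ltW.
have := p _ (ltW t10); have := p _ t20; have := p _ t30; have := p _ t40; have := p _ Q0.
move: xB1; rewrite /B0 !mulrDr !mulr1 => xB1 h1 h2 h3 h4 h5.
have lt1 t u : 0 < u -> x * (t / u) < 1 -> x * t < u.
  by move=> u0; rewrite mulrA ltr_pdivrMr// mul1r.
exists x; split.
- by rewrite x0; lra.
- by have := lt1 1 rk rk0; rewrite mulr1 div1r; apply; rewrite -/t1; lra.
- by rewrite mulrDr mulr1; lra.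
- by apply: lt1 => //; rewrite -/t2; lra.
- split.
  + by apply: lt1 => //; rewrite -/t3; lra.
  + by apply: lt1 => //; rewrite -/t4; lra.
  + move=> q Pq; apply/eqP => e; apply: xP; exists q => //.
    rewrite e sqrtr_sqr ger0_norm ?invr_ge0 ?sqr_ge0//.
    by rewrite -exprVn sqrtr_sqr ger0_norm ?invrK// invr_ge0 ltW.
Qed.

(** With core radius [x], smoothing [s = x^6], outer radius [x^-2] and cutoff error [x^8], the
    constant error is O(x^8) on an area O(x^-4), the core contributes O(x^2), and the logarithmic
    term is O(x^-6 x^8). All are O(x), while the gain [4 gam rk^2] is fixed. *)
Lemma final_estimate (R : realType) (CT kap kr x gam rk It Ar Ig : R) :
  0 <= CT -> 0 <= kap -> 0 <= kr -> 0 < x -> x < 1 ->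
  It <= 4 * x ^+ 2 -> Ar <= 16 * x ^- 4 -> Ig <= x ^+ 8 ->
  0 <= 8 * CT * It + (8 * CT * (x ^+ 6 / x ^+ 2) ^+ 2 + 24 * kap * (x ^+ 6) ^+ 2 * kr + 48 * kap / x ^- 8) * Ar +
    6 * kap / x ^+ 6 * Ig - gam * (4 * rk ^+ 2) ->
  4 * gam * rk ^+ 2 <= x * (160 * CT + 384 * kap * kr + 774 * kap).
Proof.
move=> CT0 kap0 kr0 x0 x1 iT aO ig fin.
have xle i j : (i <= j)%N -> x ^+ j <= x ^+ i by move=> ij; rewrite ler_wiXn2l// ltW.
have x6 : 0 < x ^+ 6 by rewrite exprn_gt0.
have kk0 : 0 <= kap * kr by rewrite mulr_ge0.
set c0 := _ + 48 * kap / _ in fin.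
have cE : c0 = 8 * CT * x ^+ 8 + 24 * (kap * kr) * x ^+ 12 + 48 * kap * x ^+ 8.
  by rewrite /c0; field; exact: lt0r_neq0.
have pos (t y : R) j : 0 <= t -> 0 <= y -> 0 <= t * y * x ^+ j.
  by move=> t0 y0; rewrite mulr_ge0 ?exprn_ge0 ?(ltW x0)// mulr_ge0.
have up (t y u v : R) : 0 <= t -> 0 <= y -> u <= v -> t * y * u <= t * y * v.
  by move=> t0 y0 uv; apply: ler_wpM2l uv; exact: mulr_ge0.
have c00 : 0 <= c0.
  by rewrite cE; have := pos 8 CT 8%N (ler0n _ _) CT0; have := pos 24 _ 12%N (ler0n _ _) kk0; have := pos 48 _ 8%N (ler0n _ _) kap0; lra.
have e1 : 8 * CT * It <= 32 * CT * x.
  apply: (@le_trans _ _ (8 * CT * (4 * x ^+ 2))); first by rewrite ler_wpM2l// mulr_ge0.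
  have -> : 8 * CT * (4 * x ^+ 2) = 32 * CT * x ^+ 2 by ring.
  exact: (up _ _ _ _ (ler0n _ _) CT0 (xle 1%N 2%N isT)).
have e2 : c0 * Ar <= 128 * CT * x + 384 * (kap * kr) * x + 768 * kap * x.
  apply: (@le_trans _ _ (c0 * (16 * x ^- 4))); first by rewrite ler_wpM2l.
  have -> : c0 * (16 * x ^- 4) = 128 * CT * x ^+ 4 + 384 * (kap * kr) * x ^+ 8 + 768 * kap * x ^+ 4.
    by rewrite cE; field; exact: lt0r_neq0.
  have x41 := xle 1%N 4%N isT; have x81 := xle 1%N 8%N isT.
  exact: lerD (lerD (up _ _ _ _ (ler0n _ _) CT0 x41) (up _ _ _ _ (ler0n _ _) kk0 x81)) (up _ _ _ _ (ler0n _ _) kap0 x41).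
have e3 : 6 * kap / x ^+ 6 * Ig <= 6 * kap * x.
  apply: (@le_trans _ _ (6 * kap / x ^+ 6 * x ^+ 8)).
    by rewrite ler_wpM2l// divr_ge0 ?(ltW x6)// mulr_ge0.
  have -> : 6 * kap / x ^+ 6 * x ^+ 8 = 6 * kap * x ^+ 2 by field; exact: lt0r_neq0.
  exact: (up _ _ _ _ (ler0n _ _) kap0 (xle 1%N 2%N isT)).
have -> : x * (160 * CT + 384 * kap * kr + 774 * kap) =
  32 * CT * x + (128 * CT * x + 384 * (kap * kr) * x + 768 * kap * x) + 6 * kap * x by ring.
have -> : 4 * gam * rk ^+ 2 = gam * (4 * rk ^+ 2) by ring.
by move: (gam * _) (8 * CT * It) (c0 * Ar) (6 * kap / _ * Ig) fin e1 e2 e3 => *; lra.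
Qed.

Lemma sum_bound (R : realType) (t1 t2 t3 u v w c1 c2 : R) : t1 <= u + c1 -> t2 <= c2 + v -> t3 <= - w ->
  t1 + t2 + t3 <= u + (c1 + c2) + v - w.
Proof. lra. Qed.

Section IsotropyProof.
Variables (R : realType) (n : nat) (P : set (R * R)) (F : R -> R -> 'rV[R]_n).
Hypotheses (dP : discrete_in_plane P) (bF : branched_minimal_immersion (~` P) F) (stF : stable (~` P) F).
Local Notation mu2 := ((@lebesgue_measure R) \x (@lebesgue_measure R))%E.
Local Notation RR := (measurableTypeR R * measurableTypeR R)%type.
Let S := ~` P.
Let oS : open S := open_setC_discrete dP.
Let sF : smooth_on S F. Proof. by case: bF => _ []. Qed.

Variables (a b : R * R) (r k l gam rk Q CT : R).
Hypotheses (r0 : 0 < r) (rk0 : 0 < rk) (gam0 : 0 < gam) (CT0 : 0 <= CT) (Q0 : 0 <= Q).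
Let A := pdx F a.1 a.2.
Let B := pdy F a.1 a.2.
Let C := pdx (pdx F) a.1 a.2.
Let D := pdy (pdx F) a.1 a.2.
Hypothesis taylor : forall z, square a r z ->
    dot (pdx F z.1 z.2 - (A + (z.1 - a.1) *: C + (z.2 - a.2) *: D)) (pdx F z.1 z.2 - (A + (z.1 - a.1) *: C + (z.2 - a.2) *: D)) +
    dot (pdy F z.1 z.2 - (B + (z.1 - a.1) *: D - (z.2 - a.2) *: C)) (pdy F z.1 z.2 - (B + (z.1 - a.1) *: D - (z.2 - a.2) *: C))
    <= CT * sqdist a z.1 z.2 ^+ 2.
Hypothesis coupl : forall z s e ex ey, square b rk z -> `|s| < rk -> `|e - 1| < rk -> `|ex| < rk -> `|ey| < rk ->
    coupling F a A B C D k l z.1 z.2 s e ex ey < - gam.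
Hypothesis KP : forall z p, square b rk z -> P p -> rk ^+ 2 <= sqdist p z.1 z.2.
Hypothesis KQ : forall z, square b rk z -> sqdist a z.1 z.2 <= Q.

Let kap := mass A B C D.
Let kr := (r ^+ 2) ^- 4 + (r ^+ 2) ^- 3.

Lemma sqdist_notin_square (p z : R * R) (t : R) : 0 < t -> ~ square p t z -> t ^+ 2 <= sqdist p z.1 z.2.
Proof. by move=> t0 nz; rewrite leNgt; apply/negP => h; apply: nz; exact: sqdist_lt_square. Qed.

(** Inside the square about [a] the coefficient [c] absorbs the d-bar derivative up to the Taylor
    remainder; outside [c] is 0 and the d-bar derivative is itself of order [s]. The indicator marks
    the core, where the bound is only O(1) but the area is small. *)
Lemma energy_pointwise z (s t c : R) : S z -> 0 < s -> 0 < t ->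
  (c = 2 * s * den a s z.1 z.2 ^- 2 /\ square a r z) \/ (c = 0 /\ ~ square a r z) ->
  forall U V, U = (2 * s * den a s z.1 z.2 ^- 2) *: (A + (z.1 - a.1) *: C + (z.2 - a.2) *: D) ->
  V = (2 * s * den a s z.1 z.2 ^- 2) *: ((z.2 - a.2) *: C - (z.1 - a.1) *: D - B) ->
  2 * (dot (U - c *: pdx F z.1 z.2) (U - c *: pdx F z.1 z.2) + dot (V + c *: pdy F z.1 z.2) (V + c *: pdy F z.1 z.2)) <=
  8 * CT * \1_(square a t) z + (8 * CT * (s / t ^+ 2) ^+ 2 + 24 * kap * s ^+ 2 * kr).
Proof.
move=> Sz s0 t0 hc U V -> ->.
have alg (u v w x : 'rV[R]_n) : u - v - w + x = x - (w + v - u) by apply/rowP => i; rewrite !mxE; ring.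
have q0 := sqdist_ge0 a z.1 z.2.
have alg2 (h u v : R) : 2 * (h * (h * u) + h * (h * v)) = 2 * (h ^+ 2 * (u + v)) by ring.
have kap0 : 0 <= kap := mass_ge0 A B C D.
have kr0 : 0 <= kr by rewrite /kr addr_ge0// invr_ge0 exprn_ge0// sqr_ge0.
have T1 : 0 <= 24 * kap * s ^+ 2 * kr by apply: mulr_ge0 kr0; apply: mulr_ge0 (sqr_ge0 s); exact: mulr_ge0.
have T2 : 0 <= 8 * CT * (s / t ^+ 2) ^+ 2 by apply: mulr_ge0 (sqr_ge0 _); exact: mulr_ge0.
have T3 : 0 <= 8 * CT * \1_(square a t) z :> R by apply: mulr_ge0 => //; exact: mulr_ge0.
case: hc => [[cE Dz]|[cE nDz]]; rewrite cE.
  set h := 2 * s * _; have tz := taylor Dz.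
  have -> : h *: (A + (z.1 - a.1) *: C + (z.2 - a.2) *: D) - h *: pdx F z.1 z.2 =
      - (h *: (pdx F z.1 z.2 - (A + (z.1 - a.1) *: C + (z.2 - a.2) *: D))).
    by rewrite -scalerBr -scalerN opprB.
  have -> : h *: ((z.2 - a.2) *: C - (z.1 - a.1) *: D - B) + h *: pdy F z.1 z.2 =
      h *: (pdy F z.1 z.2 - (B + (z.1 - a.1) *: D - (z.2 - a.2) *: C)).
    by rewrite -scalerDr alg.
  rewrite !dotNl !dotNr opprK !dotZl !dotZr alg2.
  apply: (@le_trans _ _ (2 * (h ^+ 2 * (CT * sqdist a z.1 z.2 ^+ 2)))).
    by rewrite ler_pM2l// ler_wpM2l// sqr_ge0.
  apply: (@le_trans _ _ (8 * CT * \1_(square a t) z + 8 * CT * (s / t ^+ 2) ^+ 2)); last by rewrite addrA lerDl.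
  apply: (@near_pole_bound R (sqdist a z.1 z.2) s (den a s z.1 z.2)) => //.
  rewrite indicE; have [zt|zt] := pselect (square a t z); first by rewrite mem_set//; left.
  by right; rewrite memNset//; split=> //; exact: sqdist_notin_square.
rewrite (scale0r (pdx F z.1 z.2)) (scale0r (pdy F z.1 z.2)) subr0 addr0.
have := @dbar_bound _ _ A B C D (z.1 - a.1) (z.2 - a.2) (2 * s * den a s z.1 z.2 ^- 2).
rewrite -(ler_pM2l (ltr0n R 2)) => /le_trans; apply.
have := @far_pole_bound R (sqdist a z.1 z.2) s (den a s z.1 z.2) kap (r ^+ 2) (exprn_gt0 _ r0) (sqdist_notin_square r0 nDz) s0 erefl kap0.
by move=> h; apply: (le_trans h); rewrite addrA lerDr addr_ge0.
Qed.

Lemma isotropy_contradiction : False.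
Proof.
have kap0 : 0 <= kap := mass_ge0 A B C D.
have kr0 : 0 <= kr by rewrite /kr addr_ge0// invr_ge0 exprn_ge0// sqr_ge0.
pose ctot := 160 * CT + 384 * kap * kr + 774 * kap.
have ctot0 : 0 <= ctot.
  exact: addr_ge0 (addr_ge0 (mulr_ge0 (ler0n _ _) CT0) (mulr_ge0 (mulr_ge0 (ler0n _ _) kap0) kr0)) (mulr_ge0 (ler0n _ _) kap0).
have [x [/andP[x0 x1] xrk xQ1 xQrk [xQ2 xc xP]]] := small_scale a dP rk0 gam0 Q0 ctot0.
have x20 : 0 < x ^+ 2 by rewrite exprn_gt0.
have xle i j : (i <= j)%N -> x ^+ j <= x ^+ i by move=> ij; rewrite ler_wiXn2l// ltW.
have rk20 : 0 < rk ^+ 2 by rewrite exprn_gt0.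
pose Rr := (x ^+ 2)^-1.
have R0 : 0 < Rr by rewrite invr_gt0.
have R2 : Rr ^+ 2 = x ^- 4 by rewrite /Rr exprVn -exprM.
have R4 : Rr ^+ 4 = x ^- 8 by rewrite /Rr exprVn -exprM.
have x80 : 0 < x ^+ 8 by rewrite exprn_gt0.
have [Om [rho [eta [g [dom [seta eta0] etaB [bg ig] KOm]]]]] :=
  punctured_disc_cutoff dP R0 xP rk20 x80.
have [cOm [OmS _]] := dom; have [mOm fOm] := (compact_measurable2 cOm, compact_mu2_finite cOm).
pose s := x ^+ 6.
have s0 : 0 < s by rewrite exprn_gt0.
have s1 : s <= 1 by rewrite exprn_ile1// ltW.
have KOm' z : square b rk z -> [/\ Om z, 1 - eta z.1 z.2 <= sqdist a z.1 z.2 / Rr ^+ 2 + x ^+ 8 & g z <= x ^+ 8].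
  move=> hz; apply: KOm; last by move=> p; exact: KP.
  apply: (le_trans (KQ hz)); rewrite R2; apply: (@le_trans _ _ (x^-1)).
    by rewrite -[x^-1]mul1r ler_pdivlMr//; move: xQ1; rewrite mulrDr mulr1 mulrC; lra.
  by rewrite lef_pV2 ?posrE ?exprn_gt0//; exact: (xle 1%N 4%N).
have [sW1 sW2] := test_smooth a A B C D oS s0 seta.
(* The real factor that matches the d-bar derivative of the test field with [phi] near [a],
   multiplied by the cutoff like the field itself and jumping to 0 outside the square where the
   Taylor formula holds. *)
pose h z := eta z.1 z.2 * (2 * s * den a s z.1 z.2 ^- 2 * \1_(square a r) z).
pose kk z := k * \1_(square b rk) z; pose ll z := l * \1_(square b rk) z.
have bk (c : R) : bmf Om (fun z => c * \1_(square b rk) z).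
  exact: bmfM (bmf_cst _ _) (bmf_indic _ (square_measurable _ _)).
have bh : bmf Om h.
  have sd : smooth_on S (den a s) by exact: (add_smooth oS (sqdist_smooth a oS) (cst_smooth s oS)).
  have sd2 := inv_smooth oS (mul_smooth oS sd sd) (fun z _ => lt0r_neq0 (mulr_gt0 (den_gt0 a s0 z.1 z.2) (den_gt0 a s0 z.1 z.2))).
  have b1 := smooth_bmf oS cOm OmS seta; have b2 := smooth_bmf oS cOm OmS sd2.
  exact: (bmfM b1 (bmfM (bmfM (bmf_cst Om (2 * s)) b2) (bmf_indic Om (square_measurable a r)))).
have W10 z : Om z -> rho z.1 z.2 = 0 -> test1 a s A B C eta z.1 z.2 = 0.
  by move=> Oz /(eta0 z Oz) e; rewrite /test1 e scale0r.
have W20 z : Om z -> rho z.1 z.2 = 0 -> test2 a s A B D eta z.1 z.2 = 0.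
  by move=> Oz /(eta0 z Oz) e; rewrite /test2 e scale0r.
have [bp pos] := pair_inequality oS bF stF dom sW1 sW2 W10 W20 bh (bk k) (bk l).
pose c0 := 8 * CT * (s / x ^+ 2) ^+ 2 + 24 * kap * s ^+ 2 * kr + 48 * kap / Rr ^+ 4.
(* A pointwise majorant of the pair form: the core, a constant small against the area, the
   logarithmic gradients, and the gain on the square about [b]. *)
pose f z := 8 * CT * \1_(square a x) z + c0 + 6 * kap / s * g z - gam * \1_(square b rk) z.
have bt : bmf Om (fun z => 8 * CT * \1_(square a x) z).
  exact: bmfM (bmf_cst _ _) (bmf_indic _ (square_measurable _ _)).
have bG : bmf Om (fun z => 6 * kap / s * g z) by exact: bmfM (bmf_cst _ _) bg.
have b3 := bmfD bt (bmf_cst Om c0); have b4 := bmfD b3 bG.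
have bf : bmf Om f by exact: (bmfB b4 (bk gam)).
have hf : forall z, Om z -> pair_form F (test1 a s A B C eta) (test2 a s A B D eta) h kk ll z <= f z.
  move=> z Oz; have Sz := OmS z Oz; have [za e01 g0 grad] := etaB z Oz.
  have xx : (\1_(square b rk) z : R) * \1_(square b rk) z = \1_(square b rk) z.
    by rewrite indicE; case: (z \in _); rewrite ?mulr1 ?mulr0.
  have tp := @test_pair_form R n S F a s A B C D eta oS s0 s1 seta z h kk ll
    (2 * s * den a s z.1 z.2 ^- 2 * \1_(square a r) z) (\1_(square b rk) z) k l Sz erefl erefl erefl xx e01.
  have [eP eQ _ _] := sfield_dbar a A B C D s0 z.
  have hc : (2 * s * den a s z.1 z.2 ^- 2 * \1_(square a r) z = 2 * s * den a s z.1 z.2 ^- 2 /\ square a r z) \/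
      (2 * s * den a s z.1 z.2 ^- 2 * \1_(square a r) z = 0 /\ ~ square a r z).
    rewrite indicE; have [zt|zt] := pselect (square a r z); first by rewrite mem_set// mulr1; left.
    by rewrite memNset// mulr0; right.
  have ep := energy_pointwise Sz s0 x0 hc eP eQ.
  have gt := gradient_term_bound (sqdist_ge0 a z.1 z.2) s0 (erefl (den a s z.1 z.2)) kap0 g0
    (exprn_gt0 4 R0) grad.
  have cp : \1_(square b rk) z * coupling F a A B C D k l z.1 z.2 s (eta z.1 z.2) (pdx eta z.1 z.2) (pdy eta z.1 z.2) <=
      - (gam * \1_(square b rk) z).
    rewrite indicE; have [zt|zt] := pselect (square b rk z); last by rewrite memNset// mul0r mulr0 oppr0.
    rewrite mem_set// mul1r mulr1; apply: ltW.
    have [_ eb gb] := KOm' z zt; have qQ := KQ zt.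
    have small (u : R) : u ^+ 2 <= pdx eta z.1 z.2 ^+ 2 + pdy eta z.1 z.2 ^+ 2 -> `|u| < rk.
      move=> hu; rewrite -(ltr_pXn2r (n := 2)) ?nnegrE ?(ltW rk0)// real_normK ?num_real//.
      apply: (le_lt_trans (le_trans hu grad)); apply: le_lt_trans xQ2.
      have -> : x * (8 * Q + 1) = 8 * Q * x + x by ring.
      rewrite R4 invrK; apply: lerD; last exact: (le_trans gb (xle 1%N 8%N isT)).
      apply: (@le_trans _ _ (8 * Q * x ^+ 8)); first by rewrite ler_wpM2r ?(ltW x80)// ler_wpM2l.
      by rewrite ler_wpM2l ?mulr_ge0//; exact: (xle 1%N 8%N).
    apply: coupl => //.
    - by rewrite ger0_norm ?(ltW s0)//; apply: le_lt_trans xrk; exact: (xle 1%N 6%N).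
    - have /andP[e0 e1] := e01; rewrite distrC ger0_norm ?subr_ge0//.
      apply: (le_lt_trans eb); apply: le_lt_trans xQrk; have -> : x * (Q + 1) = Q * x + x by ring.
      rewrite R2 invrK; apply: lerD; last exact: (xle 1%N 8%N).
      apply: (@le_trans _ _ (Q * x ^+ 4)); first by rewrite ler_wpM2r// ltW// exprn_gt0.
      by rewrite ler_wpM2l//; exact: (xle 1%N 4%N).
    - by apply: small; rewrite lerDl sqr_ge0.
    - by apply: small; rewrite lerDr sqr_ge0.
  apply: (le_trans tp); rewrite /f /c0.
  exact: sum_bound ep gt cp.
have fin := le_trans pos (le_integ mOm fOm bp bf hf).
rewrite (integB mOm fOm b4 (bk gam)) (integD mOm fOm b3 bG) (integD mOm fOm bt (bmf_cst Om c0)) in fin.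
rewrite (integ_cst mOm) (integZ mOm fOm _ bg) in fin.
rewrite !(integZ mOm fOm _ (bmf_indic _ (square_measurable _ _))) in fin.
have iK : integ Om (\1_(square b rk)) = 4 * rk ^+ 2.
  rewrite (integ_indic_sub mOm (square_measurable b rk)); last by move=> z /KOm'[].
  by rewrite /leb2 mu2_square.
have iT : integ Om (\1_(square a x)) <= 4 * x ^+ 2.
  have h1 : (mu2 (square a x : set RR) < +oo)%E by rewrite mu2_square// ltry.
  by have := integ_indic mOm (square_measurable a x) h1; rewrite mu2_square.
have aO : area_of Om <= 16 * Rr ^+ 2.
  by apply: (area_of_disc (a := a) R0 mOm) => z /etaB[].
rewrite iK /c0 R4 in fin; rewrite R2 in aO.
by have := final_estimate CT0 kap0 kr0 x0 x1 iT aO ig fin; rewrite leNgt xc.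
Qed.

End IsotropyProof.

Lemma lt_half (R : realType) (v : R) : v < 0 -> v < - (- v / 2).
Proof. by move=> v0; lra. Qed.

Lemma square_overlap (R : realType) (b p z : R * R) (r s : R) : r <= s / 2 ->
  square b r z -> square p r z -> square b s p.
Proof.
move=> rs [z1 z2] [p1 p2].
by split; [move: z1 p1|move: z2 p2]; rewrite !ltr_norml => /andP[? ?] /andP[? ?]; apply/andP; split; lra.
Qed.

Lemma sqdist_square_bound (R : realType) (a b z : R * R) (r : R) : square b r z ->
  sqdist a z.1 z.2 <= 4 * r ^+ 2 + 2 * sqdist a b.1 b.2.
Proof.
move=> [z1 z2].
have sq (x y w : R) : `|x - y| < r -> (x - w) * (x - w) <= 2 * r ^+ 2 + 2 * ((y - w) * (y - w)).
  move=> h; have r0 : 0 < r by rewrite (le_lt_trans _ h).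
  have : `|x - y| ^+ 2 <= r ^+ 2 by rewrite ler_pXn2r ?nnegrE ?(ltW r0)// ltW.
  rewrite real_normK ?num_real// => h2; have := sqr_ge0 ((x - y) - (y - w)); nra.
have := sq _ _ a.1 z1; have := sq _ _ a.2 z2; rewrite /sqdist; lra.
Qed.

Section IsotropyTheorem.
Variables (R : realType) (n : nat) (P : set (R * R)) (F : R -> R -> 'rV[R]_n).
Hypotheses (dP : discrete_in_plane P) (bF : branched_minimal_immersion (~` P) F) (stF : stable (~` P) F).
Let S := ~` P.
Let oS : open S := open_setC_discrete dP.
Let sF : smooth_on S F. Proof. by case: bF => _ []. Qed.

Theorem stable_isotropic a b : S a -> S b ->
  dot (pdx F a.1 a.2) (pdx F b.1 b.2) = dot (pdy F a.1 a.2) (pdy F b.1 b.2) /\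
  dot (pdx F a.1 a.2) (pdy F b.1 b.2) + dot (pdy F a.1 a.2) (pdx F b.1 b.2) = 0.
Proof.
move=> Sa Sb; have [<-|ab] := eqVneq b a.
  have [h1 h2] := bF.2.2.2 b Sb.
  have h3 : dot (pdy F b.1 b.2) (pdx F b.1 b.2) = 0 by apply: etrans (dotC _ _) h2.
  by split; [exact: h1|apply: etrans (congr2 +%R h2 h3) _; exact: addr0].
set A := pdx F a.1 a.2; set B := pdy F a.1 a.2.
pose C := pdx (pdx F) a.1 a.2; pose D := pdy (pdx F) a.1 a.2.
have [hne|] := boolP ((dot A (pdx F b.1 b.2) != dot B (pdy F b.1 b.2)) ||
  (dot A (pdy F b.1 b.2) + dot B (pdx F b.1 b.2) != 0)); last first.
  by rewrite negb_or !negbK => /andP[/eqP h1 /eqP h2]; split; [exact: h1|exact: h2].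
exfalso.
have [k [l kl]] := coupling_negative C D ab hne.
set v := coupling F a A B C D k l b.1 b.2 0 1 0 0 in kl.
pose gam := - v / 2.
have gam0 : 0 < gam by apply: divr_gt0; [rewrite oppr_gt0; exact: kl|exact: ltr0n].
have vg : v < - gam by exact: lt_half kl.
have [r1 r10 near] := coupling_near sF Sb ab vg.
have [r0 r00 r0S] := open_square oS Sa; have [r2 r20 r2S] := open_square oS Sb.
have [CT CT0 tay] := taylor_gradient dP bF r00 r0S.
(* The half of [r2] ensures that a point of [P] within [rk] of the square about [b] would lie within
   [r2] of [b], where there is none. *)
pose rk := Num.min r1 (r2 / 2).
have rk0 : 0 < rk by rewrite lt_min r10/=; apply: divr_gt0; [exact: r20|exact: ltr0n].
have rk1 : rk <= r1 by rewrite ge_min lexx.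
have rk2 : rk <= r2 / 2 by rewrite ge_min lexx orbT.
have r000 : 0 < r0 / 2 by apply: divr_gt0; [exact: r00|exact: ltr0n].
have KP z p : square b rk z -> P p -> rk ^+ 2 <= sqdist p z.1 z.2.
  move=> zb Pp; apply: (sqdist_notin_square rk0) => zp.
  exact: (r2S p (square_overlap rk2 zb zp) Pp).
have KQ z : square b rk z -> sqdist a z.1 z.2 <= 4 * rk ^+ 2 + 2 * sqdist a b.1 b.2.
  exact: sqdist_square_bound.
have Q0 : 0 <= 4 * rk ^+ 2 + 2 * sqdist a b.1 b.2.
  exact: addr_ge0 (mulr_ge0 (ler0n _ _) (sqr_ge0 _)) (mulr_ge0 (ler0n _ _) (sqdist_ge0 _ _ _)).
have coupl z s e ex ey : square b rk z -> `|s| < rk -> `|e - 1| < rk -> `|ex| < rk -> `|ey| < rk ->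
    coupling F a A B C D k l z.1 z.2 s e ex ey < - gam.
  move=> [z1 z2] h1 h2 h3 h4; apply: near; [split| | | |]; by apply: (lt_le_trans _ rk1).
exact: (isotropy_contradiction dP bF stF r000 rk0 gam0 CT0 Q0 tay coupl KP KQ).
Qed.

End IsotropyTheorem.

(** * The orthogonal complex structure on the span of the gradients *)

Section IsotropicSpan.
Variables (R : realType) (n : nat) (T : Type) (S : set T) (f g : T -> 'rV[R]_n).
Hypothesis iso : forall a b, S a -> S b ->
  dot (f a) (f b) = dot (g a) (g b) /\ dot (f a) (g b) + dot (g a) (f b) = 0.

Section Family.
Variables (m : nat) (q : 'I_m -> T).
Hypothesis Sq : forall i, S (q i).
Let X := \matrix_(i < m) f (q i).
Let Y := \matrix_(i < m) g (q i).
Definition spanB := col_mx X Y.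
Definition spanC := col_mx Y (- X).

Let rowdot (h h' : T -> 'rV[R]_n) i j :
  ((\matrix_(i < m) h (q i)) *m (\matrix_(i < m) h' (q i))^T) i j = dot (h (q i)) (h' (q j)).
Proof. by rewrite !mxE; apply: eq_bigr => k _; rewrite !mxE. Qed.

(** The rows of [spanC] are the prescribed images of those of [spanB] under [f |-> g], [g |-> - f].
    Isotropy says that both families have the same Gram matrix, so the assignment respects linear
    relations and is isometric. *)
Lemma span_gram : spanB *m spanB^T = spanC *m spanC^T.
Proof.
have e1 : X *m X^T = Y *m Y^T by apply/matrixP => i j; rewrite !rowdot (iso (Sq i) (Sq j)).1.
have e2 : X *m Y^T = - (Y *m X^T).
  by apply/matrixP => i j; rewrite rowdot [RHS]mxE rowdot; apply/eqP; rewrite -addr_eq0 (iso (Sq i) (Sq j)).2.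
rewrite /spanB /spanC !tr_col_mx !mul_col_row linearN/= !mulmxN !mulNmx e1 e2 opprK.
by rewrite -e2 opprK.
Qed.

Lemma span_cross a : S a -> f a *m spanB^T = g a *m spanC^T.
Proof.
move=> Sa; rewrite /spanB /spanC !tr_col_mx !mul_mx_row linearN/= mulmxN.
have rd (h h' : T -> 'rV[R]_n) j : (h a *m (\matrix_(i < m) h' (q i))^T) 0 j = dot (h a) (h' (q j)).
  by rewrite !mxE; apply: eq_bigr => k _; rewrite !mxE.
congr row_mx; apply/rowP => j.
  by rewrite !rd (iso Sa (Sq j)).1.
by rewrite rd [RHS]mxE rd; apply/eqP; rewrite -addr_eq0 (iso Sa (Sq j)).2.
Qed.

(** The squared distance between [g a] and [u *m spanC] is expanded by the Gram identities and
    vanishes; [a] may lie outside the chosen family. *)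
Lemma span_image a (u : 'rV[R]_(m + m)) : S a -> f a = u *m spanB -> g a = u *m spanC.
Proof.
move=> Sa e; apply/eqP; rewrite -subr_eq0 -dot_eq0 dotBl !dotBr.
have -> : dot (g a) (g a) = dot (f a) (f a) by rewrite (iso Sa Sa).1.
have cr : dot (g a) (u *m spanC) = dot (f a) (f a).
  by rewrite dotE trmx_mul mulmxA -span_cross// -mulmxA -trmx_mul -e -dotE.
have cc : dot (u *m spanC) (u *m spanC) = dot (f a) (f a).
  by rewrite dotE trmx_mul mulmxA -(mulmxA u) -span_gram mulmxA -mulmxA -trmx_mul -e -dotE.
rewrite (dotC (u *m spanC)) cr cc.
by rewrite !subrr.
Qed.

Lemma span_kernel k (u : 'M[R]_(k, m + m)) : u *m spanB = 0 -> u *m spanC = 0.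
Proof.
move=> e; apply/row_matrixP => i; rewrite row0 row_mul.
have ei : row i u *m spanB = 0 by rewrite -row_mul e row0.
apply/eqP; rewrite -dot_eq0 dotE trmx_mul mulmxA -(mulmxA (row i u)) -span_gram mulmxA ei mul0mx mul0mx.
by rewrite mxE.
Qed.

(** The pseudoinverse picks some coefficients of a vector with respect to the rows of [spanB]; by
    [span_kernel] the image of a vector of the span does not depend on this choice. *)
Definition spanJ := pinvmx spanB *m spanC.

Lemma spanJE k (u : 'M[R]_(k, m + m)) : u *m spanB *m spanJ = u *m spanC.
Proof.
apply/eqP; rewrite -subr_eq0 /spanJ mulmxA -mulmxBl; apply/eqP; apply: span_kernel.
by rewrite mulmxBl mulmxKpV ?subrr// submxMl.
Qed.

Lemma spanC_sub : exists K : 'M[R]_(m + m), spanC = K *m spanB /\ K *m spanC = - spanB.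
Proof.
exists (block_mx 0 1%:M (- 1%:M) 0); rewrite /spanB /spanC !mul_block_col !mul0mx !mulNmx !mul1mx !(addr0, add0r).
by split=> //; rewrite opp_col_mx.
Qed.

Lemma spanJ_structure (w w' : 'rV[R]_n) : (w <= spanB)%MS -> (w' <= spanB)%MS ->
  [/\ (w *m spanJ <= spanB)%MS, w *m spanJ *m spanJ = - w & dot (w *m spanJ) (w' *m spanJ) = dot w w'].
Proof.
move=> /submxP[u ->] /submxP[u' ->]; have [K [KC KB]] := spanC_sub; rewrite !spanJE; split.
- by rewrite KC mulmxA submxMl.
- by rewrite {1}KC mulmxA spanJE -mulmxA KB mulmxN.
- by rewrite !dotE !trmx_mul !mulmxA -(mulmxA u) -span_gram mulmxA.
Qed.

(** In a basis of the row space [J] becomes a real square matrix [j] with [j^2 = -1]; for an odd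
    size the square of its determinant would be -1. *)
Lemma spanB_even : ~~ odd (\rank spanB).
Proof.
move: (row_base spanB) (eq_row_base spanB) (row_base_free spanB) => b bB fb.
have sub : (b *m spanJ <= b)%MS.
  apply/row_subP => i; rewrite row_mul bB.
  have h : (row i b <= spanB)%MS by rewrite -bB row_sub.
  by have [] := spanJ_structure h h.
have [j jE] := submxP sub.
have jj : j *m j = - 1%:M.
  apply: (row_free_inj fb); rewrite -mulmxA -jE mulmxA -jE mulNmx mul1mx.
  apply/row_matrixP => i; rewrite !row_mul [row i (- b)]linearN/=.
  have h : (row i b <= spanB)%MS by rewrite -bB row_sub.
  have [_ e _] := spanJ_structure h h; exact: e.
apply/negP => od; have : \det (j *m j) = -1.
  by rewrite jj -scaleN1r detZ det1 mulr1 -signr_odd od.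
rewrite det_mulmx => h; have := sqr_ge0 (\det j); rewrite expr2 h.
by rewrite oppr_ge0 ler10.
Qed.

End Family.

(** A finite family whose span has the largest rank, which is at most [n]: adjoining a further point
    cannot enlarge the row space. *)
Lemma maximal_family : exists (m : nat) (q : 'I_m -> T), (forall i, S (q i)) /\
  forall a, S a -> (f a <= spanB q)%MS /\ (g a <= spanB q)%MS.
Proof.
pose Q r := `[< exists (m : nat) (q : 'I_m -> T), (forall i, S (q i)) /\ \rank (spanB q) = r >].
have exQ : exists r, Q r.
  exists 0%N; apply/asboolP; exists 0%N.
  have q0 : 'I_0 -> T by case.
  by exists q0; split=> [[]//|]; apply/eqP; rewrite -leqn0 (leq_trans (rank_leq_row _)).
have bQ r : Q r -> (r <= n)%N by move=> /asboolP[m [q [_ <-]]]; exact: rank_leq_col.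
have [r /asboolP[m [q [Sq rE]]] rmax] := ex_maxnP exQ bQ.
exists m, q; split=> // a Sa.
pose q' (i : 'I_m.+1) := if unlift ord0 i is Some j then q j else a.
have Sq' i : S (q' i) by rewrite /q'; case: unlift.
have q'0 : q' ord0 = a by rewrite /q' unlift_none.
have q'l i : q' (lift ord0 i) = q i by rewrite /q' liftK.
have rX (h : T -> 'rV[R]_n) k (p : 'I_k -> T) i : row i (\matrix_(j < k) h (p j)) = h (p i) by rewrite rowK.
have subX k (p : 'I_k -> T) : (\matrix_(j < k) f (p j) <= spanB p)%MS /\ (\matrix_(j < k) g (p j) <= spanB p)%MS.
  by rewrite /spanB; split; [rewrite -addsmxE addsmxSl|rewrite -addsmxE addsmxSr].
have fS k (p : 'I_k -> T) i : (f (p i) <= spanB p)%MS.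
  by rewrite -(rX f); apply: submx_trans (subX _ p).1; exact: row_sub.
have gS k (p : 'I_k -> T) i : (g (p i) <= spanB p)%MS.
  by rewrite -(rX g); apply: submx_trans (subX _ p).2; exact: row_sub.
have BB : (spanB q <= spanB q')%MS.
  rewrite {1}/spanB col_mx_sub; apply/andP; split; apply/row_subP => i; rewrite rowK -q'l; [exact: fS|exact: gS].
have le : (\rank (spanB q') <= \rank (spanB q))%N.
  by rewrite rE; apply: rmax; apply/asboolP; exists m.+1, q'.
have B'B : (spanB q' <= spanB q)%MS by rewrite -(geq_leqif (mxrank_leqif_sup BB)).
by rewrite -q'0; split; apply: submx_trans B'B; [exact: fS|exact: gS].
Qed.

End IsotropicSpan.

Section StableHolomorphic.
Variables (R : realType) (n : nat) (P : set (R * R)) (F : R -> R -> 'rV[R]_n).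
Hypotheses (dP : discrete_in_plane P) (bF : branched_minimal_immersion (~` P) F).

Lemma stable_holomorphic : stable (~` P) F -> holomorphic_up_to_rigid_motion (~` P) F.
Proof.
move=> stF; have oS := open_setC_discrete dP.
have sF : smooth_on (~` P) F by case: bF => _ [].
pose f (z : R * R) : 'rV[R]_n := pdx F z.1 z.2; pose g (z : R * R) : 'rV[R]_n := pdy F z.1 z.2.
have iso a b : (~` P) a -> (~` P) b ->
    dot (f a) (f b) = dot (g a) (g b) /\ dot (f a) (g b) + dot (g a) (f b) = 0.
  exact: stable_isotropic dP bF stF a b.
have [m [q [Sq sub]]] := maximal_family (~` P) f g.
have [[q0 [_ [Sq0 _]]] _] := bF.
set B := spanB f g q in sub.
(* The brackets replace [B], which has [m + m] rows, by a square matrix with the same row space, as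
   the definition prescribes. *)
exists (F q0.1 q0.2), <<B>>%MS, (spanJ f g q); split; [|split; [|split; [|split]]].
- by rewrite genmxE; exact: (spanB_even iso Sq).
(* Membership in the row space means being killed by the cokernel; the coordinates of [F] times the
   cokernel have zero gradient, hence are constant off [P]. *)
- move=> z Sz; rewrite genmxE submxE mulmxBl subr_eq0; apply/eqP/rowP => j.
  have [sG dG] := mulmx_smooth (cokermx B) oS sF.
  have z0 : (0 : 'rV[R]_n) 0 j = 0 by rewrite mxE.
  have grad w : (~` P) w -> pdx (fun x y => (F x y *m cokermx B) 0 j) w.1 w.2 = 0 /\
      pdy (fun x y => (F x y *m cokermx B) 0 j) w.1 w.2 = 0.
    move=> Sw; have [_ e1 e2] := regular_coord (smooth_on_regular sG Sw) j.
    have [e3 e4] := dG w Sw; have [] := sub w Sw; rewrite !submxE => /eqP h1 /eqP h2.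
    split; [apply: (etrans e1); rewrite e3|apply: (etrans e2); rewrite e4].
      exact: etrans (congr1 (fun v : 'rV[R]_n => v 0 j) h1) z0.
    exact: etrans (congr1 (fun v : 'rV[R]_n => v 0 j) h2) z0.
  exact: (zero_gradient_constant dP (smooth_coord oS sG j) grad Sz Sq0).
- by move=> w; rewrite genmxE => h; have [] := spanJ_structure iso Sq h h; rewrite genmxE.
- by move=> w w'; rewrite !genmxE => h h'; have [] := spanJ_structure iso Sq h h'.
- move=> z Sz; have [u e] := submxP (sub z Sz).1.
  apply: (etrans (span_image iso Sq Sz e)); rewrite -(spanJE iso Sq).
  by congr (_ *m _); exact/esym.
Qed.

End StableHolomorphic.

(** * Differentiation of the area *)

Section DerivInteg.
Variables (R : realType) (D : set (R * R)).
Local Notation RR := (measurableTypeR R * measurableTypeR R)%type.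
Local Notation mu2 := ((@lebesgue_measure R) \x (@lebesgue_measure R))%E.
Hypotheses (mD : measurable (D : set RR)) (fD : (mu2 D < +oo)%E).

Lemma is_derive_quotient (f : R -> R) (t d : R) :
  is_derive t (1 : R) f d <-> h^-1 * (f (t + h) - f t) @[h --> (0 : R)^'] --> d.
Proof.
have e : (fun h : R => h^-1 *: ((f \o shift t) (h *: 1) - f t)) = (fun h => h^-1 * (f (t + h) - f t)).
  by apply/funext => h; rewrite /= /GRing.scale/= mulr1 (addrC h).
split=> [df|cv].
  have /cvg_ex[l cl] := @ex_derive _ _ _ _ _ _ _ df.
  have el : l = d by rewrite -(@derive_val _ _ _ _ _ _ _ df); apply/esym/cvg_lim.
  by rewrite -el -e.
rewrite -e in cv; have dv : derivable f t 1 by apply/cvg_ex; exists d.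
by apply: DeriveDef => //; apply: cvg_lim.
Qed.

(** Dominated convergence of the difference quotients at [t0]: the Lipschitz bound compares with
    [t0] only, and the derivative is required almost everywhere. *)
Lemma is_derive_integ (s : R -> R * R -> R) (d : R * R -> R) (t0 r M : R) : 0 < r ->
  (forall t, `|t - t0| < r -> bmf D (s t)) -> measurable_fun (D : set RR) d ->
  (forall t q, `|t - t0| < r -> D q -> `|s t q - s t0 q| <= M * `|t - t0|) ->
  {ae mu2, forall q, D q -> is_derive t0 (1 : R) (s^~ q) (d q)} ->
  is_derive t0 (1 : R) (fun t => integ D (s t)) (integ D d).
Proof.
move=> r0 bs md lip ae; apply/is_derive_quotient.
have bt0 : bmf D (s t0) by apply: bs; rewrite subrr normr0.
have close h : 0 < `|h - 0| < r -> `|(t0 + h) - t0| < r by rewrite subr0 addrAC subrr add0r => /andP[].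
have bq h : 0 < `|h - 0| < r -> bmf D (fun q => h^-1 * (s (t0 + h) q - s t0 q)).
  by move=> /close hh; exact: bmfM (bmf_cst _ _) (bmfB (bs _ hh) bt0).
have e : \forall h \near (0 : R)^', integ D (fun q => h^-1 * (s (t0 + h) q - s t0 q)) =
    h^-1 * (integ D (s (t0 + h)) - integ D (s t0)).
  have : \forall h \near (0 : R)^', 0 < `|h - 0| < r.
    apply/nbhs_ballP; exists r => //= h hr h0; rewrite subr0 normr_gt0 h0/=.
    by move: hr; rewrite /ball/= sub0r normrN.
  apply: filterS => h hr; have hh := close h hr.
  by rewrite (integZ mD fD _ (bmfB (bs _ hh) bt0)) (integB mD fD (bs _ hh) bt0).
apply: (cvg_trans (near_eq_cvg e)).
apply: (dominated_integ mD fD (g_ := fun h q => h^-1 * (s (t0 + h) q - s t0 q)) (M := M) r0).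
- by move=> h /bq[].
- exact: md.
- move=> h q hr Dq; have hh := close h hr; have := lip _ _ hh Dq.
  have -> : t0 + h - t0 = h by rewrite addrAC subrr add0r.
  move: hr; rewrite subr0 => /andP[h0 _]; rewrite normrM normfV => le.
  by rewrite mulrC ler_pdivrMr.
- apply: negligibleS ae => q /= nQ hq; apply: nQ => Dq; exact: ((is_derive_quotient _ _ _).1 (hq Dq)).
Qed.

End DerivInteg.

(** * Lengths of quadratic vector polynomials and bivectors *)

Section Rays.
Variables (R : realType) (N : nat).
Implicit Types (u v : 'rV[R]_N) (t : R).

Lemma enorm_ge0 u : 0 <= enorm u. Proof. exact: sqrtr_ge0. Qed.

Lemma enorm_sqr u : enorm u ^+ 2 = dot u u.
Proof. by rewrite sqr_sqrtr// dot_ge0. Qed.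

Lemma dot_le_enorm u v : `|dot u v| <= enorm u * enorm v.
Proof.
rewrite -(ler_pXn2r (n := 2))// ?nnegrE ?mulr_ge0 ?enorm_ge0//.
by rewrite real_normK ?num_real// exprMn !enorm_sqr dot_cauchy.
Qed.

Lemma enormD u v : enorm (u + v) <= enorm u + enorm v.
Proof.
rewrite -(ler_pXn2r (n := 2))// ?nnegrE ?addr_ge0 ?enorm_ge0// enorm_sqr dotDl !dotDr (dotC v u).
have := le_trans (ler_norm _) (dot_le_enorm u v); rewrite sqrrD !enorm_sqr => h.
by rewrite addrA lerD2r -addrA lerD2l -mulr2n lerMn2r.
Qed.

Lemma enormZ c u : enorm (c *: u) = `|c| * enorm u.
Proof. by rewrite /enorm dotZl dotZr mulrA -expr2 sqrtrM ?sqr_ge0// sqrtr_sqr. Qed.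

Lemma enormN u : enorm (- u) = enorm u.
Proof. by rewrite -scaleN1r enormZ normrN1 mul1r. Qed.

Lemma enorm_dist u v : `|enorm u - enorm v| <= enorm (u - v).
Proof.
have h (x y : 'rV[R]_N) : enorm x - enorm y <= enorm (x - y).
  by have := enormD (x - y) y; rewrite subrK lerBlDr.
by rewrite ler_norml h lerNl opprB -(enormN (u - v)) opprB h.
Qed.

Variables m0 m1 m2 : 'rV[R]_N.
(* [ray_len] is the area element along a variation; [ray_slope] and [ray_curv]
   (with the junk value [0] where the length vanishes) are its derivatives. *)
Definition ray t := m0 + t *: m1 + (t ^+ 2) *: m2.
Definition dray t := m1 + (2 * t) *: m2.
Definition ray_len t := enorm (ray t).
Definition ray_slope t := dot (ray t) (dray t) / ray_len t.
Definition ray_curv := (dot m1 m1 + 2 * dot m0 m2) / enorm m0 - dot m0 m1 ^+ 2 / enorm m0 ^+ 3.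

Lemma ray0 : ray 0 = m0. Proof. by rewrite /ray expr0n !scale0r !addr0. Qed.

Lemma dray0 : dray 0 = m1. Proof. by rewrite /dray mulr0 scale0r addr0. Qed.

Lemma ray_lipschitz t t' : `|t| <= 1 -> `|t'| <= 1 ->
  `|ray_len t - ray_len t'| <= (enorm m1 + 2 * enorm m2) * `|t - t'|.
Proof.
move=> t1 t'1; apply: (le_trans (enorm_dist _ _)).
have -> : ray t - ray t' = (t - t') *: (m1 + (t + t') *: m2).
  by apply/rowP => i; rewrite !mxE; ring.
rewrite enormZ mulrC ler_wpM2r// (le_trans (enormD _ _))// lerD2l enormZ ler_wpM2r ?enorm_ge0//.
by rewrite (le_trans (ler_normD _ _))// (le_trans (lerD t1 t'1)).
Qed.

Lemma slope_le t : `|ray_slope t| <= enorm (dray t).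
Proof.
rewrite /ray_slope normrM normfV (ger0_norm (enorm_ge0 _)) -/(ray_len t).
have [->|l0] := eqVneq (ray_len t) 0; first by rewrite invr0 mulr0 enorm_ge0.
have lp : 0 < ray_len t by rewrite lt_neqAle eq_sym l0 enorm_ge0.
by rewrite ler_pdivrMr// mulrC dot_le_enorm.
Qed.

Lemma dray_le t : enorm (dray t) <= enorm m1 + 2 * `|t| * enorm m2.
Proof. by rewrite (le_trans (enormD _ _))// enormZ normrM ger0_norm. Qed.

(* If [`|t| <= l], compare the unit vectors along [ray t] and [m0]; if
   [l < `|t|], both slopes are [O(`|t|)]. *)
Lemma slope_lipschitz (l C : R) t : 0 <= l -> 0 <= C -> enorm m0 = l ^+ 2 -> enorm m1 <= C * l -> enorm m2 <= C ->
  `|ray_slope t - ray_slope 0| <= (4 * C ^+ 2 + 6 * C) * `|t|.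
Proof.
move=> l0 C0 e0 e1 e2; have t0 : 0 <= `|t| := normr_ge0 t.
have sl0 : `|ray_slope 0| <= C * l by rewrite (le_trans (slope_le 0))// dray0.
have dr : enorm (dray t) <= C * l + 2 * C * `|t|.
  by rewrite (le_trans (dray_le t))// lerD// mulrAC ler_wpM2r// ler_wpM2l.
have CC : 0 <= 4 * C ^+ 2 * `|t| by rewrite mulr_ge0// mulr_ge0// sqr_ge0.
have [lt|tl] := ltP l `|t|.
  apply: (le_trans (ler_normB _ _)); apply: (le_trans (lerD (le_trans (slope_le t) dr) sl0)).
  have : C * l <= C * `|t| by rewrite ler_wpM2l// ltW.
  have : 0 <= C * `|t| by exact: mulr_ge0.
  rewrite mulrDl; lra.
have [l00|lp] := eqVneq l 0.
  have tz : t = 0 by apply/normr0_eq0/eqP; rewrite eq_le t0 andbT (le_trans tl)// l00.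
  by rewrite tz subrr normr0 mulr0.
have {}lp : 0 < l by rewrite lt_neqAle eq_sym lp.
have l2 : 0 < l ^+ 2 by rewrite exprn_gt0.
set L := ray_len t; set dm := enorm (ray t - m0).
have dmE : dm <= 2 * C * l * `|t|.
  rewrite /dm (_ : ray t - m0 = t *: m1 + (t ^+ 2) *: m2); last by rewrite /ray addrC -addrA addKr.
  rewrite (le_trans (enormD _ _))// !enormZ normrX.
  have : `|t| * enorm m1 <= `|t| * (C * l) by rewrite ler_wpM2l.
  have : `|t| ^+ 2 * enorm m2 <= (`|t| * l) * C.
    by rewrite ler_pM ?enorm_ge0 ?sqr_ge0// expr2 ler_wpM2l.
  lra.
have Ll : `|l ^+ 2 - L| <= dm.
  by rewrite -e0 /L /ray_len distrC (le_trans (enorm_dist _ _)).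
have -> : ray_slope t - ray_slope 0 =
  (dot (ray t) m1 / L - dot m0 m1 / l ^+ 2) + 2 * t * (dot (ray t) m2 / L).
  by rewrite /ray_slope -/L ray0 dray0 /ray_len ray0 e0 /dray dotDr dotZr; ring.
have unit v : `|dot (ray t) v / L| <= enorm v.
  rewrite normrM normfV (ger0_norm (enorm_ge0 _)) -/(ray_len t) -/L.
  have [->|L0] := eqVneq L 0; first by rewrite invr0 mulr0 enorm_ge0.
  have Lp : 0 < L by rewrite lt_neqAle eq_sym L0 enorm_ge0.
  by rewrite ler_pdivrMr// mulrC dot_le_enorm.
have d1 : `|dot (ray t) m1 / L - dot m0 m1 / l ^+ 2| <= 4 * C ^+ 2 * `|t|.
  (* After multiplication by [l^2] the difference splits into two terms, each at most
     [dm * (C l) <= 2 C^2 l^2 |t|]. *)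
  rewrite -(ler_pM2l l2) -{1}(gtr0_norm l2) -normrM.
  have -> : l ^+ 2 * (dot (ray t) m1 / L - dot m0 m1 / l ^+ 2) =
      (l ^+ 2 - L) * (dot (ray t) m1 / L) + dot (ray t - m0) m1.
    have LL : L * (dot (ray t) m1 / L) = dot (ray t) m1.
      have [L0|L0] := eqVneq L 0; last by rewrite mulrCA mulfV// mulr1.
      have : dot (ray t) (ray t) = 0 by rewrite -enorm_sqr -/(ray_len t) -/L L0 expr0n.
      by move/eqP; rewrite dot_eq0 => /eqP ->; rewrite dot0l mul0r mulr0.
    rewrite mulrBl LL dotBl mulrBr [l ^+ 2 * (dot m0 m1 / _)]mulrCA mulfV ?lt0r_neq0// mulr1.
    by rewrite addrA subrK.
  apply: (le_trans (ler_normD _ _)).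
  have a1 : `|(l ^+ 2 - L) * (dot (ray t) m1 / L)| <= dm * (C * l).
    by rewrite normrM ler_pM// (le_trans (unit _)).
  have a2 : `|dot (ray t - m0) m1| <= dm * (C * l).
    by rewrite (le_trans (dot_le_enorm _ _))// ler_wpM2l// enorm_ge0.
  have a3 : dm * (C * l) <= 2 * C * l * `|t| * (C * l) by rewrite ler_wpM2r// mulr_ge0.
  apply: (le_trans (lerD a1 a2)); apply: (le_trans (lerD a3 a3)).
  by rewrite le_eqVlt; apply/orP; left; apply/eqP; ring.
apply: (le_trans (ler_normD _ _)); rewrite [X in _ <= X]mulrDl; apply: lerD; first exact: d1.
rewrite normrM (normrM 2) (ger0_norm (ler0n R 2)).
apply: (@le_trans _ _ (2 * `|t| * C)).
  by rewrite ler_wpM2l ?mulr_ge0// (le_trans (unit m2)).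
have -> : 6 * C * `|t| = 2 * `|t| * C + 4 * (`|t| * C) by ring.
by rewrite lerDl mulr_ge0// mulr_ge0.
Qed.

Lemma is_derive_quartic (c0 c1 c2 c3 c4 t : R) :
  is_derive t (1 : R) (fun t => c0 + t * (c1 + t * (c2 + t * (c3 + t * c4))))
    (c1 + 2 * c2 * t + 3 * c3 * t ^+ 2 + 4 * c4 * t ^+ 3).
Proof.
have st (f : R -> R) (c d : R) : is_derive t (1 : R) f d -> is_derive t (1 : R) (fun t => c + t * f t) (f t + t * d).
  move=> df; apply: (is_derive_eq (is_deriveD (is_derive_cst c t (1 : R)) (is_deriveM (is_derive_id t (1 : R)) df))).
  by rewrite /GRing.scale/= add0r mulr1 addrC.
by apply: (is_derive_eq (st _ c0 _ (st _ c1 _ (st _ c2 _ (st _ c3 _ (is_derive_cst c4 t (1 : R))))))); cbv beta; rewrite /cst; ring.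
Qed.

Definition len2 t := dot m0 m0 + t * (2 * dot m0 m1 + t * ((dot m1 m1 + 2 * dot m0 m2) + t * (2 * dot m1 m2 + t * dot m2 m2))).

Lemma len2E t : dot (ray t) (ray t) = len2 t.
Proof. by rewrite /ray /len2 !(dotDl, dotDr, dotZl, dotZr) (dotC m1 m0) (dotC m2 m0) (dotC m2 m1); ring. Qed.

(** The final [t * 0] gives the cubic the shape expected by [is_derive_quartic]. *)
Definition half2 t := dot m0 m1 + t * ((dot m1 m1 + 2 * dot m0 m2) + t * (3 * dot m1 m2 + t * (2 * dot m2 m2 + t * 0))).

Lemma half2E t : dot (ray t) (dray t) = half2 t.
Proof. by rewrite /ray /dray /half2 !(dotDl, dotDr, dotZl, dotZr) (dotC m2 m1); ring. Qed.

Lemma ray_len_derive t : ray_len t != 0 -> is_derive t (1 : R) ray_len (ray_slope t).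
Proof.
move=> l0; have lp : 0 < ray_len t by rewrite lt_neqAle eq_sym l0 enorm_ge0.
have n0 : 0 < len2 t by rewrite -len2E -enorm_sqr exprn_gt0.
have fE : ray_len = (fun t => Num.sqrt (len2 t)) by apply/funext => u; rewrite /ray_len /enorm len2E.
have h := is_derive1_comp (is_derive1_sqrt n0) (is_derive_quartic _ _ _ _ _ t).
rewrite fE; apply: (is_derive_eq h).
rewrite /ray_slope half2E /ray_len /enorm len2E /half2.
by field; rewrite lt0r_neq0// sqrtr_gt0.
Qed.

Lemma ray_slope_derive : enorm m0 != 0 -> is_derive (0 : R) (1 : R) ray_slope ray_curv.
Proof.
move=> l0; have L0 : ray_len 0 != 0 by rewrite /ray_len ray0.
have dl := ray_len_derive L0.
have dh : is_derive (0 : R) (1 : R) half2 (dot m1 m1 + 2 * dot m0 m2).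
  by apply: (is_derive_eq (is_derive_quartic _ _ _ _ _ 0)); ring.
have fE : ray_slope = (fun t => half2 t * (ray_len t)^-1).
  by apply/funext => t; rewrite /ray_slope half2E.
rewrite fE; apply: (is_derive_eq (is_deriveM dh (is_deriveV L0 dl))).
rewrite /GRing.scale/= /ray_slope half2E /ray_len ray0 /half2 /ray_curv !mul0r !addr0.
by field.
Qed.

End Rays.

Section Wedge.
Variables (R : realType) (n : nat).
Implicit Types u v : 'rV[R]_n.

(** The bivector of [u] and [v] as an antisymmetric matrix, scaled so that its norm is the area of
    the parallelogram. By bilinearity the area element along [F + t W] is the norm of a vector
    quadratic in [t]. *)
Definition wedge u v : 'rV[R]_(n * n) := (Num.sqrt 2)^-1 *: mxvec (u^T *m v - v^T *m u).

Lemma wedge_sqr u v : dot (wedge u v) (wedge u v) = dot u u * dot v v - dot u v ^+ 2.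
Proof.
have half : (Num.sqrt 2)^-1 * (Num.sqrt 2)^-1 = 2^-1 :> R by rewrite -invfM -expr2 sqr_sqrtr.
have md (x y x' y' : 'rV[R]_n) : dot (mxvec (x^T *m y)) (mxvec (x'^T *m y')) = dot x x' * dot y y'.
  rewrite dotE mxvec_dotmul mulmxA -(mulmxA _ y') mxE big_ord1 -dotE (dotC y).
  by rewrite dotE; congr (_ * _); rewrite dotE.
rewrite /wedge dotZl dotZr mulrA half linearB/= dotBl !dotBr !md (dotC v u).
by field.
Qed.

Lemma enorm_wedge u v : enorm (wedge u v) <= enorm u * enorm v.
Proof.
rewrite -(ler_pXn2r (n := 2))// ?nnegrE ?mulr_ge0 ?enorm_ge0// exprMn !enorm_sqr wedge_sqr.
by rewrite gerBl sqr_ge0.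
Qed.

Lemma wedgeDl u u' v : wedge (u + u') v = wedge u v + wedge u' v.
Proof.
rewrite /wedge -scalerDr -linearD/= [(u + u')^T]linearD/=; congr (_ *: mxvec _).
by rewrite mulmxDl mulmxDr opprD addrACA.
Qed.

Lemma wedgeDr u v v' : wedge u (v + v') = wedge u v + wedge u v'.
Proof.
rewrite /wedge -scalerDr -linearD/= [(v + v')^T]linearD/=; congr (_ *: mxvec _).
by rewrite mulmxDl mulmxDr opprD addrACA.
Qed.

Lemma wedgeZl c u v : wedge (c *: u) v = c *: wedge u v.
Proof. by rewrite /wedge [(c *: u)^T]linearZ/= -scalemxAl -scalemxAr -scalerBr linearZ/= !scalerA mulrC. Qed.

Lemma wedgeZr c u v : wedge u (c *: v) = c *: wedge u v.
Proof. by rewrite /wedge [(c *: v)^T]linearZ/= -scalemxAl -scalemxAr -scalerBr linearZ/= !scalerA mulrC. Qed.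

Lemma wedge_ray u u' v v' t :
  wedge (u + t *: u') (v + t *: v') = ray (wedge u v) (wedge u v' + wedge u' v) (wedge u' v') t.
Proof.
rewrite /ray wedgeDl !wedgeDr !wedgeZl !wedgeZr scalerA -expr2 scalerDr !addrA; congr (_ + _).
Qed.

Lemma wedge_smooth (U : set (R * R)) (G H : R -> R -> 'rV[R]_n) : open U -> smooth_on U G -> smooth_on U H ->
  smooth_on U (fun x y => wedge (G x y) (H x y)).
Proof.
move=> oU sG sH; apply: (smooth_rowI oU) => k; case/mxvec_indexP: k => i j.
have sg := smooth_coord oU sG; have sh := smooth_coord oU sH.
have h := mul_smooth oU (cst_smooth (Num.sqrt 2)^-1 oU)
  (sub_smooth oU (mul_smooth oU (sg i) (sh j)) (mul_smooth oU (sh i) (sg j))).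
apply: (eq_on_smooth oU _ h) => p _.
by rewrite /wedge [RHS]mxE mxvecE !mxE !big_ord1 !mxE.
Qed.

End Wedge.

Section IpartialAffine.
Variables (R : realType) (U : set (R * R)).
Hypothesis oU : open U.

Lemma ipartial_affine (f g : R -> R -> R) (t : R) s : smooth_on U f -> smooth_on U g ->
  forall z, U z -> ipartial (fun x y => f x y + t * g x y) s z.1 z.2 =
    ipartial f s z.1 z.2 + t * ipartial g s z.1 z.2.
Proof.
move=> sf sg; elim: s => [//|b s ih] z Uz.
have jf := jet_smooth (smooth_ipartial s sf) Uz; have jg := jet_smooth (smooth_ipartial s sg) Uz.
have [_ jx jy] := jetD jf (jetM (jet_cst t z) jg).
have alg (u v w : R) : u + (t * v + w * 0) = u + t * v by rewrite mulr0 addr0.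
case: b => /=.
  exact: etrans (eq_on_pdx oU (g := fun x y => ipartial f s x y + t * ipartial g s x y) ih Uz) (etrans jx (alg _ _ _)).
exact: etrans (eq_on_pdy oU (g := fun x y => ipartial f s x y + t * ipartial g s x y) ih Uz) (etrans jy (alg _ _ _)).
Qed.

End IpartialAffine.

Section ZeroSetOfFamily.
Variables (R : realType) (V Om : set (R * R)) (p0 p1 p2 p3 p4 : R -> R -> R).
Local Notation mu2 := ((@lebesgue_measure R) \x (@lebesgue_measure R))%E.
Local Notation RR := (measurableTypeR R * measurableTypeR R)%type.
Hypotheses (oV : open V) (cOm : compact Om) (OmV : Om `<=` V).
Hypotheses (s0 : smooth_on V p0) (s1 : smooth_on V p1) (s2 : smooth_on V p2) (s3 : smooth_on V p3) (s4 : smooth_on V p4).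
Hypothesis finite_order : forall z, V z -> exists s, ipartial p0 s z.1 z.2 != 0.

Let fam (t : R) (x y : R) := p0 x y + t * (p1 x y + t * (p2 x y + t * (p3 x y + t * p4 x y))).

(** Near each point [z] of [Om] some fixed partial derivative of [p0] is nonzero, and by joint
    continuity so is that of the family for points near [z] and [t] near 0. Compactness makes the
    range of [t] uniform, and null zero sets on countably many boxes add up. *)
Lemma family_zero_set_negligible :
  \forall t \near (0 : R), mu2.-negligible [set q | Om q /\ fam t q.1 q.2 = 0].
Proof.
pose Z t := [set q | V q /\ fam t q.1 q.2 = 0].
pose good (t : R) : set (R * R) := [set z | exists k, @rbox R k z /\ mu2.-negligible (@rbox R k `&` Z t)].
have aff (f g : R -> R -> R) (t : R) : smooth_on V f -> smooth_on V g -> smooth_on V (fun x y => f x y + t * g x y).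
  by move=> sf sg; exact: (add_smooth oV sf (mul_smooth oV (cst_smooth t oV) sg)).
have near_good : \forall t \near (0 : R), Om `<=` good t.
  have /compact_near_coveringP nc := cOm; apply: (nc R (nbhs (0 : R)) good) => z Oz.
  have [s sz] := finite_order (OmV Oz).
  pose Q p (w : (R * R) * R) : R := ipartial p s w.1.1 w.1.2.
  pose h w := Q p0 w + w.2 * (Q p1 w + w.2 * (Q p2 w + w.2 * (Q p3 w + w.2 * Q p4 w))).
  pose w0 : (R * R) * R := (z, 0).
  have cQ p : smooth_on V p -> cont_at (V := R^o) w0 (Q p).
    move=> sp; have c1 : {for w0, continuous (fun w : (R * R) * R => w.1)} by exact: cvg_fst.
    exact: (cvg_comp _ _ c1 (smooth_on_regular (smooth_ipartial s sp) (OmV Oz)).1).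
  have ct : cont_at (V := R^o) w0 (fun w => w.2) by exact: cvg_snd.
  have ch : cont_at (V := R^o) w0 h.
    exact: (cont_add (cQ _ s0) (cont_mul ct (cont_add (cQ _ s1) (cont_mul ct (cont_add (cQ _ s2)
      (cont_mul ct (cont_add (cQ _ s3) (cont_mul ct (cQ _ s4))))))))).
  have h0 : h w0 != 0 by rewrite /h /w0/= mul0r addr0.
  have : \forall w \near w0, h w != 0 by exact: (cvgr_neq0 _ ch h0).
  move=> [[A B] /= [nA nB] AB].
  have oA : open (A° `&` V) by apply: openI => //; exact: open_interior.
  have Az : (A° `&` V) z by split; [exact: nA|exact: OmV].
  have [k [kz kA]] := open_rbox oA Az.
  exists (@rbox R k, B) => /=; first by split; [apply: open_nbhs_nbhs; split=> //; exact: box_open|exact: nB].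
  move=> [z' t] /= [kz' Bt]; exists k; split; first exact: kz'.
  have kV : @rbox R k `<=` V by move=> q /kA[].
  have st : smooth_on V (fam t) by exact: (aff _ _ t s0 (aff _ _ t s1 (aff _ _ t s2 (aff _ _ t s3 s4)))).
  have ip q : V q -> ipartial (fam t) s q.1 q.2 = h (q, t).
    move=> Vq; have a4 := aff _ _ t s3 s4; have a3 := aff _ _ t s2 a4; have a2 := aff _ _ t s1 a3.
    by rewrite /fam (ipartial_affine oV t s s0 a2 Vq) (ipartial_affine oV t s s1 a3 Vq)
      (ipartial_affine oV t s s2 a4 Vq) (ipartial_affine oV t s s3 s4 Vq).
  have ne q : @rbox R k q -> ipartial (fam t) s q.1 q.2 != 0.
    move=> kq; rewrite (ip q (kV q kq)); apply: (AB (q, t)); split; last exact: Bt.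
    exact: (interior_subset (kA q kq).1).
  have := box_zero_set_negligible (smooth_onS kV st) ne.
  by apply: negligibleS => q [kq [_ qz]]; split.
apply: filterS near_good => t gt.
pose Fk (m : nat) : set RR := if @unpickle ((rat * rat) * (rat * rat))%type m is Some k
  then (if `[< mu2.-negligible (@rbox R k `&` Z t) >] then @rbox R k `&` Z t else set0) else set0.
apply: (negligibleS _ (negligible_bigcup (F := Fk) _)).
- move=> q [Oq qz]; have [k [kq kn]] := gt q Oq.
  exists (pickle k); first exact: I.
  by rewrite /Fk pickleK (asboolT kn); split; [exact: kq|split; [exact: OmV|exact: qz]].
- move=> m; rewrite /Fk; case: (unpickle m) => [k|]; last exact: negligible_set0.
  by case: asboolP => [h|_]; [exact: h|exact: negligible_set0].
Qed.

End ZeroSetOfFamily.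

(** * Calibration *)

Section KaehlerForm.
Variables (R : realType) (n : nat).

(** For a matrix [b] of basis rows the projection is [b^T (b b^T)^-1 b]; [b b^T] is invertible since
    [u b b^T = 0] makes [u b] a vector of norm 0. *)
Lemma orthogonal_projection (A : 'M[R]_n) : exists p : 'M[R]_n,
  [/\ p^T = p, forall u : 'rV[R]_n, (u *m p <= A)%MS & forall w : 'rV[R]_n, (w <= A)%MS -> w *m p = w].
Proof.
move: (row_base A) (eq_row_base A) (row_base_free A) => b bA fb.
pose M := b *m b^T.
have uM : M \in unitmx.
  rewrite -row_free_unit -kermx_eq0; apply/eqP/row_matrixP => i; rewrite row0.
  set u := row i _; have uM0 : u *m M = 0 by rewrite -row_mul mulmx_ker row0.
  have : u *m b = 0.
    by apply/eqP; rewrite -dot_eq0 dotE trmx_mul mulmxA -(mulmxA u) -/M uM0 mul0mx mxE.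
  by rewrite -[RHS](mul0mx _ b) => /(row_free_inj fb).
have MT : M^T = M by rewrite /M trmx_mul trmxK.
exists (b^T *m invmx M *m b); split.
- by rewrite !trmx_mul trmxK trmx_inv MT mulmxA.
- by move=> u; rewrite !mulmxA -bA submxMl.
- move=> w; rewrite -bA => /submxP[c ->].
  by rewrite !mulmxA -(mulmxA c) -/M -(mulmxA c) mulmxV// mulmx1.
Qed.

(* [K] is [J] on the row space of [A], precomposed and followed by the orthogonal
   projection: a constant form calibrating the holomorphic curves in it. *)
Lemma kaehler_form (A J : 'M[R]_n) :
  (forall w : 'rV[R]_n, (w <= A)%MS -> (w *m J <= A)%MS /\ w *m J *m J = - w) ->
  (forall w w' : 'rV[R]_n, (w <= A)%MS -> (w' <= A)%MS -> dot (w *m J) (w' *m J) = dot w w') ->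
  exists K : 'M[R]_n, [/\ forall u v, dot (u *m K) v = - dot (v *m K) u,
    forall u, dot (u *m K) (u *m K) <= dot u u & forall w : 'rV[R]_n, (w <= A)%MS -> w *m K = w *m J].
Proof.
move=> hJ oJ; have [p [pT pA pid]] := orthogonal_projection A.
have KE (u : 'rV[R]_n) : u *m (p *m J *m p) = u *m p *m J.
  by rewrite !mulmxA pid//; exact: (hJ _ (pA u)).1.
have dp u v : dot (u *m p) v = dot u (v *m p).
  by rewrite !dotE trmx_mul pT mulmxA.
exists (p *m J *m p); split.
- move=> u v; rewrite !KE.
  have h (x y : 'rV[R]_n) : dot (x *m p *m J) y = dot (x *m p *m J) (y *m p).
    by rewrite -dp (pid (x *m p *m J)) ?(hJ _ (pA x)).1.
  rewrite (h u v) (h v u) -(oJ (u *m p *m J)); [|exact: (hJ _ (pA u)).1|exact: pA].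
  by rewrite (hJ _ (pA u)).2 dotNl dotC.
- move=> u; rewrite KE oJ// dp pid//.
  have : 0 <= dot (u - u *m p) (u - u *m p) := dot_ge0 _.
  by rewrite dotBl !dotBr (dp u (u *m p)) (pid _ (pA u)) (dp u u) subrr subr0 subr_ge0.
- by move=> w wA; rewrite KE (pid w wA).
Qed.

(** [K] is antisymmetric, so [v] may be replaced by its component orthogonal to [u], scaled by
    [|u|^2] to avoid a division; Cauchy's inequality and the contraction property finish. *)
Lemma wirtinger (K : 'M[R]_n) (u v : 'rV[R]_n) :
  (forall u v, dot (u *m K) v = - dot (v *m K) u) -> (forall u, dot (u *m K) (u *m K) <= dot u u) ->
  dot (u *m K) v <= Num.sqrt (dot u u * dot v v - dot u v ^+ 2).
Proof.
move=> anti contr; apply: (le_trans (ler_norm _)); rewrite -sqrtr_sqr; apply: ler_wsqrtr.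
have [u0|u0] := eqVneq (dot u u) 0.
  by move/eqP: u0; rewrite dot_eq0 => /eqP ->; rewrite mul0mx !dot0l expr0n/= mul0r subr0.
have up : 0 < dot u u by rewrite lt_neqAle eq_sym u0 dot_ge0.
have uu : dot (u *m K) u = 0.
  by have := anti u u => /eqP; rewrite -addr_eq0 -mulr2n mulrn_eq0/= => /eqP.
have := dot_cauchy (u *m K) (dot u u *: v - dot u v *: u).
rewrite dotBr !dotZr uu mulr0 subr0 => h.
have e : dot (dot u u *: v - dot u v *: u) (dot u u *: v - dot u v *: u) =
    dot u u * (dot u u * dot v v - dot u v ^+ 2).
  by rewrite !(dotBl, dotBr, dotZl, dotZr) (dotC v u); ring.
have g0 : 0 <= dot u u * (dot u u * dot v v - dot u v ^+ 2) by rewrite -e dot_ge0.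
rewrite e in h; have := le_trans h (ler_wpM2r g0 (contr u)).
by rewrite exprMn [X in _ <= X]mulrA -expr2 ler_pM2l// exprn_gt0.
Qed.

End KaehlerForm.

Lemma le_of_null_terms (R : realType) (w y x z u v c d i j : R) :
  w = y - v -> y = x - u -> u = c * i -> v = d * j -> i = 0 -> j = 0 -> w <= z -> x <= z.
Proof. by move=> -> -> -> -> -> ->; rewrite !mulr0 !subr0. Qed.

Section HolomorphicStable.
Variables (R : realType) (n : nat) (P : set (R * R)) (F : R -> R -> 'rV[R]_n).
Local Notation mu2 := ((@lebesgue_measure R) \x (@lebesgue_measure R))%E.
Local Notation RR := (measurableTypeR R * measurableTypeR R)%type.
Hypotheses (dP : discrete_in_plane P) (bF : branched_minimal_immersion (~` P) F).
Let S := ~` P.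
Let oS : open S := open_setC_discrete dP.
Variables (Om : set (R * R)) (rho : R -> R -> R) (U : set (R * R)) (W : R -> R -> 'rV[R]_n).
Hypotheses (dom : smooth_domain_in S Om rho) (oU : open U) (OmU : Om `<=` U) (sW : smooth_on U W).
Hypothesis W0 : forall q, Om q -> rho q.1 q.2 = 0 -> W q.1 q.2 = 0.
Let cOm : compact Om. Proof. by case: dom. Qed.
Let OmS : Om `<=` S. Proof. by case: dom => _ []. Qed.
Let V := S `&` U.
Let oV : open V. Proof. exact: openI. Qed.
Let OmV : Om `<=` V. Proof. by move=> q Oq; split; [exact: OmS|exact: OmU]. Qed.
Let sF : smooth_on V F. Proof. by case: bF => _ [h _]; apply: smooth_onS h => q []. Qed.
Let sWV : smooth_on V W. Proof. by apply: smooth_onS sW => q []. Qed.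
Let mOm := compact_measurable2 cOm.
Let fOm := compact_mu2_finite cOm.
Let s (t : R) (q : R * R) := Num.sqrt (gram (vary F W t) q).

Section Calibrated.
Variable K : 'M[R]_n.
Hypothesis anti : forall u v : 'rV[R]_n, dot (u *m K) v = - dot (v *m K) u.
Hypothesis contr : forall u : 'rV[R]_n, dot (u *m K) (u *m K) <= dot u u.
Hypothesis holo : forall q, S q -> pdy F q.1 q.2 = pdx F q.1 q.2 *m K.

Lemma area_minimal t : integ Om (s 0) <= integ Om (s t).
Proof.
have [sFx sFy] := (smooth_on_pdx sF, smooth_on_pdy sF).
have [sWx sWy] := (smooth_on_pdx sWV, smooth_on_pdy sWV).
have [sFK dFK] := mulmx_smooth K oV sF; have [sWK dWK] := mulmx_smooth K oV sWV.
have bd (G H : R -> R -> 'rV[R]_n) : smooth_on V G -> smooth_on V H -> bmf Om (fun q => dot (G q.1 q.2) (H q.1 q.2)).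
  by move=> sG sH; exact: (smooth_bmf oV cOm OmV (dot_smooth oV sG sH)).
have W0' q : Om q -> ~ Om° q -> W q.1 q.2 = 0.
  by move=> Oq nq; apply: W0 => //; exact: (domain_boundary oS dom Oq nq).
pose br (H : R -> R -> 'rV[R]_n) q := dot (pdx W q.1 q.2) (pdy H q.1 q.2) - dot (pdy W q.1 q.2) (pdx H q.1 q.2).
have bb H : smooth_on V H -> bmf Om (br H).
  by move=> sH; exact: (bmfB (bd _ _ sWx (smooth_on_pdy sH)) (bd _ _ sWy (smooth_on_pdx sH))).
have z1 : integ Om (br (fun x y => F x y *m K)) = 0 := integ_vector_bracket oV cOm OmV sWV sFK W0'.
have z2 : integ Om (br (fun x y => W x y *m K)) = 0 := integ_vector_bracket oV cOm OmV sWV sWK W0'.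
(* The Kaehler form pulled back by [F + t W], expanded in [t]. Antisymmetry of [K] turns the
   coefficients into brackets with integral 0; in the quadratic one both halves of the bracket
   coincide, hence the division by 2. *)
pose w q := s 0 q - t * br (fun x y => F x y *m K) q - t ^+ 2 / 2 * br (fun x y => W x y *m K) q.
have b0 : bmf Om (s 0) by exact: (vary_bmf oS bF dom oU OmU sW).
have bt : bmf Om (s t) by exact: (vary_bmf oS bF dom oU OmU sW).
have b1 := bmfM (bmf_cst Om t) (bb _ sFK); have b2 := bmfM (bmf_cst Om (t ^+ 2 / 2)) (bb _ sWK).
have bw : bmf Om w by exact: (bmfB (bmfB b0 b1) b2).
have i1 := integB mOm fOm (bmfB b0 b1) b2; have i2 := integB mOm fOm b0 b1.
have i3 := integZ mOm fOm t (bb _ sFK); have i4 := integZ mOm fOm (t ^+ 2 / 2) (bb _ sWK).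
apply: (le_of_null_terms i1 i2 i3 i4 z1 z2).
apply: (le_integ mOm fOm bw bt) => q Oq; have Sq := OmS Oq; have Vq := OmV Oq.
have [e1 e2] := dFK q Vq; have [e3 e4] := dWK q Vq; have h := holo Sq.
have [cf1 cf2] := bF.2.2.2 q Sq.
rewrite /w /br /s (vary_gram bF dom OmU sW 0 Oq) (vary_gram bF dom OmU sW t Oq); cbv zeta.
move: (pdx (fun x y => F x y *m K) q.1 q.2) (pdy (fun x y => F x y *m K) q.1 q.2)
  (pdx (fun x y => W x y *m K) q.1 q.2) (pdy (fun x y => W x y *m K) q.1 q.2) e1 e2 e3 e4 => fxK fyK wxK wyK -> -> -> ->.
move: (pdx F q.1 q.2) (pdy F q.1 q.2) (pdx W q.1 q.2) (pdy W q.1 q.2) h cf1 cf2 => a b u v h cf1 cf2.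
have -> : Num.sqrt (dot (a + 0 *: u) (a + 0 *: u) * dot (b + 0 *: v) (b + 0 *: v) -
   dot (a + 0 *: u) (b + 0 *: v) ^+ 2) = dot (a *m K) b.
  by rewrite !scale0r !addr0 -h -cf1 cf2 expr0n subr0 -expr2 sqrtr_sqr ger0_norm// dot_ge0.
apply: le_trans (wirtinger _ _ anti contr).
rewrite !(mulmxDl, dotDl, dotDr) -!scalemxAl !(dotZl, dotZr).
rewrite (dotC u (b *m K)) (dotC v (a *m K)) (dotC u (v *m K)) (dotC v (u *m K)) (anti b u) (anti v u).
move: (dot (a *m K) b) (dot (u *m K) b) (dot (a *m K) v) (dot (u *m K) v) => x1 x2 x3 x4.
by rewrite le_eqVlt; apply/orP; left; apply/eqP; field.
Qed.

End Calibrated.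

End HolomorphicStable.

Lemma wedge_conformal (R : realType) (n : nat) (u v : 'rV[R]_n) : dot u u = dot v v -> dot u v = 0 ->
  dot (wedge u v) (wedge u v) = dot u u * dot u u.
Proof. by move=> uv e; rewrite wedge_sqr -uv e expr0n subr0. Qed.

(** * Twice differentiability of the area at [t = 0] *)

Section SecondVariation.
Variables (R : realType) (n : nat) (P : set (R * R)) (F : R -> R -> 'rV[R]_n).
Local Notation mu2 := ((@lebesgue_measure R) \x (@lebesgue_measure R))%E.
Local Notation RR := (measurableTypeR R * measurableTypeR R)%type.
Hypotheses (dP : discrete_in_plane P) (bF : branched_minimal_immersion (~` P) F).
Let S := ~` P.
Let oS : open S := open_setC_discrete dP.
Variables (Om : set (R * R)) (rho : R -> R -> R) (U : set (R * R)) (W : R -> R -> 'rV[R]_n).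
Hypotheses (dom : smooth_domain_in S Om rho) (oU : open U) (OmU : Om `<=` U) (sW : smooth_on U W).
Let cOm : compact Om. Proof. by case: dom. Qed.
Let OmS : Om `<=` S. Proof. by case: dom => _ []. Qed.
Let V := S `&` U.
Let oV : open V. Proof. exact: openI. Qed.
Let OmV : Om `<=` V. Proof. by move=> q Oq; split; [exact: OmS|exact: OmU]. Qed.
Let sF : smooth_on V F. Proof. by case: bF => _ [h _]; apply: smooth_onS h => q []. Qed.
Let sWV : smooth_on V W. Proof. by apply: smooth_onS sW => q []. Qed.
Let mOm := compact_measurable2 cOm.
Let fOm := compact_mu2_finite cOm.

Definition area_density (t : R) (q : R * R) := Num.sqrt (gram (vary F W t) q).

Definition jac0 x y := wedge (pdx F x y) (pdy F x y).
Definition jac1 x y := wedge (pdx F x y) (pdy W x y) + wedge (pdx W x y) (pdy F x y).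
Definition jac2 x y := wedge (pdx W x y) (pdy W x y).

Let slope t (q : R * R) := ray_slope (jac0 q.1 q.2) (jac1 q.1 q.2) (jac2 q.1 q.2) t.
Let curv (q : R * R) := ray_curv (jac0 q.1 q.2) (jac1 q.1 q.2) (jac2 q.1 q.2).

Let sj0 : smooth_on V jac0. Proof. exact: (wedge_smooth oV (smooth_on_pdx sF) (smooth_on_pdy sF)). Qed.
Let sj1 : smooth_on V jac1.
Proof.
have h1 := wedge_smooth oV (smooth_on_pdx sF) (smooth_on_pdy sWV).
have h2 := wedge_smooth oV (smooth_on_pdx sWV) (smooth_on_pdy sF).
by apply: (eq_on_smooth oV _ (lin_smooth 1 oV h1 h2)) => p _; rewrite scale1r.
Qed.
Let sj2 : smooth_on V jac2. Proof. exact: (wedge_smooth oV (smooth_on_pdx sWV) (smooth_on_pdy sWV)). Qed.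

Lemma area_densityE t q : Om q -> area_density t q = ray_len (jac0 q.1 q.2) (jac1 q.1 q.2) (jac2 q.1 q.2) t.
Proof.
move=> Oq; rewrite /area_density (vary_gram bF dom OmU sW t Oq); cbv zeta.
by rewrite -wedge_sqr wedge_ray.
Qed.

Lemma jac0_sqr q : S q -> dot (jac0 q.1 q.2) (jac0 q.1 q.2) = lam2 F q.1 q.2.
Proof.
move=> Sq; have [e1 e2] := bF.2.2.2 q Sq; have cE := comp_partials bF Sq.
apply: (etrans (wedge_conformal e1 e2)); rewrite /lam2 /lam /dot.
by congr (_ * _); apply: eq_bigr => i _; rewrite (cE i).1.
Qed.

Let bd N (G H : R -> R -> 'rV[R]_N) : smooth_on V G -> smooth_on V H -> bmf Om (fun q => dot (G q.1 q.2) (H q.1 q.2)).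
Proof. by move=> sG sH; exact: (smooth_bmf oV cOm OmV (dot_smooth oV sG sH)). Qed.

(** What matters is [|jac1| <= C |F_x|] against [|jac0| = |F_x|^2]: near a branch point the
    variation degenerates in the proportion that [slope_lipschitz] requires, with [l = |F_x|]. *)
Lemma jac_bounds : exists2 C : R, 0 <= C & forall q, Om q ->
  [/\ enorm (jac0 q.1 q.2) = enorm (pdx F q.1 q.2) ^+ 2, enorm (jac1 q.1 q.2) <= C * enorm (pdx F q.1 q.2),
   enorm (jac1 q.1 q.2) <= C & enorm (jac2 q.1 q.2) <= C].
Proof.
have eb (G : R -> R -> 'rV[R]_n) : smooth_on V G -> exists2 M : R, 0 <= M & forall q, Om q -> enorm (G q.1 q.2) <= M.
  move=> sG; have [M M0 hM] := bmf_bound (bd sG sG).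
  exists (Num.sqrt M); first exact: sqrtr_ge0.
  by move=> q Oq; apply: ler_wsqrtr; apply: le_trans (hM q Oq); exact: ler_norm.
have [M1 M10 h1] := eb _ (smooth_on_pdx sF); have [M2 M20 h2] := eb _ (smooth_on_pdx sWV).
have [M3 M30 h3] := eb _ (smooth_on_pdy sWV).
pose C := (M2 + M3) * (1 + M1) + M2 * M3.
have C0 : 0 <= C by exact: addr_ge0 (mulr_ge0 (addr_ge0 M20 M30) (addr_ge0 ler01 M10)) (mulr_ge0 M20 M30).
exists C; first exact: C0.
move=> q Oq; have [e1 e2] := bF.2.2.2 q (OmS Oq).
have {}h1 := h1 q Oq; have {}h2 := h2 q Oq; have {}h3 := h3 q Oq.
rewrite /jac0 /jac1 /jac2.
move: (pdx F q.1 q.2) (pdy F q.1 q.2) (pdx W q.1 q.2) (pdy W q.1 q.2) e1 e2 h1 h2 h3 => a b u v e1 e2 h1 h2 h3.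
have ab : enorm b = enorm a by rewrite /enorm e1.
have [a0 u0 v0] : [/\ 0 <= enorm a, 0 <= enorm u & 0 <= enorm v] by split; exact: enorm_ge0.
have j1 : enorm (wedge a v + wedge u b) <= (M2 + M3) * enorm a.
  apply: (le_trans (enormD _ _)); rewrite mulrDl addrC; apply: lerD.
    by apply: (le_trans (enorm_wedge _ _)); rewrite ab ler_wpM2r.
  by apply: (le_trans (enorm_wedge _ _)); rewrite mulrC ler_wpM2r.
have M23 : 0 <= M2 + M3 by exact: addr_ge0.
have p1 : 0 <= (M2 + M3) * M1 by exact: mulr_ge0.
have p2 : 0 <= M2 * M3 by exact: mulr_ge0.
have CE : C = (M2 + M3) + (M2 + M3) * M1 + M2 * M3 by rewrite /C; ring.
have j2 : (M2 + M3) * enorm a <= (M2 + M3) * M1 by rewrite ler_wpM2l.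
split.
- by rewrite enorm_sqr /enorm wedge_sqr -e1 e2 expr0n subr0 -expr2 sqrtr_sqr ger0_norm// dot_ge0.
- apply: (le_trans j1); rewrite ler_wpM2r// CE.
  by rewrite -addrA lerDl; exact: addr_ge0.
- apply: (le_trans j1); apply: (le_trans j2); rewrite CE -addrA addrCA lerDl; exact: addr_ge0.
- apply: (le_trans (enorm_wedge _ _)); apply: (@le_trans _ _ (M2 * M3)); first by rewrite ler_pM.
  by rewrite CE lerDr; exact: addr_ge0.
Qed.

(** The squared density is a polynomial of degree four in [t] with smooth coefficients, and its
    constant term [lam2] has finite order everywhere. *)
Let zero_null : \forall t \near (0 : R), mu2.-negligible [set q | Om q /\ area_density t q = 0].
Proof.
have d01 := dot_smooth oV sj0 sj1; have d02 := dot_smooth oV sj0 sj2; have d11 := dot_smooth oV sj1 sj1.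
have d12 := dot_smooth oV sj1 sj2; have d22 := dot_smooth oV sj2 sj2.
have two (f : R -> R -> R) : smooth_on V f -> smooth_on V (fun x y => 2 * f x y) by move=> sf; exact: (mul_smooth oV (cst_smooth 2 oV) sf).
have l2 : smooth_on V (lam2 F) by apply: smooth_onS (lam2_smooth dP bF) => q [].
have fo z : V z -> exists w, ipartial (lam2 F) w z.1 z.2 != 0 by move=> Vz; exact: (lam2_finite_order dP bF Vz.1).
have := family_zero_set_negligible oV cOm OmV l2 (two _ d01) (add_smooth oV d11 (two _ d02)) (two _ d12) d22 fo.
apply: filterS => t; apply: negligibleS => q [Oq]; rewrite (area_densityE t Oq) => l0; split; first exact: Oq.
have : len2 (jac0 q.1 q.2) (jac1 q.1 q.2) (jac2 q.1 q.2) t = 0 by rewrite -len2E -enorm_sqr -/(ray_len _ _ _ t) l0 expr0n.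
have e0 := jac0_sqr (OmS Oq).
have alg (l d u : R) : d = l -> d + u = 0 -> l + u = 0 by move=> ->.
move=> h.
exact: (alg _ _ _ e0 h).
Qed.

Let dens_bmf t : bmf Om (area_density t). Proof. exact: (vary_bmf oS bF dom oU OmU sW). Qed.

Let inv_dens t : measurable_fun (Om : set RR) (fun q => (area_density t q)^-1).
Proof. exact: (measurableT_comp (@inv_measurable R) (dens_bmf t).1). Qed.

Let slope_measurable t : measurable_fun (Om : set RR) (slope t).
Proof.
have d01 := bd sj0 sj1; have d02 := bd sj0 sj2; have d11 := bd sj1 sj1.
have d12 := bd sj1 sj2; have d22 := bd sj2 sj2.
have h := bmfD d01 (bmfM (bmf_cst Om t) (bmfD (bmfD d11 (bmfM (bmf_cst Om 2) d02)) (bmfM (bmf_cst Om t)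
  (bmfD (bmfM (bmf_cst Om 3) d12) (bmfM (bmf_cst Om t) (bmfD (bmfM (bmf_cst Om 2) d22) (bmfM (bmf_cst Om t) (bmf_cst Om 0)))))))).
have m := measurable_funM h.1 (inv_dens t).
apply: eq_measurable_fun m => q; rewrite inE => Oq.
have e (x y z w : R) : x = z -> y = w -> x * y^-1 = z / w by move=> -> ->.
exact: (e _ _ _ _ (esym (half2E _ _ _ t)) (area_densityE t Oq)).
Qed.

Let curv_measurable : measurable_fun (Om : set RR) curv.
Proof.
have d01 := bd sj0 sj1; have d02 := bd sj0 sj2; have d11 := bd sj1 sj1.
have i0 := inv_dens 0.
have h := measurable_funB (measurable_funM (bmfD d11 (bmfM (bmf_cst Om 2) d02)).1 i0)
  (measurable_funM (bmfM d01 d01).1 (measurable_funM i0 (measurable_funM i0 i0))).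
apply: eq_measurable_fun h => q; rewrite inE => Oq.
have e0 : area_density 0 q = enorm (jac0 q.1 q.2) by rewrite (area_densityE 0 Oq) /ray_len ray0.
have e (x y z w : R) : z = w -> x * z^-1 - (y * y) * (z^-1 * (z^-1 * z^-1)) = x / w - y ^+ 2 / w ^+ 3.
  by move=> ->; rewrite -exprVn; ring.
exact: (e _ _ _ _ e0).
Qed.

(** The integral is differentiated twice: densities are Lipschitz in [t] uniformly on [Om], slopes
    are so in comparison with [t = 0], and the densities vanish only on null sets. The second
    derivative is taken at 0, where the Lipschitz bound for the slopes is available. *)
Lemma second_variation : exists (A1 : R -> R) (c : R),
  (\forall t \near (0 : R), is_derive (t : R) (1 : R) (fun t => integ Om (area_density t)) (A1 t)) /\
  is_derive (0 : R) (1 : R) A1 c.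
Proof.
have [C C0 hC] := jac_bounds.
exists (fun t => integ Om (slope t)), (integ Om curv); split.
- have sm : \forall t \near (0 : R), `|t| < 1 / 2.
    by apply/nbhs_ballP; exists (1 / 2) => //= t; rewrite /ball/= sub0r normrN.
  apply: filterS2 sm zero_null => t0 t01 nt.
  apply: (@is_derive_integ R Om mOm fOm area_density (slope t0) t0 (1 / 2) (C + 2 * C)) => //.
  + move=> t q tt Oq; rewrite (area_densityE t Oq) (area_densityE t0 Oq).
    have t1 : `|t| <= 1.
      have -> : t = (t - t0) + t0 by rewrite subrK.
      by rewrite (le_trans (ler_normD _ _))//; lra.
    have t11 : `|t0| <= 1 by lra.
    apply: (le_trans (ray_lipschitz _ _ _ t1 t11)); rewrite ler_wpM2r//.
    by have [_ _ h1 h2] := hC q Oq; rewrite lerD// ler_wpM2l.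
  + apply: negligibleS nt => q /= nq.
    have [Oq|nO] := pselect (Om q); last by exfalso; apply: nq.
    split; first exact: Oq.
    apply: contrapT => l0; apply: nq => _.
    have -> : (area_density^~ q) = ray_len (jac0 q.1 q.2) (jac1 q.1 q.2) (jac2 q.1 q.2).
      by apply/funext => t; exact: area_densityE.
    by apply: ray_len_derive; rewrite -(area_densityE t0 Oq); apply/eqP.
- apply: (@is_derive_integ R Om mOm fOm slope curv 0 1 (4 * C ^+ 2 + 6 * C)) => //.
  + move=> t; rewrite subr0 => t1; split; first exact: slope_measurable.
    exists (C + 2 * C) => q Oq; have [_ _ h1 h2] := hC q Oq.
    apply: (le_trans (slope_le _ _ _ _)); apply: (le_trans (dray_le _ _ _)); apply: lerD => //.
    rewrite -mulrA ler_pM2l// (le_trans _ h2)// ler_piMl ?enorm_ge0//; exact: ltW.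
  + move=> t q _ Oq; rewrite subr0; have [h0 h1 _ h2] := hC q Oq.
    exact: (slope_lipschitz t (enorm_ge0 _) C0 h0 h1 h2).
  + have n0 := nbhs_singleton zero_null.
    apply: negligibleS n0 => q /= nq.
    have [Oq|nO] := pselect (Om q); last by exfalso; apply: nq.
    split; first exact: Oq.
    apply: contrapT => l0; apply: nq => _; apply: ray_slope_derive; apply/eqP.
    by move=> e; apply: l0; rewrite (area_densityE 0 Oq) /ray_len ray0.
Qed.

End SecondVariation.

Section HolomorphicImpliesStable.
Variables (R : realType) (n : nat) (P : set (R * R)) (F : R -> R -> 'rV[R]_n).
Hypotheses (dP : discrete_in_plane P) (bF : branched_minimal_immersion (~` P) F).

Lemma gradient_in_span (A : 'M[R]_n) (b : 'rV[R]_n) : (forall q, (~` P) q -> (F q.1 q.2 - b <= A)%MS) ->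
  forall q, (~` P) q -> (pdx F q.1 q.2 <= A)%MS.
Proof.
move=> FA q Sq; have oS := open_setC_discrete dP.
have sF : smooth_on (~` P) F by case: bF => _ [].
have [_ dG] := mulmx_smooth (cokermx A) oS sF.
have cst z : (~` P) z -> F z.1 z.2 *m cokermx A = b *m cokermx A.
  by move=> Sz; apply/eqP; rewrite -subr_eq0 -mulmxBl -submxE; exact: FA.
have e1 := eq_on_pdx (f := fun x y => F x y *m cokermx A) (g := fun _ _ => b *m cokermx A) oS cst Sq.
have e2 : pdx (fun _ _ : R => b *m cokermx A) q.1 q.2 = 0 by exact: pdx_cst.
rewrite submxE; apply/eqP.
exact: etrans (esym (dG q Sq).1) (etrans e1 e2).
Qed.

Lemma holomorphic_stable : holomorphic_up_to_rigid_motion (~` P) F -> stable (~` P) F.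
Proof.
move=> [b [A [J [_ [FA [hJ [oJ hol]]]]]]] Om rho dom W [U [oU [OmU sW]]] W0.
have oS := open_setC_discrete dP.
have [K [anti contr KJ]] := kaehler_form hJ oJ.
have holK q : (~` P) q -> pdy F q.1 q.2 = pdx F q.1 q.2 *m K.
  by move=> Sq; apply: (etrans (hol q Sq)); apply/esym/KJ; exact: gradient_in_span FA q Sq.
pose Ar t := integ Om (area_density F W t).
have [A1 [c [dA dA1]]] := second_variation dP bF dom oU OmU sW.
have A1E : \forall t \near (0 : R), A1 t = derive1 Ar t.
  by apply: filterS dA => t dt; rewrite derive1E; apply/esym; exact: (@derive_val _ _ _ _ _ _ _ dt).
have dd : is_derive (0 : R) (1 : R) (derive1 Ar) c.
  by apply: (@near_eq_is_derive R R R A1 (derive1 Ar) 0 1 c _ dA1); apply: filterS A1E => t ->.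
have min t : Ar 0 <= Ar t by exact: (area_minimal dP bF dom oU OmU sW W0 anti contr holK t).
have c0 : 0 <= c.
  by apply: (second_derivative_at_min dA dA1); apply: filterE => t; exact: min.
have goal : second_deriv_nonneg Ar.
  split; first by apply: filterS dA => t dt; exact: (@ex_derive _ _ _ _ _ _ _ dt).
  split; first exact: (@ex_derive _ _ _ _ _ _ _ dd).
  have -> : derive1 (derive1 Ar) 0 = c by rewrite derive1E; exact: (@derive_val _ _ _ _ _ _ _ dd).
  exact: c0.
exact: goal.
Qed.

End HolomorphicImpliesStable.

Theorem theorem1p2 (R : realType) (n : nat) (P : set (R * R))
    (F : R -> R -> 'rV[R]_n) :
  discrete_in_plane P ->
  branched_minimal_immersion (~` P) F ->
  locally_complete_finite_total_curvature (~` P) P F ->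
  (stable (~` P) F <-> holomorphic_up_to_rigid_motion (~` P) F).
Proof.
move=> dP bF _; split; first exact: stable_holomorphic dP bF.
exact: holomorphic_stable dP bF.
Qed.
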